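(* Let $\Gamma$ be an analytic strictly convex closed curve in the Euclidean plane. Let $a_*>0$ be the analyticity strip width of the lower boundary $C_-=\mathbb{T}_\star\times\{0\}$ of the phase space of the dual billiard map outside $\Gamma$ (that is, $C_-$ is an $(a_*,b_* )$-analytic $(0,1)$-resonant RIC of the dual billiard map for some $b_*>0$). Let $\alpha\in(0,a_* )$ and $L\ge1$. Then there exist a constant $K>0$ and a period $q_*\ge1$ such that $$\mathcal{A}^{(p,q)}\le K\mathrm{e}^{-2\pi\alpha q/p}$$ for all relatively prime integers $p$ and $q$ with $q\ge q_*$ and $0<p\le L$.
   Context: $\mathbb{T}=\mathbb{R}/\mathbb{Z}$, $\mathbb{T}_\star=\mathbb{R}/2\pi\mathbb{Z}$. The closed curve $\Gamma$ is strictly convex with positive curvature, oriented counterclockwise; $\mho$ is the unbounded component of $\mathbb{R}^2\setminus\Gamma$. The dual billiard map $f:\mho\to\mho$ sends $z$ to its reflection in the tangency point of the oriented tangent line to $\Gamma$ through $z$. Envelope coordinates $(\theta,r)\in\mathbb{T}_\star\times(0,+\infty)$ of $z\in\mho$: $\theta$ is the angle, with a fixed direction, of the positive tangent line to $\Gamma$ in the direction of $z$, and $r$ is the distance along this line from $\Gamma$ to $z$. That is, $z=\gamma(\theta)+r\,e(\theta)$, where $e(\theta)=(\cos\theta,\sin\theta)$ and $\gamma(\theta)$ is the point of $\Gamma$ whose positively oriented unit tangent is $e(\theta)$. In these coordinates $(\theta_1,r_1)=f(\theta,r)$ is determined by $\gamma(\theta)+r\,e(\theta)=\gamma(\theta_1)-r_1e(\theta_1)$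 with $0<\theta_1-\theta<\pi$ (this also fixes the lift). The map extends analytically to $r\ge0$, with $f(\theta,0)=(\theta,0)$, so $C_-=\mathbb{T}_\star\times\{0\}$ is a $(0,1)$-resonant boundary (all its points are fixed). A map on a cylinder has the intersection property if the image of any closed homotopically non trivial loop of the cylinder intersects the loop. $C_-$ is an $(a_*,b_* )$-analytic $(0,1)$-resonant RIC when there exist analytic coordinates $(x,y)$, $x\in\mathbb{T}$ (defined modulo one), in a neighbourhood of $C_-$, such that $C_-\equiv\{y=0\}$ and $f$ (analytically extended across $C_-$), written as $(x_1,y_1)=f(x,y)$, satisfies: (1) it is real analytic on $\mathbb{T}\times(-b_*,b_* )$ and extends analytically to $D_{a_*,b_*}=\{(x,y)\in(\mathbb{C}/\mathbb{Z})\times\mathbb{C}:|\Im x|<a_*,|y|<b_*\}$; (2) it has the intersection property on $\mathbb{T}\times(-b_*,b_* )$; (3) $x_1=x+y+\mathrm{O}(y^2)$, $y_1=y+\mathrm{O}(y^3)$. For relatively prime integers $p,q\ge1$, a $(p,q)$-periodic dual billiard trajectory is an orbit $\{(\theta_k,r_k)\}_{k\in\mathbb{Z}}$ of the lift with $\theta_{k+q}=\theta_k+2\pi p$, $r_{k+q}=r_k$ (a closed circumscribed polygon with $q$ sides making $p$ turns outside $\Gamma$); it is Birkhoff if for all $k,k',j\in\mathbb{Z}$, $\theta_k<\theta_{k'}+2\pi j$ if and only if $kp/q<k'p/q+j$. Its area is the area enclosed by the polygon counted with multiplicity, i.e. $\frac12\oint(x_1\,\mathrm{d}x_2-x_2\,\mathrm{d}x_1)$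 along the closed polygon; equivalently, up to the constant $p$ times the area enclosed by $\Gamma$, it is the sum over $k=0,\dots,q-1$ of the areas of the regions bounded by $\Gamma$ and its tangent lines at $\gamma(\theta_k)$ and $\gamma(\theta_{k+1})$. $\mathcal{A}^{(p,q)}$ is the supremum of the absolute values of the differences of the areas of all Birkhoff $(p,q)$-periodic dual billiard trajectories (with $\sup\emptyset=0$). *)

(* Defs.v *)
From Stdlib Require Import Reals ZArith.
From Coquelicot Require Import Coquelicot.

Set Implicit Arguments.
Unset Strict Implicit.

Open Scope R_scope.

Definition vec : Type := (R * R)%type.

Definition det (u v : vec) : R := fst u * snd v - snd u * fst v.

Definition vsub (u v : vec) : vec := (fst u - fst v, snd u - snd v).

Definition vlen (u : vec) : R := sqrt (fst u ^ 2 + snd u ^ 2).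

(** The point [u + s v]. *)
Definition along (u : vec) (s : R) (v : vec) : vec :=
  (fst u + s * fst v, snd u + s * snd v).

(** The direction of angle [theta]. *)
Definition dir (theta : R) : vec := (cos theta, sin theta).

(** * Analyticity *)

Definition analytic_at (f : R -> R) (t : R) : Prop :=
  exists (a : nat -> R) (delta : R), 0 < delta /\
    forall h : R, Rabs h < delta -> is_pseries a h (f (t + h)).

(** Local sum of an absolutely convergent double power series, summed by
    total degree. *)
Definition analytic2_at (f : R -> R -> R) (x y : R) : Prop :=
  exists (a : nat -> nat -> R) (delta : R), 0 < delta /\
    ex_series (fun n =>
      sum_n (fun i => Rabs (a i (n - i)%nat) * delta ^ n) n) /\
    forall h k : R, Rabs h < delta -> Rabs k < delta ->
      is_series (fun n =>
        sum_n (fun i => a i (n - i)%nat * h ^ i * k ^ (n - i)) n)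
        (f (x + h) (y + k)).

(** Complex Frechet differentiability (the scalars are those of [C]). *)
Definition holomorphic_at (G : C * C -> C * C) (p : C * C) : Prop :=
  @ex_filterdiff C_AbsRing
    (prod_NormedModule C_AbsRing C_NormedModule C_NormedModule)
    (prod_NormedModule C_AbsRing C_NormedModule C_NormedModule)
    G (locally p).

(** * The curve *)

Definition velocity (c : R -> vec) (t : R) : vec :=
  (Derive (fun s => fst (c s)) t, Derive (fun s => snd (c s)) t).

Definition curvature (c : R -> vec) (t : R) : R :=
  det (velocity c t) (velocity (velocity c) t) / vlen (velocity c t) ^ 3.

(** [c] is a simple regular analytic 1-periodic parametrization of the closed
    curve.  [scc_left] states both strict convexity (a tangent line meets the
    curve only at its tangency point) and the counterclockwise orientation
    (the curve lies to the left of its oriented tangent lines). *)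
Record strictly_convex_curve (c : R -> vec) : Prop := {
  scc_analytic : forall t, analytic_at (fun s => fst (c s)) t /\
                           analytic_at (fun s => snd (c s)) t;
  scc_closed : forall t, c (t + 1) = c t;
  scc_simple : forall s t, c s = c t -> exists k : Z, s = t + IZR k;
  scc_regular : forall t, velocity c t <> (0, 0);
  scc_left : forall s t, c s <> c t -> 0 < det (velocity c t) (vsub (c s) (c t));
  scc_curvature : forall t, 0 < curvature c t
}.

(** [gamma theta] is the point of the curve whose positively oriented unit
    tangent is [dir theta]; this determines [gamma]. *)
Definition tangent_angle_param (c gamma : R -> vec) : Prop :=
  forall theta, exists t, gamma theta = c t /\
    (fst (velocity c t) / vlen (velocity c t),
     snd (velocity c t) / vlen (velocity c t)) = dir theta.

(** * The dual billiard map in envelope coordinates *)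

(** The graph of the lift: [(theta1, r1) = f (theta, r)]. *)
Definition dual_billiard (gamma : R -> vec) (theta r theta1 r1 : R) : Prop :=
  0 < r /\ 0 < r1 /\ 0 < theta1 - theta < PI /\
  along (gamma theta) r (dir theta) = along (gamma theta1) (- r1) (dir theta1).

(** * Resonant boundary *)

(** Loops are given by their lifts; [m] is the winding number around the
    cylinder, and both [F] and the loop are compared modulo [1] in [x]. *)
Definition intersection_property (F : R * R -> R * R) (b : R) : Prop :=
  forall (loop : R -> R * R) (m : Z),
    m <> 0%Z ->
    (forall t, continuous loop t) ->
    (forall t, Rabs (snd (loop t)) < b) ->
    (forall t, loop (t + 1) = (fst (loop t) + IZR m, snd (loop t))) ->
    exists (s t : R) (k : Z),
      F (loop s) = (fst (loop t) + IZR k, snd (loop t)).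

Definition in_polystrip (a b : R) (p : C * C) : Prop :=
  Rabs (snd (fst p)) < a /\ Cmod (snd p) < b.

(** Conditions (analyticity, intersection, normal form) on the lift [F] of a
    map written in the coordinates [(x, y)], with [x] modulo [1].  The degree
    one of the lift is forced by the normal form. *)
Record resonant_normal_form (F : R * R -> R * R) (a b : R) : Prop := {
  rnf_real_analytic : forall x y, Rabs y < b ->
    analytic2_at (fun u v => fst (F (u, v))) x y /\
    analytic2_at (fun u v => snd (F (u, v))) x y;
  rnf_extension : exists G : C * C -> C * C,
    (forall p, in_polystrip a b p -> holomorphic_at G p) /\
    (forall p, in_polystrip a b p ->
       G (Cplus (fst p) (RtoC 1), snd p) =
         (Cplus (fst (G p)) (RtoC 1), snd (G p))) /\
    (forall x y, Rabs y < b ->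
       G (RtoC x, RtoC y) = (RtoC (fst (F (x, y))), RtoC (snd (F (x, y)))));
  rnf_intersection : intersection_property F b;
  rnf_form : exists M delta : R, 0 < delta /\
    forall x y, Rabs y < delta -> Rabs y < b ->
      Rabs (fst (F (x, y)) - (x + y)) <= M * Rabs y ^ 2 /\
      Rabs (snd (F (x, y)) - y) <= M * Rabs y ^ 3
}.

(** Analytic coordinates [x = X theta r] (modulo [1]) and [y = Y theta r] on
    the neighbourhood [|r| < rho] of the boundary [r = 0] of the cylinder,
    with [theta] modulo [2 PI].  The first half of [bc_bijective] is good
    definition, the second one injectivity, on the cylinders. *)
Record boundary_coordinates (X Y : R -> R -> R) (rho : R) : Prop := {
  bc_pos : 0 < rho;
  bc_analytic : forall theta r, Rabs r < rho ->
    analytic2_at X theta r /\ analytic2_at Y theta r;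
  bc_bijective : forall theta r theta' r', Rabs r < rho -> Rabs r' < rho ->
    ((exists k : Z, theta' = theta + 2 * PI * IZR k) /\ r' = r) <->
    ((exists m : Z, X theta' r' = X theta r + IZR m) /\
     Y theta' r' = Y theta r);
  bc_jacobian : forall theta r, Rabs r < rho ->
    Derive (fun t => X t r) theta * Derive (fun s => Y theta s) r -
    Derive (fun s => X theta s) r * Derive (fun t => Y t r) theta <> 0;
  bc_boundary : forall theta r, Rabs r < rho -> (Y theta r = 0 <-> r = 0)
}.

(** The boundary [r = 0] is an [(a, b)]-analytic [(0,1)]-resonant RIC.  The
    dual billiard map is only given for [r > 0]; since [F] is analytic, it is
    the analytic extension across [r = 0] of that map in the coordinates
    [(X, Y)]. *)
Definition analytic_resonant_boundary (gamma : R -> vec) (a b : R) : Prop :=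
  0 < a /\ 0 < b /\
  exists (X Y : R -> R -> R) (rho : R) (F : R * R -> R * R),
    boundary_coordinates X Y rho /\
    resonant_normal_form F a b /\
    forall theta r theta1 r1,
      r < rho -> r1 < rho -> Rabs (Y theta r) < b ->
      dual_billiard gamma theta r theta1 r1 ->
      exists k : Z, F (X theta r, Y theta r) =
        (X theta1 r1 + IZR k, Y theta1 r1).

(** * Periodic trajectories and their areas *)

Definition periodic_trajectory (gamma : R -> vec) (p q : nat)
    (theta r : Z -> R) : Prop :=
  (forall k : Z, dual_billiard gamma (theta k) (r k)
                   (theta (k + 1)%Z) (r (k + 1)%Z)) /\
  (forall k : Z, theta (k + Z.of_nat q)%Z = theta k + 2 * PI * INR p /\
                 r (k + Z.of_nat q)%Z = r k).

Definition birkhoff (p q : nat) (theta : Z -> R) : Prop :=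
  forall k k' j : Z,
    theta k < theta k' + 2 * PI * IZR j <->
    IZR k * INR p / INR q < IZR k' * INR p / INR q + IZR j.

Definition vertex (gamma : R -> vec) (theta r : Z -> R) (k : Z) : vec :=
  along (gamma (theta k)) (r k) (dir (theta k)).

(** Line integral of [(x1 dx2 - x2 dx1) / 2] along the segment from [u] to
    [v]. *)
Definition segment_area (u v : vec) : R :=
  / 2 * RInt (fun t =>
    fst (along u t (vsub v u)) * snd (vsub v u) -
    snd (along u t (vsub v u)) * fst (vsub v u)) 0 1.

(** The closed polygon has the [q >= 1] sides from vertex [k] to vertex
    [k + 1], for [0 <= k <= q - 1]. *)
Definition trajectory_area (gamma : R -> vec) (q : nat)
    (theta r : Z -> R) : R :=
  sum_n (fun k => segment_area
    (vertex gamma theta r (Z.of_nat k))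
    (vertex gamma theta r (Z.of_nat k + 1)%Z)) (q - 1).

(** The value [0] is added to the set so that the supremum is [0] when there is
    no trajectory; otherwise it is already the difference of an area with
    itself. *)
Definition area_spread (gamma : R -> vec) (p q : nat) : Rbar :=
  Lub_Rbar (fun d : R => d = 0 \/
    exists theta r theta' r' : Z -> R,
      periodic_trajectory gamma p q theta r /\ birkhoff p q theta /\
      periodic_trajectory gamma p q theta' r' /\ birkhoff p q theta' /\
      d = Rabs (trajectory_area gamma q theta r -
                trajectory_area gamma q theta' r')).

(* Main.v *)
Require Import Defs.
From Stdlib Require Import Reals ZArith.
From Coquelicot Require Import Coquelicot.
From Stdlib Require Import Lra Lia Classical ClassicalEpsilon List.

Open Scope R_scope.

(** Write [mu = p/q] and let [G] be the complexified map near [y = 0].  For small [mu] the points whose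
    [q]-th iterate has abscissa [x + p] form a curve [y = Y x], holomorphic on a strip [|Im x| < a2] with
    [a2 < a_star], and [w x], the ordinate of the [q]-th iterate minus [Y x], is holomorphic and 1-periodic there.
    The real zeros of [w] are the points of the [(p,q)]-periodic orbits.  Two distinct Birkhoff orbits give [2 q]
    zeros modulo 1, those of each orbit being within [O(1/q)] of a translate of the lattice of step [1/q].
    Dividing [w] by the corresponding sines and applying the maximum principle on the strip yields
    [|w| <= K exp (- 2 pi alpha' q)] on the real line, for some [alpha' > alpha].

    The side contributions to the area of a circumscribed polygon are, up to a coboundary, the values of a generating
    function [T (theta_k, theta_(k+1))] whose gradient along an orbit telescopes.  Closing up the orbit segment that
    starts at [(x, Y x)] gives a function of [x] which takes the areas of the periodic orbits at their points, and
    whose Lipschitz constant is at most a polynomial in [q] times [sup |w|].  This bounds the difference of the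
    areas of any two orbits; the polynomial is absorbed by [alpha' > alpha]. *)

(** The product of [q] sines whose zeros form a lattice of step [1/q] grows like
    [exp (PI q |Im z|)]: the zeros of two orbits are needed for the rate [2 PI], a single orbit
    gives half of it. As [p] and [q] are coprime, the multiples of [p/q] fill the whole lattice
    modulo 1, so the estimate obtained is [exp (- 2 PI alpha q)], which implies the stated one
    because [p >= 1]. The Birkhoff order makes the [q] points of an orbit distinct modulo a turn;
    the bound [p <= L] makes errors [O(mu^2)] per step add up to [O(mu)] over [q] steps. Two orbits
    that share a point have equal areas, and need no estimate. One obstacle is that the normal form
    controls its remainders at real points only, while the iteration takes place in a complex strip:
    a two constants argument carries the order of vanishing in [y] to narrower strips. Another is
    the division by sines: the quotients are only shown to be continuous at the removed zeros, so
    the maximum principle is proved for functions holomorphic off isolated points, starting from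
    mean values over circles. *)

(** * Bisection and compactness on intervals and rectangles *)

(** This plays the role of the compactness and of the connectedness of [[a, b]]. The supremum [s] of
    the [t] with [P a t] is itself such a [t], and if [s < b] the local hypothesis at [s] would push
    it further. *)
Lemma interval_induction (P : R -> R -> Prop) (a b : R) :
  a <= b ->
  (forall u v w, a <= u -> u <= v -> v <= w -> w <= b -> P u v -> P v w -> P u w) ->
  (forall x, a <= x <= b -> exists d, 0 < d /\
     forall u v, a <= u -> x - d < u -> u <= x -> x <= v -> v < x + d -> v <= b -> P u v) ->
  P a b.
Proof.
intros hab hadd hloc.
set (S := fun t => a <= t <= b /\ P a t).
assert (Sa : S a).
{ split; [lra|]. destruct (hloc a) as (d & hd & h); [lra|]. apply h; lra. }
destruct (completeness S) as (s & ub & lub).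
{ exists b. intros t ht; apply ht. }
{ exists a; exact Sa. }
assert (h1 : a <= s) by (apply ub; exact Sa).
assert (h2 : s <= b) by (apply lub; intros t ht; apply ht).
destruct (hloc s) as (d & hd & h); [lra|].
assert (exists t, S t /\ s - d < t) as (t & (ht1 & ht2) & ht3).
{ apply NNPP; intro hn. assert (s <= s - d); [|lra]. apply lub. intros t ht.
  destruct (Rle_or_lt t (s-d)); auto. exfalso; apply hn; exists t; split; auto. }
assert (ht4 : t <= s) by (apply ub; split; auto).
destruct (Rlt_or_le s b) as [hsb|hsb].
- exfalso. set (v := Rmin b (s + d/2)).
  assert (hv : s < v <= b /\ v < s + d).
  { unfold v, Rmin; destruct (Rle_dec b (s+d/2)); lra. }
  assert (v <= s); [|lra].
  apply ub; split; [lra|]. apply (hadd a t v); try lra; auto. apply h; lra.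
- apply (hadd a t b); try lra; auto. apply h; lra.
Qed.

(** If [P] fails on the whole rectangle it fails on a quarter, and so on; the nested bad rectangles
    shrink to a point, where the local hypothesis contradicts their badness. A subrectangle is given
    by its lower left corner and a scale [s], so that all of them are similar to the first. *)
Lemma quarter_principle (P : R -> R -> R -> Prop) (A C W H : R) :
  0 < W -> 0 < H ->
  (forall a c s, 0 < s -> A <= a -> a + W * s <= A + W -> C <= c -> c + H * s <= C + H ->
     P a c (s/2) -> P (a + W * (s/2)) c (s/2) -> P a (c + H * (s/2)) (s/2) ->
     P (a + W * (s/2)) (c + H * (s/2)) (s/2) -> P a c s) ->
  (forall x y, A <= x <= A + W -> C <= y <= C + H -> exists d, 0 < d /\
     forall a c s, 0 < s < d -> A <= a -> a <= x -> x <= a + W * s -> a + W * s <= A + W ->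
       C <= c -> c <= y -> y <= c + H * s -> c + H * s <= C + H -> P a c s) ->
  P A C 1.
Proof.
intros hW hH hadd hloc. apply NNPP; intro hn.
set (Bad := fun (n : nat) (p : R * R) =>
   A <= fst p /\ fst p + W * (/2)^n <= A + W /\ C <= snd p /\ snd p + H * (/2)^n <= C + H /\
   ~ P (fst p) (snd p) ((/2)^n)).
assert (step : forall n p, Bad n p -> exists p', Bad (S n) p' /\
   fst p <= fst p' /\ fst p' + W * (/2)^(S n) <= fst p + W * (/2)^n /\
   snd p <= snd p' /\ snd p' + H * (/2)^(S n) <= snd p + H * (/2)^n).
{ intros n (a, c) (h1 & h2 & h3 & h4 & h5); simpl fst in *; simpl snd in *.
  assert (hs : 0 < (/2)^n) by (apply pow_lt; lra).
  replace ((/2)^(S n)) with ((/2)^n/2) by (simpl; field).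
  set (s := (/2)^n) in *.
  assert (0 < W * s) by nra. assert (0 < H * s) by nra.
  assert (eW : W * (s/2) = W*s/2) by field. assert (eH : H * (s/2) = H*s/2) by field.
  assert (hh : forall a' c', (a' = a \/ a' = a + W*(s/2)) -> (c' = c \/ c' = c + H*(s/2)) ->
     ~ P a' c' (s/2) -> exists p', Bad (S n) p' /\
   a <= fst p' /\ fst p' + W * (s/2) <= a + W * s /\
   c <= snd p' /\ snd p' + H * (s/2) <= c + H * s).
  { intros a' c' ha hc hP. exists (a', c'). unfold Bad; simpl fst; simpl snd.
    replace ((/2)^(S n)) with (s/2) by (unfold s; simpl; field).
    destruct ha, hc; subst a' c'; repeat split; try lra; auto. }
  apply NNPP; intro hno. apply h5. apply hadd; try lra.
  all: apply NNPP; intro hP; apply hno; (eapply hh; [| |exact hP]); auto. }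
assert (h0 : Bad 0%nat (A, C)).
{ unfold Bad; simpl; repeat split; try lra. auto. }
set (next := fun n (p : R*R) => epsilon (inhabits p) (fun p' => Bad (S n) p' /\
   fst p <= fst p' /\ fst p' + W * (/2)^(S n) <= fst p + W * (/2)^n /\
   snd p <= snd p' /\ snd p' + H * (/2)^(S n) <= snd p + H * (/2)^n)).
set (sq := fix sq n := match n with O => (A, C) | S m => next m (sq m) end).
assert (hb : forall n, Bad n (sq n)).
{ induction n; [exact h0|]. simpl. unfold next.
  apply (epsilon_spec (inhabits (sq n)) (fun p' => Bad (S n) p' /\ _)); auto. }
assert (hs : forall n, fst (sq n) <= fst (sq (S n)) /\
   fst (sq (S n)) + W * (/2)^(S n) <= fst (sq n) + W * (/2)^n /\
   snd (sq n) <= snd (sq (S n)) /\ snd (sq (S n)) + H * (/2)^(S n) <= snd (sq n) + H * (/2)^n).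
{ intro n. pose proof (epsilon_spec (inhabits (sq n)) (fun p' => Bad (S n) p' /\
   fst (sq n) <= fst p' /\ fst p' + W * (/2)^(S n) <= fst (sq n) + W * (/2)^n /\
   snd (sq n) <= snd p' /\ snd p' + H * (/2)^(S n) <= snd (sq n) + H * (/2)^n) (step n _ (hb n))) as hq.
  apply hq. }
assert (hm : forall n m, fst (sq n) <= fst (sq (n+m)%nat) /\
   fst (sq (n+m)%nat) + W * (/2)^(n+m) <= fst (sq n) + W * (/2)^n /\
   snd (sq n) <= snd (sq (n+m)%nat) /\ snd (sq (n+m)%nat) + H * (/2)^(n+m) <= snd (sq n) + H * (/2)^n).
{ intros n m; induction m; [rewrite Nat.add_0_r; lra|].
  rewrite Nat.add_succ_r. pose proof (hs (n+m)%nat). lra. }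
assert (hpos : forall n, 0 < (/2)^n) by (intro; apply pow_lt; lra).
(* Left ends increase and right ends decrease, so the supremum of the left ends lies in every
   interval. *)
assert (lim : forall (u : nat -> R) K, 0 < K ->
   (forall n m, u n <= u (n+m)%nat /\ u (n+m)%nat + K * (/2)^(n+m) <= u n + K * (/2)^n) ->
   exists x, forall n, u n <= x <= u n + K * (/2)^n).
{ intros u K hK hu.
  destruct (completeness (fun x => exists n, x = u n)) as (x & ub & lub).
  - exists (u 0%nat + K). intros y (n & ->). pose proof (proj2 (hu 0%nat n)).
    simpl in *. specialize (hpos n). nra.
  - exists (u 0%nat); exists 0%nat; auto.
  - exists x; intro n; split; [apply ub; exists n; auto|].
    apply lub; intros y (m & ->).
    pose proof (proj1 (hu m n)). pose proof (proj2 (hu n m)).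
    rewrite (Nat.add_comm m n) in H0. pose proof (hpos (n+m)%nat). nra. }
destruct (lim (fun n => fst (sq n)) W hW) as (x & hx). { intros; split; apply hm. }
destruct (lim (fun n => snd (sq n)) H hH) as (y & hy). { intros; split; apply hm. }
destruct (hloc x y) as (d & hd & hP).
{ pose proof (hx 0%nat) as h; simpl in h; lra. }
{ pose proof (hy 0%nat) as h; simpl in h; lra. }
destruct (pow_lt_1_zero (/2)) with (y := d) as (N & hN); [rewrite Rabs_pos_eq; lra|lra|].
specialize (hN N (le_n N)). rewrite Rabs_pos_eq in hN; [|apply Rlt_le, hpos].
destruct (hb N) as (b1 & b2 & b3 & b4 & b5). apply b5.
apply hP; try assumption; try apply hx; try apply hy. split; auto.
Qed.

(** * Complex differentiability *)

Lemma Cmod_minus_sym a b : Cmod (a - b)%C = Cmod (b - a)%C.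
Proof. rewrite <- Cmod_opp. f_equal. ring. Qed.

Lemma Cmod_minus_le a b : Cmod (a - b)%C <= Cmod a + Cmod b.
Proof. unfold Cminus. rewrite <- (Cmod_opp b). apply Cmod_triangle. Qed.

Lemma Cmod_le_minus a b : Cmod a <= Cmod (a - b)%C + Cmod b.
Proof. replace a with ((a - b) + b)%C at 1 by ring. apply Cmod_triangle. Qed.

Lemma Cmod_minus_trans a b c : Cmod (a - c)%C <= Cmod (a - b)%C + Cmod (b - c)%C.
Proof. replace (a - c)%C with ((a - b) + (b - c))%C by ring. apply Cmod_triangle. Qed.

Lemma fst_le_Cmod z : Rabs (fst z) <= Cmod z.
Proof. eapply Rle_trans; [apply Rmax_l|apply Rmax_Cmod]. Qed.

Lemma snd_le_Cmod z : Rabs (snd z) <= Cmod z.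
Proof. eapply Rle_trans; [apply Rmax_r|apply Rmax_Cmod]. Qed.

Lemma Cmod_le_sum (z : C) : Cmod z <= Rabs (fst z) + Rabs (snd z).
Proof.
destruct z as (x, y); simpl.
replace (x, y) with (RtoC x + Ci * RtoC y)%C.
2:{ unfold RtoC, Ci, Cplus, Cmult; simpl; f_equal; ring. }
eapply Rle_trans; [apply Cmod_triangle|].
rewrite Cmod_mult, Cmod_Ci, !Cmod_R. lra.
Qed.

Lemma Cmod_self z : Cmod (z - z)%C = 0.
Proof. replace (z - z)%C with (RtoC 0) by ring. apply Cmod_0. Qed.

Lemma Cmod_eq_minus a b : Cmod (a - b)%C = 0 -> a = b.
Proof. intro h. apply Cmod_eq_0 in h. apply Ceq_minus; auto. Qed.

Lemma Cmod_pos_neq a b : a <> b -> 0 < Cmod (a - b)%C.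
Proof. intro h. apply Cmod_gt_0. intro e. apply h, Ceq_minus; auto. Qed.

Lemma fst_minus (a b : C) : fst (a - b)%C = fst a - fst b. Proof. reflexivity. Qed.
Lemma snd_minus (a b : C) : snd (a - b)%C = snd a - snd b. Proof. reflexivity. Qed.
Lemma le_epsilon_mul a b K : 0 <= K -> (forall e, 0 < e -> a <= b + e * K) -> a <= b.
Proof.
intros hK h. apply le_epsilon; intros e he.
specialize (h (e / (K + 1))). assert (0 < e / (K+1)) by (apply Rdiv_lt_0_compat; lra).
specialize (h H). assert (e / (K+1) * K <= e); [|lra].
apply Rmult_le_reg_r with (K+1); [lra|]. replace (e/(K+1)*K*(K+1)) with (e*K) by (field; lra). nra.
Qed.

(** The remainder is estimated without dividing by [w - z], so that [w = z] is no separate case and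
    the derivative [l] stays explicit. *)
Definition cdiff (f : C -> C) (z l : C) : Prop :=
  forall e, 0 < e -> exists d, 0 < d /\ forall w, Cmod (w - z)%C < d ->
    Cmod (f w - f z - l * (w - z))%C <= e * Cmod (w - z)%C.

Definition ccont (f : C -> C) (z : C) : Prop :=
  forall e, 0 < e -> exists d, 0 < d /\ forall w, Cmod (w - z)%C < d ->
    Cmod (f w - f z)%C < e.

Definition holo (f : C -> C) (z : C) : Prop := exists l, cdiff f z l.

Lemma cdiff_lip f z l : cdiff f z l -> exists d, 0 < d /\ forall w, Cmod (w - z)%C < d ->
  Cmod (f w - f z)%C <= (Cmod l + 1) * Cmod (w - z)%C.
Proof.
intro h. destruct (h 1 Rlt_0_1) as (d & hd & hh). exists d; split; auto.
intros w hw. specialize (hh w hw).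
pose proof (Cmod_le_minus (f w - f z) (l * (w - z)))%C as h2. rewrite Cmod_mult in h2. lra.
Qed.

Lemma cdiff_ccont f z l : cdiff f z l -> ccont f z.
Proof.
intros h e he. destruct (cdiff_lip _ _ _ h) as (d & hd & hh).
pose proof (Cmod_ge_0 l).
exists (Rmin d (e / (Cmod l + 2))). split.
{ apply Rmin_pos; auto. apply Rdiv_lt_0_compat; lra. }
intros w hw.
assert (h1 : Cmod (w - z)%C < d) by (eapply Rlt_le_trans; [exact hw|apply Rmin_l]).
assert (h2 : Cmod (w - z)%C < e / (Cmod l + 2)) by (eapply Rlt_le_trans; [exact hw|apply Rmin_r]).
specialize (hh w h1). eapply Rle_lt_trans; [exact hh|].
apply Rmult_lt_compat_r with (r := Cmod l + 2) in h2; [|lra].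
replace (e / (Cmod l + 2) * (Cmod l + 2)) with e in h2 by (field; lra).
pose proof (Cmod_ge_0 (w - z)%C). nra.
Qed.

Lemma holo_ccont f z : holo f z -> ccont f z.
Proof. intros (l & h). eapply cdiff_ccont; eauto. Qed.

Lemma cdiff_ext_loc f g z l d : 0 < d -> (forall w, Cmod (w - z)%C < d -> f w = g w) ->
  cdiff f z l -> cdiff g z l.
Proof.
intros hd he h e hep. destruct (h e hep) as (d1 & hd1 & hh).
exists (Rmin d d1); split; [apply Rmin_pos; auto|].
intros w hw. rewrite <- (he w), <- (he z).
- apply hh. eapply Rlt_le_trans; [exact hw|apply Rmin_r].
- rewrite Cmod_self; auto.
- eapply Rlt_le_trans; [exact hw|apply Rmin_l].
Qed.

Lemma cdiff_ext f g z l : (forall w, f w = g w) -> cdiff f z l -> cdiff g z l.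
Proof. intros he. apply (cdiff_ext_loc f g z l 1 Rlt_0_1). intros; apply he. Qed.

Lemma ccont_ext_loc f g z d : 0 < d -> (forall w, Cmod (w - z)%C < d -> f w = g w) ->
  ccont f z -> ccont g z.
Proof.
intros hd he h e hep. destruct (h e hep) as (d1 & hd1 & hh).
exists (Rmin d d1); split; [apply Rmin_pos; auto|].
intros w hw. rewrite <- (he w), <- (he z).
- apply hh. eapply Rlt_le_trans; [exact hw|apply Rmin_r].
- rewrite Cmod_self; auto.
- eapply Rlt_le_trans; [exact hw|apply Rmin_l].
Qed.

Lemma cdiff_const c z : cdiff (fun _ => c) z 0%C.
Proof.
intros e he. exists 1; split; [lra|]. intros w _.
replace (c - c - 0 * (w - z))%C with (RtoC 0) by ring. rewrite Cmod_0.
pose proof (Cmod_ge_0 (w - z)%C). nra.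
Qed.

Lemma cdiff_id z : cdiff (fun w => w) z 1%C.
Proof.
intros e he. exists 1; split; [lra|]. intros w _.
replace (w - z - 1 * (w - z))%C with (RtoC 0) by ring. rewrite Cmod_0.
pose proof (Cmod_ge_0 (w - z)%C). nra.
Qed.

Lemma cdiff_plus f g z l m : cdiff f z l -> cdiff g z m -> cdiff (fun w => f w + g w)%C z (l + m)%C.
Proof.
intros hf hg e he. destruct (hf (e/2)) as (d1 & hd1 & h1); [lra|].
destruct (hg (e/2)) as (d2 & hd2 & h2); [lra|].
exists (Rmin d1 d2); split; [apply Rmin_pos; auto|]. intros w hw.
specialize (h1 w (Rlt_le_trans _ _ _ hw (Rmin_l _ _))).
specialize (h2 w (Rlt_le_trans _ _ _ hw (Rmin_r _ _))).
replace (f w + g w - (f z + g z) - (l + m) * (w - z))%C with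
  ((f w - f z - l * (w - z)) + (g w - g z - m * (w - z)))%C by ring.
eapply Rle_trans; [apply Cmod_triangle|]. lra.
Qed.

Lemma cdiff_mult f g z l m : cdiff f z l -> cdiff g z m ->
  cdiff (fun w => f w * g w)%C z (l * g z + f z * m)%C.
Proof.
intros hf hg e he.
destruct (cdiff_lip _ _ _ hf) as (d0 & hd0 & h0).
destruct (cdiff_ccont _ _ _ hg 1 Rlt_0_1) as (d0' & hd0' & h0').
pose proof (Cmod_ge_0 l) as pl. pose proof (Cmod_ge_0 m) as pm.
pose proof (Cmod_ge_0 (f z)) as pf. pose proof (Cmod_ge_0 (g z)) as pg.
set (K := Cmod (f z) + Cmod (g z) + Cmod l + 2).
assert (hK : 0 < K) by (unfold K; lra).
set (e1 := e / (3 * K)). assert (he1 : 0 < e1) by (apply Rdiv_lt_0_compat; lra).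
destruct (hf e1 he1) as (d1 & hd1 & h1).
destruct (hg e1 he1) as (d2 & hd2 & h2).
destruct (cdiff_ccont _ _ _ hg e1 he1) as (d3 & hd3 & h3).
exists (Rmin d0 (Rmin d1 (Rmin d2 d3))). split; [repeat apply Rmin_pos; auto|].
intros w hw.
assert (a0 := Rlt_le_trans _ _ _ hw (Rmin_l _ _)).
assert (hw' := Rlt_le_trans _ _ _ hw (Rmin_r _ _)).
assert (a1 := Rlt_le_trans _ _ _ hw' (Rmin_l _ _)).
assert (hw'' := Rlt_le_trans _ _ _ hw' (Rmin_r _ _)).
assert (a2 := Rlt_le_trans _ _ _ hw'' (Rmin_l _ _)).
assert (a3 := Rlt_le_trans _ _ _ hw'' (Rmin_r _ _)).
specialize (h0 w a0). specialize (h1 w a1). specialize (h2 w a2). specialize (h3 w a3).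
replace (f w * g w - f z * g z - (l * g z + f z * m) * (w - z))%C with
  ((f w - f z) * (g w - g z) + (f w - f z - l * (w - z)) * g z + f z * (g w - g z - m * (w - z)))%C by ring.
eapply Rle_trans; [apply Cmod_triangle|].
eapply Rle_trans; [apply Rplus_le_compat_r, Cmod_triangle|].
rewrite !Cmod_mult.
set (t := Cmod (w - z)%C) in *. assert (ht : 0 <= t) by apply Cmod_ge_0.
set (A := Cmod (f w - f z)%C) in *. set (B := Cmod (g w - g z)%C) in *.
assert (0 <= A) by apply Cmod_ge_0. assert (0 <= B) by apply Cmod_ge_0.
assert (q1 : A * B <= (Cmod l + 1) * t * e1).
{ apply Rmult_le_compat; lra. }
assert (q2 : Cmod (f w - f z - l * (w - z))%C * Cmod (g z) <= e1 * t * Cmod (g z)) by (apply Rmult_le_compat_r; lra).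
assert (q3 : Cmod (f z) * Cmod (g w - g z - m * (w - z))%C <= Cmod (f z) * (e1 * t)) by (apply Rmult_le_compat_l; lra).
assert (q4 : e = 3 * K * e1) by (unfold e1; field; lra).
assert (0 <= e1 * t) by nra.
rewrite q4. unfold K. nra.
Qed.

Lemma cdiff_opp f z l : cdiff f z l -> cdiff (fun w => - f w)%C z (- l)%C.
Proof.
intros h. eapply cdiff_ext with (f := fun w => ((-1) * f w)%C); [intro; ring|].
replace (- l)%C with (0 * f z + (-1) * l)%C by ring.
apply (cdiff_mult (fun _ => (-1)%C)); auto. apply cdiff_const.
Qed.

Lemma cdiff_minus f g z l m : cdiff f z l -> cdiff g z m -> cdiff (fun w => f w - g w)%C z (l - m)%C.
Proof. intros; apply cdiff_plus; auto; apply cdiff_opp; auto. Qed.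

Lemma cdiff_scal c f z l : cdiff f z l -> cdiff (fun w => c * f w)%C z (c * l)%C.
Proof.
intros h. replace (c * l)%C with (0 * f z + c * l)%C by ring.
apply (cdiff_mult (fun _ => c)); auto. apply cdiff_const.
Qed.

Lemma cdiff_comp f g z l m : cdiff g z m -> cdiff f (g z) l -> cdiff (fun w => f (g w)) z (l * m)%C.
Proof.
intros hg hf e he.
pose proof (Cmod_ge_0 l). pose proof (Cmod_ge_0 m).
destruct (cdiff_lip _ _ _ hg) as (d0 & hd0 & h0).
set (K := Cmod l + Cmod m + 2).
set (e1 := e / (2 * K)). assert (he1 : 0 < e1) by (apply Rdiv_lt_0_compat; unfold K; lra).
destruct (hf e1 he1) as (d1 & hd1 & h1).
destruct (cdiff_ccont _ _ _ hg d1 hd1) as (d2 & hd2 & h2).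
destruct (hg e1 he1) as (d3 & hd3 & h3).
exists (Rmin d0 (Rmin d2 d3)). split; [repeat apply Rmin_pos; auto|].
intros w hw.
assert (a0 := Rlt_le_trans _ _ _ hw (Rmin_l _ _)).
assert (hw' := Rlt_le_trans _ _ _ hw (Rmin_r _ _)).
assert (a2 := Rlt_le_trans _ _ _ hw' (Rmin_l _ _)).
assert (a3 := Rlt_le_trans _ _ _ hw' (Rmin_r _ _)).
specialize (h0 w a0). specialize (h2 w a2). specialize (h3 w a3). specialize (h1 (g w) h2).
replace (f (g w) - f (g z) - l * m * (w - z))%C with
  ((f (g w) - f (g z) - l * (g w - g z)) + l * (g w - g z - m * (w - z)))%C by ring.
eapply Rle_trans; [apply Cmod_triangle|]. rewrite Cmod_mult.
set (t := Cmod (w - z)%C) in *. assert (ht : 0 <= t) by apply Cmod_ge_0.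
assert (q4 : e = 2 * K * e1) by (unfold e1; field; unfold K; lra).
assert (e1 * Cmod (g w - g z)%C <= e1 * ((Cmod m + 1) * t)) by (apply Rmult_le_compat_l; lra).
assert (Cmod l * Cmod (g w - g z - m * (w - z))%C <= Cmod l * (e1 * t)) by (apply Rmult_le_compat_l; lra).
assert (0 <= e1 * t) by nra. rewrite q4; unfold K. nra.
Qed.

Lemma ccont_comp f g z : ccont g z -> ccont f (g z) -> ccont (fun w => f (g w)) z.
Proof.
intros hg hf e he. destruct (hf e he) as (d & hd & h).
destruct (hg d hd) as (d' & hd' & h'). exists d'; split; auto.
Qed.

Lemma cdiff_inv (z : C) : z <> 0%C -> cdiff Cinv z (- / (z * z))%C.
Proof.
intros hz e he.
assert (hp : 0 < Cmod z) by (apply Cmod_gt_0; auto).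
set (m := Cmod z) in *.
exists (Rmin (m / 2) (e * m * m * m / 2)). split.
{ apply Rmin_pos; [lra|]. assert (0 < e * m * m * m) by (repeat apply Rmult_lt_0_compat; auto). lra. }
intros w hw.
assert (a1 := Rlt_le_trans _ _ _ hw (Rmin_l _ _)).
assert (a2 := Rlt_le_trans _ _ _ hw (Rmin_r _ _)).
assert (hwm : m / 2 <= Cmod w).
{ pose proof (Cmod_le_minus z w). rewrite Cmod_minus_sym in H. fold m in H. lra. }
assert (hw0 : w <> 0%C). { apply Cmod_gt_0. lra. }
replace (/ w - / z - - / (z * z) * (w - z))%C with ((w - z) * (w - z) / (z * z * w))%C by (field; auto).
assert (hne : (z * z * w)%C <> 0%C) by (repeat apply Cmult_neq_0; auto).
rewrite Cmod_div, !Cmod_mult by auto. fold m.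
set (t := Cmod (w - z)%C) in *. assert (ht : 0 <= t) by apply Cmod_ge_0.
apply Rmult_le_reg_r with (m * m * Cmod w). { apply Rmult_lt_0_compat; [nra|lra]. }
replace (t * t / (m * m * Cmod w) * (m * m * Cmod w)) with (t * t) by (field; split; lra).
assert (m * m * (m/2) <= m * m * Cmod w) by (apply Rmult_le_compat_l; nra).
assert (t * (e * m * m * m / 2) <= e * t * (m * m * Cmod w)).
{ replace (t * (e * m * m * m / 2)) with (e * t * (m * m * (m/2))) by field.
  apply Rmult_le_compat_l; nra. }
nra.
Qed.

Lemma holo_plus f g z : holo f z -> holo g z -> holo (fun w => f w + g w)%C z.
Proof. intros (l & hl) (m & hm). eexists; apply cdiff_plus; eauto. Qed.
Lemma holo_minus f g z : holo f z -> holo g z -> holo (fun w => f w - g w)%C z.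
Proof. intros (l & hl) (m & hm). eexists; apply cdiff_minus; eauto. Qed.
Lemma holo_mult f g z : holo f z -> holo g z -> holo (fun w => f w * g w)%C z.
Proof. intros (l & hl) (m & hm). eexists; apply cdiff_mult; eauto. Qed.
Lemma holo_const c z : holo (fun _ => c) z.
Proof. eexists; apply cdiff_const. Qed.
Lemma holo_id z : holo (fun w => w) z.
Proof. eexists; apply cdiff_id. Qed.
Lemma holo_comp f g z : holo g z -> holo f (g z) -> holo (fun w => f (g w)) z.
Proof. intros (m & hm) (l & hl). eexists; apply cdiff_comp; eauto. Qed.
Lemma holo_inv (f : C -> C) (z : C) : f z <> 0%C -> holo f z -> holo (fun w => / f w)%C z.
Proof. intros h0 h. apply (holo_comp Cinv f); auto. eexists; apply cdiff_inv; auto. Qed.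
Lemma holo_div (f g : C -> C) (z : C) : g z <> 0%C -> holo f z -> holo g z -> holo (fun w => f w / g w)%C z.
Proof. intros h0 hf hg. apply holo_mult; auto. apply holo_inv; auto. Qed.
Lemma holo_ext_loc f g z d : 0 < d -> (forall w, Cmod (w - z)%C < d -> f w = g w) ->
  holo f z -> holo g z.
Proof. intros hd he (l & h). exists l. eapply cdiff_ext_loc; eauto. Qed.

(** * Integrals of holomorphic functions *)

Lemma continuous_eps (g : R -> R) t :
  (forall e, 0 < e -> exists d, 0 < d /\ forall s, Rabs (s - t) < d -> Rabs (g s - g t) < e) ->
  continuous g t.
Proof.
intro h. apply filterlim_locally. intros (e & he). destruct (h e he) as (d & hd & hh).
exists (mkposreal d hd). intros s hs. apply hh. exact hs.
Qed.

Lemma ccont_path (f : C -> C) (p : R -> C) K t : 0 < K ->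
  (forall s, Cmod (p s - p t)%C <= K * Rabs (s - t)) -> ccont f (p t) ->
  forall e, 0 < e -> exists d, 0 < d /\ forall s, Rabs (s - t) < d -> Cmod (f (p s) - f (p t))%C < e.
Proof.
intros hK hp hf e he. destruct (hf e he) as (d & hd & h).
exists (d / K). split; [apply Rdiv_lt_0_compat; auto|].
intros s hs. apply h. eapply Rle_lt_trans; [apply hp|].
apply Rmult_lt_compat_l with (r := K) in hs; auto.
replace (K * (d / K)) with d in hs by (field; lra). lra.
Qed.

Lemma continuous_fst_path f p K t : 0 < K ->
  (forall s, Cmod (p s - p t)%C <= K * Rabs (s - t)) -> ccont f (p t) ->
  continuous (fun s => fst (f (p s))) t.
Proof.
intros hK hp hf. apply continuous_eps. intros e he.
destruct (ccont_path f p K t hK hp hf e he) as (d & hd & h). exists d; split; auto.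
intros s hs. eapply Rle_lt_trans; [|apply (h s hs)]. rewrite <- fst_minus. apply fst_le_Cmod.
Qed.

Lemma continuous_snd_path f p K t : 0 < K ->
  (forall s, Cmod (p s - p t)%C <= K * Rabs (s - t)) -> ccont f (p t) ->
  continuous (fun s => snd (f (p s))) t.
Proof.
intros hK hp hf. apply continuous_eps. intros e he.
destruct (ccont_path f p K t hK hp hf e he) as (d & hd & h). exists d; split; auto.
intros s hs. eapply Rle_lt_trans; [|apply (h s hs)]. rewrite <- snd_minus. apply snd_le_Cmod.
Qed.

Lemma continuous_Cmod_path f p K t : 0 < K ->
  (forall s, Cmod (p s - p t)%C <= K * Rabs (s - t)) -> ccont f (p t) ->
  continuous (fun s => Cmod (f (p s))) t.
Proof.
intros hK hp hf. apply continuous_eps. intros e he.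
destruct (ccont_path f p K t hK hp hf e he) as (d & hd & h). exists d; split; auto.
intros s hs. eapply Rle_lt_trans; [|apply (h s hs)].
pose proof (Cmod_le_minus (f (p s)) (f (p t))). pose proof (Cmod_le_minus (f (p t)) (f (p s))).
rewrite (Cmod_minus_sym (f (p t))) in H0. apply Rabs_le. lra.
Qed.

Lemma hpath_lip c t s : Cmod ((s, c) - (t, c))%C <= 1 * Rabs (s - t).
Proof.
eapply Rle_trans; [apply Cmod_le_sum|]. simpl. replace (c + - c) with 0 by ring.
rewrite Rabs_R0. unfold Rminus. lra.
Qed.

Lemma vpath_lip c t s : Cmod ((c, s) - (c, t))%C <= 1 * Rabs (s - t).
Proof.
eapply Rle_trans; [apply Cmod_le_sum|]. simpl. replace (c + - c) with 0 by ring.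
rewrite Rabs_R0. unfold Rminus. lra.
Qed.

Lemma ex_RInt_cont (g : R -> R) a b : a <= b -> (forall t, a <= t <= b -> continuous g t) -> ex_RInt g a b.
Proof.
intros hab h. apply @ex_RInt_continuous. intros z hz. apply h.
rewrite Rmin_left, Rmax_right in hz; auto.
Qed.

Lemma is_RInt_affine p q a b : is_RInt (fun t => p + q * t) a b (p * (b - a) + q * (b^2 - a^2) / 2).
Proof.
replace (p * (b - a) + q * (b^2 - a^2) / 2) with
  (minus (p * b + q * b^2 / 2) (p * a + q * a^2 / 2)) by (unfold minus, plus, opp; simpl; field).
apply (is_RInt_derive (fun t => p * t + q * t^2 / 2) (fun t => p + q * t)).
- intros x _. auto_derive; auto. field.
- intros x _. apply (continuous_plus (fun _ => p) (fun t => q * t)).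
  apply continuous_const. apply (continuous_mult (fun _ => q) (fun t => t)).
  apply continuous_const. apply continuous_id.
Qed.

Lemma RInt_near_affine g p q a b M : a <= b -> ex_RInt g a b ->
  (forall t, a <= t <= b -> Rabs (g t - (p + q * t)) <= M) ->
  Rabs (RInt g a b - (p * (b - a) + q * (b^2 - a^2) / 2)) <= M * (b - a).
Proof.
intros hab hg h.
assert (h1 : RInt g a b <= RInt (fun t => (p + M) + q * t) a b).
{ apply RInt_le; auto. eexists; apply is_RInt_affine.
  intros x hx. specialize (h x ltac:(lra)). apply Rabs_le_between in h. lra. }
assert (h2 : RInt (fun t => (p - M) + q * t) a b <= RInt g a b).
{ apply RInt_le; auto. eexists; apply is_RInt_affine.
  intros x hx. specialize (h x ltac:(lra)). apply Rabs_le_between in h. lra. }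
rewrite (is_RInt_unique _ _ _ _ (is_RInt_affine _ _ _ _)) in h1.
rewrite (is_RInt_unique _ _ _ _ (is_RInt_affine _ _ _ _)) in h2.
apply Rabs_le. lra.
Qed.

(** The real part of the integral of [f] along the boundary of a rectangle. *)
Definition loop_re (f : C -> C) (a b c d : R) : R :=
  RInt (fun x => fst (f (x, c))) a b - RInt (fun x => fst (f (x, d))) a b +
  RInt (fun y => snd (f (a, y))) c d - RInt (fun y => snd (f (b, y))) c d.

Lemma ex_h f a b c : a <= b -> (forall x, a <= x <= b -> ccont f (x, c)) ->
  ex_RInt (fun x => fst (f (x, c))) a b.
Proof.
intros hab h. apply ex_RInt_cont; auto. intros t ht.
apply (continuous_fst_path f (fun x => (x, c)) 1); auto with real. intro; apply hpath_lip.
Qed.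

Lemma ex_v f a b c : a <= b -> (forall x, a <= x <= b -> ccont f (c, x)) ->
  ex_RInt (fun x => snd (f (c, x))) a b.
Proof.
intros hab h. apply ex_RInt_cont; auto. intros t ht.
apply (continuous_snd_path f (fun x => (c, x)) 1); auto with real. intro; apply vpath_lip.
Qed.

Lemma RInt_split (g : R -> R) a m b : ex_RInt g a m -> ex_RInt g m b -> RInt g a b = RInt g a m + RInt g m b.
Proof. intros h1 h2. symmetry. apply (RInt_Chasles g a m b h1 h2). Qed.

Lemma loop_re_split f a m b c n d : a <= m -> m <= b -> c <= n -> n <= d ->
  (forall x y, a <= x <= b -> c <= y <= d -> ccont f (x, y)) ->
  loop_re f a b c d = loop_re f a m c n + loop_re f m b c n + loop_re f a m n d + loop_re f m b n d.
Proof.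
intros h1 h2 h3 h4 h. unfold loop_re.
rewrite (RInt_split (fun x => fst (f (x, c))) a m b) by (apply ex_h; auto; intros; apply h; lra).
rewrite (RInt_split (fun x => fst (f (x, d))) a m b) by (apply ex_h; auto; intros; apply h; lra).
rewrite (RInt_split (fun x => snd (f (a, x))) c n d) by (apply ex_v; auto; intros; apply h; lra).
rewrite (RInt_split (fun x => snd (f (b, x))) c n d) by (apply ex_v; auto; intros; apply h; lra).
ring.
Qed.

(** The affine part of [f] has a vanishing integral round the rectangle. On the boundary the
    remainder is at most [e] times the half perimeter, and the length of the boundary is twice the
    half perimeter. *)
Lemma loop_re_small f (x y a b c d e : R) (l : C) :
  a <= x -> x <= b -> c <= y -> y <= d -> 0 <= e ->
  (forall u v, a <= u <= b -> c <= v <= d -> ccont f (u, v)) ->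
  (forall w, a <= fst w <= b -> c <= snd w <= d ->
     Cmod (f w - f (x, y) - l * (w - (x, y)))%C <= e * Cmod (w - (x, y))%C) ->
  Rabs (loop_re f a b c d) <= 2 * e * ((b - a) + (d - c)) ^ 2.
Proof.
intros h1 h2 h3 h4 he hc h.
set (T := (b - a) + (d - c)).
assert (hE : forall w, a <= fst w <= b -> c <= snd w <= d ->
  Rabs (fst (f w) - (fst (f (x,y)) + fst l * (fst w - x) - snd l * (snd w - y))) <= e * T /\
  Rabs (snd (f w) - (snd (f (x,y)) + fst l * (snd w - y) + snd l * (fst w - x))) <= e * T).
{ intros w hw1 hw2. specialize (h w hw1 hw2).
  assert (ht : Cmod (w - (x, y))%C <= T).
  { eapply Rle_trans; [apply Cmod_le_sum|]. rewrite fst_minus, snd_minus; simpl.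
    unfold T. apply Rplus_le_compat; apply Rabs_le; lra. }
  assert (h' : Cmod (f w - f (x, y) - l * (w - (x, y)))%C <= e * T) by nra.
  split; (eapply Rle_trans; [|exact h']).
  - eapply Rle_trans; [|apply fst_le_Cmod]. apply Req_le. f_equal.
    destruct w, l; simpl. ring.
  - eapply Rle_trans; [|apply snd_le_Cmod]. apply Req_le. f_equal.
    destruct w, l; simpl. ring. }
unfold loop_re.
destruct l as (l1, l2); simpl in hE.
set (F1 := fst (f (x, y))) in *. set (F2 := snd (f (x, y))) in *.
assert (g1 := RInt_near_affine (fun s => fst (f (s, c))) (F1 - l1 * x - l2 * (c - y)) l1 a b (e * T)).
assert (g2 := RInt_near_affine (fun s => fst (f (s, d))) (F1 - l1 * x - l2 * (d - y)) l1 a b (e * T)).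
assert (g3 := RInt_near_affine (fun s => snd (f (a, s))) (F2 - l1 * y + l2 * (a - x)) l1 c d (e * T)).
assert (g4 := RInt_near_affine (fun s => snd (f (b, s))) (F2 - l1 * y + l2 * (b - x)) l1 c d (e * T)).
assert (k1 : a <= b) by lra. assert (k2 : c <= d) by lra.
specialize (g1 k1). specialize (g2 k1). specialize (g3 k2). specialize (g4 k2).
specialize (g1 ltac:(apply ex_h; auto; intros; apply hc; lra)).
specialize (g2 ltac:(apply ex_h; auto; intros; apply hc; lra)).
specialize (g3 ltac:(apply ex_v; auto; intros; apply hc; lra)).
specialize (g4 ltac:(apply ex_v; auto; intros; apply hc; lra)).
lapply g1; [clear g1; intro g1|].
2:{ intros t ht. destruct (hE (t, c)) as (q1 & _); simpl; try lra.
    eapply Rle_trans; [|exact q1]. apply Req_le; f_equal. simpl; ring. }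
lapply g2; [clear g2; intro g2|].
2:{ intros t ht. destruct (hE (t, d)) as (q1 & _); simpl; try lra.
    eapply Rle_trans; [|exact q1]. apply Req_le; f_equal. simpl; ring. }
lapply g3; [clear g3; intro g3|].
2:{ intros t ht. destruct (hE (a, t)) as (_ & q1); simpl; try lra.
    eapply Rle_trans; [|exact q1]. apply Req_le; f_equal. simpl; ring. }
lapply g4; [clear g4; intro g4|].
2:{ intros t ht. destruct (hE (b, t)) as (_ & q1); simpl; try lra.
    eapply Rle_trans; [|exact q1]. apply Req_le; f_equal. simpl; ring. }
apply Rabs_le_between in g1. apply Rabs_le_between in g2.
apply Rabs_le_between in g3. apply Rabs_le_between in g4.
assert (hT : 2 * e * T ^ 2 = 2 * (e * T * (b - a)) + 2 * (e * T * (d - c))) by (unfold T; ring).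
rewrite hT. apply Rabs_le. split; lra.
Qed.

(** The bound [e * area] for the loop integral passes from the quarters to the rectangle, since
    inner sides cancel, and holds on small rectangles by differentiability at a point; [e] is
    arbitrary. The real part is enough for the sequel: moduli are recovered by a rotation in
    [sub_mean]. *)
Theorem goursat f a b c d : a < b -> c < d ->
  (forall x y, a <= x <= b -> c <= y <= d -> holo f (x, y)) -> loop_re f a b c d = 0.
Proof.
intros hab hcd h.
assert (hc : forall x y, a <= x <= b -> c <= y <= d -> ccont f (x, y)).
{ intros; apply holo_ccont; auto. }
assert (forall e, 0 < e -> Rabs (loop_re f a b c d) <= 0 + e * ((b - a) * (d - c))).
2:{ apply Rabs_eq_0. apply Rle_antisym; [|apply Rabs_pos].
    apply (le_epsilon_mul _ _ ((b - a) * (d - c))); auto. nra. }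
intros e he.
set (W := b - a). set (H := d - c). assert (hW : 0 < W) by (unfold W; lra). assert (hH : 0 < H) by (unfold H; lra).
assert (q := quarter_principle (fun a' c' s => Rabs (loop_re f a' (a' + W * s) c' (c' + H * s)) <= e * (W * H) * s^2) a c W H hW hH).
simpl in q. replace (a + W * 1) with b in q by (unfold W; ring).
replace (c + H * 1) with d in q by (unfold H; ring).
replace (a + W) with b in q by (unfold W; ring). replace (c + H) with d in q by (unfold H; ring).
rewrite Rplus_0_l. replace (e * (W * H)) with (e * (W * H) * (1 * (1 * 1))) by ring.
apply q.
- intros a' c' s hs ha1 ha2 hc1 hc2 k1 k2 k3 k4.
  rewrite (loop_re_split f a' (a' + W * (s/2)) (a' + W * s) c' (c' + H * (s/2)) (c' + H * s)); try nra.
  2:{ intros; apply hc; lra. }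
  replace (a' + W * (s/2) + W * (s/2)) with (a' + W * s) in * by field.
  replace (c' + H * (s/2) + H * (s/2)) with (c' + H * s) in * by field.
  eapply Rle_trans; [apply Rabs_triang|].
  eapply Rle_trans; [apply Rplus_le_compat_r, Rabs_triang|].
  eapply Rle_trans; [apply Rplus_le_compat_r, Rplus_le_compat_r, Rabs_triang|].
  lra.
- intros x y hx hy. destruct (h x y hx hy) as (l & hl).
  (* Chosen so that the bound [2 e1 ((W + H) s)^2] of [loop_re_small] equals [e (W H) s^2]. *)
  set (e1 := e * (W * H) / (2 * (W + H)^2)).
  assert (hq : 0 < (W + H)^2) by (apply pow_lt; lra).
  assert (hwh : 0 < W * H) by (apply Rmult_lt_0_compat; auto).
  assert (he1 : 0 < e1). { apply Rdiv_lt_0_compat; [apply Rmult_lt_0_compat|]; lra. }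
  destruct (hl e1 he1) as (dl & hdl & hh).
  exists (dl / (W + H)). split; [apply Rdiv_lt_0_compat; lra|].
  intros a' c' s hs ha1 ha2 ha3 ha4 hc1 hc2 hc3 hc4.
  assert (hs' : (W + H) * s < dl).
  { destruct hs as (_ & hs). apply Rmult_lt_compat_l with (r := W + H) in hs; [|lra].
    replace ((W + H) * (dl / (W + H))) with dl in hs by (field; lra). lra. }
  eapply Rle_trans.
  + apply (loop_re_small f x y a' (a' + W * s) c' (c' + H * s) e1 l); try lra.
    * intros; apply hc; lra.
    * intros w hw1 hw2. apply hh. eapply Rle_lt_trans; [|exact hs'].
      eapply Rle_trans; [apply Cmod_le_sum|]. rewrite fst_minus, snd_minus; simpl.
      replace ((W + H) * s) with (W * s + H * s) by ring.
      apply Rplus_le_compat; apply Rabs_le; lra.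
  + apply Req_le. unfold e1. field. lra.
Qed.

(** * The complex exponential *)

Definition cexp (z : C) : C := (exp (fst z) * cos (snd z), exp (fst z) * sin (snd z)).

Lemma cexp_add a b : cexp (a + b)%C = (cexp a * cexp b)%C.
Proof.
destruct a as (a1, a2), b as (b1, b2). unfold cexp, Cplus, Cmult; simpl.
rewrite exp_plus, cos_plus, sin_plus. f_equal; ring.
Qed.

Lemma cexp_0 : cexp 0 = 1%C.
Proof. unfold cexp; simpl. rewrite exp_0, cos_0, sin_0. unfold RtoC; f_equal; ring. Qed.

Lemma Cmod_cexp z : Cmod (cexp z) = exp (fst z).
Proof.
unfold cexp, Cmod; simpl.
replace (exp (fst z) * cos (snd z) * (exp (fst z) * cos (snd z) * 1) +
  exp (fst z) * sin (snd z) * (exp (fst z) * sin (snd z) * 1)) with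
  (exp (fst z) * exp (fst z) * (Rsqr (sin (snd z)) + Rsqr (cos (snd z)))) by (unfold Rsqr; ring).
rewrite sin2_cos2, Rmult_1_r. apply sqrt_square. apply Rlt_le, exp_pos.
Qed.

Lemma cexp_neq_0 (z : C) : cexp z <> 0%C.
Proof. apply Cmod_gt_0. rewrite Cmod_cexp. apply exp_pos. Qed.

Lemma derivable_pt_lim_eps f x l : derivable_pt_lim f x l -> forall e, 0 < e ->
  exists d, 0 < d /\ forall h, Rabs h < d -> Rabs (f (x + h) - f x - l * h) <= e * Rabs h.
Proof.
intros hf e he. destruct (hf e he) as ((d & hd) & h). exists d; split; auto.
intros k hk. destruct (Req_dec k 0) as [->|hk0].
- rewrite Rplus_0_r, Rabs_R0. replace (f x - f x - l * 0) with 0 by ring. rewrite Rabs_R0. lra.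
- specialize (h k hk0 hk).
  replace (f (x + k) - f x - l * k) with (((f (x + k) - f x) / k - l) * k) by (field; auto).
  rewrite Rabs_mult. apply Rmult_le_compat_r; [apply Rabs_pos|lra].
Qed.

(** Only the derivative at 0 is computed, from those of [exp], [cos] and [sin]; the addition law
    carries it to [z]. *)
Lemma cdiff_cexp z : cdiff cexp z (cexp z).
Proof.
assert (h0 : cdiff cexp 0%C 1%C).
{ intros e he.
  set (e1 := Rmin (e / 10) 1). assert (he1 : 0 < e1) by (apply Rmin_pos; lra).
  assert (he1' : e1 <= e / 10) by apply Rmin_l. assert (he1'' : e1 <= 1) by apply Rmin_r. clearbody e1.
  destruct (derivable_pt_lim_eps _ _ _ (derivable_pt_lim_exp 0) e1 he1) as (d1 & hd1 & h1).
  destruct (derivable_pt_lim_eps _ _ _ (derivable_pt_lim_cos 0) e1 he1) as (d2 & hd2 & h2).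
  destruct (derivable_pt_lim_eps _ _ _ (derivable_pt_lim_sin 0) e1 he1) as (d3 & hd3 & h3).
  exists (Rmin e1 (Rmin d1 (Rmin d2 d3))). split; [repeat apply Rmin_pos; auto|].
  intros (x, y) hw. replace ((x, y) - 0)%C with ((x, y) : C) in * by (unfold RtoC, Cminus, Cplus, Copp; simpl; f_equal; ring).
  assert (a0 := Rlt_le_trans _ _ _ hw (Rmin_l _ _)).
  assert (hw' := Rlt_le_trans _ _ _ hw (Rmin_r _ _)).
  assert (a1 := Rlt_le_trans _ _ _ hw' (Rmin_l _ _)).
  assert (hw'' := Rlt_le_trans _ _ _ hw' (Rmin_r _ _)).
  assert (a2 := Rlt_le_trans _ _ _ hw'' (Rmin_l _ _)).
  assert (a3 := Rlt_le_trans _ _ _ hw'' (Rmin_r _ _)).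
  pose proof (fst_le_Cmod (x, y)) as bx. pose proof (snd_le_Cmod (x, y)) as by'. simpl in bx, by'.
  set (t := Cmod (x, y)) in *.
  specialize (h1 x ltac:(lra)). specialize (h2 y ltac:(lra)). specialize (h3 y ltac:(lra)).
  rewrite !Rplus_0_l in *. rewrite exp_0 in h1. rewrite cos_0, sin_0 in h2. rewrite cos_0, sin_0 in h3.
  assert (ex : Rabs (exp x - 1) <= 2 * Rabs x).
  { replace (exp x - 1) with ((exp x - 1 - 1 * x) + x) by ring.
    eapply Rle_trans; [apply Rabs_triang|]. pose proof (Rabs_pos x). nra. }
  assert (ex3 : Rabs (exp x) <= 3).
  { replace (exp x) with ((exp x - 1) + 1) by ring.
    eapply Rle_trans; [apply Rabs_triang|]. rewrite Rabs_R1. lra. }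
  rewrite cexp_0. replace (cexp (x,y) - 1 - 1 * (x,y))%C with
    ((exp x * (cos y - 1 - - 0 * y) + (exp x - 1 - 1 * x), exp x * (sin y - 0 - 1 * y) + (exp x - 1) * y) : C).
  2:{ unfold cexp, Cminus, Cplus, Copp, Cmult, RtoC; simpl; f_equal; ring. }
  eapply Rle_trans; [apply Cmod_le_sum|]. simpl.
  pose proof (Rabs_pos x). pose proof (Rabs_pos y).
  assert (q1 : Rabs (exp x * (cos y - 1 - - 0 * y) + (exp x - 1 - 1 * x)) <= 3 * (e1 * t) + e1 * t).
  { eapply Rle_trans; [apply Rabs_triang|]. rewrite Rabs_mult.
    apply Rplus_le_compat; [apply Rmult_le_compat; try apply Rabs_pos; nra|nra]. }
  assert (q2 : Rabs (exp x * (sin y - 0 - 1 * y) + (exp x - 1) * y) <= 3 * (e1 * t) + 2 * e1 * t).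
  { eapply Rle_trans; [apply Rabs_triang|]. rewrite !Rabs_mult.
    apply Rplus_le_compat; [apply Rmult_le_compat; try apply Rabs_pos; nra|].
    apply Rmult_le_compat; try apply Rabs_pos; lra. }
  assert (0 <= t) by (unfold t; apply Cmod_ge_0). nra. }
assert (h1 : cdiff (fun w => cexp (w - z)%C) z (1 * (1 - 0))%C).
{ apply (cdiff_comp cexp (fun w => (w - z)%C)).
  - apply cdiff_minus; [apply cdiff_id|apply cdiff_const].
  - replace (z - z)%C with (RtoC 0) by ring. exact h0. }
apply (cdiff_scal (cexp z)) in h1.
replace (cexp z * (1 * (1 - 0)))%C with (cexp z) in h1 by ring.
eapply cdiff_ext; [|exact h1].
intro w. simpl. rewrite <- cexp_add. f_equal. ring.
Qed.

Lemma holo_cexp f z : holo f z -> holo (fun w => cexp (f w)) z.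
Proof. intro h. apply (holo_comp cexp f); auto. eexists; apply cdiff_cexp. Qed.

(** * Mean values and the maximum principle *)

Definition Ctau : C := (0, 2 * PI).

Definition circ (z0 : C) (r s : R) : C := (z0 + (r * cos (2 * PI * s), r * sin (2 * PI * s))%R)%C.

Lemma Cmod_circ z0 r s : 0 <= r -> Cmod (circ z0 r s - z0)%C = r.
Proof.
intro hr. unfold circ. replace (z0 + (r * cos (2 * PI * s), r * sin (2 * PI * s))%R - z0)%C with
  ((r * cos (2 * PI * s), r * sin (2 * PI * s)) : C) by (apply injective_projections; simpl; ring).
unfold Cmod; simpl.
replace (r * cos (2 * PI * s) * (r * cos (2 * PI * s) * 1) + r * sin (2 * PI * s) * (r * sin (2 * PI * s) * 1))
 with (r * r * (Rsqr (sin (2 * PI * s)) + Rsqr (cos (2 * PI * s)))) by (unfold Rsqr; ring).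
rewrite sin2_cos2, Rmult_1_r. apply sqrt_square; auto.
Qed.

Lemma cos_lip a b : Rabs (cos a - cos b) <= Rabs (a - b).
Proof.
destruct (MVT_gen cos b a (fun x => - sin x)) as (c & _ & hc).
- intros; auto_derive; auto. ring.
- intros; apply continuity_cos.
- rewrite hc, Rabs_mult, Rabs_Ropp. pose proof (SIN_bound c). pose proof (Rabs_pos (a - b)).
  assert (Rabs (sin c) <= 1) by (apply Rabs_le; lra). nra.
Qed.

Lemma sin_lip a b : Rabs (sin a - sin b) <= Rabs (a - b).
Proof.
destruct (MVT_gen sin b a cos) as (c & _ & hc).
- intros; auto_derive; auto. ring.
- intros; apply continuity_sin.
- rewrite hc, Rabs_mult. pose proof (COS_bound c). pose proof (Rabs_pos (a - b)).
  assert (Rabs (cos c) <= 1) by (apply Rabs_le; lra). nra.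
Qed.

Lemma circ_lip z0 r s t : 0 <= r -> Cmod (circ z0 r s - circ z0 r t)%C <= (r * (4 * PI)) * Rabs (s - t).
Proof.
intro hr. pose proof PI_RGT_0.
eapply Rle_trans; [apply Cmod_le_sum|]. unfold circ; simpl.
pose proof (cos_lip (2 * PI * s) (2 * PI * t)) as hcos. pose proof (sin_lip (2 * PI * s) (2 * PI * t)) as hsin.
assert (he : Rabs (2 * PI * s - 2 * PI * t) = 2 * PI * Rabs (s - t)).
{ replace (2 * PI * s - 2 * PI * t) with (2 * PI * (s - t)) by ring.
  rewrite Rabs_mult, Rabs_pos_eq; lra. }
rewrite he in hcos, hsin.
replace (fst z0 + r * cos (2 * PI * s) + - (fst z0 + r * cos (2 * PI * t))) with (r * (cos (2*PI*s) - cos (2*PI*t))) by ring.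
replace (snd z0 + r * sin (2 * PI * s) + - (snd z0 + r * sin (2 * PI * t))) with (r * (sin (2*PI*s) - sin (2*PI*t))) by ring.
rewrite !Rabs_mult, (Rabs_pos_eq r) by auto. nra.
Qed.

(** Through [z0 + r exp (2 i PI (x + i y))] the upper half plane covers the punctured disk, and [f]
    becomes a function [ph] of period 1 in [x]. Round [[0, 1] x [0, T]] the vertical sides cancel,
    so the mean over the circle of radius [r exp (- 2 PI T)] does not depend on [T], and continuity
    at [z0] gives its limit. This is why mere continuity at the centre is enough. *)
Lemma mean_value f z0 r : 0 < r ->
  (forall w, 0 < Cmod (w - z0)%C <= r -> holo f w) -> ccont f z0 ->
  RInt (fun s => fst (f (circ z0 r s))) 0 1 = fst (f z0).
Proof.
intros hr hf hc. pose proof PI_RGT_0 as hpi.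
set (ph := fun w : C => f (z0 + r * cexp (Ctau * w))%C).
assert (hE : forall x y, cexp (Ctau * (x, y))%C =
   (exp (- (2 * PI * y)) * cos (2 * PI * x), exp (- (2 * PI * y)) * sin (2 * PI * x))).
{ intros x y. unfold cexp, Ctau; simpl. f_equal; f_equal; f_equal; ring. }
assert (hm : forall x y, Cmod (z0 + r * cexp (Ctau * (x, y)) - z0)%C = r * exp (- (2 * PI * y))).
{ intros x y. replace (z0 + r * cexp (Ctau * (x, y)) - z0)%C with (r * cexp (Ctau * (x, y)))%C by ring.
  rewrite Cmod_mult, Cmod_R, Cmod_cexp, Rabs_pos_eq by lra. simpl. f_equal. f_equal. ring. }
assert (hle : forall y, 0 <= y -> exp (- (2 * PI * y)) <= 1).
{ intros y hy. rewrite <- exp_0. destruct (Req_dec y 0) as [->|]; [right; f_equal; ring|].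
  left. apply exp_increasing. nra. }
assert (hh : forall x y, 0 <= y -> holo ph (x, y)).
{ intros x y hy. unfold ph. apply (holo_comp f (fun w => (z0 + r * cexp (Ctau * w))%C)).
  - apply holo_plus; [apply holo_const|]. apply holo_mult; [apply holo_const|].
    apply holo_cexp. apply holo_mult; [apply holo_const|apply holo_id].
  - apply hf. rewrite hm. pose proof (exp_pos (- (2 * PI * y))). specialize (hle y hy).
    split; [apply Rmult_lt_0_compat; auto|nra]. }
assert (hper : forall y, ph (1, y) = ph (0, y)).
{ intro y. unfold ph. rewrite !hE. rewrite !Rmult_1_r, Rmult_0_r.
  rewrite cos_2PI, sin_2PI, cos_0, sin_0. reflexivity. }
assert (hT : forall T, 0 < T -> RInt (fun x => fst (ph (x, T))) 0 1 = RInt (fun x => fst (ph (x, 0))) 0 1).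
{ intros T hT. assert (g := goursat ph 0 1 0 T ltac:(lra) hT ltac:(intros; apply hh; lra)).
  unfold loop_re in g.
  rewrite (RInt_ext (fun y => snd (ph (1, y))) (fun y => snd (ph (0, y)))) in g.
  2:{ intros; rewrite hper; auto. }
  lra. }
assert (hcirc : RInt (fun s => fst (f (circ z0 r s))) 0 1 = RInt (fun x => fst (ph (x, 0))) 0 1).
{ apply RInt_ext. intros x _. unfold ph, circ. rewrite hE.
  replace (- (2 * PI * 0)) with 0 by ring. rewrite exp_0. f_equal. f_equal. f_equal.
  unfold RtoC, Cmult; simpl. f_equal; ring. }
rewrite hcirc.
apply cond_eq. intros e he.
destruct (hc (e/2) ltac:(lra)) as (d & hd & h).
(* Since [exp (2 PI T) > T], the radius [r exp (- 2 PI T)] is below [r / T = d]. *)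
set (T := r / d). assert (hT0 : 0 < T) by (apply Rdiv_lt_0_compat; auto).
rewrite <- (hT T hT0).
assert (hsm : r * exp (- (2 * PI * T)) < d).
{ assert (h1 : 1 + 2 * PI * T < exp (2 * PI * T)) by (apply exp_ineq1; nra).
  rewrite exp_Ropp. pose proof (exp_pos (2 * PI * T)).
  apply Rmult_lt_reg_r with (exp (2 * PI * T)); auto.
  rewrite Rmult_assoc, Rinv_l, Rmult_1_r by lra.
  assert (r = d * T) by (unfold T; field; lra).
  assert (T < exp (2 * PI * T)). { pose proof PI2_1. unfold PI2 in *. nra. }
  rewrite H0. apply Rmult_lt_compat_l; auto. }
assert (hb : Rabs (RInt (fun x => fst (ph (x, T))) 0 1 - (fst (f z0) * (1 - 0) + 0 * (1^2 - 0^2) / 2)) <= e / 2 * (1 - 0)).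
{ apply RInt_near_affine; try lra.
  - apply ex_h; [lra|]. intros; apply holo_ccont, hh; lra.
  - intros t _. replace (fst (ph (t, T)) - (fst (f z0) + 0 * t)) with (fst (ph (t, T) - f z0)%C) by (rewrite fst_minus; ring).
    eapply Rle_trans; [apply fst_le_Cmod|]. apply Rlt_le. unfold ph. apply h. rewrite hm. auto. }
replace (fst (f z0) * (1 - 0) + 0 * (1 ^ 2 - 0 ^ 2) / 2) with (fst (f z0)) in hb by field. lra.
Qed.

Lemma Cmod_rotate (a : C) : exists c : C, Cmod c = 1 /\ (c * a)%C = RtoC (Cmod a).
Proof.
destruct (Ceq_dec a 0) as [->|h].
- exists 1%C. rewrite Cmod_1, Cmod_0. split; auto. ring.
- assert (hm : 0 < Cmod a) by (apply Cmod_gt_0; auto).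
  exists (RtoC (Cmod a) / a)%C. split.
  + rewrite Cmod_div, Cmod_R, Rabs_pos_eq by (auto; lra). field. lra.
  + field. auto.
Qed.

Lemma ccont_scal c f z : ccont f z -> ccont (fun w => c * f w)%C z.
Proof.
intro hf. apply (ccont_comp (fun w => c * w)%C f); auto.
apply holo_ccont. apply holo_mult; [apply holo_const|apply holo_id].
Qed.

(** A rotation makes the value at [z0] real and nonnegative; the mean of the real part is then at
    most the mean of the modulus. *)
Lemma sub_mean f z0 r : 0 < r ->
  (forall w, 0 < Cmod (w - z0)%C <= r -> holo f w) -> ccont f z0 ->
  Cmod (f z0) <= RInt (fun s => Cmod (f (circ z0 r s))) 0 1.
Proof.
intros hr hf hc. destruct (Cmod_rotate (f z0)) as (c & hc1 & hc2).
assert (hv := mean_value (fun w => c * f w)%C z0 r hr).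
lapply hv; [clear hv; intro hv|]. 2:{ intros; apply holo_mult; auto. apply holo_const. }
lapply hv; [clear hv; intro hv|]. 2:{ apply ccont_scal; auto. }
rewrite hc2 in hv. simpl in hv. rewrite <- hv.
assert (hcc : forall s, ccont f (circ z0 r s)).
{ intro s. apply holo_ccont, hf. rewrite Cmod_circ; lra. }
assert (hK : 0 < r * (4 * PI)). { pose proof PI_RGT_0. apply Rmult_lt_0_compat; lra. }
apply RInt_le; [lra| | |].
- apply ex_RInt_cont; [lra|]. intros t _.
  apply (continuous_fst_path (fun w => c * f w)%C (circ z0 r) (r * (4 * PI))); auto.
  intros; apply circ_lip; lra. apply ccont_scal; auto.
- apply ex_RInt_cont; [lra|]. intros t _.
  apply (continuous_Cmod_path f (circ z0 r) (r * (4 * PI))); auto.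
  intros; apply circ_lip; lra.
- intros x _. change (fst (c * f (circ z0 r x))%C <= Cmod (f (circ z0 r x))).
  eapply Rle_trans; [apply Rle_abs|]. eapply Rle_trans; [apply fst_le_Cmod|].
  rewrite Cmod_mult, hc1. lra.
Qed.

(** Continuity at [z] and holomorphy around it are what [sub_mean] needs. With this class, a
    quotient extended by continuity over a removed zero can be used without showing that the
    singularity is removable. *)
Definition tame (u : C -> C) (z : C) : Prop :=
  ccont u z /\ exists r, 0 < r /\ forall w, 0 < Cmod (w - z)%C < r -> holo u w.

Lemma holo_tame u z d : 0 < d -> (forall w, Cmod (w - z)%C < d -> holo u w) -> tame u z.
Proof.
intros hd h. split.
- apply holo_ccont, h. rewrite Cmod_self; auto.
- exists d; split; auto. intros w hw; apply h; lra.
Qed.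

(** Upper semicontinuity suffices. If no point were a maximum, the values near each point would stay
    below a value taken in the box; by quartering, a single point of the box would exceed all
    values, its own included. *)
Lemma exists_max (v : C -> R) (a c W H : R) : 0 < W -> 0 < H ->
  (forall z, a <= fst z <= a + W -> c <= snd z <= c + H -> forall e, 0 < e ->
     exists d, 0 < d /\ forall w, Cmod (w - z)%C < d -> v w < v z + e) ->
  exists z0, a <= fst z0 <= a + W /\ c <= snd z0 <= c + H /\
    forall z, a <= fst z <= a + W -> c <= snd z <= c + H -> v z <= v z0.
Proof.
intros hW hH hv. apply NNPP; intro hn.
set (Box := fun z : C => a <= fst z <= a + W /\ c <= snd z <= c + H).
assert (q := quarter_principle (fun a' c' s => exists z1, Box z1 /\
   forall z, a' <= fst z <= a' + W * s -> c' <= snd z <= c' + H * s -> v z < v z1) a c W H hW hH).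
lapply q; [clear q; intro q|].
- lapply q; [clear q; intro q|].
  + destruct q as (z1 & (hz1 & hz2) & h). specialize (h z1). rewrite !Rmult_1_r in h.
    specialize (h hz1 hz2). lra.
  + intros x y hx hy.
    assert (exists z1, Box z1 /\ v (x, y) < v z1) as (z1 & hz1 & hlt).
    { apply NNPP; intro hno. apply hn. exists (x, y). simpl. split; auto. split; auto.
      intros z h1 h2. apply Rnot_lt_le; intro. apply hno. exists z; split; auto. split; auto. }
    destruct (hv (x, y) hx hy (v z1 - v (x, y))) as (d & hd & h); [lra|].
    exists (d / (W + H)). split; [apply Rdiv_lt_0_compat; lra|].
    intros a' c' s hs h1 h2 h3 h4 h5 h6 h7 h8. exists z1; split; auto.
    intros z hz1' hz2'.
    enough (v z < v (x, y) + (v z1 - v (x, y))) by lra. apply h.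
    destruct hs as (_ & hs). apply Rmult_lt_compat_l with (r := W + H) in hs; [|lra].
    replace ((W + H) * (d / (W + H))) with d in hs by (field; lra).
    eapply Rle_lt_trans; [|exact hs]. eapply Rle_trans; [apply Cmod_le_sum|].
    rewrite fst_minus, snd_minus; simpl. rewrite Rmult_plus_distr_r.
    apply Rplus_le_compat; apply Rabs_le; lra.
- intros a' c' s hs _ _ _ _ (z1 & b1 & h1) (z2 & b2 & h2) (z3 & b3 & h3) (z4 & b4 & h4).
  assert (hmax : forall p q0, Box p -> Box q0 -> exists r, Box r /\ v p <= v r /\ v q0 <= v r).
  { intros p p' hp hq. destruct (Rle_or_lt (v p) (v p')).
    exists p'; repeat split; try apply hq; lra. exists p; repeat split; try apply hp; lra. }
  destruct (hmax z1 z2 b1 b2) as (p & hp & hp1 & hp2).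
  destruct (hmax z3 z4 b3 b4) as (p' & hp' & hp1' & hp2').
  destruct (hmax p p' hp hp') as (r & hr & hr1 & hr2).
  exists r; split; auto. intros z hz1 hz2.
  replace (W * s) with (W * (s/2) + W * (s/2)) in hz1 by field.
  replace (H * s) with (H * (s/2) + H * (s/2)) in hz2 by field.
  destruct (Rle_or_lt (fst z) (a' + W * (s/2))); destruct (Rle_or_lt (snd z) (c' + H * (s/2))).
  + specialize (h1 z ltac:(lra) ltac:(lra)). lra.
  + specialize (h3 z ltac:(lra) ltac:(lra)). lra.
  + specialize (h2 z ltac:(lra) ltac:(lra)). lra.
  + specialize (h4 z ltac:(lra) ltac:(lra)). lra.
Qed.

(** On a circle of radius [r] the mean of the squared ordinate exceeds its value at the centre by
    [r^2 / 2]: this is the strict gain used in [strip_max]. *)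
Lemma is_RInt_sin_sq A r : is_RInt (fun s => (A + r * sin (2 * PI * s)) ^ 2) 0 1 (A ^ 2 + r ^ 2 / 2).
Proof.
pose proof PI_RGT_0.
set (F := fun s => A ^ 2 * s - A * r * cos (2 * PI * s) / PI + r ^ 2 * (s / 2 - sin (2 * (2 * PI * s)) / (8 * PI))).
replace (A ^ 2 + r ^ 2 / 2) with (minus (F 1) (F 0)).
2:{ unfold minus, plus, opp, F; simpl. rewrite !Rmult_0_r, !Rmult_1_r, cos_2PI, cos_0, sin_0.
    replace (2 * (2 * PI)) with (2 * INR 2 * PI) by (simpl; ring).
    replace (2 * INR 2 * PI) with (0 + 2 * INR 2 * PI) by ring.
    rewrite sin_period, sin_0. field. lra. }
apply (is_RInt_derive F).
- intros x _. unfold F. auto_derive; auto. rewrite cos_2a_sin. field. lra.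
- intros x _. apply (ex_derive_continuous (fun s => (A + r * sin (2 * PI * s)) ^ 2)). auto_derive; auto.
Qed.

Lemma Cmod_periodic_Z u z (n : Z) (S : R -> Prop) : S (snd z) ->
  (forall w, S (snd w) -> Cmod (u (w + 1)%C) = Cmod (u w)) ->
  Cmod (u (z + RtoC (IZR n))%C) = Cmod (u z).
Proof.
intros hS h.
assert (hn : forall (m : nat) w, S (snd w) -> Cmod (u (w + RtoC (INR m))%C) = Cmod (u w)).
{ induction m; intros w hw.
  - simpl. f_equal. f_equal. ring.
  - rewrite S_INR, RtoC_plus. rewrite <- (IHm w hw), <- (h (w + RtoC (INR m))%C).
    + f_equal. f_equal. ring.
    + simpl. rewrite Rplus_0_r. auto. }
destruct (Z_le_gt_dec 0 n) as [h0|h0].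
- rewrite <- (Z2Nat.id n h0), <- INR_IZR_INZ. auto.
- rewrite <- (hn (Z.to_nat (- n)) (z + RtoC (IZR n))%C).
  + rewrite INR_IZR_INZ, Z2Nat.id by lia. f_equal. f_equal.
    rewrite opp_IZR, RtoC_opp. ring.
  + simpl. rewrite Rplus_0_r. auto.
Qed.

Lemma exists_frac (x : R) : exists n : Z, 0 <= x + IZR n <= 1.
Proof.
exists (1 - up x)%Z. rewrite minus_IZR. destruct (archimed x). lra.
Qed.

Theorem strip_max u t1 t2 B : t1 < t2 ->
  (forall z, t1 <= snd z <= t2 -> ccont u z) ->
  (forall z, t1 < snd z < t2 -> tame u z) ->
  (forall z, t1 <= snd z <= t2 -> Cmod (u (z + 1)%C) = Cmod (u z)) ->
  (forall z, snd z = t1 \/ snd z = t2 -> Cmod (u z) <= B) ->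
  forall z, t1 <= snd z <= t2 -> Cmod (u z) <= B.
Proof.
intros ht hc htame hper hB zs hzs. apply Rnot_lt_le; intro hlt.
set (eta := (Cmod (u zs) - B) / 2). assert (heta : 0 < eta) by (unfold eta; lra).
set (K := t1 ^ 2 + t2 ^ 2 + 1). assert (hK : 0 < K) by (unfold K; pose proof (pow2_ge_0 t1); pose proof (pow2_ge_0 t2); lra).
set (e := eta / K). assert (he : 0 < e) by (apply Rdiv_lt_0_compat; auto).
set (v := fun z : C => Cmod (u z) + e * (snd z) ^ 2).
destruct (exists_max v 0 t1 1 (t2 - t1)) as (z0 & hz1 & hz2 & hmax); try lra.
{ intros z hz1 hz2 e' he'.
  destruct (hc z ltac:(lra) (e'/2) ltac:(lra)) as (d & hd & h).
  set (q := e' / 2 / (e * (2 * Rabs (snd z) + 1))).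
  pose proof (Rabs_pos (snd z)) as habs.
  assert (hq : 0 < q). { apply Rdiv_lt_0_compat; [lra|]. apply Rmult_lt_0_compat; lra. }
  exists (Rmin d (Rmin 1 q)). split; [apply Rmin_pos; [auto|apply Rmin_pos; lra]|].
  intros w hw.
  assert (a0 := Rlt_le_trans _ _ _ hw (Rmin_l _ _)).
  assert (hw' := Rlt_le_trans _ _ _ hw (Rmin_r _ _)).
  assert (a1 := Rlt_le_trans _ _ _ hw' (Rmin_l _ _)).
  assert (a2 := Rlt_le_trans _ _ _ hw' (Rmin_r _ _)).
  specialize (h w a0). unfold v.
  pose proof (Cmod_le_minus (u w) (u z)).
  pose proof (snd_le_Cmod (w - z)%C) as hs. rewrite snd_minus in hs.
  assert (hb : snd w ^ 2 - snd z ^ 2 <= q * (2 * Rabs (snd z) + 1)).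
  { replace (snd w ^ 2 - snd z ^ 2) with ((snd w - snd z) * ((snd w - snd z) + 2 * snd z)) by ring.
    eapply Rle_trans; [apply Rle_abs|]. rewrite Rabs_mult.
    apply Rmult_le_compat; try apply Rabs_pos; [lra|].
    eapply Rle_trans; [apply Rabs_triang|]. rewrite Rabs_mult, (Rabs_pos_eq 2) by lra. lra. }
  assert (hb2 : e * (snd w ^ 2 - snd z ^ 2) <= e' / 2).
  { replace (e' / 2) with (e * (q * (2 * Rabs (snd z) + 1))).
    - apply Rmult_le_compat_l; lra.
    - unfold q. field. split; lra. }
  lra. }
replace (t1 + (t2 - t1)) with t2 in hz2, hmax by ring. rewrite Rplus_0_l in hz1, hmax.
assert (hall : forall z, t1 <= snd z <= t2 -> v z <= v z0).
{ intros z hz. destruct (exists_frac (fst z)) as (n & hn).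
  assert (v z = v (z + RtoC (IZR n))%C).
  { unfold v. rewrite (Cmod_periodic_Z u z n (fun y => t1 <= y <= t2)); auto.
    f_equal. f_equal. f_equal. simpl. ring. }
  rewrite H. apply hmax; simpl; [lra|]. rewrite Rplus_0_r; auto. }
assert (hvs : v z0 > B + eta).
{ specialize (hall zs hzs). unfold v in hall at 1. pose proof (pow2_ge_0 (snd zs)).
  assert (0 <= e * snd zs ^ 2) by (apply Rmult_le_pos; lra). unfold eta in *. lra. }
assert (hint : t1 < snd z0 < t2).
{ assert (hno : ~ (snd z0 = t1 \/ snd z0 = t2)).
  { intro hb. specialize (hB z0 hb). unfold v in hvs.
    assert (e * snd z0 ^ 2 <= eta); [|lra].
    replace eta with (e * K) by (unfold e; field; lra).
    apply Rmult_le_compat_l; [lra|]. unfold K.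
    pose proof (pow2_ge_0 t1); pose proof (pow2_ge_0 t2). destruct hb as [-> | ->]; lra. }
  split; apply Rnot_le_lt; intro; apply hno; lra. }
destruct (htame z0 hint) as (hc0 & r0 & hr0 & hh).
set (r := Rmin (r0/2) (Rmin ((snd z0 - t1)/2) ((t2 - snd z0)/2))).
assert (hr : 0 < r) by (repeat apply Rmin_pos; lra).
assert (hr1 : r <= r0/2) by apply Rmin_l.
assert (hr2 : r <= (snd z0 - t1)/2) by (eapply Rle_trans; [apply Rmin_r|apply Rmin_l]).
assert (hr3 : r <= (t2 - snd z0)/2) by (eapply Rle_trans; [apply Rmin_r|apply Rmin_r]).
clearbody r.
assert (hsm := sub_mean u z0 r hr ltac:(intros; apply hh; lra) hc0).
assert (hi : RInt (fun s => Cmod (u (circ z0 r s))) 0 1 <= v z0 - e * (snd z0 ^ 2 + r ^ 2 / 2)).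
{ pose proof (is_RInt_sin_sq (snd z0) r) as h1.
  pose proof (is_RInt_scal _ _ _ e _ h1) as h2.
  pose proof (is_RInt_minus _ _ _ _ _ _ (is_RInt_const 0 1 (v z0)) h2) as h3.
  assert (h4 := is_RInt_unique (V := R_CompleteNormedModule) _ _ _ _ h3).
  assert (h5 : minus (scal (1 - 0) (v z0)) (scal e (snd z0 ^ 2 + r ^ 2 / 2)) = v z0 - e * (snd z0 ^ 2 + r ^ 2 / 2)).
  { unfold minus, plus, opp, scal; simpl. unfold mult; simpl. ring. }
  eapply Rle_trans; [|right; etransitivity; [exact h4|exact h5]]. apply RInt_le; [lra| | |].
  - apply ex_RInt_cont; [lra|]. intros t _.
    apply (continuous_Cmod_path u (circ z0 r) (r * (4 * PI))).
    + pose proof PI_RGT_0. apply Rmult_lt_0_compat; lra.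
    + intros; apply circ_lip; lra.
    + apply holo_ccont, hh. rewrite Cmod_circ; lra.
  - eexists; apply h3.
  - intros x _.
    assert (hx := hall (circ z0 r x)). unfold v at 1 in hx.
    assert (hs : snd (circ z0 r x) = snd z0 + r * sin (2 * PI * x)) by reflexivity.
    rewrite hs in hx. pose proof (SIN_bound (2 * PI * x)).
    change (minus (v z0) (scal e ((snd z0 + r * sin (2 * PI * x)) ^ 2))) with
      (v z0 - e * (snd z0 + r * sin (2 * PI * x)) ^ 2).
    specialize (hx ltac:(nra)). lra. }
unfold v in hi at 1. assert (0 < e * r ^ 2) by (apply Rmult_lt_0_compat; [auto|apply pow_lt; auto]). lra.
Qed.

Lemma sub_mean_le f z0 r B : 0 < r ->
  (forall w, 0 < Cmod (w - z0)%C <= r -> holo f w) -> ccont f z0 ->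
  (forall w, Cmod (w - z0)%C = r -> Cmod (f w) <= B) -> Cmod (f z0) <= B.
Proof.
intros hr hf hc hB. eapply Rle_trans; [apply (sub_mean f z0 r); auto|].
replace B with (RInt (fun _ => B) 0 1).
2:{ rewrite RInt_const. unfold scal; simpl. unfold mult; simpl. ring. }
apply RInt_le; [lra| | |].
- apply ex_RInt_cont; [lra|]. intros t _.
  apply (continuous_Cmod_path f (circ z0 r) (r * (4 * PI))).
  + pose proof PI_RGT_0. apply Rmult_lt_0_compat; lra.
  + intros; apply circ_lip; lra.
  + apply holo_ccont, hf. rewrite Cmod_circ; lra.
- apply ex_RInt_const.
- intros x _. apply hB. apply Cmod_circ; lra.
Qed.

(** * Cauchy estimates *)

Definition divdiff (f : C -> C) (z0 l : C) (w : C) : C :=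
  if Ceq_dec w z0 then l else ((f w - f z0) / (w - z0))%C.

Lemma divdiff_neq f (z0 l w : C) : w <> z0 -> divdiff f z0 l w = ((f w - f z0) / (w - z0))%C.
Proof. intro h. unfold divdiff. destruct (Ceq_dec w z0); congruence. Qed.

Lemma divdiff_eq f z0 l : divdiff f z0 l z0 = l.
Proof. unfold divdiff. destruct (Ceq_dec z0 z0); congruence. Qed.

Lemma Cminus_neq_0 (w z : C) : w <> z -> (w - z)%C <> 0%C.
Proof. intros h e. apply h, Ceq_minus; auto. Qed.

Lemma divdiff_ccont f z0 l : cdiff f z0 l -> ccont (divdiff f z0 l) z0.
Proof.
intros h e he. destruct (h (e/2) ltac:(lra)) as (d & hd & hh). exists d; split; auto.
intros w hw. rewrite divdiff_eq.
destruct (Ceq_dec w z0) as [->|hne].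
- rewrite divdiff_eq, Cmod_self. auto.
- rewrite divdiff_neq by auto. assert (hm := Cmod_pos_neq _ _ hne).
  pose proof (Cminus_neq_0 _ _ hne) as hz.
  replace ((f w - f z0) / (w - z0) - l)%C with ((f w - f z0 - l * (w - z0)) / (w - z0))%C by (field; auto).
  rewrite Cmod_div by auto. apply Rle_lt_trans with (e/2); [|lra].
  apply Rmult_le_reg_r with (Cmod (w - z0)%C); auto.
  unfold Rdiv at 1. rewrite Rmult_assoc, Rinv_l, Rmult_1_r by lra. auto.
Qed.

Lemma divdiff_holo f (z0 l w : C) : w <> z0 -> holo f w -> holo (divdiff f z0 l) w.
Proof.
intros hne h. apply (holo_ext_loc (fun w => (f w - f z0) / (w - z0))%C _ _ (Cmod (w - z0)%C)).
- apply Cmod_pos_neq; auto.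
- intros x hx. rewrite divdiff_neq; auto. intros ->. rewrite Cmod_minus_sym in hx. lra.
- apply holo_div; [apply Cminus_neq_0; auto| |]; apply holo_minus; auto using holo_const, holo_id.
Qed.

(** [l] is the value at [z0] of the difference quotient, whose modulus on the circle of radius
    [R / 2] is at most [2 M / (R / 2)]. *)
Lemma cauchy_deriv f z0 l R M : 0 < R ->
  (forall w, Cmod (w - z0)%C < R -> holo f w) ->
  (forall w, Cmod (w - z0)%C < R -> Cmod (f w) <= M) ->
  cdiff f z0 l -> Cmod l <= 4 * M / R.
Proof.
intros hR hf hM hl. rewrite <- (divdiff_eq f z0 l).
apply (sub_mean_le _ z0 (R/2)); try lra.
- intros w hw. apply divdiff_holo.
  + intros ->. rewrite Cmod_self in hw. lra.
  + apply hf; lra.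
- apply divdiff_ccont; auto.
- intros w hw. assert (hne : w <> z0). { intros ->. rewrite Cmod_self in hw. lra. }
  rewrite divdiff_neq, Cmod_div, hw by (auto; apply Cminus_neq_0; auto).
  assert (Cmod (f w - f z0)%C <= 2 * M).
  { eapply Rle_trans; [apply Cmod_minus_le|].
    specialize (hM w ltac:(lra)) as h1. specialize (hM z0) as h2. rewrite Cmod_self in h2. specialize (h2 hR). lra. }
  apply Rmult_le_reg_r with R; auto.
  replace (Cmod (f w - f z0)%C / (R / 2) * R) with (2 * Cmod (f w - f z0)%C) by (field; lra).
  replace (4 * M / R * R) with (4 * M) by (field; lra). lra.
Qed.

(** Increments over adjacent intervals add up, so interval induction gives the constant [K + e];
    then [e] tends to 0. *)
Lemma path_lipschitz (h : R -> C) (a b K : R) : a <= b ->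
  (forall x, a <= x <= b -> forall e, 0 < e -> exists d, 0 < d /\ forall s, a <= s <= b ->
     Rabs (s - x) < d -> Cmod (h s - h x)%C <= (K + e) * Rabs (s - x)) ->
  Cmod (h b - h a)%C <= K * (b - a).
Proof.
intros hab hh. apply (le_epsilon_mul _ _ (b - a)); [lra|]. intros e he.
rewrite <- Rmult_plus_distr_r.
apply (interval_induction (fun u v => Cmod (h v - h u)%C <= (K + e) * (v - u)) a b hab).
- intros u v w _ _ _ _ h1 h2.
  eapply Rle_trans; [apply (Cmod_minus_trans _ (h v))|]. lra.
- intros x hx. destruct (hh x hx e he) as (d & hd & h1). exists d; split; auto.
  intros u v hu1 hu2 hu3 hv1 hv2 hv3.
  assert (q1 := h1 u ltac:(lra) ltac:(apply Rabs_def1; lra)).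
  assert (q2 := h1 v ltac:(lra) ltac:(apply Rabs_def1; lra)).
  rewrite Cmod_minus_sym in q1.
  rewrite Rabs_left1 in q1 by lra. rewrite Rabs_pos_eq in q2 by lra.
  eapply Rle_trans; [apply (Cmod_minus_trans _ (h x))|]. lra.
Qed.

Lemma lip_segment (f : C -> C) (z w : C) (K : R) :
  (forall t, 0 <= t <= 1 -> exists l, cdiff f (z + RtoC t * (w - z))%C l /\ Cmod l <= K) ->
  Cmod (f w - f z)%C <= K * Cmod (w - z)%C.
Proof.
intro h.
assert (q := path_lipschitz (fun t => f (z + RtoC t * (w - z))%C) 0 1 (K * Cmod (w - z)%C)).
simpl in q.
replace (z + 1 * (w - z))%C with w in q by ring. replace (z + 0 * (w - z))%C with z in q by ring.
rewrite Rminus_0_r, Rmult_1_r in q. apply q; [lra|].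
intros x hx e he. destruct (h x hx) as (l & hl & hlK).
set (D := Cmod (w - z)%C). assert (hD : 0 <= D) by apply Cmod_ge_0.
assert (he1 : 0 < e / (D + 1)) by (apply Rdiv_lt_0_compat; lra).
destruct (hl _ he1) as (d & hd & hh).
exists (d / (D + 1)). split; [apply Rdiv_lt_0_compat; lra|].
intros s _ hs.
assert (he2 : (z + RtoC s * (w - z) - (z + RtoC x * (w - z)))%C = (RtoC (s - x) * (w - z))%C).
{ rewrite RtoC_minus. ring. }
assert (hm : Cmod (z + RtoC s * (w - z) - (z + RtoC x * (w - z)))%C = Rabs (s - x) * D).
{ rewrite he2, Cmod_mult, Cmod_R. reflexivity. }
set (A := Rabs (s - x)) in *. assert (hA : 0 <= A) by apply Rabs_pos.
assert (hlt : A * (D + 1) < d).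
{ apply Rmult_lt_compat_r with (r := D + 1) in hs; [|lra].
  replace (d / (D + 1) * (D + 1)) with d in hs by (field; lra). lra. }
specialize (hh (z + RtoC s * (w - z))%C). rewrite hm in hh. specialize (hh ltac:(nra)).
eapply Rle_trans; [apply Cmod_le_minus|].
rewrite Cmod_mult in hh || idtac.
eapply Rle_trans; [apply Rplus_le_compat_r; exact hh|].
rewrite Cmod_mult, hm.
assert (e / (D + 1) * D <= e).
{ apply Rmult_le_reg_r with (D + 1); [lra|]. replace (e / (D+1) * D * (D+1)) with (e * D) by (field; lra). nra. }
assert (Cmod l * (A * D) <= K * (A * D)) by (apply Rmult_le_compat_r; auto; nra).
nra.
Qed.

(** A chosen derivative, meaningful where [f] is [holo]. *)
Definition der (f : C -> C) (z : C) : C := epsilon (inhabits (RtoC 0)) (cdiff f z).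

Lemma der_spec f z : holo f z -> cdiff f z (der f z).
Proof. intro h. apply (epsilon_spec (inhabits (RtoC 0)) (cdiff f z)). exact h. Qed.

(** For a real function the limit at 0 is the supremum of the lower bounds [g t - K |t|]. The two
    parts of a complex function are treated separately, whence the factor 2. *)
Lemma lip_limit (ph : C -> C) (rho K : R) : 0 < rho ->
  (forall s t, 0 < Cmod s < rho -> 0 < Cmod t < rho -> Cmod (ph s - ph t)%C <= K * (Cmod s + Cmod t)) ->
  exists l, forall s, 0 < Cmod s < rho -> Cmod (ph s - l)%C <= 2 * K * Cmod s.
Proof.
intros hr h.
assert (hreal : forall g : C -> R, (forall s t, 0 < Cmod s < rho -> 0 < Cmod t < rho ->
    Rabs (g s - g t) <= K * (Cmod s + Cmod t)) ->
    exists l, forall s, 0 < Cmod s < rho -> Rabs (g s - l) <= K * Cmod s).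
{ intros g hg.
  assert (hs0 : 0 < Cmod (RtoC (rho/2)) < rho) by (rewrite Cmod_R, Rabs_pos_eq; lra).
  destruct (completeness (fun x => exists t, 0 < Cmod t < rho /\ x = g t - K * Cmod t)) as (l & ub & lub).
  - exists (g (RtoC (rho/2)) + K * Cmod (RtoC (rho/2))). intros x (t & ht & ->).
    specialize (hg t _ ht hs0). apply Rabs_le_between in hg. lra.
  - eexists; exists (RtoC (rho/2)); split; eauto.
  - exists l. intros s hs. apply Rabs_le. split.
    + assert (l <= g s + K * Cmod s); [|lra]. apply lub. intros x (t & ht & ->).
      specialize (hg t s ht hs). apply Rabs_le_between in hg. lra.
    + assert (g s - K * Cmod s <= l); [|lra]. apply ub. exists s; auto. }
destruct (hreal (fun s => fst (ph s))) as (l1 & h1).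
{ intros s t hs ht. rewrite <- fst_minus. eapply Rle_trans; [apply fst_le_Cmod|]; auto. }
destruct (hreal (fun s => snd (ph s))) as (l2 & h2).
{ intros s t hs ht. rewrite <- snd_minus. eapply Rle_trans; [apply snd_le_Cmod|]; auto. }
exists (l1, l2). intros s hs. eapply Rle_trans; [apply Cmod_le_sum|].
rewrite fst_minus, snd_minus; simpl. specialize (h1 s hs). specialize (h2 s hs). lra.
Qed.

(** Second order Taylor expansion: the Cauchy estimate, applied to the
    differences [f (. + s) - f] and then to their difference quotients, bounds
    the increments of the derivative and of its difference quotients. *)
Lemma taylor2 f z0 R M : 0 < R ->
  (forall w, Cmod (w - z0)%C < R -> holo f w) ->
  (forall w, Cmod (w - z0)%C < R -> Cmod (f w) <= M) ->
  exists l m K, cdiff f z0 l /\ forall w, Cmod (w - z0)%C < R / 8 ->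
    Cmod (f w - f z0 - l * (w - z0) - m * ((w - z0) * (w - z0)))%C <= K * Cmod (w - z0)%C ^ 3.
Proof.
intros hR hf hM.
assert (hM0 : 0 <= M). { specialize (hM z0). rewrite Cmod_self in hM. pose proof (Cmod_ge_0 (f z0)). lra. }
set (K1 := 8 * M / R). assert (hK1 : 0 <= K1) by (apply Rdiv_le_0_compat; lra).
assert (ha : forall w, Cmod (w - z0)%C < R/2 -> Cmod (der f w) <= K1).
{ intros w hw. replace K1 with (4 * M / (R/2)) by (unfold K1; field; lra).
  apply (cauchy_deriv f w); try lra.
  - intros x hx. apply hf. pose proof (Cmod_minus_trans x w z0). lra.
  - intros x hx. apply hM. pose proof (Cmod_minus_trans x w z0). lra.
  - apply der_spec, hf. lra. }
assert (seg : forall a b t r, 0 <= t <= 1 -> Cmod (a - z0)%C < r -> Cmod (b - z0)%C < r ->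
   Cmod (a + RtoC t * (b - a) - z0)%C < r).
{ intros a b t r ht h1 h2.
  replace (a + RtoC t * (b - a) - z0)%C with (RtoC (1 - t) * (a - z0) + RtoC t * (b - z0))%C by (rewrite RtoC_minus; ring).
  eapply Rle_lt_trans; [apply Cmod_triangle|]. rewrite !Cmod_mult, !Cmod_R, !Rabs_pos_eq by lra.
  pose proof (Cmod_ge_0 (a - z0)%C). pose proof (Cmod_ge_0 (b - z0)%C).
  destruct (Req_dec t 0) as [->|]; nra. }
assert (hlip : forall a b, Cmod (a - z0)%C < R/2 -> Cmod (b - z0)%C < R/2 -> Cmod (f b - f a)%C <= K1 * Cmod (b - a)%C).
{ intros a b h1 h2. apply lip_segment. intros t ht. exists (der f (a + RtoC t * (b - a))%C).
  assert (hs := seg a b t (R/2) ht h1 h2). split; [apply der_spec, hf; lra|auto]. }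
set (K2 := 32 * K1 / R). assert (hK2 : 0 <= K2) by (apply Rdiv_le_0_compat; lra).
assert (hshift : forall w s, holo f (w + s)%C -> cdiff (fun x => f (x + s)%C) w (der f (w + s)%C)).
{ intros w s h. replace (der f (w + s)%C) with (der f (w + s)%C * (1 + 0))%C by ring.
  apply (cdiff_comp f (fun x => (x + s)%C)); [apply cdiff_plus; [apply cdiff_id|apply cdiff_const]|apply der_spec; auto]. }
assert (hb : forall y s, Cmod (y - z0)%C < R/8 -> Cmod s < R/8 -> Cmod (der f (y + s)%C - der f y)%C <= K2 * Cmod s).
{ intros y s hy hs. replace (K2 * Cmod s) with (4 * (K1 * Cmod s) / (R/8)) by (unfold K2; field; lra).
  assert (hin : forall w, Cmod (w - y)%C < R/8 -> Cmod (w - z0)%C < R/2 /\ Cmod (w + s - z0)%C < R/2).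
  { intros w hw. pose proof (Cmod_minus_trans w y z0).
    replace (w + s - z0)%C with ((w - z0) + s)%C by ring. pose proof (Cmod_triangle (w - z0) s). lra. }
  apply (cauchy_deriv (fun w => (f (w + s) - f w)%C) y); try lra.
  - intros w hw. destruct (hin w hw). apply holo_minus; [eexists; apply hshift|]; apply hf; lra.
  - intros w hw. destruct (hin w hw).
    replace (Cmod s) with (Cmod (w + s - w)%C) by (f_equal; ring). apply hlip; auto.
  - destruct (hin y) as (q1 & q2); [rewrite Cmod_self; lra|].
    apply cdiff_minus; [apply hshift|apply der_spec]; apply hf; lra. }
assert (hc : forall y s, Cmod (y - z0)%C < R/8 -> Cmod s < R/8 -> Cmod (f (y + s) - f y - der f y * s)%C <= K2 * Cmod s * Cmod s).
{ intros y s hy hs.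
  replace (f (y + s) - f y - der f y * s)%C with ((fun w => f w - der f y * w)%C (y + s)%C - (fun w => f w - der f y * w)%C y)%C by ring.
  replace (Cmod s) with (Cmod (y + s - y)%C) at 2 by (f_equal; ring).
  apply (lip_segment (fun w => f w - der f y * w)%C). intros t ht. replace (y + RtoC t * (y + s - y))%C with (y + RtoC t * s)%C by ring.
  assert (hts : Cmod (RtoC t * s)%C <= Cmod s).
  { rewrite Cmod_mult, Cmod_R, Rabs_pos_eq by lra. pose proof (Cmod_ge_0 s). nra. }
  exists (der f (y + RtoC t * s)%C - der f y * 1)%C. split.
  - apply cdiff_minus; [|apply cdiff_scal, cdiff_id]. apply der_spec, hf.
    replace (y + RtoC t * s - z0)%C with ((y - z0) + RtoC t * s)%C by ring.
    pose proof (Cmod_triangle (y - z0) (RtoC t * s)). lra.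
  - replace (der f y * 1)%C with (der f y) by ring. eapply Rle_trans; [apply hb; lra|]. nra. }
set (D := fun s => (der f (z0 + s) - der f z0)%C).
set (K3 := 32 * K2 / R).
assert (hz0 : Cmod (z0 - z0)%C < R/8) by (rewrite Cmod_self; lra).
assert (hd : forall s t, 0 < Cmod s < R/8 -> 0 < Cmod t < R/8 -> Cmod (D s / s - D t / t)%C <= K3 * (Cmod s + Cmod t)).
{ intros s t hs ht.
  assert (s0 : s <> 0%C) by (apply Cmod_gt_0; lra). assert (t0 : t <> 0%C) by (apply Cmod_gt_0; lra).
  replace (K3 * (Cmod s + Cmod t)) with (4 * (K2 * (Cmod s + Cmod t)) / (R/8)) by (unfold K3; field; lra).
  assert (hin : forall w s, Cmod s < R/8 -> Cmod (w - z0)%C < R/8 -> Cmod (w + s - z0)%C < R).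
  { intros w s' hs' hw. replace (w + s' - z0)%C with ((w - z0) + s')%C by ring.
    pose proof (Cmod_triangle (w - z0) s'). lra. }
  assert (hq : forall w s, 0 < Cmod s < R/8 -> Cmod (w - z0)%C < R/8 ->
     cdiff (fun w => (/ s * (f (w + s) - f w))%C) w (/ s * (der f (w + s) - der f w))%C).
  { intros w s' hs' hw. apply cdiff_scal. apply cdiff_minus; [apply hshift|apply der_spec]; apply hf; [apply hin; lra|lra]. }
  apply (cauchy_deriv (fun w => / s * (f (w + s) - f w) - / t * (f (w + t) - f w))%C z0); try lra.
  - intros w hw. apply holo_minus; eexists; apply hq; auto.
  - intros w hw.
    replace (/ s * (f (w + s) - f w) - / t * (f (w + t) - f w))%C with
      ((f (w + s) - f w - der f w * s) / s - (f (w + t) - f w - der f w * t) / t)%C by (field; auto).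
    eapply Rle_trans; [apply Cmod_minus_le|]. rewrite !Cmod_div by auto.
    assert (q : forall s, 0 < Cmod s < R/8 -> Cmod (f (w + s) - f w - der f w * s)%C / Cmod s <= K2 * Cmod s).
    { intros s' hs'. apply Rmult_le_reg_r with (Cmod s'); [lra|].
      replace (Cmod (f (w + s') - f w - der f w * s')%C / Cmod s' * Cmod s') with (Cmod (f (w + s') - f w - der f w * s')%C) by (field; lra).
      apply hc; lra. }
    pose proof (q s hs). pose proof (q t ht). lra.
  - unfold D. replace ((der f (z0 + s) - der f z0) / s)%C with (/ s * (der f (z0 + s) - der f z0))%C by (field; auto).
    replace ((der f (z0 + t) - der f z0) / t)%C with (/ t * (der f (z0 + t) - der f z0))%C by (field; auto).
    apply cdiff_minus; apply hq; auto. }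
destruct (lip_limit (fun s => D s / s)%C (R/8) K3 ltac:(lra) hd) as (ll & hll).
exists (der f z0), (/ 2 * ll)%C, (2 * K3). split; [apply der_spec, hf; lra|].
intros w hw.
set (s := (w - z0)%C) in *.
assert (hK3 : 0 <= K3) by (apply Rdiv_le_0_compat; lra).
replace (f w - f z0 - der f z0 * s - / 2 * ll * (s * s))%C with
  ((fun x => f x - der f z0 * x - / 2 * ll * ((x - z0) * (x - z0)))%C w -
   (fun x => f x - der f z0 * x - / 2 * ll * ((x - z0) * (x - z0)))%C z0)%C.
2:{ unfold s. ring. }
replace (2 * K3 * Cmod s ^ 3) with (2 * K3 * (Cmod s * Cmod s) * Cmod (w - z0)%C) by (unfold s; ring).
apply (lip_segment (fun x => f x - der f z0 * x - / 2 * ll * ((x - z0) * (x - z0)))%C). intros t ht.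
fold s.
assert (hts : Cmod (RtoC t * s)%C <= Cmod s).
{ rewrite Cmod_mult, Cmod_R, Rabs_pos_eq by lra. pose proof (Cmod_ge_0 s). nra. }
assert (hx : (z0 + RtoC t * s - z0)%C = (RtoC t * s)%C) by ring.
set (x := (z0 + RtoC t * s)%C) in *.
exists (der f x - der f z0 * 1 - / 2 * ll * ((1 - 0) * (x - z0) + (x - z0) * (1 - 0)))%C. split.
- apply cdiff_minus; [apply cdiff_minus|].
  + apply der_spec, hf. rewrite hx. lra.
  + apply cdiff_scal, cdiff_id.
  + apply cdiff_scal.
    apply (cdiff_mult (fun y => y - z0)%C (fun y => y - z0)%C x (1 - 0)%C (1 - 0)%C);
      apply cdiff_minus; auto using cdiff_id, cdiff_const.
- rewrite hx. set (u := (RtoC t * s)%C) in *.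
  replace (der f x - der f z0 * 1 - / 2 * ll * ((1 - 0) * u + u * (1 - 0)))%C with (der f x - der f z0 - ll * u)%C.
  2:{ field. }
  destruct (Ceq_dec u 0) as [hu|hu].
  + unfold x. fold u. rewrite hu. replace (z0 + 0)%C with z0 by ring.
    replace (der f z0 - der f z0 - ll * 0)%C with (RtoC 0) by ring. rewrite Cmod_0.
    pose proof (Cmod_ge_0 s). apply Rmult_le_pos; nra.
  + assert (hup : 0 < Cmod u) by (apply Cmod_gt_0; auto).
    specialize (hll u ltac:(lra)). unfold D in hll. fold u in x. fold x in hll.
    replace (der f x - der f z0 - ll * u)%C with (((der f x - der f z0) / u - ll) * u)%C by (field; auto).
    rewrite Cmod_mult.
    assert (Cmod u * Cmod u <= Cmod s * Cmod s) by nra.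
    eapply Rle_trans; [apply Rmult_le_compat_r; [lra|exact hll]|]. nra.
Qed.

(** At [z0] the difference quotient has for derivative the second coefficient [m] of [taylor2]. Thus
    a zero can be divided out with a quotient that is holomorphic at that zero too. *)
Lemma divdiff_holo_disk f z0 R M : 0 < R ->
  (forall w, Cmod (w - z0)%C < R -> holo f w) ->
  (forall w, Cmod (w - z0)%C < R -> Cmod (f w) <= M) ->
  exists k : C -> C, (forall w, Cmod (w - z0)%C < R -> holo k w) /\
    forall w, f w = (f z0 + (w - z0) * k w)%C.
Proof.
intros hR hf hM. destruct (taylor2 f z0 R M hR hf hM) as (l & m & K & hl & ht).
exists (divdiff f z0 l). split.
- intros w hw. destruct (Ceq_dec w z0) as [->|hne]; [|apply divdiff_holo; auto].
  exists m. intros e he.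
  set (q := e / (Rabs K + 1)). assert (hq : 0 < q) by (apply Rdiv_lt_0_compat; auto; pose proof (Rabs_pos K); lra).
  exists (Rmin (R/8) q). split; [apply Rmin_pos; lra|].
  intros w hw'. assert (a1 := Rlt_le_trans _ _ _ hw' (Rmin_l _ _)). assert (a2 := Rlt_le_trans _ _ _ hw' (Rmin_r _ _)).
  rewrite divdiff_eq. destruct (Ceq_dec w z0) as [->|hne].
  + rewrite divdiff_eq. replace (l - l - m * (z0 - z0))%C with (RtoC 0) by ring.
    rewrite Cmod_0, Cmod_self. lra.
  + rewrite divdiff_neq by auto. pose proof (Cminus_neq_0 _ _ hne) as hz. pose proof (Cmod_pos_neq _ _ hne) as hp.
    replace ((f w - f z0) / (w - z0) - l - m * (w - z0))%C with
      ((f w - f z0 - l * (w - z0) - m * ((w - z0) * (w - z0))) / (w - z0))%C by (field; auto).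
    rewrite Cmod_div by auto. set (t := Cmod (w - z0)%C) in *.
    apply Rmult_le_reg_r with t; auto.
    replace (Cmod (f w - f z0 - l * (w - z0) - m * ((w - z0) * (w - z0)))%C / t * t) with
      (Cmod (f w - f z0 - l * (w - z0) - m * ((w - z0) * (w - z0)))%C) by (field; lra).
    eapply Rle_trans; [apply ht; auto|]. fold t.
    assert (hKt : K * t <= e).
    { pose proof (Rle_abs K). pose proof (Rabs_pos K).
      assert (e = q * (Rabs K + 1)) by (unfold q; field; lra). nra. }
    replace (K * t ^ 3) with (K * t * (t * t)) by ring. replace (e * t * t) with (e * (t * t)) by ring.
    apply Rmult_le_compat_r; nra.
- intros w. destruct (Ceq_dec w z0) as [->|hne]; [ring|].
  rewrite divdiff_neq by auto. field. apply Cminus_neq_0; auto.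
Qed.

(** The power [0 ^ j] is 1 for [j = 0] and 0 otherwise, which covers both cases met in
    [factor_pow]. *)
Lemma bound_at_zero (k : C -> C) (R K : R) (j : nat) : 0 < R -> ccont k 0%C ->
  (forall w, 0 < Cmod w < R -> Cmod (k w) <= K * Cmod w ^ j) -> Cmod (k 0%C) <= K * 0 ^ j.
Proof.
intros hR hc h. apply le_epsilon. intros e he.
destruct (hc (e/2) ltac:(lra)) as (d & hd & hh).
set (q := e / 2 / (Rabs K + 1)). assert (hq : 0 < q) by (apply Rdiv_lt_0_compat; [lra|]; pose proof (Rabs_pos K); lra).
set (t := Rmin (Rmin d R) (Rmin 1 q) / 2).
assert (ht : 0 < t). { unfold t. assert (0 < Rmin (Rmin d R) (Rmin 1 q)) by (repeat apply Rmin_pos; lra). lra. }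
assert (ht' : t < Rmin (Rmin d R) (Rmin 1 q)) by (unfold t in *; lra).
assert (hw' := Rlt_le_trans _ _ _ ht' (Rmin_l _ _)). assert (hw := Rlt_le_trans _ _ _ ht' (Rmin_r _ _)).
assert (a1 := Rlt_le_trans _ _ _ hw' (Rmin_l _ _)). assert (a2 := Rlt_le_trans _ _ _ hw' (Rmin_r _ _)).
assert (a3 := Rlt_le_trans _ _ _ hw (Rmin_l _ _)). assert (a4 := Rlt_le_trans _ _ _ hw (Rmin_r _ _)).
clearbody t.
assert (hmt : Cmod (RtoC t) = t) by (rewrite Cmod_R, Rabs_pos_eq; lra).
specialize (h (RtoC t)). rewrite hmt in h. specialize (h ltac:(lra)).
specialize (hh (RtoC t)). replace (RtoC t - 0)%C with (RtoC t) in hh by ring. rewrite hmt in hh. specialize (hh a1).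
pose proof (Cmod_le_minus (k 0%C) (k (RtoC t))). rewrite Cmod_minus_sym in H.
assert (K * t ^ j <= K * 0 ^ j + e / 2); [|lra].
destruct j; simpl; [lra|]. rewrite Rmult_0_l, Rmult_0_r.
assert (0 <= t ^ j <= 1).
{ split; [apply pow_le; lra|]. rewrite <- (pow1 j). apply pow_incr; lra. }
assert (K * (t * t ^ j) <= Rabs K * (t * 1)).
{ apply Rle_trans with (Rabs K * (t * t ^ j)).
  - apply Rmult_le_compat_r; [nra|apply Rle_abs].
  - apply Rmult_le_compat_l; [apply Rabs_pos|nra]. }
pose proof (Rabs_pos K).
assert (e / 2 = q * (Rabs K + 1)) by (unfold q; field; lra). nra.
Qed.

(** One factor [w] is split off at a time; the bound with the exponent lowered by one is obtained by
    division away from 0 and reaches 0 by continuity, so the constant [K] is not degraded. *)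
Lemma factor_pow (j : nat) : forall h R M K, 0 < R -> 0 <= K ->
  (forall w, Cmod w < R -> holo h w) -> (forall w, Cmod w < R -> Cmod (h w) <= M) ->
  (forall w, Cmod w < R -> Cmod (h w) <= K * Cmod w ^ j) ->
  exists k : C -> C, (forall w, Cmod w < R -> holo k w) /\
    (forall w, Cmod w < R -> h w = (w ^ j * k w)%C) /\
    (forall w, Cmod w < R -> Cmod (k w) <= K).
Proof.
induction j; intros h R M K hR hK hf hM hb.
- exists h. split; [auto|]. split; [intros; simpl; ring|]. intros w hw. specialize (hb w hw). simpl in hb. lra.
- assert (h0 : h 0%C = 0%C).
  { apply Cmod_eq_0. specialize (hb 0%C). rewrite Cmod_0 in hb. specialize (hb hR). simpl in hb.
    pose proof (Cmod_ge_0 (h 0%C)). lra. }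
  assert (hz : forall w : C, (w - 0)%C = w) by (intro; ring).
  destruct (divdiff_holo_disk h 0%C R M hR) as (k1 & hk1 & hk2).
  { intros w hw. rewrite hz in hw. auto. }
  { intros w hw. rewrite hz in hw. auto. }
  rewrite h0 in hk2.
  assert (b1 : forall w, Cmod w < R -> Cmod (k1 w) <= K * Cmod w ^ j).
  { assert (b0 : forall w, 0 < Cmod w < R -> Cmod (k1 w) <= K * Cmod w ^ j).
    { intros w hw. specialize (hb w ltac:(lra)). rewrite hk2 in hb.
      replace (0 + (w - 0) * k1 w)%C with (w * k1 w)%C in hb by ring.
      rewrite Cmod_mult in hb. simpl in hb. apply Rmult_le_reg_l with (Cmod w); lra. }
    intros w hw. destruct (Ceq_dec w 0) as [->|hne].
    - rewrite Cmod_0. apply (bound_at_zero k1 R); auto. apply holo_ccont, hk1. rewrite hz, Cmod_0. auto.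
    - apply b0. split; auto. apply Cmod_gt_0; auto. }
  destruct (IHj k1 R (K * R ^ j) K hR hK) as (k & g1 & g2 & g3); auto.
  { intros w hw. apply hk1. rewrite hz; auto. }
  { intros w hw. eapply Rle_trans; [apply b1; auto|]. apply Rmult_le_compat_l; auto.
    apply pow_incr. split; [apply Cmod_ge_0|lra]. }
  exists k. split; auto. split; auto.
  intros w hw. rewrite hk2, (g2 w hw). simpl. ring.
Qed.

Lemma ccont_mult u g z : ccont u z -> ccont g z -> ccont (fun w => u w * g w)%C z.
Proof.
intros hc hgc e he. destruct (hc 1 Rlt_0_1) as (d1 & hd1 & h1).
pose proof (Cmod_ge_0 (u z)). pose proof (Cmod_ge_0 (g z)).
set (K := Cmod (u z) + Cmod (g z) + 1).
assert (hq : 0 < e / (2 * K)) by (apply Rdiv_lt_0_compat; unfold K; lra).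
destruct (hc _ hq) as (d2 & hd2 & h2). destruct (hgc _ hq) as (d3 & hd3 & h3).
exists (Rmin d1 (Rmin d2 d3)). split; [repeat apply Rmin_pos; auto|].
intros w hw. assert (a1 := Rlt_le_trans _ _ _ hw (Rmin_l _ _)). assert (hw' := Rlt_le_trans _ _ _ hw (Rmin_r _ _)).
assert (a2 := Rlt_le_trans _ _ _ hw' (Rmin_l _ _)). assert (a3 := Rlt_le_trans _ _ _ hw' (Rmin_r _ _)).
specialize (h1 w a1). specialize (h2 w a2). specialize (h3 w a3).
replace (u w * g w - u z * g z)%C with ((u w - u z) * (g w - g z) + (u w - u z) * g z + u z * (g w - g z))%C by ring.
eapply Rle_lt_trans; [apply Cmod_triangle|].
eapply Rle_lt_trans; [apply Rplus_le_compat_r, Cmod_triangle|]. rewrite !Cmod_mult.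
set (q := e / (2 * K)) in *. assert (he' : e = 2 * K * q) by (unfold q; field; unfold K; lra).
pose proof (Cmod_ge_0 (u w - u z)%C). pose proof (Cmod_ge_0 (g w - g z)%C).
assert (Cmod (u w - u z)%C * Cmod (g w - g z)%C <= 1 * q) by (apply Rmult_le_compat; lra).
rewrite he'. unfold K. nra.
Qed.

Lemma tame_mult_holo u g z d : 0 < d -> tame u z -> (forall w, Cmod (w - z)%C < d -> holo g w) ->
  tame (fun w => u w * g w)%C z.
Proof.
intros hd (hc & r & hr & hh) hg. split.
- apply ccont_mult; auto. apply holo_ccont, hg. rewrite Cmod_self; auto.
- exists (Rmin r d). split; [apply Rmin_pos; auto|]. intros w (hw1 & hw2).
  assert (a1 := Rlt_le_trans _ _ _ hw2 (Rmin_l _ _)). assert (a2 := Rlt_le_trans _ _ _ hw2 (Rmin_r _ _)).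
  apply holo_mult; auto.
Qed.

Lemma exp_nonpos_le_1 x : x <= 0 -> exp x <= 1.
Proof. intro h. rewrite <- exp_0. destruct h as [h|h]; [left; apply exp_increasing; auto|right; f_equal; auto]. Qed.

(** The factor [exp (i c z)] has modulus [exp (- c Im z)], and the maximum principle for the product
    weighs the two edges against each other. The weight [c] stays free; it is chosen in
    [order_in_strip]. *)
Lemma two_constants u b M e c : 0 < b ->
  (forall z, 0 <= snd z <= b -> tame u z) ->
  (forall z, 0 <= snd z <= b -> Cmod (u (z + 1)%C) = Cmod (u z)) ->
  (forall z, snd z = 0 -> Cmod (u z) <= e) -> (forall z, snd z = b -> Cmod (u z) <= M) ->
  forall z, 0 <= snd z <= b -> Cmod (u z) <= exp (c * snd z) * Rmax e (M * exp (- (c * b))).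
Proof.
intros hb ht hp h0 h1 z hz.
set (g := fun w => cexp ((0, c) * w)%C).
assert (hg : forall w, holo g w).
{ intro w. unfold g. apply holo_cexp. apply holo_mult; [apply holo_const|apply holo_id]. }
assert (mg : forall w, Cmod (g w) = exp (- (c * snd w))).
{ intro w. unfold g. rewrite Cmod_cexp. f_equal. simpl. ring. }
assert (htg : forall w, 0 <= snd w <= b -> tame (fun w => u w * g w)%C w).
{ intros w hw. apply (tame_mult_holo u g w 1); auto with real. }
assert (q := strip_max (fun w => u w * g w)%C 0 b (Rmax e (M * exp (- (c * b)))) hb).
assert (hq : Cmod (u z * g z)%C <= Rmax e (M * exp (- (c * b)))).
{ apply q; auto.
  - intros w hw. apply htg; auto.
  - intros w hw. apply htg; lra.
  - intros w hw. rewrite !Cmod_mult, hp, !mg by auto. f_equal. f_equal. simpl. ring.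
  - intros w [hw|hw]; rewrite Cmod_mult, mg, hw.
    + rewrite Rmult_0_r, Ropp_0, exp_0, Rmult_1_r. eapply Rle_trans; [apply h0; auto|apply Rmax_l].
    + eapply Rle_trans; [|apply Rmax_r]. apply Rmult_le_compat_r; [apply Rlt_le, exp_pos|auto]. }
rewrite Cmod_mult, mg in hq.
replace (Cmod (u z)) with (exp (c * snd z) * (Cmod (u z) * exp (- (c * snd z)))).
- apply Rmult_le_compat_l; [apply Rlt_le, exp_pos|auto].
- rewrite exp_Ropp. pose proof (exp_pos (c * snd z)). field. lra.
Qed.

(** * Holomorphic functions with many real zeros *)

Definition Chpi : C := (0, PI).

(** [sp w = - 2 i sin (PI w)] and [cp w = 2 cos (PI w)]. *)
Definition sp (w : C) : C := (cexp (- Chpi * w) - cexp (Chpi * w))%C.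
Definition cp (w : C) : C := (cexp (- Chpi * w) + cexp (Chpi * w))%C.

Lemma Cmod_cexp_hpi w : Cmod (cexp (Chpi * w)) = exp (- (PI * snd w)).
Proof. rewrite Cmod_cexp. f_equal. unfold Chpi; simpl. ring. Qed.

Lemma Cmod_cexp_mhpi w : Cmod (cexp (- Chpi * w)) = exp (PI * snd w).
Proof. rewrite Cmod_cexp. f_equal. unfold Chpi; simpl. ring. Qed.

Lemma cdiff_sp w : cdiff sp w (- Chpi * cp w)%C.
Proof.
unfold sp, cp.
replace (- Chpi * (cexp (- Chpi * w) + cexp (Chpi * w)))%C with
  (cexp (- Chpi * w) * (- Chpi * 1) - cexp (Chpi * w) * (Chpi * 1))%C by ring.
apply cdiff_minus.
- apply (cdiff_comp cexp (fun w => - Chpi * w)%C); [apply cdiff_scal, cdiff_id|apply cdiff_cexp].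
- apply (cdiff_comp cexp (fun w => Chpi * w)%C); [apply cdiff_scal, cdiff_id|apply cdiff_cexp].
Qed.

Lemma sp_lower w : exp (PI * Rabs (snd w)) - exp (- (PI * Rabs (snd w))) <= Cmod (sp w).
Proof.
unfold sp. pose proof (Cmod_le_minus (cexp (- Chpi * w)) (cexp (Chpi * w))) as h1.
pose proof (Cmod_le_minus (cexp (Chpi * w)) (cexp (- Chpi * w))) as h2.
rewrite (Cmod_minus_sym (cexp (Chpi * w))) in h2. rewrite Cmod_cexp_hpi, Cmod_cexp_mhpi in h1, h2.
unfold Rabs; destruct (Rcase_abs (snd w)).
- replace (PI * - snd w) with (- (PI * snd w)) by ring. rewrite Ropp_involutive. lra.
- lra.
Qed.

Lemma cp_upper w : Cmod (cp w) <= exp (PI * Rabs (snd w)) + exp (- (PI * Rabs (snd w))).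
Proof.
unfold cp. eapply Rle_trans; [apply Cmod_triangle|]. rewrite Cmod_cexp_hpi, Cmod_cexp_mhpi.
unfold Rabs; destruct (Rcase_abs (snd w)).
- replace (PI * - snd w) with (- (PI * snd w)) by ring. rewrite Ropp_involutive. lra.
- lra.
Qed.

Lemma sp_pos w : snd w <> 0 -> 0 < Cmod (sp w).
Proof.
intro h. eapply Rlt_le_trans; [|apply sp_lower].
assert (0 < Rabs (snd w)) by (apply Rabs_pos_lt; auto). pose proof PI_RGT_0.
assert (0 < PI * Rabs (snd w)) by (apply Rmult_lt_0_compat; lra).
assert (exp (- (PI * Rabs (snd w))) < exp (PI * Rabs (snd w))) by (apply exp_increasing; lra). lra.
Qed.

Lemma sp_eq_0 (w : C) : sp w = 0%C -> exists k : Z, w = RtoC (IZR k).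
Proof.
intro h. assert (hs : snd w = 0).
{ apply NNPP; intro hn. apply sp_pos in hn. rewrite h, Cmod_0 in hn. lra. }
destruct w as (x, y); simpl in hs; subst y.
assert (hx : sin (x * PI) = 0).
{ apply (f_equal snd) in h. unfold sp, cexp, Chpi in h; simpl in h.
  replace ((-0) * x - - PI * 0) with 0 in h by ring.
  replace ((-0) * 0 + - PI * x) with (- (x * PI)) in h by ring.
  replace (0 * x - PI * 0) with 0 in h by ring.
  replace (0 * 0 + PI * x) with (x * PI) in h by ring.
  rewrite exp_0, sin_neg in h. lra. }
destruct (sin_eq_0_0 _ hx) as (k & hk). exists k. unfold RtoC. f_equal.
pose proof PI_RGT_0. apply Rmult_eq_reg_r with PI; lra.
Qed.

Lemma cexp_mhpi_1 : cexp (- Chpi * 1) = (-1)%C.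
Proof.
unfold cexp, Chpi; simpl. replace ((-0) * 1 - - PI * 0) with 0 by ring.
replace ((-0) * 0 + - PI * 1) with (- PI) by ring.
rewrite exp_0, cos_neg, sin_neg, cos_PI, sin_PI. unfold RtoC. f_equal; ring.
Qed.

Lemma cexp_hpi_1 : cexp (Chpi * 1) = (-1)%C.
Proof.
unfold cexp, Chpi; simpl. replace (0 * 1 - PI * 0) with 0 by ring.
replace (0 * 0 + PI * 1) with PI by ring.
rewrite exp_0, cos_PI, sin_PI. unfold RtoC. f_equal; ring.
Qed.

Lemma sp_period w : sp (w + 1)%C = (- sp w)%C.
Proof.
unfold sp. replace (- Chpi * (w + 1))%C with (- Chpi * w + - Chpi * 1)%C by ring.
replace (Chpi * (w + 1))%C with (Chpi * w + Chpi * 1)%C by ring.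
rewrite !cexp_add, cexp_mhpi_1, cexp_hpi_1. ring.
Qed.

Lemma holo_sp_shift (x : R) z : holo (fun w => sp (w - RtoC x)%C) z.
Proof.
apply (holo_comp sp (fun w => w - RtoC x)%C); [apply holo_minus; auto using holo_id, holo_const|].
eexists; apply cdiff_sp.
Qed.

Lemma Cmod_eq_lim f g z r : 0 < r -> ccont f z -> ccont g z ->
  (forall w, 0 < Cmod (w - z)%C < r -> Cmod (f w) = Cmod (g w)) -> Cmod (f z) = Cmod (g z).
Proof.
intros hr hf hg h. apply cond_eq. intros e he.
destruct (hf (e/2) ltac:(lra)) as (d1 & hd1 & h1). destruct (hg (e/2) ltac:(lra)) as (d2 & hd2 & h2).
set (t := Rmin r (Rmin d1 d2) / 2).
assert (ht0 : 0 < Rmin r (Rmin d1 d2)) by (repeat apply Rmin_pos; auto).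
assert (ht : t < Rmin r (Rmin d1 d2)) by (unfold t; lra). assert (ht' : 0 < t) by (unfold t; lra).
assert (a1 := Rlt_le_trans _ _ _ ht (Rmin_l _ _)). assert (hw' := Rlt_le_trans _ _ _ ht (Rmin_r _ _)).
assert (a2 := Rlt_le_trans _ _ _ hw' (Rmin_l _ _)). assert (a3 := Rlt_le_trans _ _ _ hw' (Rmin_r _ _)).
clearbody t.
assert (hz : Cmod (z + RtoC t - z)%C = t).
{ replace (z + RtoC t - z)%C with (RtoC t) by ring. rewrite Cmod_R, Rabs_pos_eq; lra. }
specialize (h (z + RtoC t)%C). specialize (h1 (z + RtoC t)%C). specialize (h2 (z + RtoC t)%C).
rewrite hz in h, h1, h2. specialize (h ltac:(lra)). specialize (h1 a2). specialize (h2 a3).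
pose proof (Cmod_le_minus (f z) (f (z + RtoC t)%C)). pose proof (Cmod_le_minus (f (z + RtoC t)%C) (f z)).
pose proof (Cmod_le_minus (g z) (g (z + RtoC t)%C)). pose proof (Cmod_le_minus (g (z + RtoC t)%C) (g z)).
rewrite (Cmod_minus_sym (f z)) in H. rewrite (Cmod_minus_sym (g z)) in H1.
apply Rabs_def1; lra.
Qed.

(** Distinct integer translates of one [e] are at distance at least 1, so at most one of them lies
    within [1/2] of [z]. *)
Lemma avoid_translates (E : list R) (z : C) : exists r, 0 < r /\
  forall w, 0 < Cmod (w - z)%C < r -> forall e k, In e E -> w <> RtoC (e + IZR k).
Proof.
induction E as [|e E (r & hr & h)].
- exists 1; split; [lra|]. intros w _ e k [].
- assert (exists r', 0 < r' /\ forall w, 0 < Cmod (w - z)%C < r' -> forall k, w <> RtoC (e + IZR k)) as (r' & hr' & h').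
  { destruct (classic (exists k, 0 < Cmod (RtoC (e + IZR k) - z)%C < /2)) as [(k & hk)|hn].
    - exists (Cmod (RtoC (e + IZR k) - z)%C). split; [apply hk|]. intros w hw k' ->.
      assert (k = k'); [|subst; lra].
      assert (hd : Cmod (RtoC (e + IZR k) - RtoC (e + IZR k'))%C < 1).
      { pose proof (Cmod_minus_trans (RtoC (e + IZR k)) z (RtoC (e + IZR k'))).
        rewrite (Cmod_minus_sym z) in H. lra. }
      rewrite <- RtoC_minus, Cmod_R in hd.
      replace (e + IZR k - (e + IZR k')) with (IZR (k - k')) in hd by (rewrite minus_IZR; ring).
      rewrite <- abs_IZR in hd. apply lt_IZR in hd. lia.
    - exists (/2). split; [lra|]. intros w hw k ->. apply hn. exists k; auto. }
  exists (Rmin r r'). split; [apply Rmin_pos; auto|].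
  intros w (hw1 & hw2) e' k [->|hin].
  + apply h'. split; auto. eapply Rlt_le_trans; [exact hw2|apply Rmin_r].
  + apply h; auto. split; auto. eapply Rlt_le_trans; [exact hw2|apply Rmin_l].
Qed.

(** [E] collects the zeros already divided out: at their translates the quotient is only known to be
    continuous. Periodicity is asked of the modulus because [sp (w + 1) = - sp w]. *)
Definition regular_off (b : R) (u : C -> C) (E : list R) : Prop :=
  (forall z, Rabs (snd z) < b -> ccont u z) /\
  (forall z, Rabs (snd z) < b -> (forall e k, In e E -> z <> RtoC (e + IZR k)) -> holo u z) /\
  (forall z, Rabs (snd z) < b -> Cmod (u (z + 1)%C) = Cmod (u z)).

Lemma strip_nbhd b (z : C) : Rabs (snd z) < b -> exists d, 0 < d /\
  forall w, Cmod (w - z)%C < d -> Rabs (snd w) < b.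
Proof.
intro h. exists (b - Rabs (snd z)). split; [lra|]. intros w hw.
pose proof (snd_le_Cmod (w - z)%C). rewrite snd_minus in H.
replace (snd w) with ((snd w - snd z) + snd z) by ring.
eapply Rle_lt_trans; [apply Rabs_triang|]. lra.
Qed.

Lemma regular_off_tame b u E z : regular_off b u E -> Rabs (snd z) < b -> tame u z.
Proof.
intros (h1 & h2 & _) hz. split; [auto|].
destruct (avoid_translates E z) as (r & hr & h). destruct (strip_nbhd b z hz) as (d & hd & h').
exists (Rmin r d). split; [apply Rmin_pos; auto|]. intros w (hw1 & hw2). apply h2.
- apply h'. eapply Rlt_le_trans; [exact hw2|apply Rmin_r].
- apply h. split; auto. eapply Rlt_le_trans; [exact hw2|apply Rmin_l].
Qed.

(** As [x0] differs modulo 1 from the zeros removed before, [u] is holomorphic at the translates of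
    [x0]. The zeros of the sine are simple, so the quotient extends continuously there. *)
Lemma remove_zero b u E (x0 : R) : regular_off b u E ->
  (forall e k, In e E -> x0 <> e + IZR k) ->
  u (RtoC x0) = 0%C ->
  exists v, regular_off b v (x0 :: E) /\ forall z, Rabs (snd z) < b -> u z = (sp (z - RtoC x0) * v z)%C.
Proof.
intros hreg hx0 hu0. destruct hreg as (h1 & h2 & h3).
destruct (Rle_or_lt b 0) as [hb|hb].
{ exists (fun _ => 0%C). split; [repeat split; intros; exfalso|intros; exfalso]; pose proof (Rabs_pos (snd z)); lra. }
(* At a zero of the sine the value is the quotient of the derivatives. *)
set (v := fun z : C => if Ceq_dec (sp (z - RtoC x0)) 0 then (der u z / (- Chpi * cp (z - RtoC x0)))%C
   else (u z / sp (z - RtoC x0))%C).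
assert (huz : forall k, u (RtoC (x0 + IZR k)) = 0%C).
{ intro k. apply Cmod_eq_0. rewrite RtoC_plus.
  rewrite (Cmod_periodic_Z u (RtoC x0) k (fun y => Rabs y < b)); auto.
  - rewrite hu0. apply Cmod_0.
  - simpl. rewrite Rabs_R0; auto. }
assert (hz : forall z : C, sp (z - RtoC x0)%C = 0%C -> exists k, z = RtoC (x0 + IZR k)).
{ intros z hs. apply sp_eq_0 in hs. destruct hs as (k & hk). exists k.
  rewrite RtoC_plus, <- hk. ring. }
assert (hfac : forall z, Rabs (snd z) < b -> u z = (sp (z - RtoC x0) * v z)%C).
{ intros z _. unfold v. destruct (Ceq_dec (sp (z - RtoC x0)) 0) as [h0|h0].
  - rewrite h0. destruct (hz z h0) as (k & ->). rewrite huz. ring.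
  - field. auto. }
assert (hnz : forall z, Rabs (snd z) < b -> sp (z - RtoC x0)%C <> 0%C -> holo u z -> holo v z).
{ intros z hzb h0 hu.
  assert (hc := holo_ccont _ _ (holo_sp_shift x0 z)).
  destruct (hc (Cmod (sp (z - RtoC x0)%C))) as (d & hd & hh); [apply Cmod_gt_0; auto|].
  apply (holo_ext_loc (fun z => (u z / sp (z - RtoC x0))%C) _ _ d hd).
  - intros w hw. specialize (hh w hw). unfold v. destruct (Ceq_dec (sp (w - RtoC x0)) 0) as [h0'|h0']; auto.
    rewrite h0' in hh. rewrite Cmod_minus_sym in hh.
    replace (sp (z - RtoC x0) - 0)%C with (sp (z - RtoC x0)) in hh by ring. lra.
  - apply holo_div; auto. apply holo_sp_shift. }
assert (hcz : forall z, Rabs (snd z) < b -> sp (z - RtoC x0)%C = 0%C -> ccont v z).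
{ intros z hzb h0.
  assert (hu : holo u z).
  { apply h2; auto. destruct (hz z h0) as (k & ->). intros e k' he heq.
    apply RtoC_inj in heq. apply (hx0 e (k' - k)%Z he). rewrite minus_IZR. lra. }
  (* [cp + sp] is twice an exponential, so [cp] and [sp] have no common zero. *)
  assert (hcp : cp (z - RtoC x0)%C <> 0%C).
  { intro hc. assert (hs : (cp (z - RtoC x0) + sp (z - RtoC x0))%C = 0%C) by (rewrite hc, h0; ring).
    unfold cp, sp in hs. apply (cexp_neq_0 (- Chpi * (z - RtoC x0))%C).
    apply Cmod_eq_0. apply (f_equal Cmod) in hs. rewrite Cmod_0 in hs.
    replace (cexp (- Chpi * (z - x0)) + cexp (Chpi * (z - x0)) + (cexp (- Chpi * (z - x0)) - cexp (Chpi * (z - x0))))%C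
      with (RtoC 2 * cexp (- Chpi * (z - x0)))%C in hs by ring.
    rewrite Cmod_mult, Cmod_R, Rabs_pos_eq in hs by lra. lra. }
  assert (hhp : (- Chpi)%C <> 0%C).
  { intro hc. apply (f_equal snd) in hc. simpl in hc. pose proof PI_RGT_0. lra. }
  set (m := (- Chpi * cp (z - RtoC x0))%C). assert (hm : m <> 0%C) by (apply Cmult_neq_0; auto).
  assert (hsd : cdiff (fun w => sp (w - RtoC x0)%C) z m).
  { replace m with (m * (1 - 0))%C by ring. apply (cdiff_comp sp (fun w => w - RtoC x0)%C).
    apply cdiff_minus; auto using cdiff_id, cdiff_const. apply cdiff_sp. }
  assert (hud := der_spec _ _ hu).
  (* Near [z], where [u] and the sine vanish, [v] is the quotient of their difference quotients,
     both continuous at [z]. *)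
  set (U := divdiff u z (der u z)). set (S := divdiff (fun w => sp (w - RtoC x0)%C) z m).
  assert (hUc : ccont (fun w => U w * / S w)%C z).
  { apply ccont_mult; [apply divdiff_ccont; auto|].
    apply (ccont_comp Cinv S); [apply divdiff_ccont; auto|].
    apply holo_ccont. eexists. apply cdiff_inv. unfold S. rewrite divdiff_eq. auto. }
  apply (ccont_ext_loc (fun w => U w * / S w)%C _ _ 1 Rlt_0_1); auto.
  intros w hw. unfold v, U, S. destruct (Ceq_dec w z) as [->|hne].
  - rewrite !divdiff_eq. destruct (Ceq_dec (sp (z - RtoC x0)) 0); [reflexivity|contradiction].
  - rewrite !divdiff_neq by auto. destruct (Ceq_dec (sp (w - RtoC x0)) 0) as [h0'|h0'].
    + exfalso. apply hne. destruct (hz z h0) as (k & ->). destruct (hz w h0') as (k' & ->).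
      rewrite <- RtoC_minus, Cmod_R in hw.
      replace (x0 + IZR k' - (x0 + IZR k)) with (IZR (k' - k)) in hw by (rewrite minus_IZR; ring).
      rewrite <- abs_IZR in hw. apply lt_IZR in hw. f_equal. f_equal. f_equal. lia.
    + pose proof (Cminus_neq_0 _ _ hne). rewrite h0.
      destruct (hz z h0) as (k & hk). rewrite hk at 1. rewrite huz.
      field. split; auto. }
assert (hcont : forall z, Rabs (snd z) < b -> ccont v z).
{ intros z hzb. destruct (Ceq_dec (sp (z - RtoC x0)) 0) as [h0|h0]; [auto|].
  assert (hc := holo_ccont _ _ (holo_sp_shift x0 z)).
  destruct (hc (Cmod (sp (z - RtoC x0)%C))) as (d & hd & hh); [apply Cmod_gt_0; auto|].
  apply (ccont_ext_loc (fun z => (u z * / sp (z - RtoC x0))%C) _ _ d hd).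
  - intros w hw. specialize (hh w hw). unfold v. destruct (Ceq_dec (sp (w - RtoC x0)) 0) as [h0'|h0']; auto.
    rewrite h0' in hh. rewrite Cmod_minus_sym in hh.
    replace (sp (z - RtoC x0) - 0)%C with (sp (z - RtoC x0)) in hh by ring. lra.
  - apply ccont_mult; [apply h1; auto|]. apply holo_ccont, (holo_inv (fun w => sp (w - RtoC x0)%C)); auto. apply holo_sp_shift. }
exists v. split; [|exact hfac]. split; [exact hcont|]. split.
- intros z hzb hE. destruct (Ceq_dec (sp (z - RtoC x0)) 0) as [h0|h0].
  + exfalso. destruct (hz z h0) as (k & hk). apply (hE x0 k); simpl; auto.
  + apply hnz; auto. apply h2; auto. intros; apply hE; simpl; auto.
- intros z hzb.
  (* Periodicity of the modulus is obtained by division off the zeros of the sine, and by continuity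
     at them. *)
  destruct (avoid_translates (x0 :: nil) z) as (r & hr & hav). destruct (strip_nbhd b z hzb) as (d & hd & hnb).
  assert (hsh : forall w : C, snd (w + 1)%C = snd w) by (intro w; simpl; ring).
  apply (Cmod_eq_lim (fun z => v (z + 1)%C) v z (Rmin r d)).
  + apply Rmin_pos; auto.
  + apply (ccont_comp v (fun z => z + 1)%C).
    * apply holo_ccont, holo_plus; auto using holo_id, holo_const.
    * apply hcont. rewrite hsh; auto.
  + auto.
  + intros w (hw1 & hw2). assert (a1 := Rlt_le_trans _ _ _ hw2 (Rmin_l _ _)). assert (a2 := Rlt_le_trans _ _ _ hw2 (Rmin_r _ _)).
    assert (hwb := hnb w a2). assert (hs0 : sp (w - RtoC x0)%C <> 0%C).
    { intro h0. destruct (hz w h0) as (k & hk). apply (hav w ltac:(lra) x0 k); simpl; auto. }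
    assert (hp := h3 w hwb). rewrite (hfac w hwb) in hp. rewrite (hfac (w + 1)%C) in hp by (rewrite hsh; auto).
    replace (w + 1 - RtoC x0)%C with ((w - RtoC x0) + 1)%C in hp by ring.
    rewrite sp_period, !Cmod_mult, Cmod_opp in hp.
    apply Rmult_eq_reg_l in hp; auto. apply Cmod_gt_0 in hs0. lra.
Qed.

Definition spP (xs : list R) (z : C) : C := fold_right (fun x acc => sp (z - RtoC x) * acc)%C 1%C xs.

Lemma spP_app xs ys z : spP (xs ++ ys) z = (spP xs z * spP ys z)%C.
Proof. induction xs; simpl; [ring|]. unfold spP in *. simpl. rewrite IHxs. ring. Qed.

(** The zeros are distinct modulo 1, so the product of the sines already extracted does not vanish
    at the next zero of [u], and the current quotient must. *)
Lemma factor_zeros b u xs : 0 < b -> regular_off b u nil ->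
  NoDup xs -> (forall x y k, In x xs -> In y xs -> x = y + IZR k -> x = y) ->
  (forall x, In x xs -> u (RtoC x) = 0%C) ->
  exists v, regular_off b v xs /\ forall z, Rabs (snd z) < b -> u z = (spP xs z * v z)%C.
Proof.
intros hb hu. induction xs as [|x xs IH]; intros hnd hmod hz.
- exists u; split; auto. intros; simpl; ring.
- inversion hnd as [|? ? hni hnd']; subst.
  destruct IH as (v & hv1 & hv2); auto.
  { intros; eapply hmod; simpl; eauto. }
  { intros; apply hz; simpl; auto. }
  assert (hnx : forall e k, In e xs -> x <> e + IZR k).
  { intros e k he heq. apply hni. rewrite (hmod x e k); simpl; auto. }
  assert (hxb : Rabs (snd (RtoC x)) < b) by (simpl; rewrite Rabs_R0; auto).
  destruct (remove_zero b v xs x hv1 hnx) as (w & hw1 & hw2).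
  + assert (h0 := hv2 (RtoC x) hxb). rewrite hz in h0 by (simpl; auto).
    assert (hp : spP xs (RtoC x) <> 0%C).
    { clear - hnx. induction xs as [|y xs IH]; simpl; [intro h; apply (f_equal fst) in h; simpl in h; lra|].
      apply Cmult_neq_0.
      - intro hs. apply sp_eq_0 in hs. destruct hs as (k & hk). apply (hnx y k); simpl; auto.
        rewrite <- RtoC_minus in hk. apply RtoC_inj in hk. lra.
      - apply IH. intros; apply hnx; simpl; auto. }
    destruct (Ceq_dec (v (RtoC x)) 0) as [|hn]; auto. exfalso. apply (Cmult_neq_0 _ _ hp hn). auto.
  + exists w. split; auto. intros z hzb. rewrite hv2, hw2 by auto. simpl. ring.
Qed.

Lemma spP_nonzero xs z : snd z <> 0 -> 0 < Cmod (spP xs z).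
Proof.
intro h. induction xs as [|x xs IH].
- simpl. rewrite Cmod_1. lra.
- change (spP (x :: xs) z) with (sp (z - RtoC x) * spP xs z)%C. rewrite Cmod_mult. apply Rmult_lt_0_compat; auto. apply sp_pos.
  rewrite snd_minus. simpl. lra.
Qed.

(** The quotient of [u] by the product of sines is bounded by [B] on the two lines [|Im z| = t],
    hence between them. *)
Lemma many_zeros_bound b t u xs B : 0 < t < b -> regular_off b u nil ->
  NoDup xs -> (forall x y k, In x xs -> In y xs -> x = y + IZR k -> x = y) ->
  (forall x, In x xs -> u (RtoC x) = 0%C) ->
  (forall z, Rabs (snd z) = t -> Cmod (u z) <= B * Cmod (spP xs z)) ->
  forall z, Rabs (snd z) <= t -> Cmod (u z) <= B * Cmod (spP xs z).
Proof.
intros ht hu hnd hmod hz hB z hzt.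
destruct (factor_zeros b u xs ltac:(lra) hu hnd hmod hz) as (v & hv & hf).
assert (htame : forall z, Rabs (snd z) < b -> tame v z) by (intros; eapply regular_off_tame; eauto).
rewrite hf by lra. rewrite Cmod_mult, Rmult_comm. apply Rmult_le_compat_r; [apply Cmod_ge_0|].
apply (strip_max v (- t) t B); try lra.
- intros w hw. apply htame. apply Rabs_def1; lra.
- intros w hw. apply htame. apply Rabs_def1; lra.
- intros w hw. apply hv. apply Rabs_def1; lra.
- intros w hw. assert (hwt : Rabs (snd w) = t).
  { destruct hw as [-> | ->]; [rewrite Rabs_Ropp|]; apply Rabs_pos_eq; lra. }
  specialize (hB w hwt). rewrite hf in hB by lra. rewrite Cmod_mult, Rmult_comm in hB.
  apply Rmult_le_reg_r in hB; auto. apply spP_nonzero. intro h0. rewrite h0, Rabs_R0 in hwt. lra.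
- apply Rabs_le_between; auto.
Qed.

(** * Lattice products *)

(** The monic polynomial with lower coefficients [c], constant term first; its degree is the length
    of [c]. *)
Definition mpoly (c : list C) (u : C) : C := fold_right (fun a acc => a + u * acc)%C 1%C c.

Lemma mpoly_root_factor c : forall a0 a, exists c', length c' = length c /\
  forall u, mpoly (a0 :: c) u = (mpoly (a0 :: c) a + (u - a) * mpoly c' u)%C.
Proof.
induction c as [|a1 c IH]; intros a0 a.
- exists nil. split; auto. intro u; simpl. ring.
- destruct (IH a1 a) as (c' & hl & hc). exists (mpoly (a1 :: c) a :: c'). split; [simpl; auto|].
  intro u. change (mpoly (a0 :: a1 :: c) u) with (a0 + u * mpoly (a1 :: c) u)%C.
  change (mpoly (a0 :: a1 :: c) a) with (a0 + a * mpoly (a1 :: c) a)%C.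
  change (mpoly (mpoly (a1 :: c) a :: c') u) with (mpoly (a1 :: c) a + u * mpoly c' u)%C.
  rewrite (hc u). ring.
Qed.

(** Roots are divided out one at a time. It serves for [u^q - 1] and the [q]-th roots of unity. *)
Lemma mpoly_split zs : forall c, length c = length zs -> NoDup zs ->
  (forall z, In z zs -> mpoly c z = 0%C) ->
  forall u, mpoly c u = fold_right (fun z acc => (u - z) * acc)%C 1%C zs.
Proof.
induction zs as [|z zs IH]; intros c hl hnd hr u.
- destruct c; [reflexivity|discriminate].
- destruct c as [|a0 c]; [discriminate|]. inversion hnd as [|? ? hni hnd']; subst.
  destruct (mpoly_root_factor c a0 z) as (c' & hl' & hc').
  rewrite (hr z) in hc' by (simpl; auto).
  rewrite hc'. simpl. rewrite <- (IH c'); auto.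
  + ring.
  + simpl in hl. lia.
  + intros w hw. assert (h0 := hc' w). rewrite (hr w) in h0 by (simpl; auto).
    destruct (Ceq_dec (mpoly c' w) 0) as [|hn]; auto. exfalso.
    assert (hwz : w <> z) by (intros ->; auto).
    apply (Cmult_neq_0 _ _ (Cminus_neq_0 _ _ hwz) hn).
    rewrite h0. ring.
Qed.

Lemma mpoly_repeat0 n u : mpoly (repeat (RtoC 0) n) u = (u ^ n)%C.
Proof.
induction n; [reflexivity|].
change (mpoly (repeat (RtoC 0) (S n)) u) with (0 + u * mpoly (repeat (RtoC 0) n) u)%C.
rewrite IHn. simpl. ring.
Qed.

Lemma cexp_pow z n : (cexp z ^ n)%C = cexp (RtoC (INR n) * z).
Proof.
induction n.
- simpl. replace (0 * z)%C with (RtoC 0) by ring. rewrite cexp_0. reflexivity.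
- rewrite S_INR, RtoC_plus. simpl. rewrite IHn, <- cexp_add. f_equal. ring.
Qed.

Lemma cexp_tau_Z (k : Z) : cexp (Ctau * RtoC (IZR k)) = 1%C.
Proof.
assert (h : sin (IZR k * PI) = 0) by (apply sin_eq_0_1; exists k; auto).
unfold cexp, Ctau; simpl. replace (0 * IZR k - 2 * PI * 0) with 0 by ring.
replace (0 * 0 + 2 * PI * IZR k) with (2 * (IZR k * PI)) by ring.
rewrite exp_0, cos_2a_sin, sin_2a, h. unfold RtoC; f_equal; ring.
Qed.

Lemma Ctau_hpi : Ctau = (RtoC 2 * Chpi)%C.
Proof. unfold Ctau, Chpi, RtoC, Cmult; simpl. f_equal; ring. Qed.

Lemma sp_as_tau w : sp w = (cexp (- Chpi * w) * (1 - cexp (Ctau * w)))%C.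
Proof.
unfold sp. rewrite Ctau_hpi.
replace (cexp (- Chpi * w) * (1 - cexp (2 * Chpi * w)))%C with
  (cexp (- Chpi * w) - cexp (- Chpi * w) * cexp (2 * Chpi * w))%C by ring.
rewrite <- cexp_add. replace (- Chpi * w + 2 * Chpi * w)%C with (Chpi * w)%C by ring. reflexivity.
Qed.

Lemma cexp_tau_eq_1 (w : C) : cexp (Ctau * w) = 1%C -> exists k, w = RtoC (IZR k).
Proof. intro h. apply sp_eq_0. rewrite sp_as_tau, h. ring. Qed.

Lemma Zgcd_of_nat (p q : nat) : Nat.gcd p q = 1%nat -> Z.gcd (Z.of_nat p) (Z.of_nat q) = 1%Z.
Proof.
intro h. set (g := Z.gcd (Z.of_nat p) (Z.of_nat q)).
assert (hg0 : (0 <= g)%Z) by apply Z.gcd_nonneg.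
assert (hdiv : forall n, (g | Z.of_nat n)%Z -> Nat.divide (Z.to_nat g) n).
{ intros n (m & hm). exists (Z.to_nat (Z.abs m)). apply Nat2Z.inj.
  rewrite Nat2Z.inj_mul, !Z2Nat.id by lia. nia. }
assert (hd : Nat.divide (Z.to_nat g) 1).
{ rewrite <- h. apply Nat.gcd_greatest; apply hdiv; [apply Z.gcd_divide_l|apply Z.gcd_divide_r]. }
apply Nat.divide_1_r in hd. lia.
Qed.

(** [q] divides [(k - l) p], hence [k - l], which is less than [q] in absolute value. *)
Lemma coprime_fraction (p q k l : nat) (j : Z) : Nat.gcd p q = 1%nat -> (k < q)%nat -> (l < q)%nat ->
  INR k * INR p / INR q = INR l * INR p / INR q + IZR j -> k = l.
Proof.
intros hg hk hl h. assert (hq : 0 < INR q) by (apply lt_0_INR; lia).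
assert (h1 : (INR k - INR l) * INR p = IZR j * INR q).
{ apply Rmult_eq_reg_r with (/ INR q); [|apply Rinv_neq_0_compat; lra].
  replace (IZR j * INR q * / INR q) with (IZR j) by (field; lra).
  replace ((INR k - INR l) * INR p * / INR q) with (INR k * INR p / INR q - INR l * INR p / INR q) by (field; lra). lra. }
rewrite !INR_IZR_INZ, <- minus_IZR, <- !mult_IZR in h1. apply eq_IZR in h1.
assert (hdiv : (Z.of_nat q | (Z.of_nat k - Z.of_nat l))%Z).
{ apply Z.gauss with (Z.of_nat p).
  - exists j. rewrite Z.mul_comm. lia.
  - rewrite Z.gcd_comm. apply Zgcd_of_nat; auto. }
destruct hdiv as (m & hm). assert (m = 0)%Z by nia. lia.
Qed.

Definition lattice (x0 : R) (p q : nat) : list R :=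
  map (fun k => x0 + INR k * INR p / INR q) (seq 0 q).

(** With [u = exp (2 i PI (z - x0))], each sine is, up to a factor of known modulus, [u - xi k], and
    the [xi k] are all the [q]-th roots of unity because [p] is prime to [q]. Their product is
    [u^q - 1]: the [q] sines multiply to a single sine of [q (z - x0)]. *)
Lemma Cmod_spP_lattice x0 p q z : Nat.gcd p q = 1%nat -> (0 < q)%nat ->
  Cmod (spP (lattice x0 p q) z) =
  exp (INR q * (PI * snd z)) * Cmod (cexp (RtoC (INR q) * (Ctau * (z - RtoC x0))) - 1)%C.
Proof.
intros hg hq. assert (hqR : 0 < INR q) by (apply lt_0_INR; lia).
set (u := cexp (Ctau * (z - RtoC x0))).
set (xi := fun k => cexp (Ctau * RtoC (INR k * INR p / INR q))).
rewrite <- cexp_pow. fold u.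
assert (hs : forall s, Cmod (spP (map (fun k => x0 + INR k * INR p / INR q) s) z) =
   exp (INR (length s) * (PI * snd z)) * Cmod (fold_right (fun z acc => (u - z) * acc)%C 1%C (map xi s))).
{ induction s as [|k s IH].
  - simpl. rewrite Rmult_0_l, exp_0, Cmod_1. ring.
  - simpl map. change (spP (?a :: ?l) z) with (sp (z - RtoC a) * spP l z)%C.
    simpl fold_right. rewrite Cmod_mult, (Cmod_mult (u - xi k)), IH.
    replace (length (k :: s)) with (S (length s)) by reflexivity. rewrite S_INR, Rmult_plus_distr_r, exp_plus, Rmult_1_l.
    rewrite sp_as_tau, Cmod_mult, Cmod_cexp_mhpi.
    replace (snd (z - RtoC (x0 + INR k * INR p / INR q))%C) with (snd z) by (simpl; ring).
    assert (he : (1 - cexp (Ctau * (z - RtoC (x0 + INR k * INR p / INR q))))%C =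
      (- cexp (- (Ctau * RtoC (INR k * INR p / INR q))) * (u - xi k))%C).
    { unfold u, xi. rewrite RtoC_plus.
      replace (Ctau * (z - (RtoC x0 + RtoC (INR k * INR p / INR q))))%C with
        (- (Ctau * (INR k * INR p / INR q)%R) + Ctau * (z - x0))%C.
      2:{ ring. }
      rewrite cexp_add.
      assert (h1 : (cexp (- (Ctau * (INR k * INR p / INR q)%R)) * cexp (Ctau * (INR k * INR p / INR q)%R))%C = 1%C).
      { rewrite <- cexp_add, <- cexp_0. f_equal. ring. }
      rewrite <- h1. ring. }
    rewrite he, Cmod_mult, Cmod_opp.
    rewrite (Cmod_cexp (- (Ctau * RtoC (INR k * INR p / INR q)))%C).
    replace (fst (- (Ctau * RtoC (INR k * INR p / INR q)))%C) with 0 by (unfold Ctau; simpl; ring).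
    rewrite exp_0. ring. }
unfold lattice. rewrite hs, length_seq. f_equal. f_equal.
(* The coefficients of [u^q - 1] below the leading one: [-1], then [q - 1] zeros. *)
rewrite <- (mpoly_split (map xi (seq 0 q)) ((RtoC (-1)) :: repeat (RtoC 0) (q - 1))).
- change (mpoly ((RtoC (-1)) :: repeat (RtoC 0) (q - 1)) u) with (-1 + u * mpoly (repeat (RtoC 0) (q - 1)) u)%C.
  rewrite mpoly_repeat0. replace q with (S (q - 1)) at 2 by lia. simpl. ring.
- simpl. rewrite repeat_length, length_map, length_seq. lia.
- apply NoDup_map_NoDup_ForallPairs; [|apply seq_NoDup].
  intros k l hk hl he. apply in_seq in hk. apply in_seq in hl. unfold xi in he.
  assert (h1 : cexp (Ctau * RtoC (INR k * INR p / INR q - INR l * INR p / INR q)) = 1%C).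
  { rewrite RtoC_minus.
    replace (Ctau * (RtoC (INR k * INR p / INR q) - RtoC (INR l * INR p / INR q)))%C with
     (Ctau * RtoC (INR k * INR p / INR q) + - (Ctau * RtoC (INR l * INR p / INR q)))%C by ring.
    rewrite cexp_add, he, <- cexp_add, <- cexp_0. f_equal. ring. }
  apply cexp_tau_eq_1 in h1. destruct h1 as (j & hj). apply RtoC_inj in hj.
  apply (coprime_fraction p q k l j hg); try lia. lra.
- intros w hw. apply in_map_iff in hw. destruct hw as (k & <- & hk).
  change (mpoly ((RtoC (-1)) :: repeat (RtoC 0) (q - 1)) (xi k)) with (-1 + xi k * mpoly (repeat (RtoC 0) (q - 1)) (xi k))%C.
  rewrite mpoly_repeat0.
  replace (xi k * xi k ^ (q - 1))%C with (xi k ^ q)%C.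
  2:{ replace q with (S (q - 1)) at 1 by lia. reflexivity. }
  unfold xi. rewrite cexp_pow.
  replace (RtoC (INR q) * (Ctau * RtoC (INR k * INR p / INR q)))%C with
    (Ctau * RtoC (INR q * (INR k * INR p / INR q)))%C by (rewrite RtoC_mult; ring).
  replace (INR q * (INR k * INR p / INR q)) with (IZR (Z.of_nat (k * p))).
  + rewrite cexp_tau_Z. ring.
  + rewrite <- INR_IZR_INZ, mult_INR. field. lra.
Qed.

(** The second factor in [Cmod_spP_lattice] is the modulus of [u - 1], where now
    [|u| = exp (- 2 PI q Im z)]. In the lower bound [exp (- 2 PI q |Im z|)] is replaced by the
    larger [exp (- 2 PI |Im z|)], so that the constant does not depend on [q]. *)
Lemma lattice_bounds x0 p q z : Nat.gcd p q = 1%nat -> (0 < q)%nat ->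
  exp (INR q * (PI * Rabs (snd z))) * (1 - exp (- (2 * PI * Rabs (snd z)))) <=
   Cmod (spP (lattice x0 p q) z) <= 2 * exp (INR q * (PI * Rabs (snd z))).
Proof.
intros hg hq. rewrite Cmod_spP_lattice by auto.
assert (hqR : 1 <= INR q) by (apply (le_INR 1); lia).
set (u := cexp (RtoC (INR q) * (Ctau * (z - RtoC x0)))).
assert (hu : Cmod u = exp (- (2 * INR q * (PI * snd z)))).
{ unfold u. rewrite Cmod_cexp. f_equal. unfold Ctau; simpl. ring. }
pose proof (Cmod_le_minus u 1%C) as b1. pose proof (Cmod_le_minus 1%C u) as b2. pose proof (Cmod_minus_le u 1%C) as b3.
rewrite (Cmod_minus_sym 1%C) in b2. rewrite Cmod_1, hu in b1, b2, b3.
set (a := INR q * (PI * Rabs (snd z))).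
pose proof PI_RGT_0. pose proof (Rabs_pos (snd z)).
assert (hP : 0 <= PI * Rabs (snd z)) by (apply Rmult_le_pos; lra).
assert (haP : PI * Rabs (snd z) <= a).
{ unfold a. rewrite <- (Rmult_1_l (PI * Rabs (snd z))) at 1. apply Rmult_le_compat_r; lra. }
assert (ha : exp (- (2 * a)) <= exp (- (2 * PI * Rabs (snd z)))).
{ assert (hle : 2 * PI * Rabs (snd z) <= 2 * a) by lra.
  destruct hle as [hle|hle]; [left; apply exp_increasing; lra|right; f_equal; lra]. }
assert (ha1 : exp (- (2 * a)) <= 1) by (apply exp_nonpos_le_1; lra).
pose proof (exp_pos a) as pa. pose proof (exp_pos (- (2 * a))).
assert (hcase : (exp (INR q * (PI * snd z)) = exp a /\ exp (- (2 * INR q * (PI * snd z))) = exp (- (2 * a))) \/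
  (exp (INR q * (PI * snd z)) = exp a * exp (- (2 * a)) /\ exp (- (2 * INR q * (PI * snd z))) * exp (- (2 * a)) = 1)).
{ unfold Rabs in *. destruct (Rcase_abs (snd z)).
  - right. rewrite <- !exp_plus. split; [f_equal; unfold a; ring|].
    rewrite <- exp_0. f_equal. unfold a; ring.
  - left. split; f_equal; unfold a; ring. }
destruct hcase as [(h1 & h2)|(h1 & h2)].
- rewrite h1. rewrite h2 in b1, b2, b3. split; [nra|]. nra.
- rewrite h1. set (E := exp (- (2 * INR q * (PI * snd z)))) in *. set (e := exp (- (2 * a))) in *.
  rewrite (Rmult_assoc (exp a) e). split.
  + apply Rmult_le_compat_l; [lra|]. assert (e * (E - 1) <= e * Cmod (u - 1)%C) by (apply Rmult_le_compat_l; lra). lra.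
  + rewrite (Rmult_comm 2). apply Rmult_le_compat_l; [lra|].
    assert (e * Cmod (u - 1)%C <= e * (E + 1)) by (apply Rmult_le_compat_l; lra). lra.
Qed.

(** An upper bound for [|sp' / sp|] on the lines [|Im z| = t]. *)
Definition kap (t : R) : R := PI * (exp (PI * t) + exp (- (PI * t))) / (exp (PI * t) - exp (- (PI * t))).

Lemma kap_den t : 0 < t -> 0 < exp (PI * t) - exp (- (PI * t)).
Proof.
intro ht. pose proof PI_RGT_0. assert (0 < PI * t) by (apply Rmult_lt_0_compat; lra).
assert (exp (- (PI * t)) < exp (PI * t)) by (apply exp_increasing; lra). lra.
Qed.

Lemma kap_pos t : 0 < t -> 0 < kap t.
Proof.
intro ht. pose proof (kap_den t ht). pose proof PI_RGT_0. pose proof (exp_pos (PI * t)). pose proof (exp_pos (- (PI * t))).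
apply Rdiv_lt_0_compat; auto. apply Rmult_lt_0_compat; lra.
Qed.

(** [sp (w + d)] equals [cos (PI d) sp w - i sin (PI d) cp w], and [PI |cp w| <= kap t |sp w|] on
    the lines considered; it remains to use [1 + x <= exp x]. *)
Lemma sp_perturb w (d t : R) : 0 < t -> Rabs (snd w) = t ->
  Cmod (sp (w + RtoC d)) <= exp (kap t * Rabs d) * Cmod (sp w).
Proof.
intros ht hw.
assert (he : sp (w + RtoC d) = (RtoC (cos (PI * d)) * sp w + (0, - sin (PI * d))%R * cp w)%C).
{ unfold sp, cp. replace (- Chpi * (w + RtoC d))%C with (- Chpi * w + - Chpi * RtoC d)%C by ring.
  replace (Chpi * (w + RtoC d))%C with (Chpi * w + Chpi * RtoC d)%C by ring. rewrite !cexp_add.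
  assert (e1 : cexp (- Chpi * RtoC d) = (RtoC (cos (PI * d)) + (0, - sin (PI * d))%R)%C).
  { unfold cexp, Chpi, RtoC, Cplus; simpl. replace ((-0) * d - - PI * 0) with 0 by ring.
    replace ((-0) * 0 + - PI * d) with (- (PI * d)) by ring. rewrite exp_0, cos_neg, sin_neg. f_equal; ring. }
  assert (e2 : cexp (Chpi * RtoC d) = (RtoC (cos (PI * d)) - (0, - sin (PI * d))%R)%C).
  { unfold cexp, Chpi, RtoC, Cminus, Cplus, Copp; simpl. replace (0 * d - PI * 0) with 0 by ring.
    replace (0 * 0 + PI * d) with (PI * d) by ring. rewrite exp_0. f_equal; ring. }
  rewrite e1, e2. ring. }
rewrite he. pose proof PI_RGT_0.
assert (hs : 0 <= Cmod (sp w)) by apply Cmod_ge_0.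
assert (hcp : Cmod (cp w) * PI <= kap t * Cmod (sp w)).
{ pose proof (kap_den t ht). pose proof (sp_lower w) as h1. pose proof (cp_upper w) as h2. rewrite hw in h1, h2.
  pose proof (kap_pos t ht).
  assert (hk : kap t * (exp (PI * t) - exp (- (PI * t))) = PI * (exp (PI * t) + exp (- (PI * t)))) by (unfold kap; field; lra).
  assert (kap t * (exp (PI * t) - exp (- (PI * t))) <= kap t * Cmod (sp w)) by (apply Rmult_le_compat_l; lra).
  nra. }
eapply Rle_trans; [apply Cmod_triangle|]. rewrite !Cmod_mult, Cmod_R.
assert (hc : Rabs (cos (PI * d)) <= 1) by (apply Rabs_le, COS_bound).
assert (hsn : Cmod ((0, - sin (PI * d)) : C) <= PI * Rabs d).
{ eapply Rle_trans; [apply Cmod_le_sum|]. simpl. rewrite Rabs_R0, Rabs_Ropp, Rplus_0_l.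
  pose proof (sin_lip (PI * d) 0) as h. rewrite sin_0, !Rminus_0_r in h. rewrite Rabs_mult, (Rabs_pos_eq PI) in h by lra. auto. }
assert (h1 : 1 + kap t * Rabs d <= exp (kap t * Rabs d)).
{ apply exp_ineq1_le. }
assert (Rabs (cos (PI * d)) * Cmod (sp w) <= 1 * Cmod (sp w)) by (apply Rmult_le_compat_r; auto).
assert (Cmod ((0, - sin (PI * d)) : C) * Cmod (cp w) <= PI * Rabs d * Cmod (cp w)) by (apply Rmult_le_compat_r; [apply Cmod_ge_0|auto]).
pose proof (Rabs_pos d).
assert (PI * Rabs d * Cmod (cp w) <= kap t * Rabs d * Cmod (sp w)).
{ replace (PI * Rabs d * Cmod (cp w)) with (Rabs d * (Cmod (cp w) * PI)) by ring.
  replace (kap t * Rabs d * Cmod (sp w)) with (Rabs d * (kap t * Cmod (sp w))) by ring.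
  apply Rmult_le_compat_l; auto. }
assert ((1 + kap t * Rabs d) * Cmod (sp w) <= exp (kap t * Rabs d) * Cmod (sp w)) by (apply Rmult_le_compat_r; auto).
lra.
Qed.

Lemma spP_perturb (f g : nat -> R) (s : list nat) (E t : R) z : 0 < t -> Rabs (snd z) = t ->
  (forall k, In k s -> Rabs (f k - g k) <= E) ->
  Cmod (spP (map f s) z) <= exp (INR (length s) * (kap t * E)) * Cmod (spP (map g s) z).
Proof.
intros ht hz. induction s as [|k s IH]; intro h.
- simpl. rewrite Rmult_0_l, exp_0. lra.
- simpl map. change (spP (?a :: ?l) z) with (sp (z - RtoC a) * spP l z)%C. rewrite !Cmod_mult.
  replace (length (k :: s)) with (S (length s)) by reflexivity. rewrite S_INR, Rmult_plus_distr_r, exp_plus, Rmult_1_l.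
  assert (h1 : Cmod (sp (z - RtoC (f k))) <= exp (kap t * E) * Cmod (sp (z - RtoC (g k)))).
  { replace (z - RtoC (f k))%C with ((z - RtoC (g k)) + RtoC (g k - f k))%C by (rewrite RtoC_minus; ring).
    eapply Rle_trans; [apply (sp_perturb _ _ t ht)|].
    - rewrite snd_minus. simpl. rewrite Rminus_0_r. auto.
    - apply Rmult_le_compat_r; [apply Cmod_ge_0|].
      assert (hle : kap t * Rabs (g k - f k) <= kap t * E).
      { apply Rmult_le_compat_l; [apply Rlt_le, kap_pos; auto|]. rewrite Rabs_minus_sym. apply h; simpl; auto. }
      destruct hle as [hle|hle]; [left; apply exp_increasing; auto|right; f_equal; auto]. }
  assert (h2 := IH ltac:(intros; apply h; simpl; auto)).
  eapply Rle_trans; [apply Rmult_le_compat; [apply Cmod_ge_0|apply Cmod_ge_0|exact h1|exact h2]|]. right; ring.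
Qed.

(** Each of the [q] zeros is moved by at most [D / q], so the modulus changes by a factor between
    [exp (- kap t D)] and [exp (kap t D)], uniformly in [q]. This is why a distance [O(1/q)] to a
    lattice is good enough. *)
Lemma spP_near_lattice (f : nat -> R) x0 p q D z t : Nat.gcd p q = 1%nat -> (0 < q)%nat ->
  0 < t -> Rabs (snd z) = t ->
  (forall k, (k < q)%nat -> Rabs (f k - (x0 + INR k * INR p / INR q)) <= D / INR q) ->
  exp (- (kap t * D)) * (exp (INR q * (PI * t)) * (1 - exp (- (2 * PI * t)))) <=
  Cmod (spP (map f (seq 0 q)) z) <= exp (kap t * D) * (2 * exp (INR q * (PI * t))).
Proof.
intros hg hq ht hz hf. assert (hqR : 0 < INR q) by (apply lt_0_INR; lia).
destruct (lattice_bounds x0 p q z hg hq) as (b1 & b2). rewrite hz in b1, b2. unfold lattice in *.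
set (g := fun k => x0 + INR k * INR p / INR q) in *.
assert (he : INR (length (seq 0 q)) * (kap t * (D / INR q)) = kap t * D) by (rewrite length_seq; field; lra).
assert (h1 := spP_perturb f g (seq 0 q) (D / INR q) t z ht hz).
assert (h2 := spP_perturb g f (seq 0 q) (D / INR q) t z ht hz).
rewrite he in h1, h2.
lapply h1; [clear h1; intro h1|]. 2:{ intros k hk; apply in_seq in hk. apply hf; lia. }
lapply h2; [clear h2; intro h2|]. 2:{ intros k hk; apply in_seq in hk. rewrite Rabs_minus_sym. apply hf; lia. }
pose proof (exp_pos (kap t * D)). pose proof (exp_pos (- (kap t * D))).
split.
- apply Rmult_le_reg_l with (exp (kap t * D)); auto.
  rewrite <- Rmult_assoc, <- exp_plus. replace (kap t * D + - (kap t * D)) with 0 by ring. rewrite exp_0. lra.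
- eapply Rle_trans; [exact h1|]. apply Rmult_le_compat_l; lra.
Qed.

(** Each of the two products of sines is of order [exp (PI q t)] at height [t] and [exp (PI q s)] at
    height [s]; the square of the ratio is the exponential gain. The comparison is made at a height
    [s > 0] because [kap s] blows up as [s] tends to 0; a last maximum principle reaches the real
    line. *)
Theorem interlaced_zeros_bound b t s u M D (f g : nat -> R) x0 y0 p q :
  0 < s < t -> t < b -> regular_off b u nil -> 0 <= M ->
  (forall z, Rabs (snd z) = t -> Cmod (u z) <= M) ->
  Nat.gcd p q = 1%nat -> (0 < q)%nat ->
  (forall k, (k < q)%nat -> Rabs (f k - (x0 + INR k * INR p / INR q)) <= D / INR q) ->
  (forall k, (k < q)%nat -> Rabs (g k - (y0 + INR k * INR p / INR q)) <= D / INR q) ->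
  (forall k, (k < q)%nat -> u (RtoC (f k)) = 0%C) ->
  (forall k, (k < q)%nat -> u (RtoC (g k)) = 0%C) ->
  (forall k l j, (k < q)%nat -> (l < q)%nat -> f k = f l + IZR j -> k = l) ->
  (forall k l j, (k < q)%nat -> (l < q)%nat -> g k = g l + IZR j -> k = l) ->
  (forall k l j, (k < q)%nat -> (l < q)%nat -> f k <> g l + IZR j) ->
  forall z, Rabs (snd z) <= s ->
  Cmod (u z) <= M * (4 * exp (2 * ((kap s + kap t) * D)) / (1 - exp (- (2 * PI * t))) ^ 2) *
                exp (- (2 * PI * (t - s) * INR q)).
Proof.
intros hst htb hu hM hMb hg hq hf hg' zf zg df dg dfg.
assert (hqR : 1 <= INR q) by (apply (le_INR 1); lia). pose proof PI_RGT_0 as hpi.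
set (xs := map f (seq 0 q) ++ map g (seq 0 q)).
assert (hin : forall x, In x xs -> exists k, (k < q)%nat /\ (x = f k \/ x = g k)).
{ intros x hx. apply in_app_or in hx. destruct hx as [hx|hx]; apply in_map_iff in hx; destruct hx as (k & <- & hk);
  apply in_seq in hk; exists k; split; auto; lia. }
assert (hnd : NoDup xs).
{ apply NoDup_app.
  - apply NoDup_map_NoDup_ForallPairs; [|apply seq_NoDup]. intros k l hk hl he. apply in_seq in hk. apply in_seq in hl.
    apply (df k l 0%Z); try lia. lra.
  - apply NoDup_map_NoDup_ForallPairs; [|apply seq_NoDup]. intros k l hk hl he. apply in_seq in hk. apply in_seq in hl.
    apply (dg k l 0%Z); try lia. lra.
  - intros x hx hx'. apply in_map_iff in hx. apply in_map_iff in hx'. destruct hx as (k & <- & hk).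
    destruct hx' as (l & hl & hl'). apply in_seq in hk. apply in_seq in hl'. apply (dfg k l 0%Z); try lia. lra. }
assert (hmod : forall x y k, In x xs -> In y xs -> x = y + IZR k -> x = y).
{ intros x y j hx hy he. destruct (hin x hx) as (k & hk & hk'). destruct (hin y hy) as (l & hl & hl').
  destruct hk' as [-> | ->]; destruct hl' as [-> | ->].
  - rewrite (df k l j); auto.
  - exfalso. apply (dfg k l j); auto.
  - exfalso. apply (dfg l k (- j)%Z); auto. rewrite opp_IZR. lra.
  - rewrite (dg k l j); auto. }
assert (hz0 : forall x, In x xs -> u (RtoC x) = 0%C).
{ intros x hx. destruct (hin x hx) as (k & hk & [-> | ->]); auto. }
set (c := 1 - exp (- (2 * PI * t))).
assert (hc : 0 < c).
{ unfold c. assert (exp (- (2 * PI * t)) < exp 0) by (apply exp_increasing; nra). rewrite exp_0 in H. lra. }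
(* [lo] bounds each product from below on [|Im z| = t], so the quotient of [u] by both is at most
   [M / lo^2] there. *)
set (lo := exp (- (kap t * D)) * (exp (INR q * (PI * t)) * c)).
assert (hlo : 0 < lo) by (unfold lo; repeat apply Rmult_lt_0_compat; auto using exp_pos).
set (B := M / (lo * lo)).
assert (hB0 : 0 <= B) by (apply Rdiv_le_0_compat; auto; apply Rmult_lt_0_compat; auto).
assert (hB : forall z, Rabs (snd z) = t -> Cmod (u z) <= B * Cmod (spP xs z)).
{ intros z hz. eapply Rle_trans; [apply hMb; auto|]. unfold xs. rewrite spP_app, Cmod_mult.
  destruct (spP_near_lattice f x0 p q D z t hg hq ltac:(lra) hz hf) as (q1 & _).
  destruct (spP_near_lattice g y0 p q D z t hg hq ltac:(lra) hz hg') as (q2 & _).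
  fold c lo in q1, q2.
  replace M with (B * (lo * lo)) at 1 by (unfold B; field; lra).
  apply Rmult_le_compat_l; auto. apply Rmult_le_compat; lra. }
assert (hb2 := many_zeros_bound b t u xs B ltac:(lra) hu hnd hmod hz0 hB).
set (hi := exp (kap s * D) * (2 * exp (INR q * (PI * s)))).
assert (hs2 : forall z, Rabs (snd z) = s -> Cmod (u z) <= B * (hi * hi)).
{ intros z hz. eapply Rle_trans; [apply hb2; lra|]. apply Rmult_le_compat_l; auto.
  unfold xs. rewrite spP_app, Cmod_mult.
  destruct (spP_near_lattice f x0 p q D z s hg hq ltac:(lra) hz hf) as (_ & q1).
  destruct (spP_near_lattice g y0 p q D z s hg hq ltac:(lra) hz hg') as (_ & q2).
  apply Rmult_le_compat; auto using Cmod_ge_0. }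
assert (hfin : B * (hi * hi) = M * (4 * exp (2 * ((kap s + kap t) * D)) / c ^ 2) * exp (- (2 * PI * (t - s) * INR q))).
{ replace (exp (2 * ((kap s + kap t) * D))) with (exp (kap s * D) * exp (kap s * D) * (exp (kap t * D) * exp (kap t * D)))
    by (rewrite <- !exp_plus; f_equal; ring).
  replace (exp (- (2 * PI * (t - s) * INR q))) with
    (exp (INR q * (PI * s)) * exp (INR q * (PI * s)) * (exp (- (INR q * (PI * t))) * exp (- (INR q * (PI * t)))))
    by (rewrite <- !exp_plus; f_equal; ring).
  unfold B, hi, lo. rewrite !exp_Ropp.
  pose proof (exp_pos (kap t * D)). pose proof (exp_pos (INR q * (PI * t))).
  field. repeat split; lra. }
rewrite <- hfin. intros z hz.
assert (hz' : - s <= snd z <= s) by (apply Rabs_le_between; auto).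
apply (strip_max u (- s) s); auto; try lra.
- intros w hw. apply hu. apply Rabs_def1; lra.
- intros w hw. eapply regular_off_tame; eauto. apply Rabs_def1; lra.
- intros w hw. apply hu. apply Rabs_def1; lra.
- intros w hw. apply hs2. destruct hw as [-> | ->]; [rewrite Rabs_Ropp|]; apply Rabs_pos_eq; lra.
Qed.

(** * Bounds for the complexified normal form *)

(** Compactness in one real variable, uniformly in a parameter: [near d t] says that [t] is in the
    neighbourhood of size [d] of some fixed place. In [bounded_box4] it is applied to the four
    coordinates in turn, those already treated ranging over their whole intervals. *)
Lemma tube (T : Type) (near : R -> T -> Prop) (f : R -> T -> R) (a b : R) :
  (forall d d' t, d <= d' -> near d t -> near d' t) -> a <= b ->
  (forall x, a <= x <= b -> exists d B, 0 < d /\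
     forall x' t, Rabs (x' - x) < d -> near d t -> f x' t <= B) ->
  exists d B, 0 < d /\ forall x t, a <= x <= b -> near d t -> f x t <= B.
Proof.
intros hm hab h.
apply (interval_induction (fun u v => exists d B, 0 < d /\ forall x t, u <= x <= v -> near d t -> f x t <= B) a b hab).
- intros u v w _ h1 h2 _ (d1 & B1 & hd1 & q1) (d2 & B2 & hd2 & q2).
  exists (Rmin d1 d2), (Rmax B1 B2). split; [apply Rmin_pos; auto|].
  intros x t hx ht. destruct (Rle_or_lt x v).
  + eapply Rle_trans; [|apply Rmax_l]. apply q1; [lra|]. eapply hm; [|exact ht]. apply Rmin_l.
  + eapply Rle_trans; [|apply Rmax_r]. apply q2; [lra|]. eapply hm; [|exact ht]. apply Rmin_r.
- intros x hx. destruct (h x hx) as (d & B & hd & q). exists d. split; auto.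
  intros u v h1 h2 h3 h4 h5 h6. exists d, B. split; auto.
  intros x' t hx' ht. apply q; auto. apply Rabs_def1; lra.
Qed.

Lemma bounded_box4 (f : R -> R -> R -> R -> R) a1 b1 a2 b2 a3 b3 a4 b4 :
  a1 <= b1 -> a2 <= b2 -> a3 <= b3 -> a4 <= b4 ->
  (forall x1 x2 x3 x4, a1 <= x1 <= b1 -> a2 <= x2 <= b2 -> a3 <= x3 <= b3 -> a4 <= x4 <= b4 ->
    exists d B, 0 < d /\ forall y1 y2 y3 y4, Rabs (y1 - x1) < d -> Rabs (y2 - x2) < d ->
      Rabs (y3 - x3) < d -> Rabs (y4 - x4) < d -> f y1 y2 y3 y4 <= B) ->
  exists B, forall x1 x2 x3 x4, a1 <= x1 <= b1 -> a2 <= x2 <= b2 -> a3 <= x3 <= b3 -> a4 <= x4 <= b4 ->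
    f x1 x2 x3 x4 <= B.
Proof.
intros h1 h2 h3 h4 h.
assert (s1 : forall x2 x3 x4, a2 <= x2 <= b2 -> a3 <= x3 <= b3 -> a4 <= x4 <= b4 ->
  exists d B, 0 < d /\ forall y1 y2 y3 y4, a1 <= y1 <= b1 -> Rabs (y2 - x2) < d ->
      Rabs (y3 - x3) < d -> Rabs (y4 - x4) < d -> f y1 y2 y3 y4 <= B).
{ intros x2 x3 x4 k2 k3 k4.
  destruct (tube (R * R * R) (fun d t => Rabs (fst (fst t) - x2) < d /\ Rabs (snd (fst t) - x3) < d /\ Rabs (snd t - x4) < d)
    (fun y t => f y (fst (fst t)) (snd (fst t)) (snd t)) a1 b1) as (d & B & hd & q); auto.
  { intros; lra. }
  { intros x1 k1. destruct (h x1 x2 x3 x4) as (d & B & hd & q); auto. exists d, B; split; auto.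
    intros y ((y2, y3), y4) ky (e2 & e3 & e4); simpl in *. auto. }
  exists d, B; split; auto. intros y1 y2 y3 y4 e1 e2 e3 e4. apply (q y1 (y2, y3, y4)); simpl; auto. }
assert (s2 : forall x3 x4, a3 <= x3 <= b3 -> a4 <= x4 <= b4 ->
  exists d B, 0 < d /\ forall y1 y2 y3 y4, a1 <= y1 <= b1 -> a2 <= y2 <= b2 ->
      Rabs (y3 - x3) < d -> Rabs (y4 - x4) < d -> f y1 y2 y3 y4 <= B).
{ intros x3 x4 k3 k4.
  destruct (tube (R * R * R) (fun d t => a1 <= fst (fst t) <= b1 /\ Rabs (snd (fst t) - x3) < d /\ Rabs (snd t - x4) < d)
    (fun y t => f (fst (fst t)) y (snd (fst t)) (snd t)) a2 b2) as (d & B & hd & q); auto.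
  { intros; lra. }
  { intros x2 k2. destruct (s1 x2 x3 x4) as (d & B & hd & q); auto. exists d, B; split; auto.
    intros y ((y2, y3), y4) ky (e2 & e3 & e4); simpl in *. auto. }
  exists d, B; split; auto. intros y1 y2 y3 y4 e1 e2 e3 e4. apply (q y2 (y1, y3, y4)); simpl; auto. }
assert (s3 : forall x4, a4 <= x4 <= b4 ->
  exists d B, 0 < d /\ forall y1 y2 y3 y4, a1 <= y1 <= b1 -> a2 <= y2 <= b2 ->
      a3 <= y3 <= b3 -> Rabs (y4 - x4) < d -> f y1 y2 y3 y4 <= B).
{ intros x4 k4.
  destruct (tube (R * R * R) (fun d t => a1 <= fst (fst t) <= b1 /\ a2 <= snd (fst t) <= b2 /\ Rabs (snd t - x4) < d)
    (fun y t => f (fst (fst t)) (snd (fst t)) y (snd t)) a3 b3) as (d & B & hd & q); auto.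
  { intros; lra. }
  { intros x3 k3. destruct (s2 x3 x4) as (d & B & hd & q); auto. exists d, B; split; auto.
    intros y ((y2, y3), y4) ky (e2 & e3 & e4); simpl in *. auto. }
  exists d, B; split; auto. intros y1 y2 y3 y4 e1 e2 e3 e4. apply (q y3 (y1, y2, y4)); simpl; auto. }
destruct (tube (R * R * R) (fun d t => a1 <= fst (fst t) <= b1 /\ a2 <= snd (fst t) <= b2 /\ a3 <= snd t <= b3)
  (fun y t => f (fst (fst t)) (snd (fst t)) (snd t) y) a4 b4) as (d & B & hd & q); auto.
{ intros x4 k4. destruct (s3 x4) as (d & B & hd & q); auto. exists d, B; split; auto.
  intros y ((y2, y3), y4) ky (e2 & e3 & e4); simpl in *. auto. }
exists B. intros y1 y2 y3 y4 e1 e2 e3 e4. apply (q y4 (y1, y2, y3)); simpl; auto.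
Qed.

(** * Differentiability in two complex variables *)

Definition cdiff2 (g : C * C -> C) (p : C * C) (l m : C) : Prop :=
  forall e, 0 < e -> exists d, 0 < d /\ forall p',
    Cmod (fst p' - fst p)%C < d -> Cmod (snd p' - snd p)%C < d ->
    Cmod (g p' - g p - l * (fst p' - fst p) - m * (snd p' - snd p))%C <=
      e * (Cmod (fst p' - fst p)%C + Cmod (snd p' - snd p)%C).

Definition diff2 g p := exists l m, cdiff2 g p l m.

(** The differential is linear over the complex numbers, hence given by its values [L1] and [L2] at
    the two unit vectors, whose components are the partial derivatives. The rest compares product
    norms with sums of moduli. *)
Lemma holomorphic_at_diff2 (G : C * C -> C * C) p : holomorphic_at G p ->
  diff2 (fun x => fst (G x)) p /\ diff2 (fun x => snd (G x)) p.
Proof.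
intros (l & hl & hd).
specialize (hd p (fun P h => h)).
set (L1 := l (RtoC 1, RtoC 0)). set (L2 := l (RtoC 0, RtoC 1)).
assert (hlin : forall u v : C, fst (l (u, v)) = (u * fst L1 + v * fst L2)%C /\ snd (l (u, v)) = (u * snd L1 + v * snd L2)%C).
{ intros u v.
  assert (e : l (u, v) = plus (scal u L1) (scal v L2)).
  { unfold L1, L2. rewrite <- !(linear_scal l hl), <- (linear_plus l hl). f_equal.
    apply injective_projections.
    - change (u = (u * RtoC 1 + v * RtoC 0)%C). ring.
    - change (v = (u * RtoC 0 + v * RtoC 1)%C). ring. }
  rewrite e. split; reflexivity. }
assert (key : forall e, 0 < e -> exists d, 0 < d /\ forall p' : C * C,
    Cmod (fst p' - fst p)%C < d -> Cmod (snd p' - snd p)%C < d ->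
    Cmod (fst (G p') - fst (G p) - fst L1 * (fst p' - fst p) - fst L2 * (snd p' - snd p))%C <=
      e * (Cmod (fst p' - fst p)%C + Cmod (snd p' - snd p)%C) /\
    Cmod (snd (G p') - snd (G p) - snd L1 * (fst p' - fst p) - snd L2 * (snd p' - snd p))%C <=
      e * (Cmod (fst p' - fst p)%C + Cmod (snd p' - snd p)%C)).
{ intros e he. destruct (hd (mkposreal e he)) as ((d & hdp) & h). simpl in h.
  exists (d / 2). split; [lra|]. intros p' h1 h2.
  assert (hb : ball p d p').
  { split; simpl.
    - split; simpl; unfold AbsRing_ball; simpl; unfold abs, minus, plus, opp; simpl.
      + eapply Rle_lt_trans; [|apply (Rlt_trans _ (d/2)); [exact h1|lra]]. apply (fst_le_Cmod (fst p' - fst p)%C).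
      + eapply Rle_lt_trans; [|apply (Rlt_trans _ (d/2)); [exact h1|lra]]. apply (snd_le_Cmod (fst p' - fst p)%C).
    - split; simpl; unfold AbsRing_ball; simpl; unfold abs, minus, plus, opp; simpl.
      + eapply Rle_lt_trans; [|apply (Rlt_trans _ (d/2)); [exact h2|lra]]. apply (fst_le_Cmod (snd p' - snd p)%C).
      + eapply Rle_lt_trans; [|apply (Rlt_trans _ (d/2)); [exact h2|lra]]. apply (snd_le_Cmod (snd p' - snd p)%C). }
  specialize (h p' hb).
  set (D := minus (minus (G p') (G p)) (l (minus p' p))) in h.
  assert (hn : forall z : C * C, Cmod (fst z) <= prod_norm z /\ Cmod (snd z) <= prod_norm z).
  { intros z. change (prod_norm z) with (sqrt (Cmod (fst z) ^ 2 + Cmod (snd z) ^ 2)). pose proof (Cmod_ge_0 (fst z)). pose proof (Cmod_ge_0 (snd z)).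
    split; (rewrite <- (sqrt_pow2 (Cmod _)) at 1 by apply Cmod_ge_0); apply sqrt_le_1_alt; nra. }
  assert (hn2 : prod_norm (minus p' p) <= Cmod (fst p' - fst p)%C + Cmod (snd p' - snd p)%C).
  { change (prod_norm (minus p' p)) with (sqrt (Cmod (fst p' - fst p)%C ^ 2 + Cmod (snd p' - snd p)%C ^ 2)).
    pose proof (Cmod_ge_0 (fst p' - fst p)%C). pose proof (Cmod_ge_0 (snd p' - snd p)%C).
    rewrite <- (sqrt_pow2 (Cmod (fst p' - fst p)%C + Cmod (snd p' - snd p)%C)) by lra.
    apply sqrt_le_1_alt. nra. }
  destruct (hlin (fst p' - fst p)%C (snd p' - snd p)%C) as (e1 & e2).
  assert (eD1 : @eq C (fst D) (fst (G p') - fst (G p) - fst L1 * (fst p' - fst p) - fst L2 * (snd p' - snd p))%C).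
  { unfold D. change (fst (minus (minus (G p') (G p)) (l (minus p' p)))) with
      ((fst (G p') - fst (G p)) - fst (l (minus p' p)))%C.
    change (minus p' p) with ((fst p' - fst p)%C, (snd p' - snd p)%C). rewrite e1. ring. }
  assert (eD2 : @eq C (snd D) (snd (G p') - snd (G p) - snd L1 * (fst p' - fst p) - snd L2 * (snd p' - snd p))%C).
  { unfold D. change (snd (minus (minus (G p') (G p)) (l (minus p' p)))) with
      ((snd (G p') - snd (G p)) - snd (l (minus p' p)))%C.
    change (minus p' p) with ((fst p' - fst p)%C, (snd p' - snd p)%C). rewrite e2. ring. }
  rewrite <- eD1, <- eD2. destruct (hn D) as (g1 & g2).
  assert (e * prod_norm (minus p' p) <= e * (Cmod (fst p' - fst p)%C + Cmod (snd p' - snd p)%C)) by (apply Rmult_le_compat_l; lra).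
  split; (eapply Rle_trans; [eassumption|]; eapply Rle_trans; [exact h|exact H]). }
split.
- exists (fst L1), (fst L2). intros e he. destruct (key e he) as (d & hd0 & h). exists d; split; auto.
  intros p' h1 h2. apply (h p' h1 h2).
- exists (snd L1), (snd L2). intros e he. destruct (key e he) as (d & hd0 & h). exists d; split; auto.
  intros p' h1 h2. apply (h p' h1 h2).
Qed.

Lemma cdiff2_lip g p l m : cdiff2 g p l m -> exists d K, 0 < d /\ 0 < K /\ forall p',
  Cmod (fst p' - fst p)%C < d -> Cmod (snd p' - snd p)%C < d ->
  Cmod (g p' - g p)%C <= K * (Cmod (fst p' - fst p)%C + Cmod (snd p' - snd p)%C).
Proof.
intros h. destruct (h 1 Rlt_0_1) as (d & hd & hh).
pose proof (Cmod_ge_0 l). pose proof (Cmod_ge_0 m).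
exists d, (Cmod l + Cmod m + 1). split; auto. split; [lra|].
intros p' h1 h2. specialize (hh p' h1 h2).
set (D1 := (fst p' - fst p)%C) in *. set (D2 := (snd p' - snd p)%C) in *.
replace (g p' - g p)%C with ((g p' - g p - l * D1 - m * D2) + (l * D1 + m * D2))%C by ring.
eapply Rle_trans; [apply Cmod_triangle|].
eapply Rle_trans; [apply Rplus_le_compat_l, Cmod_triangle|]. rewrite !Cmod_mult.
pose proof (Cmod_ge_0 D1). pose proof (Cmod_ge_0 D2). nra.
Qed.

Lemma cdiff2_comp_path g (X Y : C -> C) z l m l' m' : cdiff2 g (X z, Y z) l m ->
  cdiff X z l' -> cdiff Y z m' -> cdiff (fun w => g (X w, Y w)) z (l * l' + m * m')%C.
Proof.
intros hg hX hY e he.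
destruct (cdiff_lip _ _ _ hX) as (d1 & hd1 & h1). destruct (cdiff_lip _ _ _ hY) as (d2 & hd2 & h2).
pose proof (Cmod_ge_0 l). pose proof (Cmod_ge_0 m). pose proof (Cmod_ge_0 l'). pose proof (Cmod_ge_0 m').
set (K := Cmod l + Cmod m + Cmod l' + Cmod m' + 2).
set (e1 := e / (2 * K)). assert (he1 : 0 < e1) by (apply Rdiv_lt_0_compat; unfold K; lra).
destruct (hg e1 he1) as (d3 & hd3 & h3).
destruct (cdiff_ccont _ _ _ hX d3 hd3) as (d4 & hd4 & h4). destruct (cdiff_ccont _ _ _ hY d3 hd3) as (d5 & hd5 & h5).
destruct (hX e1 he1) as (d6 & hd6 & h6). destruct (hY e1 he1) as (d7 & hd7 & h7).
exists (Rmin (Rmin d1 d2) (Rmin (Rmin d4 d5) (Rmin d6 d7))). split; [repeat apply Rmin_pos; auto|].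
intros w hw.
assert (b1 := Rlt_le_trans _ _ _ hw (Rmin_l _ _)). assert (b2 := Rlt_le_trans _ _ _ hw (Rmin_r _ _)).
assert (b3 := Rlt_le_trans _ _ _ b2 (Rmin_l _ _)). assert (b4 := Rlt_le_trans _ _ _ b2 (Rmin_r _ _)).
specialize (h1 w (Rlt_le_trans _ _ _ b1 (Rmin_l _ _))). specialize (h2 w (Rlt_le_trans _ _ _ b1 (Rmin_r _ _))).
specialize (h4 w (Rlt_le_trans _ _ _ b3 (Rmin_l _ _))). specialize (h5 w (Rlt_le_trans _ _ _ b3 (Rmin_r _ _))).
specialize (h6 w (Rlt_le_trans _ _ _ b4 (Rmin_l _ _))). specialize (h7 w (Rlt_le_trans _ _ _ b4 (Rmin_r _ _))).
specialize (h3 (X w, Y w) h4 h5). simpl in h3.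
replace (g (X w, Y w) - g (X z, Y z) - (l * l' + m * m') * (w - z))%C with
  ((g (X w, Y w) - g (X z, Y z) - l * (X w - X z) - m * (Y w - Y z)) +
   (l * (X w - X z - l' * (w - z)) + m * (Y w - Y z - m' * (w - z))))%C by ring.
eapply Rle_trans; [apply Cmod_triangle|].
eapply Rle_trans; [apply Rplus_le_compat_l, Cmod_triangle|]. rewrite !Cmod_mult.
set (t := Cmod (w - z)%C) in *. assert (ht : 0 <= t) by apply Cmod_ge_0.
assert (he' : e = 2 * K * e1) by (unfold e1; field; unfold K; lra).
assert (q1 : Cmod l * Cmod (X w - X z - l' * (w - z))%C <= Cmod l * (e1 * t)) by (apply Rmult_le_compat_l; auto).
assert (q2 : Cmod m * Cmod (Y w - Y z - m' * (w - z))%C <= Cmod m * (e1 * t)) by (apply Rmult_le_compat_l; auto).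
assert (q3 : e1 * (Cmod (X w - X z)%C + Cmod (Y w - Y z)%C) <= e1 * ((Cmod l' + 1) * t + (Cmod m' + 1) * t)) by (apply Rmult_le_compat_l; lra).
assert (0 <= e1 * t) by (apply Rmult_le_pos; lra).
rewrite he'. unfold K. nra.
Qed.

Lemma diff2_comp_path g (X Y : C -> C) z : diff2 g (X z, Y z) -> holo X z -> holo Y z ->
  holo (fun w => g (X w, Y w)) z.
Proof. intros (l & m & h) (l' & h1) (m' & h2). eexists. eapply cdiff2_comp_path; eauto. Qed.

Lemma cdiff2_comp g X Y p l m l1 m1 l2 m2 : cdiff2 g (X p, Y p) l m ->
  cdiff2 X p l1 m1 -> cdiff2 Y p l2 m2 ->
  cdiff2 (fun w => g (X w, Y w)) p (l * l1 + m * l2)%C (l * m1 + m * m2)%C.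
Proof.
intros hg hX hY e he.
destruct (cdiff2_lip _ _ _ _ hX) as (d1 & K1 & hd1 & hK1 & h1). destruct (cdiff2_lip _ _ _ _ hY) as (d2 & K2 & hd2 & hK2 & h2).
pose proof (Cmod_ge_0 l). pose proof (Cmod_ge_0 m).
set (K := Cmod l + Cmod m + K1 + K2 + 1).
set (e1 := e / K). assert (he1 : 0 < e1) by (apply Rdiv_lt_0_compat; unfold K; lra).
destruct (hg e1 he1) as (d3 & hd3 & h3).
destruct (hX e1 he1) as (d6 & hd6 & h6). destruct (hY e1 he1) as (d7 & hd7 & h7).
set (d4 := d3 / (2 * (K1 + K2))). assert (hd4 : 0 < d4) by (apply Rdiv_lt_0_compat; lra).
exists (Rmin (Rmin d1 d2) (Rmin d4 (Rmin d6 d7))). split; [repeat apply Rmin_pos; auto|].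
intros p' hp1 hp2.
assert (b1 := Rlt_le_trans _ _ _ hp1 (Rmin_l _ _)). assert (b2 := Rlt_le_trans _ _ _ hp1 (Rmin_r _ _)).
assert (b3 := Rlt_le_trans _ _ _ b2 (Rmin_l _ _)). assert (b4 := Rlt_le_trans _ _ _ b2 (Rmin_r _ _)).
assert (c1 := Rlt_le_trans _ _ _ hp2 (Rmin_l _ _)). assert (c2 := Rlt_le_trans _ _ _ hp2 (Rmin_r _ _)).
assert (c3 := Rlt_le_trans _ _ _ c2 (Rmin_l _ _)). assert (c4 := Rlt_le_trans _ _ _ c2 (Rmin_r _ _)).
specialize (h1 p' (Rlt_le_trans _ _ _ b1 (Rmin_l _ _)) (Rlt_le_trans _ _ _ c1 (Rmin_l _ _))).
specialize (h2 p' (Rlt_le_trans _ _ _ b1 (Rmin_r _ _)) (Rlt_le_trans _ _ _ c1 (Rmin_r _ _))).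
specialize (h6 p' (Rlt_le_trans _ _ _ b4 (Rmin_l _ _)) (Rlt_le_trans _ _ _ c4 (Rmin_l _ _))).
specialize (h7 p' (Rlt_le_trans _ _ _ b4 (Rmin_r _ _)) (Rlt_le_trans _ _ _ c4 (Rmin_r _ _))).
set (D1 := (fst p' - fst p)%C) in *. set (D2 := (snd p' - snd p)%C) in *.
pose proof (Cmod_ge_0 D1). pose proof (Cmod_ge_0 D2).
set (t := Cmod D1 + Cmod D2) in *.
assert (ht : t * (K1 + K2) < d3).
{ assert (t < d3 / (K1 + K2)). { replace (d3 / (K1 + K2)) with (d4 + d4) by (unfold d4; field; lra). unfold t; lra. }
  apply Rmult_lt_compat_r with (r := K1 + K2) in H3; [|lra].
  replace (d3 / (K1 + K2) * (K1 + K2)) with d3 in H3 by (field; lra). lra. }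
assert (ht0 : 0 <= t) by (unfold t; lra).
specialize (h3 (X p', Y p')). simpl in h3. specialize (h3 ltac:(nra) ltac:(nra)).
replace (g (X p', Y p') - g (X p, Y p) - (l * l1 + m * l2) * D1 - (l * m1 + m * m2) * D2)%C with
  ((g (X p', Y p') - g (X p, Y p) - l * (X p' - X p) - m * (Y p' - Y p)) +
   (l * (X p' - X p - l1 * D1 - m1 * D2) + m * (Y p' - Y p - l2 * D1 - m2 * D2)))%C by ring.
eapply Rle_trans; [apply Cmod_triangle|].
eapply Rle_trans; [apply Rplus_le_compat_l, Cmod_triangle|]. rewrite !Cmod_mult.
assert (he' : e = K * e1) by (unfold e1; field; unfold K; lra).
assert (q1 : Cmod l * Cmod (X p' - X p - l1 * D1 - m1 * D2)%C <= Cmod l * (e1 * t)) by (apply Rmult_le_compat_l; auto).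
assert (q2 : Cmod m * Cmod (Y p' - Y p - l2 * D1 - m2 * D2)%C <= Cmod m * (e1 * t)) by (apply Rmult_le_compat_l; auto).
assert (q3 : e1 * (Cmod (X p' - X p)%C + Cmod (Y p' - Y p)%C) <= e1 * (K1 * t + K2 * t)) by (apply Rmult_le_compat_l; lra).
assert (0 <= e1 * t) by (apply Rmult_le_pos; lra).
rewrite he'. unfold K. nra.
Qed.

Lemma cdiff2_fst p : cdiff2 fst p 1%C 0%C.
Proof.
intros e he. exists 1. split; [lra|]. intros p' _ _.
replace (fst p' - fst p - 1 * (fst p' - fst p) - 0 * (snd p' - snd p))%C with (RtoC 0) by ring.
rewrite Cmod_0. pose proof (Cmod_ge_0 (fst p' - fst p)%C). pose proof (Cmod_ge_0 (snd p' - snd p)%C). nra.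
Qed.

Lemma cdiff2_snd p : cdiff2 snd p 0%C 1%C.
Proof.
intros e he. exists 1. split; [lra|]. intros p' _ _.
replace (snd p' - snd p - 0 * (fst p' - fst p) - 1 * (snd p' - snd p))%C with (RtoC 0) by ring.
rewrite Cmod_0. pose proof (Cmod_ge_0 (fst p' - fst p)%C). pose proof (Cmod_ge_0 (snd p' - snd p)%C). nra.
Qed.

(** The lower half of the strip is the upper half for [u (- z)]. *)
Lemma two_constants_sym u b b' M e c : 0 < b < b' ->
  (forall z, Rabs (snd z) < b' -> holo u z) ->
  (forall z, Rabs (snd z) < b' -> Cmod (u (z + 1)%C) = Cmod (u z)) ->
  (forall z, snd z = 0 -> Cmod (u z) <= e) -> (forall z, Rabs (snd z) = b -> Cmod (u z) <= M) ->
  forall z, Rabs (snd z) <= b -> Cmod (u z) <= exp (c * Rabs (snd z)) * Rmax e (M * exp (- (c * b))).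
Proof.
intros hb hu hp h0 h1 z hz.
assert (key : forall v : C -> C, (forall z, Rabs (snd z) < b' -> holo v z) ->
  (forall z, Rabs (snd z) < b' -> Cmod (v (z + 1)%C) = Cmod (v z)) ->
  (forall z, snd z = 0 -> Cmod (v z) <= e) -> (forall z, Rabs (snd z) = b -> Cmod (v z) <= M) ->
  forall z, 0 <= snd z <= b -> Cmod (v z) <= exp (c * snd z) * Rmax e (M * exp (- (c * b)))).
{ intros v k1 k2 k3 k4 w hw. apply two_constants; auto; try lra.
  - intros x hx. assert (hxb : Rabs (snd x) < b') by (apply Rabs_def1; lra).
    destruct (strip_nbhd b' x hxb) as (d & hd & h). apply (holo_tame v x d); auto.
  - intros x hx. apply k2. apply Rabs_def1; lra.
  - intros x hx. apply k4. rewrite hx. apply Rabs_pos_eq; lra. }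
destruct (Rle_or_lt 0 (snd z)) as [hs|hs].
- rewrite Rabs_pos_eq in * by lra. apply key; auto.
- rewrite Rabs_left in * by lra.
  assert (hn : forall w : C, snd (- w)%C = - snd w) by reflexivity.
  replace z with (- - z)%C at 1 by ring. rewrite <- hn.
  apply (key (fun w => u (- w)%C)).
  + intros w hw. apply (holo_comp u (fun w => - w)%C).
    * eexists; apply cdiff_opp, cdiff_id.
    * apply hu. rewrite hn, Rabs_Ropp. auto.
  + intros w hw. rewrite <- (hp (- (w + 1))%C).
    * f_equal. f_equal. ring.
    * simpl. rewrite Rplus_0_r, Rabs_Ropp. auto.
  + intros w hw. apply h0. rewrite hn. lra.
  + intros w hw. apply h1. rewrite hn, Rabs_Ropp. auto.
  + rewrite hn. lra.
Qed.

Lemma exp_small (K t e : R) : 0 <= K -> 0 < t -> 0 < e -> exists c, 0 < c /\ K * exp (- (c * t)) <= e.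
Proof.
intros hK ht he. exists ((K / e + 1) / t).
assert (0 <= K / e) by (apply Rdiv_le_0_compat; lra).
split; [apply Rdiv_lt_0_compat; lra|].
replace ((K / e + 1) / t * t) with (K / e + 1) by (field; lra). rewrite exp_Ropp.
pose proof (exp_ineq1_le (K / e + 1)).
apply Rmult_le_reg_r with (exp (K / e + 1)); [apply exp_pos|].
rewrite Rmult_assoc, Rinv_l by (pose proof (exp_pos (K / e + 1)); lra).
assert (e * (1 + (K / e + 1)) <= e * exp (K / e + 1)) by (apply Rmult_le_compat_l; lra).
replace (e * (1 + (K / e + 1))) with (K + 2 * e) in H1 by (field; lra). lra.
Qed.

(** The coefficient of [y^j] in [v x y] is bounded on a strip and small on the
    real line; by the two constants theorem it vanishes if [j < n]. *)
Lemma order_in_strip (v : C -> C -> C) a b n M d : 0 < b -> 0 < d ->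
  (forall x y : C, Rabs (snd x) < a -> Cmod y < b -> holo (fun x => v x y) x) ->
  (forall x y : C, Rabs (snd x) < a -> Cmod y < b -> holo (v x) y) ->
  (forall x y : C, Rabs (snd x) < a -> Cmod y < b -> v (x + 1)%C y = v x y) ->
  (forall a1, 0 < a1 < a -> exists b1 K, 0 < b1 <= b /\ 0 <= K /\
     forall x y : C, Rabs (snd x) <= a1 -> Cmod y < b1 -> Cmod (v x y) <= K) ->
  (forall x y : R, Rabs y < d -> Cmod (v (RtoC x) (RtoC y)) <= M * Rabs y ^ n) ->
  forall j, (j <= n)%nat -> forall a1, 0 < a1 < a -> exists b1 K, 0 < b1 <= b /\ 0 <= K /\
     forall x y : C, Rabs (snd x) <= a1 -> Cmod y < b1 -> Cmod (v x y) <= K * Cmod y ^ j.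
Proof.
intros hb hd hx hy hper hbd hreal. induction j; intros hj a1 ha1.
- destruct (hbd a1 ha1) as (b1 & K & q1 & q2 & q3). exists b1, K. repeat split; try apply q1; auto.
  intros; simpl. rewrite Rmult_1_r. auto.
- set (a2 := (a1 + a) / 2). assert (ha2 : a1 < a2 < a) by (unfold a2; lra).
  destruct (IHj ltac:(lia) a2 ltac:(lra)) as (b2 & K & hb2 & hK & hv).
  exists (b2 / 2), (8 * K / b2). split; [lra|].
  assert (hK' : 0 <= 8 * K / b2) by (apply Rdiv_le_0_compat; lra). split; auto.
  intros x y hxa hyb.
  destruct (factor_pow j (v x) b2 (K * b2 ^ j) K) as (k & k1 & k2 & k3); auto; try lra.
  { intros w hw. apply hy; lra. }
  { intros w hw. eapply Rle_trans; [apply hv; lra|]. apply Rmult_le_compat_l; auto.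
    apply pow_incr. split; [apply Cmod_ge_0|lra]. }
  { intros w hw. apply hv; lra. }
  assert (hm0 : Cmod 0%C < b2) by (rewrite Cmod_0; lra).
  assert (hk0 : k 0%C = 0%C).
  { apply Cmod_eq_0. apply Rle_antisym; [|apply Cmod_ge_0]. apply le_epsilon. intros e he.
    (* The order of the choices matters: [c] makes the contribution of the edges [|Im x| = a2]
       small, and only then is [s] taken small enough for the contribution of the real line, which
       carries the factor [exp (c a1)]. *)
    destruct (exp_small K (a2 - a1) (e/3) hK ltac:(lra) ltac:(lra)) as (c & hc & hce).
    destruct (holo_ccont _ _ (k1 0%C hm0) (e/3) ltac:(lra)) as (d1 & hd1 & hh).
    set (E := exp (c * a1) * (Rabs M + 1)). assert (hE : 0 < E).
    { apply Rmult_lt_0_compat; [apply exp_pos|pose proof (Rabs_pos M); lra]. }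
    set (s := Rmin (Rmin (d1/2) (b2/2)) (Rmin (d/2) (Rmin 1 (e / 3 / E)))).
    assert (hs : 0 < s). { repeat apply Rmin_pos; try lra. apply Rdiv_lt_0_compat; lra. }
    assert (s1 : s <= Rmin (d1/2) (b2/2)) by apply Rmin_l.
    assert (s2 : s <= Rmin (d/2) (Rmin 1 (e / 3 / E))) by apply Rmin_r.
    assert (s3 := Rle_trans _ _ _ s1 (Rmin_l _ _)). assert (s4 := Rle_trans _ _ _ s1 (Rmin_r _ _)).
    assert (s5 := Rle_trans _ _ _ s2 (Rmin_l _ _)). assert (s6 := Rle_trans _ _ _ s2 (Rmin_r _ _)).
    assert (s7 := Rle_trans _ _ _ s6 (Rmin_l _ _)). assert (s8 := Rle_trans _ _ _ s6 (Rmin_r _ _)).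
    clearbody s.
    assert (hms : Cmod (RtoC s) = s) by (rewrite Cmod_R, Rabs_pos_eq; lra).
    assert (hsj : 0 < s ^ j) by (apply pow_lt; auto).
    assert (hM : M * s ^ n <= (Rabs M * s) * s ^ j).
    { replace n with ((n - S j) + S j)%nat by lia. rewrite pow_add. simpl.
      assert (0 <= s ^ (n - S j) <= 1).
      { split; [apply pow_le; lra|]. rewrite <- (pow1 (n - S j)). apply pow_incr; lra. }
      pose proof (Rle_abs M). pose proof (Rabs_pos M).
      apply Rle_trans with (Rabs M * (s ^ (n - S j) * (s * s ^ j))).
      - apply Rmult_le_compat_r; auto. repeat apply Rmult_le_pos; try lra.
      - rewrite Rmult_assoc. apply Rmult_le_compat_l; auto.
        assert (0 <= s * s ^ j) by (apply Rmult_le_pos; lra). nra. }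
    assert (hq := two_constants_sym (fun z => v z (RtoC s)) a2 a (K * s ^ j) (Rabs M * s * s ^ j) c ltac:(lra)).
    assert (hq' : Cmod (v x (RtoC s)) <= exp (c * Rabs (snd x)) * Rmax (Rabs M * s * s ^ j) (K * s ^ j * exp (- (c * a2)))).
    { apply hq; try lra.
      - intros z hz. apply hx; lra.
      - intros z hz. f_equal. apply hper; lra.
      - intros z hz. destruct z as (zr, zi); simpl in hz; subst zi.
        eapply Rle_trans; [apply (hreal zr s)|]; rewrite Rabs_pos_eq; lra.
      - intros z hz. eapply Rle_trans; [apply hv; lra|]. rewrite hms. lra. }
    assert (hks : Cmod (k (RtoC s)) <= exp (c * a1) * (Rabs M * s) + K * exp (- (c * (a2 - a1)))).
    { rewrite k2, Cmod_mult, Cmod_pow, hms in hq' by lra.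
      apply Rmult_le_reg_l with (s ^ j); auto. eapply Rle_trans; [exact hq'|].
      assert (he1 : exp (c * Rabs (snd x)) <= exp (c * a1)).
      { assert (hle : c * Rabs (snd x) <= c * a1) by (apply Rmult_le_compat_l; lra).
        destruct hle as [hle|hle]; [left; apply exp_increasing; auto|right; f_equal; auto]. }
      assert (he2 : exp (- (c * (a2 - a1))) = exp (c * a1) * exp (- (c * a2))) by (rewrite <- exp_plus; f_equal; ring).
      rewrite he2. pose proof (exp_pos (c * a1)). pose proof (exp_pos (c * Rabs (snd x))). pose proof (exp_pos (- (c * a2))).
      pose proof (Rabs_pos M).
      assert (p1 : 0 <= Rabs M * s * s ^ j) by (repeat apply Rmult_le_pos; lra).
      assert (p2 : 0 <= K * s ^ j * exp (- (c * a2))) by (repeat apply Rmult_le_pos; lra).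
      assert (hmx : Rmax (Rabs M * s * s ^ j) (K * s ^ j * exp (- (c * a2))) <= Rabs M * s * s ^ j + K * s ^ j * exp (- (c * a2))).
      { apply Rmax_lub; lra. }
      eapply Rle_trans; [apply Rmult_le_compat; [lra| |exact he1|exact hmx]|].
      - eapply Rle_trans; [exact p1|apply Rmax_l].
      - right; ring. }
    assert (hs9 : exp (c * a1) * (Rabs M * s) <= e / 3).
    { assert (E * s <= e / 3). { apply Rmult_le_compat_l with (r := E) in s8; [|lra]. replace (E * (e / 3 / E)) with (e / 3) in s8 by (field; lra). lra. }
      unfold E in H. pose proof (exp_pos (c * a1)). assert (0 <= exp (c * a1) * s) by (apply Rmult_le_pos; lra). nra. }
    specialize (hh (RtoC s)). replace (RtoC s - 0)%C with (RtoC s) in hh by ring. rewrite hms in hh. specialize (hh ltac:(lra)).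
    pose proof (Cmod_le_minus (k 0%C) (k (RtoC s))) as ht. rewrite Cmod_minus_sym in ht. lra. }
  assert (hky : Cmod (k y) <= 8 * K / b2 * Cmod y).
  { replace (k y) with (k y - k 0)%C by (rewrite hk0; ring). replace (Cmod y) with (Cmod (y - 0)%C) by (f_equal; ring).
    apply lip_segment. intros t ht. replace (0 + RtoC t * (y - 0))%C with (RtoC t * y)%C by ring.
    assert (hty : Cmod (RtoC t * y)%C < b2 / 2).
    { rewrite Cmod_mult, Cmod_R, Rabs_pos_eq by lra. pose proof (Cmod_ge_0 y). nra. }
    assert (hnear : forall w, Cmod (w - RtoC t * y)%C < b2 / 2 -> Cmod w < b2).
    { intros w hw. pose proof (Cmod_le_minus w (RtoC t * y)%C). lra. }
    exists (der k (RtoC t * y)%C). split; [apply der_spec, k1; lra|].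
    replace (8 * K / b2) with (4 * K / (b2 / 2)) by (field; lra).
    apply (cauchy_deriv k (RtoC t * y)%C); try lra.
    - intros w hw; apply k1; auto.
    - intros w hw; apply k3; auto.
    - apply der_spec, k1; lra. }
  rewrite k2 by lra. rewrite Cmod_mult, Cmod_pow. simpl.
  assert (0 <= Cmod y ^ j) by (apply pow_le, Cmod_ge_0). nra.
Qed.

(** What is kept of the complexified map. The expansion [nm_form] is stated at real points;
    [normal_map_bounds] extends it to narrower strips. *)
Record normal_map (G : C * C -> C * C) (a b : R) : Prop := {
  nm_a : 0 < a;
  nm_b : 0 < b;
  nm_diff : forall p, Rabs (snd (fst p)) < a -> Cmod (snd p) < b ->
    diff2 (fun x => fst (G x)) p /\ diff2 (fun x => snd (G x)) p;
  nm_per : forall x y : C, Rabs (snd x) < a -> Cmod y < b ->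
    G ((x + 1)%C, y) = ((fst (G (x, y)) + 1)%C, snd (G (x, y)));
  nm_real : forall x y : R, Rabs y < b ->
    snd (fst (G (RtoC x, RtoC y))) = 0 /\ snd (snd (G (RtoC x, RtoC y))) = 0;
  nm_form : exists M d, 0 < d /\ forall x y : R, Rabs y < d ->
    Cmod (fst (G (RtoC x, RtoC y)) - RtoC x - RtoC y)%C <= M * Rabs y ^ 2 /\
    Cmod (snd (G (RtoC x, RtoC y)) - RtoC y)%C <= M * Rabs y ^ 3
}.

Lemma diff2_fst p : diff2 fst p. Proof. exists 1%C, 0%C. apply cdiff2_fst. Qed.
Lemma diff2_snd p : diff2 snd p. Proof. exists 0%C, 1%C. apply cdiff2_snd. Qed.

(** By periodicity one period of the strip is enough, and it is compact. For [y], the square of half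
    side [b / 4] contains the disk of radius [b / 4] and lies in that of radius [b]. *)
Lemma bounded_on_strip (g : C * C -> C) a b a1 : 0 < b -> 0 < a1 < a ->
  (forall p, Rabs (snd (fst p)) < a -> Cmod (snd p) < b -> diff2 g p) ->
  (forall x y : C, Rabs (snd x) < a -> Cmod y < b -> g ((x + 1)%C, y) = g (x, y)) ->
  exists b1 K, 0 < b1 <= b /\ 0 <= K /\
     forall x y : C, Rabs (snd x) <= a1 -> Cmod y < b1 -> Cmod (g (x, y)) <= K.
Proof.
intros hb ha1 hg hp.
destruct (bounded_box4 (fun x1 x2 y1 y2 => Cmod (g ((x1, x2), (y1, y2)))) 0 1 (- a1) a1 (- (b/4)) (b/4) (- (b/4)) (b/4)) as (B & hB); try lra.
{ intros x1 x2 y1 y2 h1 h2 h3 h4.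
  assert (hy : Cmod (y1, y2) < b).
  { eapply Rle_lt_trans; [apply Cmod_le_sum|]. simpl.
    assert (Rabs y1 <= b/4) by (apply Rabs_le; lra). assert (Rabs y2 <= b/4) by (apply Rabs_le; lra). lra. }
  destruct (hg ((x1, x2), (y1, y2))) as (l & m & h); simpl; auto. { apply Rabs_def1; lra. }
  destruct (cdiff2_lip _ _ _ _ h) as (d & K & hd & hK & hl). simpl in hl.
  exists (d / 2), (Cmod (g ((x1, x2), (y1, y2))) + K * (2 * d)). split; [lra|].
  intros x1' x2' y1' y2' k1 k2 k3 k4.
  assert (m1 : Cmod ((x1', x2') - (x1, x2))%C < d).
  { eapply Rle_lt_trans; [apply Cmod_le_sum|]. rewrite fst_minus, snd_minus; simpl. lra. }
  assert (m2 : Cmod ((y1', y2') - (y1, y2))%C < d).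
  { eapply Rle_lt_trans; [apply Cmod_le_sum|]. rewrite fst_minus, snd_minus; simpl. lra. }
  specialize (hl ((x1', x2'), (y1', y2')) m1 m2). simpl in hl.
  pose proof (Cmod_le_minus (g ((x1', x2'), (y1', y2'))) (g ((x1, x2), (y1, y2)))).
  assert (K * (Cmod ((x1', x2') - (x1, x2))%C + Cmod ((y1', y2') - (y1, y2))%C) <= K * (2 * d)) by (apply Rmult_le_compat_l; lra).
  unfold C in *. lra. }
exists (b / 4), (Rmax B 0). split; [lra|]. split; [apply Rmax_r|].
intros x y hx hy. destruct (exists_frac (fst x)) as (n & hn).
assert (hper : Cmod (g (x, y)) = Cmod (g ((x + RtoC (IZR n))%C, y))).
{ symmetry. apply (Cmod_periodic_Z (fun x => g (x, y)) x n (fun s => Rabs s < a)); [lra|].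
  intros w hw. f_equal. apply hp; lra. }
rewrite hper. eapply Rle_trans; [|apply Rmax_l].
destruct x as (x1, x2), y as (y1, y2). simpl in *.
pose proof (fst_le_Cmod (y1, y2)) as f1. pose proof (snd_le_Cmod (y1, y2)) as f2. simpl in f1, f2.
apply Rabs_le_between in hx.
assert (g1 : - (b/4) <= y1 <= b/4) by (apply Rabs_le_between; lra).
assert (g2 : - (b/4) <= y2 <= b/4) by (apply Rabs_le_between; lra).
apply (hB (x1 + IZR n) (x2 + 0) y1 y2); lra.
Qed.

Lemma normal_map_bounds G a b a1 : normal_map G a b -> 0 < a1 < a ->
  exists b1 M, 0 < b1 <= b /\ 0 <= M /\ forall x y : C, Rabs (snd x) <= a1 -> Cmod y < b1 ->
    Cmod (fst (G (x, y)) - x - y)%C <= M * Cmod y ^ 2 /\ Cmod (snd (G (x, y)) - y)%C <= M * Cmod y ^ 3.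
Proof.
intros [ha hb hdiff hper hreal (M & d & hd & hform)] ha1.
set (v1 := fun x y => (fst (G (x, y)) - x - y)%C). set (v2 := fun x y => (snd (G (x, y)) - y)%C).
assert (D1 : forall p, Rabs (snd (fst p)) < a -> Cmod (snd p) < b -> diff2 (fun p => fst (G p)) p) by (intros; apply hdiff; auto).
assert (D2 : forall p, Rabs (snd (fst p)) < a -> Cmod (snd p) < b -> diff2 (fun p => snd (G p)) p) by (intros; apply hdiff; auto).
assert (hsh : forall w : C, snd (w + 1)%C = snd w) by (intro w; simpl; ring).
assert (E1 : exists b1 K, 0 < b1 <= b /\ 0 <= K /\ forall x y : C, Rabs (snd x) <= a1 -> Cmod y < b1 -> Cmod (v1 x y) <= K * Cmod y ^ 2).
{ apply (order_in_strip v1 a b 2 M d); auto.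
  - intros x y hx hy. unfold v1. apply holo_minus; [apply holo_minus|]; auto using holo_id, holo_const.
    apply (diff2_comp_path (fun p => fst (G p)) (fun x => x) (fun _ => y)); auto using holo_id, holo_const.
  - intros x y hx hy. unfold v1. apply holo_minus; [apply holo_minus|]; auto using holo_id, holo_const.
    apply (diff2_comp_path (fun p => fst (G p)) (fun _ => x) (fun y => y)); auto using holo_id, holo_const.
  - intros x y hx hy. unfold v1. rewrite hper by auto. cbn [fst snd]. ring.
  - intros a2 ha2.
    destruct (bounded_on_strip (fun p => fst (G p) - fst p - snd p)%C a b a2 hb ha2) as (b1 & K & q1 & q2 & q3).
    + intros p h1 h2. destruct (D1 p h1 h2) as (l & m & hlm).
      exists (l - 1)%C, (m - 1)%C. intros e he. destruct (hlm e he) as (d0 & hd0 & h). exists d0; split; auto.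
      intros p' k1 k2. eapply Rle_trans; [|apply (h p' k1 k2)]. right. f_equal. ring.
    + intros x y hx hy. cbn [fst snd]. rewrite hper by auto. cbn [fst snd]. ring.
    + exists b1, K. auto.
  - intros x y hy. apply hform; auto. }
assert (E2 : exists b1 K, 0 < b1 <= b /\ 0 <= K /\ forall x y : C, Rabs (snd x) <= a1 -> Cmod y < b1 -> Cmod (v2 x y) <= K * Cmod y ^ 3).
{ apply (order_in_strip v2 a b 3 M d); auto.
  - intros x y hx hy. unfold v2. apply holo_minus; auto using holo_id, holo_const.
    apply (diff2_comp_path (fun p => snd (G p)) (fun x => x) (fun _ => y)); auto using holo_id, holo_const.
  - intros x y hx hy. unfold v2. apply holo_minus; auto using holo_id, holo_const.
    apply (diff2_comp_path (fun p => snd (G p)) (fun _ => x) (fun y => y)); auto using holo_id, holo_const.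
  - intros x y hx hy. unfold v2. rewrite hper by auto. cbn [fst snd]. ring.
  - intros a2 ha2.
    destruct (bounded_on_strip (fun p => snd (G p) - snd p)%C a b a2 hb ha2) as (b1 & K & q1 & q2 & q3).
    + intros p h1 h2. destruct (D2 p h1 h2) as (l & m & hlm).
      exists l, (m - 1)%C. intros e he. destruct (hlm e he) as (d0 & hd0 & h). exists d0; split; auto.
      intros p' k1 k2. eapply Rle_trans; [|apply (h p' k1 k2)]. right. f_equal. ring.
    + intros x y hx hy. cbn [fst snd]. rewrite hper by auto. cbn [fst snd]. ring.
    + exists b1, K. auto.
  - intros x y hy. apply hform; auto. }
destruct E1 as (b1 & K1 & q1 & q2 & q3). destruct E2 as (b2 & K2 & r1 & r2 & r3).
exists (Rmin b1 b2), (K1 + K2). split.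
{ split; [apply Rmin_pos; lra|]. eapply Rle_trans; [apply Rmin_l|lra]. }
split; [lra|]. intros x y hx hy.
assert (h1 := q3 x y hx (Rlt_le_trans _ _ _ hy (Rmin_l _ _))). assert (h2 := r3 x y hx (Rlt_le_trans _ _ _ hy (Rmin_r _ _))).
unfold v1, v2 in *.
assert (0 <= Cmod y ^ 2) by (apply pow_le, Cmod_ge_0). assert (0 <= Cmod y ^ 3) by (apply pow_le, Cmod_ge_0). split; nra.
Qed.

(** * Iterates near the boundary *)

(** Iteration from the centre, with geometric convergence. In the last clause the iterates of a real
    centre stay real, and so does their limit. *)
Lemma disk_fixpoint (Psi : C -> C) (c : C) (r : R) : 0 <= r ->
  (forall y, Cmod (y - c)%C <= r -> Cmod (Psi y - c)%C <= r) ->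
  (forall y y', Cmod (y - c)%C <= r -> Cmod (y' - c)%C <= r -> Cmod (Psi y - Psi y')%C <= / 2 * Cmod (y - y')%C) ->
  exists y, Cmod (y - c)%C <= r /\ Psi y = y /\
    ((snd c = 0 /\ forall y, Cmod (y - c)%C <= r -> snd y = 0 -> snd (Psi y) = 0) -> snd y = 0).
Proof.
intros hr hm hl.
set (s := fun n => Nat.iter n Psi c).
assert (hs : forall n, Cmod (s n - c)%C <= r).
{ induction n; [simpl; rewrite Cmod_self; auto|]. apply (hm (s n)); auto. }
assert (hstep : forall n, Cmod (s (S n) - s n)%C <= r * (/2)^n).
{ induction n.
  - simpl. rewrite Rmult_1_r. apply (hs 1%nat).
  - eapply Rle_trans; [apply (hl (s (S n)) (s n)); auto|]. change ((/2)^(S n)) with (/2 * (/2)^n). lra. }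
assert (hpos : forall n, 0 < (/2)^n) by (intro; apply pow_lt; lra).
assert (hdist : forall n m, Cmod (s (n + m)%nat - s n)%C <= 2 * r * (/2)^n - 2 * r * (/2)^(n+m)).
{ intros n m; induction m; [rewrite Nat.add_0_r, Cmod_self; lra|].
  rewrite Nat.add_succ_r. eapply Rle_trans; [apply (Cmod_minus_trans _ (s (n+m)%nat))|].
  specialize (hstep (n+m)%nat). change ((/2)^(S (n+m))) with (/2 * (/2)^(n+m)). lra. }
assert (hlim : forall e, 0 < e -> exists N, forall n, (N <= n)%nat -> 2 * r * (/2)^n < e).
{ intros e he. destruct (pow_lt_1_zero (/2)) with (y := e / (2 * r + 1)) as (N & hN).
  - rewrite Rabs_pos_eq; lra.
  - apply Rdiv_lt_0_compat; lra.
  - exists N. intros n hn. specialize (hN n hn). rewrite Rabs_pos_eq in hN by (apply Rlt_le, hpos).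
    apply Rmult_lt_compat_r with (r := 2 * r + 1) in hN; [|lra].
    replace (e / (2 * r + 1) * (2 * r + 1)) with e in hN by (field; lra). specialize (hpos n). nra. }
assert (hcauchy : forall g : C -> R, (forall a b : C, Rabs (g a - g b) <= Cmod (a - b)%C) -> Cauchy_crit (fun n => g (s n))).
{ intros g hg e he. destruct (hlim e he) as (N & hN). exists N.
  assert (hw : forall n m, (n >= N)%nat -> (n <= m)%nat -> R_dist (g (s m)) (g (s n)) < e).
  { intros n m hn hnm. unfold R_dist. eapply Rle_lt_trans; [apply hg|]. eapply Rle_lt_trans; [|apply (hN n hn)].
    replace m with (n + (m - n))%nat by lia. eapply Rle_trans; [apply hdist|].
    specialize (hpos (n + (m - n))%nat). nra. }
  intros n m hn hm'. destruct (Nat.le_ge_cases n m).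
  - rewrite R_dist_sym. apply hw; auto.
  - apply hw; auto. }
destruct (Rcomplete.R_complete _ (hcauchy fst ltac:(intros a b; rewrite <- fst_minus; apply fst_le_Cmod))) as (l1 & h1).
destruct (Rcomplete.R_complete _ (hcauchy snd ltac:(intros a b; rewrite <- snd_minus; apply snd_le_Cmod))) as (l2 & h2).
assert (hcv : forall e, 0 < e -> exists N, forall n, (N <= n)%nat -> Cmod (s n - (l1, l2))%C < e).
{ intros e he. destruct (h1 (e/2) ltac:(lra)) as (N1 & q1). destruct (h2 (e/2) ltac:(lra)) as (N2 & q2).
  exists (max N1 N2). intros n hn. specialize (q1 n ltac:(lia)). specialize (q2 n ltac:(lia)).
  unfold R_dist in *. eapply Rle_lt_trans; [apply Cmod_le_sum|]. rewrite fst_minus, snd_minus; simpl. lra. }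
assert (hy : Cmod ((l1, l2) - c)%C <= r).
{ apply le_epsilon. intros e he. destruct (hcv e he) as (N & hN). specialize (hN N (le_n N)).
  eapply Rle_trans; [apply (Cmod_minus_trans _ (s N))|]. rewrite Cmod_minus_sym. specialize (hs N). lra. }
exists (l1, l2). split; auto. split.
- apply Cmod_eq_minus. apply Rle_antisym; [|apply Cmod_ge_0]. apply le_epsilon. intros e he.
  destruct (hcv (e/2) ltac:(lra)) as (N & hN).
  eapply Rle_trans; [apply (Cmod_minus_trans _ (s (S N)))|].
  pose proof (hN N (le_n N)). pose proof (hN (S N) ltac:(lia)).
  assert (Cmod (Psi (l1, l2) - s (S N))%C <= / 2 * Cmod ((l1, l2) - s N)%C) by (apply (hl (l1, l2) (s N)); auto).
  rewrite (Cmod_minus_sym (l1, l2)) in H1. pose proof (Cmod_ge_0 (s N - (l1, l2))%C). lra.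
- intros (hc & hreal). assert (hsn : forall n, snd (s n) = 0).
  { induction n; [exact hc|]. apply (hreal (s n)); auto. }
  simpl. apply cond_eq. intros e he. destruct (h2 e he) as (N & hN). specialize (hN N (le_n N)).
  rewrite hsn in hN. unfold R_dist in hN. rewrite Rabs_minus_sym in hN. auto.
Qed.

Definition it (G : C * C -> C * C) (n : nat) (p : C * C) : C * C := Nat.iter n G p.

(** For [y = O(mu)] a step changes the ordinate by [O(mu^3)] and the abscissa by [y + O(mu^2)]. Over
    at most [q] steps, as [q mu = p <= L], the errors become [O(mu^2)] and [O(mu)]. The hypothesis
    on [q |Im y|] limits the drift of [Im x] to half of the margin [a1 - a2]; the other half absorbs
    the errors. *)
Lemma iterate_estimates (G : C * C -> C * C) a1 b1 M a2 A L :
  0 < a2 < a1 -> 0 < b1 -> 0 <= M -> 1 <= A -> 1 <= L ->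
  (forall x y : C, Rabs (snd x) <= a1 -> Cmod y < b1 ->
    Cmod (fst (G (x, y)) - x - y)%C <= M * Cmod y ^ 2 /\ Cmod (snd (G (x, y)) - y)%C <= M * Cmod y ^ 3) ->
  exists K m, 0 <= K /\ 0 < m /\ forall p q : nat, (1 <= q)%nat -> INR p <= L ->
    forall mu, mu = INR p / INR q -> 0 < mu -> mu <= m -> forall x y : C, Rabs (snd x) <= a2 -> Cmod y <= A * mu ->
    INR q * Rabs (snd y) <= (a1 - a2) / 2 -> forall k, (k <= q)%nat ->
    Cmod (snd (it G k (x, y)) - y)%C <= K * mu ^ 2 /\
    Cmod (fst (it G k (x, y)) - x - RtoC (INR k) * y)%C <= K * mu /\
    Rabs (snd (fst (it G k (x, y)))) <= a1 /\ Cmod (snd (it G k (x, y))) < b1.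
Proof.
intros ha hb hM hA hL hG.
(* [B3] and [B2] are the remainders of the normal form, in units of [mu^3] and [mu^2], at ordinates
   of modulus at most [2 A mu]. *)
set (B3 := 8 * M * A ^ 3). assert (hB3 : 0 <= B3).
{ unfold B3. assert (0 <= A ^ 3) by (apply pow_le; lra). nra. }
set (B2 := 4 * M * A ^ 2). assert (hB2 : 0 <= B2).
{ unfold B2. assert (0 <= A ^ 2) by (apply pow_le; lra). nra. }
assert (hBL : 0 <= B3 * L) by nra.
set (K := B3 * L + L * (B2 + B3 * L)). assert (hK : 0 <= K) by (unfold K; nra).
set (m := Rmin (A / (B3 * L + 1)) (Rmin (b1 / (4 * A)) ((a1 - a2) / (2 * (K + 1))))).
assert (hm : 0 < m).
{ unfold m. repeat apply Rmin_pos; apply Rdiv_lt_0_compat; lra. }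
exists K, m. split; auto. split; auto.
intros p q hq hpL mu hmu hmu0 hmum x y hx hy hyi.
assert (m1 : mu <= A / (B3 * L + 1)) by (eapply Rle_trans; [exact hmum|apply Rmin_l]).
assert (m2 : mu <= b1 / (4 * A)) by (eapply Rle_trans; [exact hmum|eapply Rle_trans; [apply Rmin_r|apply Rmin_l]]).
assert (m3 : mu <= (a1 - a2) / (2 * (K + 1))) by (eapply Rle_trans; [exact hmum|eapply Rle_trans; [apply Rmin_r|apply Rmin_r]]).
assert (hqR : 0 < INR q) by (apply lt_0_INR; lia).
assert (hqmu : INR q * mu <= L) by (rewrite hmu; replace (INR q * (INR p / INR q)) with (INR p) by (field; lra); auto).
assert (m1' : B3 * L * mu <= A).
{ apply Rmult_le_compat_l with (r := B3 * L + 1) in m1; [|lra].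
  replace ((B3 * L + 1) * (A / (B3 * L + 1))) with A in m1 by (field; lra). lra. }
assert (m2' : 2 * A * mu < b1).
{ apply Rmult_le_compat_l with (r := 4 * A) in m2; [|lra]. replace (4 * A * (b1 / (4 * A))) with b1 in m2 by (field; lra). lra. }
assert (m3' : K * mu <= (a1 - a2) / 2).
{ apply Rmult_le_compat_l with (r := 2 * (K + 1)) in m3; [|lra].
  replace (2 * (K + 1) * ((a1 - a2) / (2 * (K + 1)))) with (a1 - a2) in m3 by (field; lra). lra. }
clearbody m. clear m1 m2 m3.
assert (hmu2 : 0 < mu ^ 2) by (apply pow_lt; auto). assert (hmu3 : 0 < mu ^ 3) by (apply pow_lt; auto).
(* Bootstrap: the bounds linear in [k] imply that the [k]-th iterate is still in the domain of [hG],
   with an ordinate at most [2 A mu], which allows the next step. *)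
assert (cons : forall k, (k <= q)%nat ->
  Cmod (snd (it G k (x, y)) - y)%C <= INR k * (B3 * mu ^ 3) /\
  Cmod (fst (it G k (x, y)) - x - RtoC (INR k) * y)%C <= INR k * ((B2 + B3 * L) * mu ^ 2) ->
  Cmod (snd (it G k (x, y)) - y)%C <= B3 * L * mu ^ 2 /\
  Cmod (fst (it G k (x, y)) - x - RtoC (INR k) * y)%C <= L * (B2 + B3 * L) * mu /\
  Rabs (snd (fst (it G k (x, y)))) <= a1 /\ Cmod (snd (it G k (x, y))) <= 2 * A * mu).
{ intros k hk (h1 & h2).
  assert (hkq : INR k <= INR q) by (apply le_INR; auto).
  assert (hkmu : INR k * mu <= L). { eapply Rle_trans; [|exact hqmu]. apply Rmult_le_compat_r; lra. }
  pose proof (pos_INR k) as hk0.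
  assert (g1 : INR k * (B3 * mu ^ 3) <= B3 * L * mu ^ 2).
  { replace (INR k * (B3 * mu ^ 3)) with ((B3 * mu ^ 2) * (INR k * mu)) by ring.
    replace (B3 * L * mu ^ 2) with ((B3 * mu ^ 2) * L) by ring. apply Rmult_le_compat_l; auto. nra. }
  assert (g2 : INR k * ((B2 + B3 * L) * mu ^ 2) <= L * (B2 + B3 * L) * mu).
  { replace (INR k * ((B2 + B3 * L) * mu ^ 2)) with ((B2 + B3 * L) * mu * (INR k * mu)) by ring.
    replace (L * (B2 + B3 * L) * mu) with ((B2 + B3 * L) * mu * L) by ring. apply Rmult_le_compat_l; auto.
    apply Rmult_le_pos; lra. }
  split; [lra|]. split; [lra|]. split.
  - pose proof (snd_le_Cmod (fst (it G k (x, y)) - x - RtoC (INR k) * y)%C) as h3.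
    assert (e3 : snd (fst (it G k (x, y)) - x - RtoC (INR k) * y)%C = snd (fst (it G k (x, y))) - snd x - INR k * snd y).
    { simpl. ring. }
    rewrite e3 in h3.
    assert (hky : Rabs (INR k * snd y) <= (a1 - a2) / 2).
    { rewrite Rabs_mult, (Rabs_pos_eq (INR k)) by auto. eapply Rle_trans; [|exact hyi].
      apply Rmult_le_compat_r; auto. apply Rabs_pos. }
    assert (L * (B2 + B3 * L) * mu <= K * mu) by (unfold K; nra).
    apply Rabs_le_between in h3. apply Rabs_le_between in hky. apply Rabs_le_between in hx. apply Rabs_le. lra.
  - pose proof (Cmod_le_minus (snd (it G k (x, y))) y).
    assert (B3 * L * mu ^ 2 <= A * mu). { replace (B3 * L * mu ^ 2) with (B3 * L * mu * mu) by ring. nra. }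
    lra. }
assert (main : forall k, (k <= q)%nat ->
  Cmod (snd (it G k (x, y)) - y)%C <= INR k * (B3 * mu ^ 3) /\
  Cmod (fst (it G k (x, y)) - x - RtoC (INR k) * y)%C <= INR k * ((B2 + B3 * L) * mu ^ 2)).
{ induction k; intro hk.
  - simpl. rewrite Cmod_self. replace (x - x - 0 * y)%C with (RtoC 0) by ring. rewrite Cmod_0. lra.
  - specialize (IHk ltac:(lia)). destruct (cons k ltac:(lia) IHk) as (c1 & c2 & c3 & c4).
    destruct IHk as (i1 & i2).
    change (it G (S k) (x, y)) with (G (it G k (x, y))).
    revert c1 c2 c3 c4 i1 i2. destruct (it G k (x, y)) as (xk, yk). cbn [fst snd]. intros c1 c2 c3 c4 i1 i2.
    destruct (hG xk yk c3 ltac:(lra)) as (g1 & g2).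
    assert (y3 : M * Cmod yk ^ 3 <= B3 * mu ^ 3).
    { unfold B3. replace (8 * M * A ^ 3 * mu ^ 3) with (M * (2 * A * mu) ^ 3) by ring.
      apply Rmult_le_compat_l; auto. apply pow_incr. split; [apply Cmod_ge_0|auto]. }
    assert (y2 : M * Cmod yk ^ 2 <= B2 * mu ^ 2).
    { unfold B2. replace (4 * M * A ^ 2 * mu ^ 2) with (M * (2 * A * mu) ^ 2) by ring.
      apply Rmult_le_compat_l; auto. apply pow_incr. split; [apply Cmod_ge_0|auto]. }
    rewrite S_INR. split.
    + eapply Rle_trans; [apply (Cmod_minus_trans _ yk)|]. lra.
    + replace (fst (G (xk, yk)) - x - RtoC (INR k + 1) * y)%C with
        ((fst (G (xk, yk)) - xk - yk) + ((xk - x - RtoC (INR k) * y) + (yk - y)))%C by (rewrite RtoC_plus; ring).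
      eapply Rle_trans; [apply Cmod_triangle|].
      eapply Rle_trans; [apply Rplus_le_compat_l, Cmod_triangle|]. nra. }
intros k hk. destruct (cons k hk (main k hk)) as (c1 & c2 & c3 & c4).
assert (hLB : 0 <= L * (B2 + B3 * L)) by (apply Rmult_le_pos; lra).
split; [eapply Rle_trans; [exact c1|]; apply Rmult_le_compat_r; unfold K; lra|].
split; [eapply Rle_trans; [exact c2|]; apply Rmult_le_compat_r; unfold K; lra|]. split; auto. lra.
Qed.

Lemma cdiff2_ext f g p l m : (forall w, f w = g w) -> cdiff2 f p l m -> cdiff2 g p l m.
Proof.
intros he h e hep. destruct (h e hep) as (d & hd & hh). exists d; split; auto.
intros p' h1 h2. rewrite <- !he. auto.
Qed.

Lemma it_diff2 G a b k p : normal_map G a b ->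
  (forall j, (j < k)%nat -> Rabs (snd (fst (it G j p))) < a /\ Cmod (snd (it G j p)) < b) ->
  diff2 (fun w => fst (it G k w)) p /\ diff2 (fun w => snd (it G k w)) p.
Proof.
intros hG. induction k; intro h.
- split; [apply diff2_fst|apply diff2_snd].
- destruct IHk as ((l1 & m1 & h1) & (l2 & m2 & h2)). { intros; apply h; lia. }
  destruct (h k ltac:(lia)) as (q1 & q2).
  destruct (nm_diff _ _ _ hG (it G k p) q1 q2) as ((l & m & h3) & (l' & m' & h4)).
  rewrite (surjective_pairing (it G k p)) in h3, h4.
  split.
  + eexists; eexists. eapply cdiff2_ext; [|eapply (cdiff2_comp (fun x => fst (G x)) (fun w => fst (it G k w)) (fun w => snd (it G k w))); eauto].
    intro w. simpl. rewrite <- surjective_pairing. reflexivity.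
  + eexists; eexists. eapply cdiff2_ext; [|eapply (cdiff2_comp (fun x => snd (G x)) (fun w => fst (it G k w)) (fun w => snd (it G k w))); eauto].
    intro w. simpl. rewrite <- surjective_pairing. reflexivity.
Qed.

(** * The curve of points that advance by [p] in [q] steps *)

(** [pc_unique] recognizes points of the curve within the disk of radius [kp mu] around [mu = p/q];
    [orbit_near_curve] will show that trajectories are in that disk. The fields indexed by [k]
    include [k = 0], which gives the holomorphy and the periodicity of [Y]. *)
Record periodic_curve (G : C * C -> C * C) (a b kp K : R) (p q : nat) (Y : C -> C) : Prop := {
  pc_disk : forall x : C, Rabs (snd x) < a -> Cmod (Y x - RtoC (INR p / INR q))%C <= kp * (INR p / INR q);
  pc_eq : forall x : C, Rabs (snd x) < a -> fst (it G q (x, Y x)) = (x + RtoC (INR p))%C;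
  pc_unique : forall x y : C, Rabs (snd x) < a -> Cmod (y - RtoC (INR p / INR q))%C <= kp * (INR p / INR q) ->
    fst (it G q (x, y)) = (x + RtoC (INR p))%C -> y = Y x;
  pc_real : forall x : R, snd (Y (RtoC x)) = 0;
  pc_holo : forall (k : nat) (x : C), (k <= q)%nat -> Rabs (snd x) < a ->
    holo (fun x => fst (it G k (x, Y x))) x /\ holo (fun x => snd (it G k (x, Y x))) x;
  pc_x : forall (k : nat) (x : C), (k <= q)%nat -> Rabs (snd x) < a ->
    Cmod (fst (it G k (x, Y x)) - x - RtoC (INR k * (INR p / INR q)))%C <= K * (INR p / INR q);
  pc_y : forall (k : nat) (x : C), (k <= q)%nat -> Rabs (snd x) < a ->
    Cmod (snd (it G k (x, Y x)) - Y x)%C <= K * (INR p / INR q) ^ 2;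
  pc_per : forall (k : nat) (x : C), (k <= q)%nat -> Rabs (snd x) < a ->
    it G k ((x + 1)%C, Y (x + 1)%C) = ((fst (it G k (x, Y x)) + 1)%C, snd (it G k (x, Y x)));
  pc_dom : forall (k : nat) (x : C), (k <= q)%nat -> Rabs (snd x) < a -> Cmod (snd (it G k (x, Y x))) < b
}.

(** The equation reads [y = mu - E x y / q], where [E] is the error of the abscissa after [q] steps.
    Since [E = O(mu)] on a disk of radius [k0 mu], the Cauchy estimate bounds its Lipschitz constant
    by [8 K / k0 <= q / 2], independently of [mu], and the right side is a contraction. Holomorphy
    in [x] is an implicit function argument: the derivative in [y] has modulus at least [q / 2]. *)
Theorem exists_periodic_curve G a b a2 L : normal_map G a b -> 0 < a2 < a -> 1 <= L ->
  exists kp K m, 0 < kp <= / 4 /\ 0 <= K /\ 0 < m /\ forall p q : nat, (1 <= p)%nat -> (1 <= q)%nat -> INR p <= L ->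
    INR p / INR q <= m -> exists Y, periodic_curve G a2 b kp K p q Y.
Proof.
intros hG ha2 hL.
set (a1 := (a2 + a) / 2). assert (ha1 : a2 < a1 < a) by (unfold a1; lra).
destruct (normal_map_bounds G a b a1 hG ltac:(lra)) as (b1 & M & hb1 & hM & hbd).
destruct (iterate_estimates G a1 b1 M a2 2 L ltac:(lra) ltac:(lra) hM ltac:(lra) hL hbd) as (K & m0 & hK & hm0 & hit).
(* [k0 <= 1/2] keeps [|y| <= 2 mu], and [k0 L <= (a1 - a2) / 2] keeps [q |Im y|] within the margin
   of [iterate_estimates]. *)
set (k0 := Rmin (/ 2) ((a1 - a2) / (2 * L))).
assert (hk0 : 0 < k0) by (apply Rmin_pos; [lra|apply Rdiv_lt_0_compat; lra]).
assert (hk0a : k0 <= / 2) by apply Rmin_l. assert (hk0b : k0 <= (a1 - a2) / (2 * L)) by apply Rmin_r.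
assert (hk0c : k0 * L <= (a1 - a2) / 2).
{ apply Rmult_le_compat_r with (r := L) in hk0b; [|lra]. replace ((a1 - a2) / (2 * L) * L) with ((a1 - a2) / 2) in hk0b by (field; lra). auto. }
clearbody k0. clear hk0b.
(* [16 K m <= k0] and [1 <= p = q mu <= q m] give [16 K <= k0 q], which is used for the
   contraction. *)
set (m := Rmin m0 (k0 / (16 * K + 1))).
assert (hm : 0 < m) by (apply Rmin_pos; [auto|apply Rdiv_lt_0_compat; lra]).
assert (hma : m <= m0) by apply Rmin_l. assert (hmb : m <= k0 / (16 * K + 1)) by apply Rmin_r.
assert (hmc : 16 * K * m <= k0).
{ apply Rmult_le_compat_r with (r := 16 * K + 1) in hmb; [|lra]. replace (k0 / (16 * K + 1) * (16 * K + 1)) with k0 in hmb by (field; lra). lra. }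
clearbody m. clear hmb.
exists (k0 / 2), (2 * K), m. split; [lra|]. split; [lra|]. split; auto.
intros p q hp hq hpL hmum.
set (mu := INR p / INR q) in *.
assert (hpR : 1 <= INR p) by (apply (le_INR 1); auto). assert (hqR : 1 <= INR q) by (apply (le_INR 1); auto).
assert (hmu : 0 < mu) by (apply Rdiv_lt_0_compat; lra).
assert (hqmu : INR q * mu = INR p) by (unfold mu; field; lra).
assert (hqK : 16 * K <= k0 * INR q).
{ assert (1 <= INR q * m) by nra. nra. }
specialize (hit p q hq hpL mu eq_refl hmu ltac:(lra)).
assert (hdisk : forall y : C, Cmod (y - RtoC mu)%C <= k0 * mu -> Cmod y <= 2 * mu /\ INR q * Rabs (snd y) <= (a1 - a2) / 2).
{ intros y hy. split.
  - pose proof (Cmod_le_minus y (RtoC mu)). rewrite Cmod_R, Rabs_pos_eq in H by lra. nra.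
  - pose proof (snd_le_Cmod (y - RtoC mu)%C). rewrite snd_minus in H. simpl in H. rewrite Rminus_0_r in H.
    assert (INR q * Rabs (snd y) <= INR q * (k0 * mu)) by (apply Rmult_le_compat_l; lra).
    replace (INR q * (k0 * mu)) with (k0 * (INR q * mu)) in H0 by ring. rewrite hqmu in H0. nra. }
assert (hit' : forall x y : C, Rabs (snd x) <= a2 -> Cmod (y - RtoC mu)%C <= k0 * mu -> forall k, (k <= q)%nat ->
   Cmod (snd (it G k (x, y)) - y)%C <= K * mu ^ 2 /\
    Cmod (fst (it G k (x, y)) - x - RtoC (INR k) * y)%C <= K * mu /\
    Rabs (snd (fst (it G k (x, y)))) <= a1 /\ Cmod (snd (it G k (x, y))) < b1).
{ intros x y hx hy. destruct (hdisk y hy) as (d1 & d2). apply hit; auto. }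
clear hit.
assert (hd2 : forall x y : C, Rabs (snd x) <= a2 -> Cmod (y - RtoC mu)%C <= k0 * mu -> forall k, (k <= q)%nat ->
  diff2 (fun w => fst (it G k w)) (x, y) /\ diff2 (fun w => snd (it G k w)) (x, y)).
{ intros x y hx hy k hk. apply (it_diff2 G a b); auto. intros j hj.
  destruct (hit' x y hx hy j ltac:(lia)) as (_ & _ & c3 & c4). split; lra. }
set (E := fun x y => (fst (it G q (x, y)) - x - RtoC (INR q) * y)%C).
assert (hE : forall x y : C, Rabs (snd x) <= a2 -> Cmod (y - RtoC mu)%C <= k0 * mu -> Cmod (E x y) <= K * mu).
{ intros x y hx hy. apply (hit' x y hx hy q (le_n q)). }
assert (hElip : forall x y y' : C, Rabs (snd x) <= a2 -> Cmod (y - RtoC mu)%C <= k0 / 2 * mu -> Cmod (y' - RtoC mu)%C <= k0 / 2 * mu ->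
  Cmod (E x y - E x y')%C <= INR q / 2 * Cmod (y - y')%C).
{ intros x y y' hx hy hy'. apply lip_segment. intros t ht.
  set (w := (y' + RtoC t * (y - y'))%C).
  assert (hw : Cmod (w - RtoC mu)%C <= k0 / 2 * mu).
  { unfold w. replace (y' + RtoC t * (y - y') - RtoC mu)%C with (RtoC (1 - t) * (y' - RtoC mu) + RtoC t * (y - RtoC mu))%C by (rewrite RtoC_minus; ring).
    eapply Rle_trans; [apply Cmod_triangle|]. rewrite !Cmod_mult, !Cmod_R, !Rabs_pos_eq by lra. nra. }
  assert (hk0mu : 0 < k0 * mu) by (apply Rmult_lt_0_compat; auto).
  assert (hholo : forall v, Cmod (v - w)%C < k0 * mu / 2 -> Cmod (v - RtoC mu)%C <= k0 * mu /\ holo (E x) v).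
  { intros v hv. assert (hv' : Cmod (v - RtoC mu)%C <= k0 * mu).
    { eapply Rle_trans; [apply (Cmod_minus_trans _ w)|]. lra. }
    split; auto. unfold E. apply holo_minus; [apply holo_minus|]; auto using holo_const.
    - apply (diff2_comp_path (fun p => fst (it G q p)) (fun _ => x) (fun y => y)); auto using holo_id, holo_const.
      apply hd2; auto.
    - apply holo_mult; auto using holo_id, holo_const. }
  assert (hw0 : Cmod (w - w)%C < k0 * mu / 2) by (rewrite Cmod_self; lra).
  exists (der (E x) w). split; [apply der_spec, hholo; auto|].
  apply Rle_trans with (4 * (K * mu) / (k0 * mu / 2)).
  - apply (cauchy_deriv (E x) w); try lra.
    + intros v hv. apply hholo; auto.
    + intros v hv. apply hE; auto. apply hholo; auto.
    + apply der_spec, hholo; auto.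
  - replace (4 * (K * mu) / (k0 * mu / 2)) with (8 * K / k0) by (field; lra).
    apply Rmult_le_reg_r with k0; auto. replace (8 * K / k0 * k0) with (8 * K) by (field; lra). lra. }
assert (hex : forall x : C, Rabs (snd x) <= a2 -> exists y, Cmod (y - RtoC mu)%C <= k0 / 2 * mu /\
   fst (it G q (x, y)) = (x + RtoC (INR p))%C /\ (snd x = 0 -> snd y = 0)).
{ intros x hx.
  set (Psi := fun y => (RtoC mu - / RtoC (INR q) * E x y)%C).
  assert (hq0 : RtoC (INR q) <> 0%C). { intro h. apply RtoC_inj in h. lra. }
  assert (hmi : Cmod (/ RtoC (INR q)) = / INR q) by (rewrite Cmod_inv, Cmod_R, Rabs_pos_eq by (auto; lra); auto).
  assert (hiq : 0 < / INR q) by (apply Rinv_0_lt_compat; lra).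
  destruct (disk_fixpoint Psi (RtoC mu) (k0 / 2 * mu)) as (y & h1 & h2 & h3).
  - nra.
  - intros y hy. unfold Psi. replace (RtoC mu - / RtoC (INR q) * E x y - RtoC mu)%C with (- (/ RtoC (INR q) * E x y))%C by ring.
    rewrite Cmod_opp, Cmod_mult, hmi. assert (h := hE x y hx ltac:(nra)).
    apply Rmult_le_reg_l with (INR q); [lra|].
    replace (INR q * (/ INR q * Cmod (E x y))) with (Cmod (E x y)) by (field; lra).
    replace (INR q * (k0 / 2 * mu)) with (k0 * INR q / 2 * mu) by lra.
    eapply Rle_trans; [exact h|]. apply Rmult_le_compat_r; lra.
  - intros y y' hy hy'. unfold Psi.
    replace (RtoC mu - / RtoC (INR q) * E x y - (RtoC mu - / RtoC (INR q) * E x y'))%C with (/ RtoC (INR q) * (E x y' - E x y))%C by ring.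
    rewrite Cmod_mult, hmi, Cmod_minus_sym. assert (h := hElip x y y' hx hy hy').
    apply Rmult_le_reg_l with (INR q); [lra|].
    replace (INR q * (/ INR q * Cmod (E x y - E x y')%C)) with (Cmod (E x y - E x y')%C) by (field; lra). lra.
  - exists y. split; auto. split.
    + unfold Psi, E in h2.
      assert (h4 : (RtoC (INR q) * y)%C = (RtoC (INR q) * RtoC mu - (fst (it G q (x, y)) - x - RtoC (INR q) * y))%C).
      { rewrite <- h2 at 1. field. auto. }
      rewrite <- RtoC_mult, hqmu in h4.
      replace (fst (it G q (x, y))) with ((RtoC (INR p) - (RtoC (INR p) - (fst (it G q (x, y)) - x - RtoC (INR q) * y))) + x + RtoC (INR q) * y)%C by ring.
      rewrite <- h4. ring.
    + intro hx0. apply h3. split; [reflexivity|].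
      intros w hw hw0. unfold Psi.
      assert (hr : snd (fst (it G q (x, w))) = 0).
      { assert (hrk : forall k, (k <= q)%nat -> snd (fst (it G k (x, w))) = 0 /\ snd (snd (it G k (x, w))) = 0).
        { induction k; intro hk; [simpl; auto|]. destruct (IHk ltac:(lia)) as (i1 & i2).
          destruct (hit' x w hx ltac:(nra) k ltac:(lia)) as (_ & _ & _ & c4).
          change (it G (S k) (x, w)) with (G (it G k (x, w))).
          revert i1 i2 c4. destruct (it G k (x, w)) as ((u1, u2), (v1, v2)). cbn [fst snd]. intros i1 i2 c4. subst u2 v2.
          apply (nm_real _ _ _ hG u1 v1). change (v1, 0) with (RtoC v1) in c4. rewrite Cmod_R in c4. lra. }
        apply hrk; auto. }
      unfold E. rewrite <- RtoC_inv by lra. simpl. rewrite hr, hx0, hw0. ring. }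
set (Y := fun x => epsilon (inhabits (RtoC 0)) (fun y => Cmod (y - RtoC mu)%C <= k0 / 2 * mu /\
   fst (it G q (x, y)) = (x + RtoC (INR p))%C /\ (snd x = 0 -> snd y = 0))).
assert (hY : forall x : C, Rabs (snd x) <= a2 -> Cmod (Y x - RtoC mu)%C <= k0 / 2 * mu /\
   fst (it G q (x, Y x)) = (x + RtoC (INR p))%C /\ (snd x = 0 -> snd (Y x) = 0)).
{ intros x hx. apply (epsilon_spec (inhabits (RtoC 0)) (fun y => Cmod (y - RtoC mu)%C <= k0 / 2 * mu /\
   fst (it G q (x, y)) = (x + RtoC (INR p))%C /\ (snd x = 0 -> snd y = 0))). auto. }
clearbody Y.
assert (huniq : forall x y y' : C, Rabs (snd x) <= a2 -> Cmod (y - RtoC mu)%C <= k0 / 2 * mu -> Cmod (y' - RtoC mu)%C <= k0 / 2 * mu ->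
   INR q / 2 * Cmod (y - y')%C <= Cmod (fst (it G q (x, y)) - fst (it G q (x, y')))%C).
{ intros x y y' hx hy hy'. assert (h := hElip x y y' hx hy hy'). unfold E in h.
  replace (fst (it G q (x, y)) - x - RtoC (INR q) * y - (fst (it G q (x, y')) - x - RtoC (INR q) * y'))%C with
    ((fst (it G q (x, y)) - fst (it G q (x, y'))) - RtoC (INR q) * (y - y'))%C in h by ring.
  pose proof (Cmod_le_minus (RtoC (INR q) * (y - y')) (fst (it G q (x, y)) - fst (it G q (x, y'))))%C as h2.
  rewrite Cmod_minus_sym in h2. rewrite Cmod_mult, Cmod_R, Rabs_pos_eq in h2 by lra. lra. }
assert (hu : forall x y : C, Rabs (snd x) <= a2 -> Cmod (y - RtoC mu)%C <= k0 / 2 * mu ->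
    fst (it G q (x, y)) = (x + RtoC (INR p))%C -> y = Y x).
{ intros x y hx hy he. destruct (hY x hx) as (y1 & y2 & _). assert (h := huniq x y (Y x) hx hy y1).
  rewrite he, y2, Cmod_self in h. apply Cmod_eq_minus. pose proof (Cmod_ge_0 (y - Y x)%C). nra. }
assert (hnb : forall x : C, Rabs (snd x) < a2 -> holo Y x).
{ intros x hx. destruct (hY x ltac:(lra)) as (y1 & y2 & _).
  destruct (hd2 x (Y x) ltac:(lra) ltac:(nra) q (le_n q)) as ((l & n & hln) & _).
  assert (hn : INR q / 2 <= Cmod n).
  { assert (hcd : cdiff (E x) (Y x) (n - RtoC (INR q))%C).
    { unfold E. replace (n - RtoC (INR q))%C with (l * 0 + n * 1 - 0 - RtoC (INR q) * 1)%C by ring.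
      apply cdiff_minus; [apply cdiff_minus; [|apply cdiff_const]|apply cdiff_scal, cdiff_id].
      apply (cdiff2_comp_path (fun p => fst (it G q p)) (fun _ => x) (fun y => y)); auto using cdiff_id, cdiff_const. }
    assert (hc : Cmod (n - RtoC (INR q))%C <= 4 * (K * mu) / (k0 * mu / 2)).
    { assert (hk0mu : 0 < k0 * mu) by (apply Rmult_lt_0_compat; auto).
      assert (hin : forall v, Cmod (v - Y x)%C < k0 * mu / 2 -> Cmod (v - RtoC mu)%C <= k0 * mu).
      { intros v hv. eapply Rle_trans; [apply (Cmod_minus_trans _ (Y x))|]. lra. }
      apply (cauchy_deriv (E x) (Y x)); auto; try lra.
      - intros v hv. unfold E. apply holo_minus; [apply holo_minus|]; auto using holo_const.
        + apply (diff2_comp_path (fun p => fst (it G q p)) (fun _ => x) (fun y => y)); auto using holo_id, holo_const.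
          apply hd2; auto; lra.
        + apply holo_mult; auto using holo_id, holo_const.
      - intros v hv. apply hE; auto; lra. }
    replace (4 * (K * mu) / (k0 * mu / 2)) with (8 * K / k0) in hc by (field; lra).
    assert (8 * K / k0 <= INR q / 2).
    { apply Rmult_le_reg_r with k0; auto. replace (8 * K / k0 * k0) with (8 * K) by (field; lra). lra. }
    pose proof (Cmod_le_minus (RtoC (INR q)) n). rewrite Cmod_minus_sym, Cmod_R, Rabs_pos_eq in H0 by lra. lra. }
  assert (hn0 : n <> 0%C) by (apply Cmod_gt_0; lra).
  destruct (cdiff2_lip _ _ _ _ hln) as (d1 & K1 & hd1 & hK1 & hl1). simpl in hl1.
  destruct (strip_nbhd a2 x hx) as (d2 & hd2' & hs2).
  set (K2 := 2 * (1 + K1)).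
  (* [huniq] bounds [Y x' - Y x] by the defect of [Y x] in the equation at [x']: a Lipschitz bound,
     obtained before differentiability. *)
  assert (hYl : forall x', Cmod (x' - x)%C < Rmin d1 d2 -> Cmod (Y x' - Y x)%C <= K2 * Cmod (x' - x)%C).
  { intros x' hx'. assert (q1 := Rlt_le_trans _ _ _ hx' (Rmin_l _ _)). assert (q2 := Rlt_le_trans _ _ _ hx' (Rmin_r _ _)).
    assert (hx2 := hs2 x' q2). destruct (hY x' ltac:(lra)) as (z1 & z2 & _).
    assert (h := huniq x' (Y x') (Y x) ltac:(lra) z1 y1). rewrite z2 in h.
    assert (h1 := hl1 (x', Y x)). simpl in h1. rewrite Cmod_self in h1. specialize (h1 q1 hd1).
    rewrite y2 in h1.
    replace (x' + RtoC (INR p) - fst (it G q (x', Y x)))%C with ((x' - x) - (fst (it G q (x', Y x)) - (x + RtoC (INR p))))%C in h by ring.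
    pose proof (Cmod_minus_le (x' - x) (fst (it G q (x', Y x)) - (x + RtoC (INR p))))%C.
    pose proof (Cmod_ge_0 (Y x' - Y x)%C). unfold K2. nra. }
  exists ((1 - l) / n)%C. intros e he.
  assert (hK2 : 0 < 1 + K2) by (unfold K2; lra).
  set (e1 := e / (2 * (1 + K2))). assert (he1 : 0 < e1) by (apply Rdiv_lt_0_compat; lra).
  destruct (hln e1 he1) as (d3 & hd3 & h3). simpl in h3.
  assert (hd4 : 0 < d3 / (K2 + 1)) by (apply Rdiv_lt_0_compat; lra).
  exists (Rmin (Rmin d1 d2) (Rmin d3 (d3 / (K2 + 1)))). split; [repeat apply Rmin_pos; auto|].
  intros x' hx'. assert (q1 := Rlt_le_trans _ _ _ hx' (Rmin_l _ _)). assert (q2 := Rlt_le_trans _ _ _ hx' (Rmin_r _ _)).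
  assert (q3 := Rlt_le_trans _ _ _ q2 (Rmin_l _ _)). assert (q4 := Rlt_le_trans _ _ _ q2 (Rmin_r _ _)).
  specialize (hYl x' q1). assert (hx2 := hs2 x' (Rlt_le_trans _ _ _ q1 (Rmin_r _ _))).
  destruct (hY x' ltac:(lra)) as (z1 & z2 & _).
  assert (hy3 : Cmod (Y x' - Y x)%C < d3).
  { apply Rmult_lt_compat_l with (r := K2 + 1) in q4; [|lra].
    replace ((K2 + 1) * (d3 / (K2 + 1))) with d3 in q4 by (field; lra). pose proof (Cmod_ge_0 (x' - x)%C). lra. }
  specialize (h3 (x', Y x') q3 hy3). simpl in h3. rewrite z2, y2 in h3.
  replace (Y x' - Y x - (1 - l) / n * (x' - x))%C with
    (- ((x' + RtoC (INR p) - (x + RtoC (INR p)) - l * (x' - x) - n * (Y x' - Y x)) / n))%C by (field; auto).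
  rewrite Cmod_opp, Cmod_div by auto.
  apply Rmult_le_reg_r with (Cmod n); [lra|]. unfold Rdiv at 1. rewrite Rmult_assoc, Rinv_l, Rmult_1_r by lra.
  eapply Rle_trans; [exact h3|].
  assert (he' : e = 2 * (1 + K2) * e1) by (unfold e1; field; lra).
  pose proof (Cmod_ge_0 (x' - x)%C) as ht. set (t := Cmod (x' - x)%C) in *.
  assert (hh1 : e1 * (t + Cmod (Y x' - Y x)%C) <= e1 * ((1 + K2) * t)) by (apply Rmult_le_compat_l; lra).
  assert (hn12 : / 2 <= Cmod n) by lra.
  assert (hh2 : e * t * / 2 <= e * t * Cmod n) by (apply Rmult_le_compat_l; [apply Rmult_le_pos; lra|auto]).
  rewrite he' in hh2 at 1. lra. }
assert (hshift : forall w : C, snd (w + 1)%C = snd w) by (intro w; simpl; ring).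
assert (hperG : forall x y : C, Rabs (snd x) <= a2 -> Cmod (y - RtoC mu)%C <= k0 * mu -> forall k, (k <= q)%nat ->
   it G k ((x + 1)%C, y) = ((fst (it G k (x, y)) + 1)%C, snd (it G k (x, y)))).
{ intros x y hx hy. induction k; intro hk; [reflexivity|].
  change (it G (S k) ((x + 1)%C, y)) with (G (it G k ((x + 1)%C, y))).
  change (it G (S k) (x, y)) with (G (it G k (x, y))).
  rewrite IHk by lia. destruct (hit' x y hx hy k ltac:(lia)) as (_ & _ & c3 & c4).
  rewrite (nm_per _ _ _ hG) by lra. rewrite <- surjective_pairing. reflexivity. }
exists Y. constructor; fold mu.
- intros x hx. apply hY; lra.
- intros x hx. apply hY; lra.
- intros x y hx hy he. apply hu; auto; lra.
- intros x. apply hY; simpl; [rewrite Rabs_R0; lra|auto].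
- intros k x hk hx. destruct (hY x ltac:(lra)) as (y1 & _ & _).
  destruct (hd2 x (Y x) ltac:(lra) ltac:(nra) k hk) as (h1 & h2). split.
  + apply (diff2_comp_path (fun p => fst (it G k p)) (fun x => x) Y); auto using holo_id.
  + apply (diff2_comp_path (fun p => snd (it G k p)) (fun x => x) Y); auto using holo_id.
- intros k x hk hx. destruct (hY x ltac:(lra)) as (y1 & y2 & _).
  destruct (hit' x (Y x) ltac:(lra) ltac:(nra) k hk) as (_ & c2 & _ & _).
  assert (hkq : INR k <= INR q) by (apply le_INR; auto). pose proof (pos_INR k).
  (* The equation of the curve improves the disk: [q (Y x - mu)] is minus the error of the abscissa,
     so [k Y x] differs from [k mu] by at most [K mu]. This is why the final constant is [2 K]. *)
  assert (hYmu : INR q * Cmod (Y x - RtoC mu)%C <= K * mu).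
  { assert (h := hE x (Y x) ltac:(lra) ltac:(nra)). unfold E in h. rewrite y2 in h.
    replace (x + RtoC (INR p) - x - RtoC (INR q) * Y x)%C with (- (RtoC (INR q) * (Y x - RtoC mu)))%C in h.
    - rewrite Cmod_opp, Cmod_mult, Cmod_R, Rabs_pos_eq in h by lra. auto.
    - rewrite <- hqmu, RtoC_mult. ring. }
  replace (fst (it G k (x, Y x)) - x - RtoC (INR k * mu))%C with
    ((fst (it G k (x, Y x)) - x - RtoC (INR k) * Y x) + RtoC (INR k) * (Y x - RtoC mu))%C by (rewrite RtoC_mult; ring).
  eapply Rle_trans; [apply Cmod_triangle|]. rewrite Cmod_mult, Cmod_R, Rabs_pos_eq by auto.
  assert (INR k * Cmod (Y x - RtoC mu)%C <= INR q * Cmod (Y x - RtoC mu)%C) by (apply Rmult_le_compat_r; [apply Cmod_ge_0|auto]).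
  lra.
- intros k x hk hx. destruct (hY x ltac:(lra)) as (y1 & y2 & _).
  destruct (hit' x (Y x) ltac:(lra) ltac:(nra) k hk) as (c1 & _). assert (0 < mu ^ 2) by (apply pow_lt; auto). nra.
- intros k x hk hx. assert (hx1 : Rabs (snd (x + 1)%C) <= a2) by (rewrite hshift; lra).
  destruct (hY x ltac:(lra)) as (y1 & y2 & _). destruct (hY (x + 1)%C hx1) as (z1 & z2 & _).
  assert (he : Y (x + 1)%C = Y x).
  { symmetry. apply hu; auto. rewrite hperG by (auto; nra). cbn [fst snd]. rewrite y2. ring. }
  rewrite he. apply hperG; auto; nra.
- intros k x hk hx. destruct (hY x ltac:(lra)) as (y1 & y2 & _).
  destruct (hit' x (Y x) ltac:(lra) ltac:(nra) k hk) as (_ & _ & _ & c4). lra.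
Qed.

(** [interlaced_zeros_bound] is applied to the displacement [u]. It is at most [2 b] because the
    ordinates stay in the disk of radius [b], and by [pc_x] the points of an orbit are within
    [K p / q <= K L / q] of a translated lattice, whence [D = K L]. *)
Lemma curve_displacement_small G b a2 kp K p q L al s t (Y : C -> C) (f g : nat -> R) :
  0 < s < t -> t < a2 -> al <= t - s -> 0 <= K -> 0 <= b ->
  (1 <= p)%nat -> (1 <= q)%nat -> INR p <= L -> Nat.gcd p q = 1%nat ->
  periodic_curve G a2 b kp K p q Y ->
  (forall k, (k < q)%nat -> RtoC (f k) = fst (it G k (RtoC (f 0%nat), Y (RtoC (f 0%nat)))) /\
     snd (it G q (RtoC (f k), Y (RtoC (f k)))) = Y (RtoC (f k))) ->
  (forall k, (k < q)%nat -> RtoC (g k) = fst (it G k (RtoC (g 0%nat), Y (RtoC (g 0%nat)))) /\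
     snd (it G q (RtoC (g k), Y (RtoC (g k)))) = Y (RtoC (g k))) ->
  (forall k l j, (k < q)%nat -> (l < q)%nat -> f k = f l + IZR j -> k = l) ->
  (forall k l j, (k < q)%nat -> (l < q)%nat -> g k = g l + IZR j -> k = l) ->
  (forall k l j, (k < q)%nat -> (l < q)%nat -> f k <> g l + IZR j) ->
  forall x : R, Cmod (snd (it G q (RtoC x, Y (RtoC x))) - Y (RtoC x))%C <=
   2 * b * (4 * exp (2 * ((kap s + kap t) * (K * L))) / (1 - exp (- (2 * PI * t))) ^ 2) *
   exp (- (2 * PI * al * INR q)).
Proof.
intros hst ht hal hK hb hp hq hpL hg [P1 P2 P3 P4 P5 P6 P7 P8 P9] hf hg' df dg dfg x.
assert (hqR : 1 <= INR q) by (apply (le_INR 1); auto). assert (hpR : 1 <= INR p) by (apply (le_INR 1); auto).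
set (u := fun z => (snd (it G q (z, Y z)) - Y z)%C).
assert (hholo : forall z : C, Rabs (snd z) < a2 -> holo u z).
{ intros z hz. unfold u. apply holo_minus; [apply (P5 q z); auto|]. apply (P5 0%nat z); auto. lia. }
assert (hshift : forall w : C, snd (w + 1)%C = snd w) by (intro w; simpl; ring).
assert (hreg : regular_off a2 u nil).
{ split; [|split].
  - intros z hz. apply holo_ccont; auto.
  - intros; auto.
  - intros z hz. unfold u. rewrite (P8 q z) by auto. cbn [snd].
    assert (h := P8 0%nat z ltac:(lia) hz). simpl in h. apply (f_equal snd) in h. cbn [snd] in h. rewrite h. reflexivity. }
assert (hbd : forall z : C, Rabs (snd z) < a2 -> Cmod (u z) <= 2 * b).
{ intros z hz. unfold u. eapply Rle_trans; [apply Cmod_minus_le|].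
  pose proof (P9 q z (le_n q) hz). pose proof (P9 0%nat z ltac:(lia) hz). simpl in H0. lra. }
assert (hlat : forall f : nat -> R, (forall k, (k < q)%nat -> RtoC (f k) = fst (it G k (RtoC (f 0%nat), Y (RtoC (f 0%nat)))) /\
     snd (it G q (RtoC (f k), Y (RtoC (f k)))) = Y (RtoC (f k))) ->
   forall k, (k < q)%nat -> Rabs (f k - (f 0%nat + INR k * INR p / INR q)) <= K * L / INR q).
{ intros f0 h0 k hk. assert (h := P6 k (RtoC (f0 0%nat)) ltac:(lia)). rewrite <- (proj1 (h0 k hk)) in h.
  rewrite <- !RtoC_minus, Cmod_R in h. simpl snd in h. rewrite Rabs_R0 in h. specialize (h ltac:(lra)).
  replace (f0 k - (f0 0%nat + INR k * INR p / INR q)) with (f0 k - f0 0%nat - INR k * (INR p / INR q)) by (field; lra).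
  eapply Rle_trans; [exact h|]. unfold Rdiv. rewrite <- Rmult_assoc. apply Rmult_le_compat_r.
  - apply Rlt_le, Rinv_0_lt_compat; lra.
  - apply Rmult_le_compat_l; lra. }
assert (main := interlaced_zeros_bound a2 t s u (2 * b) (K * L) f g (f 0%nat) (g 0%nat) p q hst ht hreg ltac:(lra)).
change (snd (it G q (RtoC x, Y (RtoC x))) - Y (RtoC x))%C with (u (RtoC x)).
eapply Rle_trans; [apply main; auto|].
- intros z hz. apply hbd. lra.
- intros k hk. unfold u. rewrite (proj2 (hf k hk)). ring.
- intros k hk. unfold u. rewrite (proj2 (hg' k hk)). ring.
- simpl. rewrite Rabs_R0. lra.
- apply Rmult_le_compat_l.
  + apply Rmult_le_pos; [lra|]. apply Rdiv_le_0_compat.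
    * pose proof (exp_pos (2 * ((kap s + kap t) * (K * L)))). lra.
    * apply pow_lt. assert (exp (- (2 * PI * t)) < exp 0).
      { apply exp_increasing. pose proof PI_RGT_0. assert (0 < PI * t) by (apply Rmult_lt_0_compat; lra). lra. }
      rewrite exp_0 in H. lra.
  + assert (hle : 2 * PI * al * INR q <= 2 * PI * (t - s) * INR q).
    { pose proof PI_RGT_0. apply Rmult_le_compat_r; [lra|]. apply Rmult_le_compat_l; lra. }
    destruct hle as [hle|hle]; [left; apply exp_increasing; lra|right; f_equal; lra].
Qed.

(** One ordinate [y j = O(mu)] is enough. In [q] steps the abscissa gains exactly [p = q mu], but
    also [q y j] up to [O(mu)]; so [y j] is within [O(mu / q)] of [mu], and [1/q <= mu]. The other
    ordinates differ from [y j] by [O(mu^2)]. *)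
Lemma orbit_near_curve G a b kp C0 L : normal_map G a b -> 0 < kp -> 0 <= C0 -> 1 <= L ->
  exists m, 0 < m /\ forall p q : nat, (1 <= p)%nat -> (1 <= q)%nat -> INR p <= L -> INR p / INR q <= m ->
  forall x y : Z -> R,
  (forall k, G (RtoC (x k), RtoC (y k)) = (RtoC (x (k + 1)%Z), RtoC (y (k + 1)%Z))) ->
  (forall k, x (k + Z.of_nat q)%Z = x k + INR p) -> (forall k, y (k + Z.of_nat q)%Z = y k) ->
  (exists j, Rabs (y j) <= C0 * (INR p / INR q)) ->
  forall k, Cmod (RtoC (y k) - RtoC (INR p / INR q))%C <= kp * (INR p / INR q).
Proof.
intros hG hkp hC0 hL. pose proof (nm_a _ _ _ hG) as ha.
set (a1 := a / 2).
destruct (normal_map_bounds G a b a1 hG ltac:(unfold a1; lra)) as (b1 & M & hb1 & hM & hbd).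
destruct (iterate_estimates G a1 b1 M (a1/2) (C0 + 1) L ltac:(unfold a1; lra) ltac:(lra) hM ltac:(lra) hL hbd) as (K & m0 & hK & hm0 & hit).
set (m := Rmin m0 (kp / (2 * K + 1))).
assert (hm : 0 < m) by (apply Rmin_pos; [auto|apply Rdiv_lt_0_compat; lra]).
assert (hma : m <= m0) by apply Rmin_l. assert (hmb : m <= kp / (2 * K + 1)) by apply Rmin_r.
assert (hmc : 2 * K * m <= kp).
{ apply Rmult_le_compat_r with (r := 2 * K + 1) in hmb; [|lra]. replace (kp / (2 * K + 1) * (2 * K + 1)) with kp in hmb by (field; lra). lra. }
clearbody m. exists m. split; auto.
intros p q hp hq hpL hmum x y horb hx hy (j & hj).
set (mu := INR p / INR q) in *.
assert (hpR : 1 <= INR p) by (apply (le_INR 1); auto). assert (hqR : 1 <= INR q) by (apply (le_INR 1); auto).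
assert (hmu : 0 < mu) by (apply Rdiv_lt_0_compat; lra).
assert (hqmu : INR q * mu = INR p) by (unfold mu; field; lra).
assert (hiter : forall k : nat, it G k (RtoC (x j), RtoC (y j)) = (RtoC (x (j + Z.of_nat k)%Z), RtoC (y (j + Z.of_nat k)%Z))).
{ induction k.
  - simpl. rewrite Z.add_0_r. reflexivity.
  - change (it G (S k) (RtoC (x j), RtoC (y j))) with (G (it G k (RtoC (x j), RtoC (y j)))).
    rewrite IHk, horb. rewrite Nat2Z.inj_succ. replace (j + Z.of_nat k + 1)%Z with (j + Z.succ (Z.of_nat k))%Z by lia. reflexivity. }
assert (hest := fun k hk => hit p q hq hpL mu eq_refl hmu ltac:(lra) (RtoC (x j)) (RtoC (y j))
  ltac:(simpl; rewrite Rabs_R0; unfold a1; lra) ltac:(rewrite Cmod_R; nra) ltac:(simpl; rewrite Rabs_R0; unfold a1; lra) k hk).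
assert (hyj : Rabs (y j - mu) <= K * mu ^ 2).
{ destruct (hest q (le_n q)) as (_ & h & _). rewrite hiter in h. cbn [fst] in h. rewrite hx in h.
  rewrite <- RtoC_mult, <- !RtoC_minus, Cmod_R in h.
  replace (x j + INR p - x j - INR q * y j) with (- (INR q * (y j - mu))) in h by (rewrite <- hqmu; ring).
  rewrite Rabs_Ropp, Rabs_mult, (Rabs_pos_eq (INR q)) in h by lra.
  assert (1 <= INR q * mu) by lra.
  assert (h2 : INR q * Rabs (y j - mu) <= INR q * (K * mu ^ 2)).
  { eapply Rle_trans; [exact h|]. replace (INR q * (K * mu ^ 2)) with (K * mu * (INR q * mu)) by ring.
    assert (0 <= K * mu) by (apply Rmult_le_pos; lra). nra. }
  apply Rmult_le_reg_l in h2; lra. }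
intro k.
assert (hper : forall n : nat, forall l, y (l + Z.of_nat n * Z.of_nat q)%Z = y l).
{ induction n; intro l; [f_equal; lia|].
  replace (l + Z.of_nat (S n) * Z.of_nat q)%Z with ((l + Z.of_nat n * Z.of_nat q) + Z.of_nat q)%Z by lia. rewrite hy. auto. }
assert (hperZ : forall n l, y (l + n * Z.of_nat q)%Z = y l).
{ intros n l. destruct (Z_le_gt_dec 0 n).
  - rewrite <- (Z2Nat.id n) by lia. apply hper.
  - rewrite <- (hper (Z.to_nat (- n)) (l + n * Z.of_nat q)%Z). f_equal. rewrite Z2Nat.id by lia. lia. }
set (i := Z.to_nat ((k - j) mod Z.of_nat q)).
assert (hq0 : (0 < Z.of_nat q)%Z) by lia.
pose proof (Z.mod_pos_bound (k - j) (Z.of_nat q) hq0) as hmod.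
assert (hk : y k = y (j + Z.of_nat i)%Z).
{ rewrite <- (hperZ ((k - j) / Z.of_nat q)%Z (j + Z.of_nat i)%Z). f_equal.
  unfold i. rewrite Z2Nat.id by lia. pose proof (Z.div_mod (k - j) (Z.of_nat q) ltac:(lia)). lia. }
destruct (hest i) as (h & _). { unfold i. lia. }
rewrite hiter in h. cbn [snd] in h. rewrite <- hk in h.
eapply Rle_trans; [apply (Cmod_minus_trans _ (RtoC (y j)))|].
rewrite <- (RtoC_minus (y j)), Cmod_R.
assert (2 * K * mu * mu <= kp * mu) by (apply Rmult_le_compat_r; nra). nra.
Qed.

(** Cauchy estimates on disks of radius [a2] centred on the real line, with constants independent of
    [q]. The abscissa is bounded only after subtraction of [x], whence the extra 1. *)
Lemma curve_lipschitz G a2 b kp K p q L (Y : C -> C) : 0 < a2 -> 0 <= K -> 0 <= b ->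
  (1 <= p)%nat -> (1 <= q)%nat -> INR p <= L -> periodic_curve G a2 b kp K p q Y ->
  forall k (x x' : R), (k <= q)%nat ->
  Cmod (fst (it G k (RtoC x, Y (RtoC x))) - fst (it G k (RtoC x', Y (RtoC x'))))%C <= (1 + 4 * ((K + 1) * L) / a2) * Rabs (x - x') /\
  Cmod (snd (it G k (RtoC x, Y (RtoC x))) - snd (it G k (RtoC x', Y (RtoC x'))))%C <= 4 * b / a2 * Rabs (x - x').
Proof.
intros ha hK hb hp hq hpL [P1 P2 P3 P4 P5 P6 P7 P8 P9] k x x' hk.
assert (hqR : 1 <= INR q) by (apply (le_INR 1); auto). assert (hpR : 1 <= INR p) by (apply (le_INR 1); auto).
assert (gen : forall (h : C -> C) B, (forall z : C, Rabs (snd z) < a2 -> holo h z) -> (forall z : C, Rabs (snd z) < a2 -> Cmod (h z) <= B) ->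
  Cmod (h (RtoC x) - h (RtoC x'))%C <= 4 * B / a2 * Rabs (x - x')).
{ intros h B hh hB. rewrite <- Cmod_R, RtoC_minus. apply lip_segment. intros t ht.
  set (w := (RtoC x' + RtoC t * (RtoC x - RtoC x'))%C).
  assert (hw : snd w = 0). { unfold w; simpl. ring. }
  assert (hin : forall v, Cmod (v - w)%C < a2 -> Rabs (snd v) < a2).
  { intros v hv. pose proof (snd_le_Cmod (v - w)%C). rewrite snd_minus, hw, Rminus_0_r in H. lra. }
  assert (hw0 : Cmod (w - w)%C < a2) by (rewrite Cmod_self; auto).
  exists (der h w). split; [apply der_spec, hh, hin; auto|].
  apply (cauchy_deriv h w); auto. apply der_spec, hh, hin; auto. }
split.
- assert (h := gen (fun z => fst (it G k (z, Y z)) - z)%C ((K + 1) * L)).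
  replace (fst (it G k (RtoC x, Y (RtoC x))) - fst (it G k (RtoC x', Y (RtoC x'))))%C with
    ((fst (it G k (RtoC x, Y (RtoC x))) - RtoC x - (fst (it G k (RtoC x', Y (RtoC x'))) - RtoC x')) + RtoC (x - x'))%C by (rewrite RtoC_minus; ring).
  eapply Rle_trans; [apply Cmod_triangle|]. rewrite Cmod_R.
  rewrite Rmult_plus_distr_r, Rmult_1_l, Rplus_comm. apply Rplus_le_compat_l. apply h.
  + intros z hz. apply holo_minus; [apply (P5 k z); auto|apply holo_id].
  + intros z hz. assert (h6 := P6 k z hk hz).
    assert (hmu : INR p / INR q <= INR p).
    { apply Rmult_le_reg_r with (INR q); [lra|]. replace (INR p / INR q * INR q) with (INR p) by (field; lra). nra. }
    assert (hmu0 : 0 < INR p / INR q) by (apply Rdiv_lt_0_compat; lra).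
    assert (hkq : INR k <= INR q) by (apply le_INR; auto). pose proof (pos_INR k).
    assert (hkm : Rabs (INR k * (INR p / INR q)) <= L).
    { rewrite Rabs_pos_eq by (apply Rmult_le_pos; lra).
      apply Rle_trans with (INR q * (INR p / INR q)); [apply Rmult_le_compat_r; lra|].
      replace (INR q * (INR p / INR q)) with (INR p) by (field; lra). auto. }
    pose proof (Cmod_le_minus (fst (it G k (z, Y z)) - z) (RtoC (INR k * (INR p / INR q))))%C as h1.
    rewrite Cmod_R in h1. assert (K * (INR p / INR q) <= K * L) by (apply Rmult_le_compat_l; lra). lra.
- apply (gen (fun z => snd (it G k (z, Y z)))).
  + intros z hz. apply (P5 k z); auto.
  + intros z hz. apply Rlt_le. apply P9; auto.
Qed.

(** * Boundary coordinates *)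

(** Strict differentiability: the linear approximation holds for the increment between any two
    nearby points. This is what bi-Lipschitz bounds on a chart require. *)
Definition sdiff (f : R -> R -> R) (x y A B : R) : Prop :=
  forall e, 0 < e -> exists d, 0 < d /\ forall h k h' k',
    Rabs h <= d -> Rabs k <= d -> Rabs h' <= d -> Rabs k' <= d ->
    Rabs (f (x + h) (y + k) - f (x + h') (y + k') - A * (h - h') - B * (k - k')) <=
    e * (Rabs (h - h') + Rabs (k - k')).

(** The factor [r] on the left avoids the exponent [n - 1], so that [n = 0] and [r = 0] are no
    exceptions. *)
Lemma pow_diff_bound x y r n : Rabs x <= r -> Rabs y <= r ->
  r * Rabs (x ^ n - y ^ n) <= INR n * r ^ n * Rabs (x - y).
Proof.
intros hx hy. assert (hr : 0 <= r) by (pose proof (Rabs_pos x); lra).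
induction n.
- simpl. rewrite Rminus_diag, Rabs_R0. lra.
- rewrite S_INR. replace (x ^ S n - y ^ S n) with (x * (x ^ n - y ^ n) + (x - y) * y ^ n) by (simpl; ring).
  eapply Rle_trans; [apply Rmult_le_compat_l; [auto|apply Rabs_triang]|].
  rewrite !Rabs_mult, <- RPow_abs.
  assert (h1 : Rabs y ^ n <= r ^ n) by (apply pow_incr; split; [apply Rabs_pos|auto]).
  assert (h2 : 0 <= r * Rabs (x ^ n - y ^ n)) by (apply Rmult_le_pos; [auto|apply Rabs_pos]).
  assert (h3 : Rabs x * (r * Rabs (x ^ n - y ^ n)) <= r * (INR n * r ^ n * Rabs (x - y))) by (apply Rmult_le_compat; auto; apply Rabs_pos).
  assert (h4 : 0 <= r * Rabs (x - y)) by (apply Rmult_le_pos; [auto|apply Rabs_pos]).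
  assert (h5 : r * Rabs (x - y) * Rabs y ^ n <= r * Rabs (x - y) * r ^ n) by (apply Rmult_le_compat_l; auto).
  simpl. nra.
Qed.

Lemma monomial_diff_bound h k h' k' r i j : Rabs h <= r -> Rabs k <= r -> Rabs h' <= r -> Rabs k' <= r ->
  r * Rabs (h ^ i * k ^ j - h' ^ i * k' ^ j) <= INR (i + j) * r ^ (i + j) * (Rabs (h - h') + Rabs (k - k')).
Proof.
intros h1 h2 h3 h4. assert (hr : 0 <= r) by (pose proof (Rabs_pos h); lra).
replace (h ^ i * k ^ j - h' ^ i * k' ^ j) with ((h ^ i - h' ^ i) * k ^ j + h' ^ i * (k ^ j - k' ^ j)) by ring.
eapply Rle_trans; [apply Rmult_le_compat_l; [auto|apply Rabs_triang]|].
rewrite !Rabs_mult, <- !RPow_abs.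
assert (p1 : Rabs k ^ j <= r ^ j) by (apply pow_incr; split; [apply Rabs_pos|auto]).
assert (p2 : Rabs h' ^ i <= r ^ i) by (apply pow_incr; split; [apply Rabs_pos|auto]).
pose proof (pow_diff_bound h h' r i h1 h3) as q1. pose proof (pow_diff_bound k k' r j h2 h4) as q2.
assert (p3 : 0 <= Rabs k ^ j) by (apply pow_le, Rabs_pos). assert (p4 : 0 <= Rabs h' ^ i) by (apply pow_le, Rabs_pos).
assert (q3 : r * Rabs (h ^ i - h' ^ i) * Rabs k ^ j <= INR i * r ^ i * Rabs (h - h') * r ^ j).
{ apply Rmult_le_compat; auto. apply Rmult_le_pos; [auto|apply Rabs_pos]. }
assert (q4 : Rabs h' ^ i * (r * Rabs (k ^ j - k' ^ j)) <= r ^ i * (INR j * r ^ j * Rabs (k - k'))).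
{ apply Rmult_le_compat; auto. apply Rmult_le_pos; [auto|apply Rabs_pos]. }
rewrite pow_add, plus_INR.
assert (0 <= INR i * (r ^ i * r ^ j) * Rabs (k - k')).
{ repeat apply Rmult_le_pos; try apply Rabs_pos; try apply pos_INR; apply pow_le; auto. }
assert (0 <= INR j * (r ^ i * r ^ j) * Rabs (h - h')).
{ repeat apply Rmult_le_pos; try apply Rabs_pos; try apply pos_INR; apply pow_le; auto. }
nra.
Qed.

Lemma S_le_pow2 n : INR n + 1 <= 2 ^ n.
Proof. induction n; [simpl; lra|]. rewrite S_INR. simpl. pose proof (pos_INR n). lra. Qed.

Lemma sum_n_Rminus (u v : nat -> R) n : sum_n u n - sum_n v n = sum_n (fun i => u i - v i) n.
Proof.
induction n; [rewrite !sum_O; reflexivity|]. rewrite !sum_Sn, <- IHn. unfold plus; simpl. ring.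
Qed.

Lemma Rabs_sum_n_le (u v : nat -> R) (r M : R) n : 0 <= r ->
  (forall i, (i <= n)%nat -> r * Rabs (u i) <= v i * M) -> r * Rabs (sum_n u n) <= sum_n v n * M.
Proof.
intros hr. induction n; intro h.
- rewrite !sum_O. apply h. lia.
- rewrite !sum_Sn. unfold plus; simpl. specialize (IHn ltac:(intros; apply h; lia)). specialize (h (S n) (le_n _)).
  assert (r * Rabs (sum_n u n + u (S n)) <= r * (Rabs (sum_n u n) + Rabs (u (S n)))) by (apply Rmult_le_compat_l; [auto|apply Rabs_triang]).
  lra.
Qed.

Lemma is_series_geom_bound (u : nat -> R) l M : is_series u l -> (forall k, Rabs (u k) <= M * (/ 2) ^ k) -> Rabs l <= M * 2.
Proof.
intros hu hb.
assert (hg : is_series (fun k => M * (/ 2) ^ k) (M * 2)).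
{ replace (M * 2) with (M * / (1 - / 2)) by field.
  apply (is_series_scal_l M (fun k => (/ 2) ^ k) (/ (1 - / 2))).
  apply is_series_geom. rewrite Rabs_pos_eq; lra. }
rewrite <- (is_series_unique _ _ hu), <- (is_series_unique _ _ hg).
eapply Rle_trans; [apply Series_Rabs|].
- apply (ex_series_le (K := R_AbsRing) (V := R_CompleteNormedModule) _ (fun k => M * (/ 2) ^ k)).
  + intro k. unfold norm; simpl. unfold abs; simpl. rewrite Rabs_Rabsolu. auto.
  + eexists; exact hg.
- apply Series_le; [|eexists; exact hg]. intro k. split; [apply Rabs_pos|auto].
Qed.

(** On a box of radius [r = dl s], the terms of total degree [n >= 2] contribute at most
    [B n s^n / r] times the increments; their sum is of order [B s / dl], small with [s]. *)
Lemma analytic2_sdiff f x y : analytic2_at f x y -> exists A B, sdiff f x y A B.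
Proof.
intros (a & dl & hdl & hex & hser).
set (S := fun n => sum_n (fun i => Rabs (a i (n - i)%nat) * dl ^ n) n) in *.
assert (hB : exists B, 0 < B /\ forall n, S n <= B).
{ pose proof (ex_series_lim_0 _ hex) as hl. apply is_lim_seq_Reals in hl.
  destruct (maj_by_pos S) as (B & hB & h). { exists 0. exact hl. }
  exists B; split; auto. intro n. eapply Rle_trans; [apply Rle_abs|apply h]. }
destruct hB as (B & hB0 & hB).
exists (a 1%nat 0%nat), (a 0%nat 1%nat). intros e he.
(* [s <= 1/4] makes [n s^n] decay like the powers of [1/2], and [32 B s <= e dl] leaves room for the
   constants. *)
set (s := Rmin (/ 4) (e * dl / (32 * B))).
assert (hs : 0 < s). { apply Rmin_pos; [lra|]. apply Rdiv_lt_0_compat; [apply Rmult_lt_0_compat; auto|lra]. }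
assert (hs4 : s <= / 4) by apply Rmin_l.
assert (hse : 32 * B * s <= e * dl).
{ assert (h : s <= e * dl / (32 * B)) by apply Rmin_r. apply Rmult_le_compat_l with (r := 32 * B) in h; [|lra].
  replace (32 * B * (e * dl / (32 * B))) with (e * dl) in h by (field; lra). auto. }
clearbody s. set (r := dl * s). assert (hr : 0 < r) by (apply Rmult_lt_0_compat; auto).
assert (hrd : r < dl) by (unfold r; nra).
exists r. split; auto. intros h k h' k' b1 b2 b3 b4.
set (D := Rabs (h - h') + Rabs (k - k')). assert (hD : 0 <= D) by (unfold D; pose proof (Rabs_pos (h - h')); pose proof (Rabs_pos (k - k')); lra).
assert (h1 := hser h k ltac:(lra) ltac:(lra)). assert (h2 := hser h' k' ltac:(lra) ltac:(lra)).
set (T := fun n => sum_n (fun i => a i (n - i)%nat * (h ^ i * k ^ (n - i) - h' ^ i * k' ^ (n - i))) n).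
assert (hT : is_series T (f (x + h) (y + k) - f (x + h') (y + k'))).
{ eapply is_series_ext; [|apply (is_series_minus _ _ _ _ h1 h2)].
  intro n. unfold T, minus, plus, opp; simpl.
  change (sum_n (fun i => a i (n - i)%nat * h ^ i * k ^ (n - i)) n - sum_n (fun i => a i (n - i)%nat * h' ^ i * k' ^ (n - i)) n =
    sum_n (fun i => a i (n - i)%nat * (h ^ i * k ^ (n - i) - h' ^ i * k' ^ (n - i))) n).
  rewrite sum_n_Rminus. apply sum_n_ext. intro i.
  match goal with |- ?u = ?v => change (@eq R u v) end. ring. }
assert (hTn : forall n, r * Rabs (T n) <= B * (INR n * s ^ n * D)).
{ intro n. apply Rle_trans with (S n * (INR n * s ^ n * D)).
  - unfold T, S. apply Rabs_sum_n_le; [lra|]. intros i hi. rewrite Rabs_mult.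
    pose proof (monomial_diff_bound h k h' k' r i (n - i) b1 b2 b3 b4) as hm.
    replace (i + (n - i))%nat with n in hm by lia. fold D in hm.
    assert (hrn : r ^ n = dl ^ n * s ^ n) by (unfold r; apply Rpow_mult_distr).
    rewrite hrn in hm. pose proof (Rabs_pos (a i (n - i)%nat)).
    assert (Rabs (a i (n - i)%nat) * (r * Rabs (h ^ i * k ^ (n - i) - h' ^ i * k' ^ (n - i))) <=
        Rabs (a i (n - i)%nat) * (INR n * (dl ^ n * s ^ n) * D)) by (apply Rmult_le_compat_l; auto).
    lra.
  - apply Rmult_le_compat_r; auto. repeat apply Rmult_le_pos; auto; [apply pos_INR|apply pow_le; lra]. }
set (lin := a 1%nat 0%nat * (h - h') + a 0%nat 1%nat * (k - k')).
(* The term of degree 0 cancels and that of degree 1 is the linear part [lin]. *)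
assert (hT2 : is_series (fun j => T (2 + j)%nat) (f (x + h) (y + k) - f (x + h') (y + k') - lin)).
{ apply (is_series_incr_n T 2); [lia|].
  assert (heq : @eq R (plus (f (x + h) (y + k) - f (x + h') (y + k') - lin) (sum_n T 1)) (f (x + h) (y + k) - f (x + h') (y + k'))).
  { rewrite sum_Sn, sum_O. unfold T. rewrite !sum_Sn, !sum_O. unfold plus, lin; simpl. ring. }
  rewrite <- heq in hT. exact hT. }
replace (f (x + h) (y + k) - f (x + h') (y + k') - a 1%nat 0%nat * (h - h') - a 0%nat 1%nat * (k - k')) with
  (f (x + h) (y + k) - f (x + h') (y + k') - lin) by (unfold lin; ring).
replace (e * D) with (e * D / 2 * 2) by field.
apply (is_series_geom_bound _ _ _ hT2). intro j.
assert (hb := hTn (2 + j)%nat).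
assert (hj : INR (2 + j) * s ^ (2 + j) <= 2 * s * s * (/ 2) ^ j).
{ rewrite plus_INR, pow_add. simpl INR. pose proof (S_le_pow2 j).
  assert (hsj : s ^ j <= (/ 4) ^ j) by (apply pow_incr; lra).
  assert (hq : (/ 4) ^ j = (/ 2) ^ j * (/ 2) ^ j) by (rewrite <- Rpow_mult_distr; f_equal; lra).
  assert (hp : 2 ^ j * (/ 2) ^ j = 1) by (rewrite <- Rpow_mult_distr; replace (2 * / 2) with 1 by lra; apply pow1).
  assert (p2 : 0 < (/ 2) ^ j) by (apply pow_lt; lra). assert (p3 : 0 <= s ^ j) by (apply pow_le; lra).
  pose proof (pos_INR j). assert (1 <= 2 ^ j) by (apply pow_R1_Rle; lra).
  assert (q1 : (1 + 1 + INR j) * s ^ j <= (2 * 2 ^ j) * ((/ 2) ^ j * (/ 2) ^ j)).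
  { apply Rmult_le_compat; lra. }
  replace (2 * 2 ^ j * ((/ 2) ^ j * (/ 2) ^ j)) with (2 * (2 ^ j * (/ 2) ^ j) * (/ 2) ^ j) in q1 by ring. rewrite hp in q1.
  replace ((1 + 1 + INR j) * (s ^ 2 * s ^ j)) with (s * s * ((1 + 1 + INR j) * s ^ j)) by ring.
  replace (2 * s * s * (/ 2) ^ j) with (s * s * (2 * 1 * (/ 2) ^ j)) by ring. apply Rmult_le_compat_l; [nra|auto]. }
apply Rmult_le_reg_l with r; auto. eapply Rle_trans; [exact hb|].
assert (p2 : 0 < (/ 2) ^ j) by (apply pow_lt; lra).
apply Rle_trans with (B * (2 * s * s * (/ 2) ^ j * D)).
{ apply Rmult_le_compat_l; [lra|]. apply Rmult_le_compat_r; auto. }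
assert (hed : 0 < e * dl) by (apply Rmult_lt_0_compat; auto).
unfold r. assert (h0 : 0 <= s * (/ 2) ^ j * D) by (repeat apply Rmult_le_pos; lra).
assert (2 * B * s * (s * (/ 2) ^ j * D) <= e * dl / 2 * (s * (/ 2) ^ j * D)) by (apply Rmult_le_compat_r; lra).
lra.
Qed.

Lemma sdiff_derive_x f x y A B : sdiff f x y A B -> is_derive (fun t => f t y) x A.
Proof.
intro h. apply is_derive_Reals. intros e he. destruct (h (e/2) ltac:(lra)) as (d & hd & hh).
exists (mkposreal d hd). intros u hu hud. simpl in hud.
specialize (hh u 0 0 0). rewrite !Rplus_0_r, !Rminus_0_r, Rabs_R0, Rmult_0_r, Rplus_0_r, Rminus_0_r in hh.
specialize (hh ltac:(lra) ltac:(lra) ltac:(lra) ltac:(lra)).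
assert (hup : 0 < Rabs u) by (apply Rabs_pos_lt; auto).
replace ((f (x + u) y - f x y) / u - A) with ((f (x + u) y - f x y - A * u) / u) by (field; auto).
unfold Rdiv. rewrite Rabs_mult, Rabs_inv.
apply Rmult_lt_reg_r with (Rabs u); auto. rewrite Rmult_assoc, Rinv_l, Rmult_1_r by lra. nra.
Qed.

Lemma sdiff_derive_y f x y A B : sdiff f x y A B -> is_derive (fun t => f x t) y B.
Proof.
intro h. apply (sdiff_derive_x (fun a b => f b a) y x B A).
intros e he. destruct (h e he) as (d & hd & hh). exists d; split; auto.
intros a k a' k' h1 h2 h3 h4. specialize (hh k a k' a' h2 h1 h4 h3).
eapply Rle_trans; [|eapply Rle_trans; [exact hh|right; ring]]. right. f_equal. ring.
Qed.

Lemma continuous_integer_const (f : R -> R) a b : a <= b ->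
  (forall x, a <= x <= b -> exists d, 0 < d /\ forall y, Rabs (y - x) < d -> Rabs (f y - f x) < 1) ->
  (forall x, a <= x <= b -> exists n : Z, f x = IZR n) -> f a = f b.
Proof.
intros hab hc hz. apply (interval_induction (fun u v => f u = f v) a b hab).
- intros; congruence.
- intros x hx. destruct (hc x hx) as (d & hd & h). exists d; split; auto.
  intros u v h1 h2 h3 h4 h5 h6. destruct (hz x hx) as (n & hn).
  assert (hi : forall y, a <= y <= b -> Rabs (y - x) < d -> f y = f x).
  { intros y hy hyd. destruct (hz y hy) as (k & hk). specialize (h y hyd). rewrite hk, hn in *.
    rewrite <- minus_IZR, <- abs_IZR in h. apply lt_IZR in h. f_equal. lia. }
  rewrite (hi u), (hi v); auto; try lra; apply Rabs_def1; lra.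
Qed.

Lemma sign_const (A : R -> R) : (forall x, A x <> 0) ->
  (forall x, exists d, 0 < d /\ forall y, Rabs (y - x) < d -> Rabs (A y - A x) < Rabs (A x)) ->
  exists s, (s = 1 \/ s = -1) /\ forall x, 0 < s * A x.
Proof.
intros hA hc.
assert (hprod : forall u v, 0 < A u * A v -> (0 < A u /\ 0 < A v) \/ (A u < 0 /\ A v < 0)).
{ intros u v h. destruct (Rtotal_order (A u) 0) as [q|[q|q]]; [right|exfalso; apply (hA u); auto|left]; split; auto; nra. }
assert (key : forall a b, a <= b -> 0 < A a * A b).
{ intros a b hab. apply (interval_induction (fun u v => 0 < A u * A v) a b hab).
  - intros u v w _ _ _ _ h1 h2. destruct (hprod _ _ h1) as [(p1 & p2)|(p1 & p2)]; destruct (hprod _ _ h2) as [(q1 & q2)|(q1 & q2)]; try lra; nra.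
  - intros x _. destruct (hc x) as (d & hd & h). exists d; split; auto.
    intros u v _ h2 h3 h4 h5 _.
    assert (p1 := h u ltac:(apply Rabs_def1; lra)). assert (p2 := h v ltac:(apply Rabs_def1; lra)).
    apply Rabs_def2 in p1. apply Rabs_def2 in p2. unfold Rabs in p1, p2. destruct (Rcase_abs (A x)); nra. }
assert (key0 : forall x, 0 < A 0 * A x).
{ intro x. destruct (Rle_or_lt 0 x); [apply key; auto|]. rewrite Rmult_comm. apply key; lra. }
destruct (Rle_or_lt 0 (A 0)).
- exists 1. split; auto. intro x. destruct (hprod _ _ (key0 x)) as [(p1 & p2)|(p1 & p2)]; lra.
- exists (-1). split; auto. intro x. destruct (hprod _ _ (key0 x)) as [(p1 & p2)|(p1 & p2)]; lra.
Qed.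

(** [s] and [t] are the signs of [dX/dtheta] and [dY/dr]. *)
Definition chart_on (X Y : R -> R -> R) (s t c K e d u v : R) : Prop :=
  forall th th' r r', u <= th -> th <= th' -> th' <= v -> Rabs r <= d -> Rabs r' <= d ->
    c * (th' - th) <= s * (X th' r - X th r) <= K * (th' - th) /\
    Rabs (X th r' - X th r) <= K * Rabs (r' - r) /\
    (r <= r' -> c * (r' - r) <= t * (Y th r' - Y th r) <= K * (r' - r)) /\
    Rabs (Y th' r - Y th r) <= e * (th' - th).

Lemma chart_on_glue X Y s t c K e d u v w : u <= v -> v <= w ->
  chart_on X Y s t c K e d u v -> chart_on X Y s t c K e d v w -> chart_on X Y s t c K e d u w.
Proof.
intros huv hvw h1 h2 th th' r r' b1 b2 b3 b4 b5.
destruct (Rle_or_lt th' v) as [q|q]; [apply h1; auto|].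
destruct (Rle_or_lt v th) as [q'|q']; [apply h2; auto|].
destruct (h1 th v r r') as (p1 & p2 & p3 & p4); auto; try lra.
destruct (h2 v th' r r') as (n1 & n2 & n3 & n4); auto; try lra.
split; [lra|]. split; auto. split; auto.
replace (Y th' r - Y th r) with ((Y th' r - Y v r) + (Y v r - Y th r)) by ring.
eapply Rle_trans; [apply Rabs_triang|]. lra.
Qed.

Lemma chart_on_weaken X Y s t c K e d u v c' K' e' d' u' v' : chart_on X Y s t c K e d u v ->
  c' <= c -> K <= K' -> e <= e' -> d' <= d -> u <= u' -> v' <= v -> chart_on X Y s t c' K' e' d' u' v'.
Proof.
intros h h1 h2 h3 h4 h5 h6 th th' r r' b1 b2 b3 b4 b5.
destruct (h th th' r r') as (p1 & p2 & p3 & p4); try lra.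
pose proof (Rabs_pos (r' - r)). split; [nra|]. split; [nra|]. split; [|nra].
intro hr. specialize (p3 hr). nra.
Qed.

(** [Y] vanishes on the boundary, so its derivative in the angle is 0 there: this is why the slope
    [e] can be made as small as desired, at the cost of [d]. *)
Lemma chart_on_local X Y s t th0 A BX BY c K e : (s = 1 \/ s = -1) -> (t = 1 \/ t = -1) ->
  sdiff X th0 0 A BX -> sdiff Y th0 0 0 BY -> 0 < c -> 2 * c <= s * A -> 2 * c <= t * BY ->
  s * A + t * BY + Rabs BX + c <= K -> 0 < e ->
  exists d, 0 < d /\ chart_on X Y s t c K e d (th0 - d) (th0 + d).
Proof.
intros hs ht hX hY hc hcA hcB hK he.
assert (he' : 0 < Rmin e c) by (apply Rmin_pos; auto).
destruct (hX _ he') as (d1 & hd1 & g1). destruct (hY _ he') as (d2 & hd2 & g2).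
exists (Rmin d1 d2). split; [apply Rmin_pos; auto|].
intros th th' r r' b1 b2 b3 b4 b5.
pose proof (Rmin_l d1 d2). pose proof (Rmin_r d1 d2). pose proof (Rmin_l e c). pose proof (Rmin_r e c).
set (e1 := Rmin e c) in *. set (d := Rmin d1 d2) in *.
assert (hth : Rabs (th - th0) <= d) by (apply Rabs_le; lra). assert (hth' : Rabs (th' - th0) <= d) by (apply Rabs_le; lra).
assert (gx : forall a a' k k', Rabs (a - th0) <= d -> Rabs (a' - th0) <= d -> Rabs k <= d -> Rabs k' <= d ->
  Rabs (X a k - X a' k' - A * (a - a') - BX * (k - k')) <= e1 * (Rabs (a - a') + Rabs (k - k')) /\
  Rabs (Y a k - Y a' k' - BY * (k - k')) <= e1 * (Rabs (a - a') + Rabs (k - k'))).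
{ intros a a' k k' q1 q2 q3 q4.
  assert (w1 := g1 (a - th0) k (a' - th0) k' ltac:(lra) ltac:(lra) ltac:(lra) ltac:(lra)).
  assert (w2 := g2 (a - th0) k (a' - th0) k' ltac:(lra) ltac:(lra) ltac:(lra) ltac:(lra)).
  replace (th0 + (a - th0)) with a in * by ring. replace (th0 + (a' - th0)) with a' in * by ring.
  rewrite !Rplus_0_l in *. replace (a - th0 - (a' - th0)) with (a - a') in * by ring.
  split; auto. replace (Y a k - Y a' k' - BY * (k - k')) with (Y a k - Y a' k' - 0 * (a - a') - BY * (k - k')) by ring. auto. }
assert (hs2 : s * s = 1) by (destruct hs; subst; ring). assert (ht2 : t * t = 1) by (destruct ht; subst; ring).
assert (hsabs : forall z, Rabs (s * z) = Rabs z).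
{ intro z. destruct hs; subst s. rewrite Rmult_1_l; auto. replace (-1 * z) with (- z) by ring. apply Rabs_Ropp. }
assert (htabs : forall z, Rabs (t * z) = Rabs z).
{ intro z. destruct ht; subst t. rewrite Rmult_1_l; auto. replace (-1 * z) with (- z) by ring. apply Rabs_Ropp. }
pose proof (Rabs_pos BX) as hBX.
destruct (gx th' th r r hth' hth b4 b4) as (x1 & y1).
replace (r - r) with 0 in x1, y1 by ring. rewrite Rabs_R0, Rmult_0_r, Rplus_0_r, Rminus_0_r, (Rabs_pos_eq (th' - th)) in x1 by lra.
rewrite Rabs_R0, Rmult_0_r, Rplus_0_r, Rminus_0_r, (Rabs_pos_eq (th' - th)) in y1 by lra.
destruct (gx th th r' r hth hth b5 b4) as (x2 & y2).
replace (th - th) with 0 in x2, y2 by ring. rewrite Rabs_R0 in x2, y2. rewrite Rmult_0_r, Rminus_0_r in x2. rewrite Rplus_0_l in x2, y2.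
split; [|split; [|split]].
- rewrite <- hsabs in x1. apply Rabs_le_between in x1.
  replace (s * (X th' r - X th r - A * (th' - th))) with (s * (X th' r - X th r) - s * A * (th' - th)) in x1 by ring.
  nra.
- replace (X th r' - X th r) with ((X th r' - X th r - BX * (r' - r)) + BX * (r' - r)) by ring.
  eapply Rle_trans; [apply Rabs_triang|]. rewrite Rabs_mult. pose proof (Rabs_pos (r' - r)). nra.
- intro hr. rewrite (Rabs_pos_eq (r' - r)) in y2 by lra. rewrite <- htabs in y2. apply Rabs_le_between in y2.
  replace (t * (Y th r' - Y th r - BY * (r' - r))) with (t * (Y th r' - Y th r) - t * BY * (r' - r)) in y2 by ring.
  nra.
- eapply Rle_trans; [exact y1|]. apply Rmult_le_compat_r; lra.
Qed.

(** The chart is nearly triangular: the dependence of [Y] on the angle is bounded by [e] with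
    [4 K e <= c^2], which makes the system invertible in [chart_bilip] and [chart_surj]. [Y]
    increases with [r], while the orientation [s] of [X] is decided later, by the dynamics. *)
Record good_chart (X Y : R -> R -> R) (s c K d : R) : Prop := {
  gc_s : s = 1 \/ s = -1;
  gc_c : 0 < c;
  gc_K : 0 < K;
  gc_d : 0 < d;
  gc_est : forall u v, exists e, 0 < e /\ 4 * K * e <= c * c /\ chart_on X Y s 1 c K e d u v;
  gc_Y0 : forall th, Y th 0 = 0;
  gc_per : forall th r, Rabs r <= d -> X (th + 2 * PI) r = X th r + s /\ Y (th + 2 * PI) r = Y th r;
  gc_inj : forall th r th' r' (m : Z), Rabs r <= d -> Rabs r' <= d ->
    X th' r' = X th r + IZR m -> Y th' r' = Y th r -> (exists k : Z, th' = th + 2 * PI * IZR k) /\ r' = r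
}.

(** Both coordinates are multiplied by the sign [t] of the derivative of [Y] in [r], because the
    normal form [x1 = x + y] is preserved by the central symmetry but not by changing the sign of
    one coordinate. *)
Lemma boundary_good_chart X Y rho : boundary_coordinates X Y rho ->
  exists t s c K d, (t = 1 \/ t = -1) /\ d < rho /\
    good_chart (fun th r => t * X th r) (fun th r => t * Y th r) s c K d.
Proof.
intros [hrho han hbij hjac hbd]. pose proof PI_RGT_0 as hpi.
set (A := fun th => Derive (fun t => X t 0) th). set (BX := fun th => Derive (fun s => X th s) 0).
set (BY := fun th => Derive (fun s => Y th s) 0).
assert (hY0 : forall th, Y th 0 = 0). { intro th. apply (hbd th 0); [rewrite Rabs_R0; auto|auto]. }
assert (hX : forall th, sdiff X th 0 (A th) (BX th)).
{ intro th. destruct (analytic2_sdiff X th 0) as (a & b & h). { apply han. rewrite Rabs_R0; auto. }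
  replace (A th) with a by (symmetry; apply is_derive_unique, (sdiff_derive_x _ _ _ _ _ h)).
  replace (BX th) with b by (symmetry; apply is_derive_unique, (sdiff_derive_y _ _ _ _ _ h)). auto. }
assert (hYt : forall th, Derive (fun t => Y t 0) th = 0).
{ intro th. rewrite (Derive_ext _ (fun _ => 0)); [apply Derive_const|]. intro; apply hY0. }
assert (hY : forall th, sdiff Y th 0 0 (BY th)).
{ intro th. destruct (analytic2_sdiff Y th 0) as (a & b & h). { apply han. rewrite Rabs_R0; auto. }
  replace (BY th) with b by (symmetry; apply is_derive_unique, (sdiff_derive_y _ _ _ _ _ h)).
  assert (a = 0). { rewrite <- (hYt th). symmetry. apply is_derive_unique. apply (sdiff_derive_x _ _ _ _ _ h). }
  subst a. auto. }
assert (hAB : forall th, A th <> 0 /\ BY th <> 0).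
{ intro th. assert (h := hjac th 0 ltac:(rewrite Rabs_R0; auto)). rewrite hYt in h. fold (A th) (BY th) in h.
  split; intro h0; apply h; rewrite h0; ring. }
(* The partial derivatives are continuous along the boundary: the expansions at [x] and at [y] are
   compared on a common small increment [q]. *)
assert (hsg : forall f : R -> R -> R, forall D E : R -> R, (forall th, sdiff f th 0 (D th) (E th)) ->
  (forall x e, 0 < e -> exists d, 0 < d /\ forall y, Rabs (y - x) < d -> Rabs (D y - D x) <= e /\ Rabs (E y - E x) <= e)).
{ intros f D E hf x e he. destruct (hf x (e/2) ltac:(lra)) as (d & hd & h). exists d; split; auto.
  intros y hy.
  destruct (hf y (e/2) ltac:(lra)) as (d' & hd' & h').
  set (q := Rmin (d - Rabs (y - x)) d' / 2).
  assert (hq0 : 0 < Rmin (d - Rabs (y - x)) d') by (apply Rmin_pos; lra).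
  assert (hq : 0 < q) by (unfold q; lra).
  assert (hq1 : q <= d - Rabs (y - x)) by (unfold q; pose proof (Rmin_l (d - Rabs (y - x)) d'); lra).
  assert (hq2 : q <= d') by (unfold q; pose proof (Rmin_r (d - Rabs (y - x)) d'); lra).
  clearbody q. assert (hqa : Rabs q = q) by (apply Rabs_pos_eq; lra).
  pose proof (Rabs_pos (y - x)).
  split.
  - assert (w1 := h (y - x + q) 0 (y - x) 0). assert (w2 := h' q 0 0 0).
    replace (x + (y - x + q)) with (y + q) in w1 by ring. replace (x + (y - x)) with y in w1 by ring.
    replace (y - x + q - (y - x)) with q in w1 by ring.
    rewrite !Rplus_0_r, !Rminus_0_r, Rabs_R0, !Rmult_0_r, hqa, !Rplus_0_r, !Rminus_0_r in *.
    pose proof (Rabs_triang (y - x) q). rewrite hqa in H0.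
    specialize (w1 ltac:(lra) ltac:(lra) ltac:(lra) ltac:(lra)). specialize (w2 ltac:(lra) ltac:(lra) ltac:(lra) ltac:(lra)).
    apply Rabs_le_between in w1. apply Rabs_le_between in w2. apply Rabs_le. nra.
  - assert (w1 := h (y - x) q (y - x) 0). assert (w2 := h' 0 q 0 0).
    replace (x + (y - x)) with y in w1 by ring. replace (y - x - (y - x)) with 0 in w1 by ring.
    rewrite !Rplus_0_r, !Rplus_0_l, !Rminus_0_r, Rabs_R0, !Rmult_0_r, hqa, ?Rplus_0_l, ?Rminus_0_r in *.
    specialize (w1 ltac:(lra) ltac:(lra) ltac:(lra) ltac:(lra)). specialize (w2 ltac:(lra) ltac:(lra) ltac:(lra) ltac:(lra)).
    apply Rabs_le_between in w1. apply Rabs_le_between in w2. apply Rabs_le. nra. }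
destruct (sign_const A) as (s & hs & hsA).
{ intro; apply hAB. }
{ intro x. assert (hp : 0 < Rabs (A x)) by (apply Rabs_pos_lt, hAB).
  destruct (hsg X A BX hX x (Rabs (A x) / 2) ltac:(lra)) as (d & hd & h). exists d; split; auto.
  intros y hy. destruct (h y hy) as (h1 & _). lra. }
destruct (sign_const BY) as (t & ht & htB).
{ intro; apply hAB. }
{ intro x. assert (hp : 0 < Rabs (BY x)) by (apply Rabs_pos_lt, hAB).
  destruct (hsg Y (fun _ => 0) BY hY x (Rabs (BY x) / 2) ltac:(lra)) as (d & hd & h). exists d; split; auto.
  intros y hy. destruct (h y hy) as (_ & h1). lra. }
assert (hB : forall u v, u <= v -> exists c K, 0 < c /\ forall th, u <= th <= v ->
   2 * c <= s * A th /\ 2 * c <= t * BY th /\ s * A th + t * BY th + Rabs (BX th) + c <= K).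
{ intros u v huv.
  apply (interval_induction (fun u v => exists c K, 0 < c /\ forall th, u <= th <= v ->
   2 * c <= s * A th /\ 2 * c <= t * BY th /\ s * A th + t * BY th + Rabs (BX th) + c <= K) u v huv).
  - intros a b w _ hab hbw _ (c1 & K1 & hc1 & q1) (c2 & K2 & hc2 & q2).
    exists (Rmin c1 c2), (Rmax K1 K2). split; [apply Rmin_pos; auto|].
    pose proof (Rmin_l c1 c2). pose proof (Rmin_r c1 c2). pose proof (Rmax_l K1 K2). pose proof (Rmax_r K1 K2).
    intros th hth. destruct (Rle_or_lt th b).
    + specialize (q1 th ltac:(lra)). lra.
    + specialize (q2 th ltac:(lra)). lra.
  - intros x _. set (m := Rmin (s * A x) (t * BY x)). assert (hm : 0 < m) by (apply Rmin_pos; auto).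
    assert (hm1 : m <= s * A x) by apply Rmin_l. assert (hm2 : m <= t * BY x) by apply Rmin_r. clearbody m.
    destruct (hsg X A BX hX x (m/2) ltac:(lra)) as (d1 & hd1 & h1).
    destruct (hsg Y (fun _ => 0) BY hY x (m/2) ltac:(lra)) as (d2 & hd2 & h2).
    exists (Rmin d1 d2). split; [apply Rmin_pos; auto|]. intros a b _ q1 q2 q3 q4 _.
    exists (m / 4), (s * A x + t * BY x + Rabs (BX x) + 2 * m). split; [lra|]. intros th hth.
    pose proof (Rmin_l d1 d2). pose proof (Rmin_r d1 d2).
    destruct (h1 th ltac:(apply Rabs_def1; lra)) as (w1 & w2). destruct (h2 th ltac:(apply Rabs_def1; lra)) as (_ & w3).
    pose proof (Rabs_triang_inv (BX th) (BX x)) as w4.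
    apply Rabs_le_between in w1. apply Rabs_le_between in w3.
    destruct hs as [-> | ->]; destruct ht as [-> | ->]; lra. }
assert (hQ : forall u v, u <= v -> exists c K, 0 < c /\ 0 < K /\ forall e, 0 < e -> exists d, 0 < d /\ chart_on X Y s t c K e d u v).
{ intros u v huv. destruct (hB u v huv) as (c & K & hc & h). exists c, K. split; auto. split.
  { destruct (h u ltac:(lra)) as (w1 & w2 & w3). pose proof (Rabs_pos (BX u)). lra. }
  intros e he.
  apply (interval_induction (fun u v => exists d, 0 < d /\ chart_on X Y s t c K e d u v) u v huv).
  - intros a b w _ hab hbw _ (d1 & hd1 & h1) (d2 & hd2 & h2).
    exists (Rmin d1 d2). split; [apply Rmin_pos; auto|]. apply chart_on_glue with b; auto.
    + eapply chart_on_weaken; [exact h1|lra|lra|lra|apply Rmin_l|lra|lra].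
    + eapply chart_on_weaken; [exact h2|lra|lra|lra|apply Rmin_r|lra|lra].
  - intros x hx. destruct (h x hx) as (w1 & w2 & w3).
    destruct (chart_on_local X Y s t x (A x) (BX x) (BY x) c K e hs ht (hX x) (hY x) hc w1 w2 w3 he) as (d & hd & hl).
    exists d. split; auto. intros a b _ q1 q2 q3 q4 _. exists d. split; auto.
    eapply chart_on_weaken; [exact hl|lra|lra|lra|lra|lra|lra]. }
assert (hs2 : s * s = 1) by (destruct hs; subst; ring). assert (ht2 : t * t = 1) by (destruct ht; subst; ring).
assert (hXc : forall th, forall x e, 0 < e -> Rabs x < rho -> exists d, 0 < d /\ forall y, Rabs (y - x) < d -> Rabs (X th y - X th x) < e).
{ intros th x e he hx. destruct (analytic2_sdiff X th x) as (a & b & h); [apply han; auto|].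
  assert (hcont := ex_derive_continuous _ _ (ex_intro _ _ (sdiff_derive_y _ _ _ _ _ h))).
  destruct (proj1 (filterlim_locally _ _) hcont (mkposreal e he)) as ((d & hd) & hh). exists d; split; [exact hd|].
  intros y hy. apply (hh y hy). }
(* The gain of [X] over a turn is an integer of the sign of [s]. If its absolute value exceeded 1,
   an angle less than a turn away would have the same image on the cylinder, against injectivity. *)
assert (hper0 : forall th, X (th + 2 * PI) 0 = X th 0 + s).
{ intro th. destruct (hQ th (th + 2 * PI) ltac:(lra)) as (c & K & hc & hK & hq).
  destruct (hq 1 Rlt_0_1) as (d & hd & hch). assert (h0 : Rabs 0 <= d) by (rewrite Rabs_R0; lra).
  assert (hmono : forall a b, th <= a -> a <= b -> b <= th + 2 * PI -> c * (b - a) <= s * (X b 0 - X a 0)).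
  { intros a b q1 q2 q3. destruct (hch a b 0 0) as ((w & _) & _); auto. }
  destruct (proj1 (hbij th 0 (th + 2 * PI) 0 ltac:(rewrite Rabs_R0; auto) ltac:(rewrite Rabs_R0; auto))) as ((m & hm) & _).
  { split; auto. exists 1%Z. ring. }
  assert (hpos : 0 < s * IZR m).
  { assert (w := hmono th (th + 2 * PI) ltac:(lra) ltac:(lra) ltac:(lra)). rewrite hm in w.
    replace (X th 0 + IZR m - X th 0) with (IZR m) in w by ring. replace (th + 2 * PI - th) with (2 * PI) in w by ring. nra. }
  destruct (Req_dec (IZR m) s) as [he|hne]; [rewrite <- he; exact hm|]. exfalso.
  assert (hgt : 1 < s * IZR m).
  { destruct hs as [-> | ->].
    - rewrite Rmult_1_l in *. assert (0 < m)%Z by (apply lt_IZR; auto). assert (m <> 1)%Z by (intros ->; apply hne; reflexivity).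
      apply IZR_lt. lia.
    - replace (-1 * IZR m) with (IZR (- m)) in * by (rewrite opp_IZR; ring). assert (0 < - m)%Z by (apply lt_IZR; auto).
      assert (m <> -1)%Z by (intros ->; apply hne; reflexivity). apply IZR_lt. lia. }
  destruct (IVT_gen (fun x => s * (X x 0 - X th 0)) th (th + 2 * PI) 1) as (th' & b1 & b2).
  { intro x. apply continuity_pt_filterlim.
    apply (ex_derive_continuous (fun x => s * (X x 0 - X th 0))). eexists.
    apply (is_derive_scal (fun x => X x 0 - X th 0)). apply @is_derive_minus; [apply (sdiff_derive_x _ _ _ _ _ (hX x))|apply @is_derive_const]. }
  { rewrite Rmin_left, Rmax_right.
    - rewrite hm. replace (X th 0 + IZR m - X th 0) with (IZR m) by ring. rewrite Rminus_diag. lra.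
    - rewrite hm. replace (X th 0 + IZR m - X th 0) with (IZR m) by ring. rewrite Rminus_diag. lra.
    - rewrite hm. replace (X th 0 + IZR m - X th 0) with (IZR m) by ring. rewrite Rminus_diag. lra. }
  rewrite Rmin_left, Rmax_right in b1 by lra.
  assert (hX1 : X th' 0 = X th 0 + s). { replace s with (s * (s * (X th' 0 - X th 0))) by (rewrite b2; ring). rewrite <- Rmult_assoc, hs2. ring. }
  destruct (proj2 (hbij th 0 th' 0 ltac:(rewrite Rabs_R0; auto) ltac:(rewrite Rabs_R0; auto))) as ((k & hk) & _).
  { split; [|rewrite !hY0; auto]. destruct hs as [-> | ->]; [exists 1%Z|exists (-1)%Z]; auto. }
  assert (hk1 : (0 < k)%Z).
  { apply lt_IZR. assert (th <> th'). { intro he. rewrite <- he, Rminus_diag in b2. lra. } nra. }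
  assert (hk2 : (k < 1)%Z).
  { apply lt_IZR. assert (th' <> th + 2 * PI). { intro he. rewrite he, hm in b2. replace (X th 0 + IZR m - X th 0) with (IZR m) in b2 by ring. lra. } nra. }
  lia. }
assert (hper : forall th r, Rabs r < rho -> X (th + 2 * PI) r = X th r + s /\ Y (th + 2 * PI) r = Y th r).
{ intros th r hr.
  assert (hm : forall r, Rabs r < rho -> (exists m, X (th + 2 * PI) r = X th r + IZR m) /\ Y (th + 2 * PI) r = Y th r).
  { intros r' hr'. apply (hbij th r' (th + 2 * PI) r'); auto. split; auto. exists 1%Z. ring. }
  split; [|apply hm; auto].
  (* The gain over a turn is an integer depending continuously on the radius, hence equal to its
     value on the boundary. *)
  assert (hcst : (fun x => X (th + 2 * PI) (x * r) - X th (x * r)) 0 = (fun x => X (th + 2 * PI) (x * r) - X th (x * r)) 1).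
  { assert (hxr : forall x, 0 <= x <= 1 -> Rabs (x * r) < rho).
    { intros x hx. rewrite Rabs_mult, Rabs_pos_eq by lra. pose proof (Rabs_pos r). nra. }
    apply (continuous_integer_const (fun x => X (th + 2 * PI) (x * r) - X th (x * r)) 0 1); [lra| |].
    - intros x hx. destruct (hXc (th + 2 * PI) (x * r) (/2) ltac:(lra) (hxr x hx)) as (d1 & hd1 & w1).
      destruct (hXc th (x * r) (/2) ltac:(lra) (hxr x hx)) as (d2 & hd2 & w2).
      pose proof (Rabs_pos r).
      exists (Rmin d1 d2 / (Rabs r + 1)). split; [apply Rdiv_lt_0_compat; [apply Rmin_pos; auto|lra]|].
      intros y hy. assert (hyr : Rabs (y * r - x * r) < Rmin d1 d2).
      { replace (y * r - x * r) with ((y - x) * r) by ring. rewrite Rabs_mult.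
        apply Rmult_lt_compat_r with (r := Rabs r + 1) in hy; [|lra].
        replace (Rmin d1 d2 / (Rabs r + 1) * (Rabs r + 1)) with (Rmin d1 d2) in hy by (field; lra).
        pose proof (Rabs_pos (y - x)). nra. }
      assert (v1 := w1 _ (Rlt_le_trans _ _ _ hyr (Rmin_l _ _))). assert (v2 := w2 _ (Rlt_le_trans _ _ _ hyr (Rmin_r _ _))).
      apply Rabs_def2 in v1. apply Rabs_def2 in v2. apply Rabs_def1; lra.
    - intros x hx. destruct (hm (x * r) (hxr x hx)) as ((m & he) & _). exists m. rewrite he. ring. }
  simpl in hcst. rewrite Rmult_0_l, Rmult_1_l, hper0 in hcst. lra. }
(* The bounds on [[0, 4 PI]] are carried to its translates by multiples of [2 PI]. Every angle is at
   distance at least [PI] from the ends of one of them, so that local intervals can be glued. *)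
assert (hglob : exists c K, 0 < c /\ 0 < K /\ forall e, 0 < e -> exists d, 0 < d /\ d < rho /\ forall u v, chart_on X Y s t c K e d u v).
{ destruct (hQ 0 (4 * PI) ltac:(lra)) as (c & K & hc & hK & hq). exists c, K. split; auto. split; auto.
  intros e he. destruct (hq e he) as (d0 & hd0 & h0).
  set (d := Rmin d0 (rho / 2)). assert (hd : 0 < d) by (apply Rmin_pos; lra).
  assert (hdr : d <= rho / 2) by apply Rmin_r. assert (hdd : d <= d0) by apply Rmin_l.
  exists d. split; auto. split; [lra|]. clearbody d.
  assert (hperN : forall (n : nat) th r, Rabs r <= d -> X (th + 2 * PI * INR n) r = X th r + INR n * s /\ Y (th + 2 * PI * INR n) r = Y th r).
  { induction n; intros th r hr; [simpl; rewrite Rmult_0_r, Rplus_0_r; lra|].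
    destruct (IHn th r hr) as (w1 & w2). destruct (hper (th + 2 * PI * INR n) r ltac:(lra)) as (w3 & w4).
    rewrite S_INR. replace (th + 2 * PI * (INR n + 1)) with (th + 2 * PI * INR n + 2 * PI) by ring. lra. }
  assert (hperZ : forall (n : Z) th r, Rabs r <= d -> X (th + 2 * PI * IZR n) r = X th r + IZR n * s /\ Y (th + 2 * PI * IZR n) r = Y th r).
  { intros n th r hr. destruct (Z_le_gt_dec 0 n) as [hn|hn].
    - rewrite <- (Z2Nat.id n hn), <- INR_IZR_INZ. apply hperN; auto.
    - destruct (hperN (Z.to_nat (- n)) (th + 2 * PI * IZR n) r hr) as (w1 & w2).
      rewrite INR_IZR_INZ, Z2Nat.id, opp_IZR in w1, w2 by lia.
      replace (th + 2 * PI * IZR n + 2 * PI * - IZR n) with th in w1, w2 by ring. lra. }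
  assert (hshift : forall n : Z, chart_on X Y s t c K e d (2 * PI * IZR n) (4 * PI + 2 * PI * IZR n)).
  { intros n th th' r r' b1 b2 b3 b4 b5.
    destruct (h0 (th - 2 * PI * IZR n) (th' - 2 * PI * IZR n) r r') as (w1 & w2 & w3 & w4); try lra.
    destruct (hperZ n (th - 2 * PI * IZR n) r b4) as (z1 & z2). destruct (hperZ n (th' - 2 * PI * IZR n) r b4) as (z3 & z4).
    destruct (hperZ n (th - 2 * PI * IZR n) r' b5) as (z5 & z6).
    replace (th - 2 * PI * IZR n + 2 * PI * IZR n) with th in * by ring. replace (th' - 2 * PI * IZR n + 2 * PI * IZR n) with th' in * by ring.
    replace (th' - 2 * PI * IZR n - (th - 2 * PI * IZR n)) with (th' - th) in * by ring.
    rewrite z1, z2, z3, z4, z5, z6.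
    replace (X (th' - 2 * PI * IZR n) r + IZR n * s - (X (th - 2 * PI * IZR n) r + IZR n * s)) with (X (th' - 2 * PI * IZR n) r - X (th - 2 * PI * IZR n) r) by ring.
    replace (X (th - 2 * PI * IZR n) r' + IZR n * s - (X (th - 2 * PI * IZR n) r + IZR n * s)) with (X (th - 2 * PI * IZR n) r' - X (th - 2 * PI * IZR n) r) by ring.
    auto. }
  intros u v. destruct (Rle_or_lt u v) as [huv|huv].
  2:{ intros th th' r r' b1 b2 b3. lra. }
  apply (interval_induction (fun u v => chart_on X Y s t c K e d u v) u v huv).
  - intros a b w _ hab hbw _ w1 w2. apply chart_on_glue with b; auto.
  - intros x _. exists PI. split; [lra|]. intros a b _ q1 q2 q3 q4 _.
    set (y := (x - PI) / (2 * PI)). set (n := (up y - 1)%Z).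
    assert (hn : PI <= x - 2 * PI * IZR n <= 3 * PI).
    { unfold n. rewrite minus_IZR. destruct (archimed y) as (w1 & w2).
      assert (hx : x = 2 * PI * y + PI) by (unfold y; field; lra). rewrite hx. nra. }
    eapply chart_on_weaken; [apply (hshift n)|lra|lra|lra|lra|lra|lra]. }
destruct hglob as (c & K & hc & hK & hg).
destruct (hg (c * c / (4 * K))) as (d & hd & hdr & hch).
{ apply Rdiv_lt_0_compat; [apply Rmult_lt_0_compat; auto|lra]. }
exists t, (t * s), c, K, d. split; auto. split; auto.
constructor; auto.
- destruct ht as [-> | ->]; destruct hs as [-> | ->]; lra.
- intros u v. exists (c * c / (4 * K)). split; [apply Rdiv_lt_0_compat; [apply Rmult_lt_0_compat; auto|lra]|].
  split; [right; field; lra|]. intros th th' r r' b1 b2 b3 b4 b5.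
  destruct (hch u v th th' r r' b1 b2 b3 b4 b5) as (w1 & w2 & w3 & w4).
  split; [|split; [|split]].
  + replace (t * s * (t * X th' r - t * X th r)) with (t * t * (s * (X th' r - X th r))) by ring. rewrite ht2, Rmult_1_l. auto.
  + replace (t * X th r' - t * X th r) with (t * (X th r' - X th r)) by ring. rewrite Rabs_mult.
    replace (Rabs t) with 1; [lra|]. destruct ht as [-> | ->]; [rewrite Rabs_R1|rewrite Rabs_left]; lra.
  + intro hr. replace (1 * (t * Y th r' - t * Y th r)) with (t * (Y th r' - Y th r)) by ring. auto.
  + replace (t * Y th' r - t * Y th r) with (t * (Y th' r - Y th r)) by ring. rewrite Rabs_mult.
    replace (Rabs t) with 1; [lra|]. destruct ht as [-> | ->]; [rewrite Rabs_R1|rewrite Rabs_left]; lra.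
- intro th. rewrite hY0. ring.
- intros th r hr. destruct (hper th r ltac:(lra)) as (w1 & w2). rewrite w1, w2. split; ring.
- intros th r th' r' m h1 h2 e1 e2.
  apply (hbij th r th' r'); try lra. split.
  + destruct ht as [-> | ->]; [exists m; lra|exists (- m)%Z; rewrite opp_IZR; lra].
  + destruct ht as [-> | ->]; lra.
Qed.

Lemma chart_on_bounds X Y s c K e d th th' r r' : (s = 1 \/ s = -1) -> 0 < c -> chart_on X Y s 1 c K e d th th' ->
  th <= th' -> Rabs r <= d -> Rabs r' <= d ->
  c * (th' - th) <= Rabs (X th' r' - X th r) + K * Rabs (r' - r) /\
  c * Rabs (r' - r) <= Rabs (Y th' r' - Y th r) + e * (th' - th) /\
  Rabs (X th' r' - X th r) <= K * (th' - th) + K * Rabs (r' - r) /\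
  Rabs (Y th' r' - Y th r) <= K * Rabs (r' - r) + e * (th' - th).
Proof.
intros hs hc h hth hr hr'.
destruct (h th th' r' r) as (x1 & x2 & x3 & x4); auto; try lra.
destruct (h th th' r r') as (_ & _ & x3' & _); auto; try lra.
assert (hsa : forall z, Rabs (s * z) = Rabs z).
{ intro z. destruct hs; subst s. rewrite Rmult_1_l; auto. replace (-1 * z) with (- z) by ring. apply Rabs_Ropp. }
rewrite (Rabs_minus_sym r r') in x2.
assert (ya : c * Rabs (r' - r) <= Rabs (Y th r' - Y th r) <= K * Rabs (r' - r)).
{ destruct (Rle_or_lt r r') as [q|q].
  - specialize (x3' q). rewrite (Rabs_pos_eq (r' - r)) by lra. rewrite Rmult_1_l in x3'.
    assert (0 <= c * (r' - r)) by (apply Rmult_le_pos; lra). rewrite Rabs_pos_eq; lra.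
  - specialize (x3 ltac:(lra)). rewrite (Rabs_left (r' - r)) by lra. rewrite Rmult_1_l in x3.
    assert (0 <= c * (r - r')) by (apply Rmult_le_pos; lra). rewrite Rabs_minus_sym, Rabs_pos_eq; lra. }
assert (xa : c * (th' - th) <= Rabs (X th' r' - X th r') <= K * (th' - th)).
{ rewrite <- (hsa (X th' r' - X th r')). assert (0 <= c * (th' - th)) by (apply Rmult_le_pos; lra). rewrite Rabs_pos_eq; lra. }
pose proof (Rabs_triang (X th' r' - X th r) (- (X th r' - X th r))) as t1.
replace (X th' r' - X th r + - (X th r' - X th r)) with (X th' r' - X th r') in t1 by ring. rewrite Rabs_Ropp in t1.
pose proof (Rabs_triang (X th' r' - X th r') (X th r' - X th r)) as t2.
replace (X th' r' - X th r' + (X th r' - X th r)) with (X th' r' - X th r) in t2 by ring.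
pose proof (Rabs_triang (Y th' r' - Y th r) (- (Y th' r' - Y th r'))) as t3.
replace (Y th' r' - Y th r + - (Y th' r' - Y th r')) with (Y th r' - Y th r) in t3 by ring. rewrite Rabs_Ropp in t3.
pose proof (Rabs_triang (Y th' r' - Y th r') (Y th r' - Y th r)) as t4.
replace (Y th' r' - Y th r' + (Y th r' - Y th r)) with (Y th' r' - Y th r) in t4 by ring.
rewrite (Rabs_minus_sym (X th r)) in x2.
split; [|split; [|split]]; lra.
Qed.

(** Eliminating [r] introduces a coupling [K e / c], at most [c / 4], which the rate [c] of [X] in
    the angle absorbs. *)
Lemma chart_bilip X Y s c K d : good_chart X Y s c K d -> exists Lam, 0 < Lam /\
  forall th th' r r', Rabs r <= d -> Rabs r' <= d ->
  Rabs (th' - th) + Rabs (r' - r) <= Lam * (Rabs (X th' r' - X th r) + Rabs (Y th' r' - Y th r)) /\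
  Rabs (X th' r' - X th r) + Rabs (Y th' r' - Y th r) <= Lam * (Rabs (th' - th) + Rabs (r' - r)).
Proof.
intros [hs hc hK hd hest _ _ _].
set (e0 := c * c / (4 * K)).
assert (he0 : 0 < e0) by (apply Rdiv_lt_0_compat; [apply Rmult_lt_0_compat; auto|lra]).
assert (heK : K * e0 = c * c / 4) by (unfold e0; field; lra).
set (L1 := 2 / c * (1 + K / c)). assert (hKc : 0 < K / c) by (apply Rdiv_lt_0_compat; auto).
assert (h2c : 0 < 2 / c) by (apply Rdiv_lt_0_compat; lra).
assert (hL1 : 0 < L1) by (unfold L1; apply Rmult_lt_0_compat; lra).
assert (hic : 0 < / c) by (apply Rinv_0_lt_compat; auto).
set (Lam := L1 + (1 + e0 * L1) / c + 2 * K + e0).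
assert (hq : 0 < (1 + e0 * L1) / c) by (apply Rdiv_lt_0_compat; [assert (0 < e0 * L1) by (apply Rmult_lt_0_compat; auto); lra|auto]).
exists Lam. split; [unfold Lam; lra|].
assert (key : forall th th' r r', th <= th' -> Rabs r <= d -> Rabs r' <= d ->
  Rabs (th' - th) + Rabs (r' - r) <= Lam * (Rabs (X th' r' - X th r) + Rabs (Y th' r' - Y th r)) /\
  Rabs (X th' r' - X th r) + Rabs (Y th' r' - Y th r) <= Lam * (Rabs (th' - th) + Rabs (r' - r))).
{ intros th th' r r' hth hr hr'. destruct (hest th th') as (e & he & hKe & hch).
  assert (hee : e <= e0). { apply Rmult_le_reg_l with K; auto. rewrite heK. lra. }
  destruct (chart_on_bounds X Y s c K e d th th' r r' hs hc hch hth hr hr') as (b1 & b2 & b3 & b4).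
  rewrite (Rabs_pos_eq (th' - th)) by lra.
  set (DX := Rabs (X th' r' - X th r)) in *. set (DY := Rabs (Y th' r' - Y th r)) in *. set (Dr := Rabs (r' - r)) in *.
  set (Dt := th' - th) in *. assert (0 <= DX) by apply Rabs_pos. assert (0 <= DY) by apply Rabs_pos. assert (0 <= Dr) by apply Rabs_pos.
  assert (hDt : 0 <= Dt) by (unfold Dt; lra).
  assert (b2' : c * Dr <= DY + e0 * Dt) by nra. assert (b4' : DY <= K * Dr + e0 * Dt) by nra.
  assert (hDr : Dr <= / c * (DY + e0 * Dt)).
  { apply Rmult_le_reg_l with c; auto. rewrite <- Rmult_assoc, Rinv_r, Rmult_1_l by lra. auto. }
  assert (hDt1 : Dt <= L1 * (DX + DY)).
  { assert (hk : K * Dr <= K / c * DY + c / 4 * Dt).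
    { apply Rle_trans with (K * (/ c * (DY + e0 * Dt))); [apply Rmult_le_compat_l; lra|].
      replace (K * (/ c * (DY + e0 * Dt))) with (K / c * DY + (K * e0) / c * Dt) by (field; lra). rewrite heK.
      right. field. lra. }
    assert (h3 : c / 2 * Dt <= (1 + K / c) * (DX + DY)) by nra.
    apply Rmult_le_compat_l with (r := 2 / c) in h3; [|lra].
    replace (2 / c * (c / 2 * Dt)) with Dt in h3 by (field; lra). unfold L1. lra. }
  assert (hDr1 : Dr <= (1 + e0 * L1) / c * (DX + DY)).
  { eapply Rle_trans; [exact hDr|]. unfold Rdiv. rewrite (Rmult_comm (1 + e0 * L1)), Rmult_assoc. apply Rmult_le_compat_l; [lra|].
    assert (e0 * Dt <= e0 * (L1 * (DX + DY))) by (apply Rmult_le_compat_l; lra). lra. }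
  split.
  - unfold Lam. nra.
  - assert (DX + DY <= (2 * K + e0) * (Dt + Dr)) by nra. unfold Lam. nra. }
intros th th' r r' hr hr'. destruct (Rle_or_lt th th') as [q|q]; [apply key; auto|].
rewrite (Rabs_minus_sym th'), (Rabs_minus_sym r'), (Rabs_minus_sym (X th' r')), (Rabs_minus_sym (Y th' r')). apply key; auto; lra.
Qed.

Lemma lip_ivt (f : R -> R) (a b K v : R) : a <= b -> 0 <= K ->
  (forall x y, a <= x <= b -> a <= y <= b -> Rabs (f x - f y) <= K * Rabs (x - y)) ->
  f a <= v <= f b -> exists x, a <= x <= b /\ f x = v.
Proof.
intros hab hK hl hv.
(* Clamping to [[a, b]] gives a function continuous on the whole line, to which [IVT_gen]
   applies. *)
set (cl := fun x => Rmax a (Rmin x b)).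
assert (hcl : forall x, a <= cl x <= b). { intro x. unfold cl, Rmax, Rmin. repeat destruct Rle_dec; lra. }
assert (hcll : forall x y, Rabs (cl x - cl y) <= Rabs (x - y)).
{ intros x y. unfold cl, Rmax, Rmin. repeat destruct Rle_dec; unfold Rabs; repeat destruct Rcase_abs; lra. }
assert (ca : cl a = a). { unfold cl, Rmax, Rmin. repeat destruct Rle_dec; lra. }
assert (cb : cl b = b). { unfold cl, Rmax, Rmin. repeat destruct Rle_dec; lra. }
destruct (IVT_gen (fun x => f (cl x)) a b v) as (x & h1 & h2).
- intro x. apply continuity_pt_filterlim. apply (continuous_eps (fun x => f (cl x)) x).
  intros e he. exists (e / (K + 1)). split; [apply Rdiv_lt_0_compat; lra|].
  intros y hy. eapply Rle_lt_trans; [apply hl; auto|]. specialize (hcll y x).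
  apply Rmult_lt_compat_r with (r := K + 1) in hy; [|lra]. replace (e / (K + 1) * (K + 1)) with e in hy by (field; lra).
  pose proof (Rabs_pos (y - x)). pose proof (Rabs_pos (cl y - cl x)). nra.
- rewrite ca, cb. rewrite Rmin_left, Rmax_right; lra.
- exists (cl x). auto.
Qed.

(** At each angle [Y = y] is solved for [r]. The level curve so obtained is nearly flat, so along it
    [s X] still increases at a rate at least [c / 2] and takes every value. *)
Lemma chart_surj X Y s c K d : good_chart X Y s c K d -> forall x y, 0 < y < c * d ->
  exists th r, 0 < r <= d /\ X th r = x /\ Y th r = y.
Proof.
intros [hs hc hK hd hest hY0 _ _] x y hy.
assert (hch : forall th th', exists e, 0 < e /\ 4 * K * e <= c * c /\ chart_on X Y s 1 c K e d th th') by auto.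
assert (hrex : forall th, exists r, 0 <= r <= d /\ Y th r = y).
{ intro th. destruct (hch th th) as (e & he & _ & h).
  assert (hYr : forall r r', Rabs r <= d -> Rabs r' <= d -> r <= r' -> c * (r' - r) <= Y th r' - Y th r <= K * (r' - r)).
  { intros r r' q1 q2 q3. destruct (h th th r r' ltac:(lra) ltac:(lra) ltac:(lra) q1 q2) as (_ & _ & w & _). specialize (w q3). lra. }
  apply (lip_ivt (Y th) 0 d K y); try lra.
  - intros a b ha hb. destruct (Rle_or_lt a b) as [q|q].
    + rewrite Rabs_minus_sym, (Rabs_minus_sym a). assert (w := hYr a b ltac:(apply Rabs_le; lra) ltac:(apply Rabs_le; lra) q).
      assert (0 <= c * (b - a)) by (apply Rmult_le_pos; lra). rewrite !Rabs_pos_eq; lra.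
    + assert (w := hYr b a ltac:(apply Rabs_le; lra) ltac:(apply Rabs_le; lra) ltac:(lra)).
      assert (0 <= c * (a - b)) by (apply Rmult_le_pos; lra). rewrite !Rabs_pos_eq; lra.
  - assert (w := hYr 0 d ltac:(rewrite Rabs_R0; lra) ltac:(rewrite Rabs_pos_eq; lra) ltac:(lra)).
    rewrite hY0 in *. rewrite !Rminus_0_r in w. lra. }
set (rr := fun th => epsilon (inhabits 0) (fun r => 0 <= r <= d /\ Y th r = y)).
assert (hrr : forall th, 0 <= rr th <= d /\ Y th (rr th) = y).
{ intro th. apply (epsilon_spec (inhabits 0) (fun r => 0 <= r <= d /\ Y th r = y)), hrex. }
clearbody rr.
set (g := fun th => s * X th (rr th)).
assert (hg : forall th th', th <= th' -> c / 2 * (th' - th) <= g th' - g th <= (K + c) * (th' - th)).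
{ intros th th' hth. destruct (hch th th') as (e & he & hKe & h).
  destruct (hrr th) as (p1 & p2). destruct (hrr th') as (p3 & p4).
  assert (q1 : Rabs (rr th) <= d) by (apply Rabs_le; lra). assert (q2 : Rabs (rr th') <= d) by (apply Rabs_le; lra).
  destruct (chart_on_bounds X Y s c K e d th th' _ _ hs hc h hth q1 q2) as (_ & b2 & _ & _).
  rewrite p2, p4, Rminus_diag, Rabs_R0, Rplus_0_l in b2.
  destruct (h th th' (rr th') (rr th)) as (w1 & w2 & _); auto; try lra.
  rewrite (Rabs_minus_sym (rr th)) in w2.
  assert (hKr : K * Rabs (rr th' - rr th) <= c / 4 * (th' - th)).
  { apply Rmult_le_reg_l with c; auto. replace (c * (K * Rabs (rr th' - rr th))) with (K * (c * Rabs (rr th' - rr th))) by ring.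
    apply Rle_trans with (K * (e * (th' - th))); [apply Rmult_le_compat_l; lra|].
    replace (c * (c / 4 * (th' - th))) with (c * c / 4 * (th' - th)) by field. rewrite <- Rmult_assoc. apply Rmult_le_compat_r; lra. }
  assert (hsx : Rabs (s * (X th (rr th') - X th (rr th))) <= c / 4 * (th' - th)).
  { rewrite Rabs_mult. replace (Rabs s) with 1. 2:{ destruct hs as [-> | ->]; [rewrite Rabs_R1|rewrite Rabs_left]; lra. }
    rewrite Rabs_minus_sym. lra. }
  apply Rabs_le_between in hsx. unfold g. assert (0 <= c * (th' - th)) by (apply Rmult_le_pos; lra). nra. }
(* At rate [c / 2], a length [N] on either side of 0 is enough to reach [s x]. *)
set (N := 2 / c * Rabs (s * x - g 0)). assert (hN : 0 <= N).
{ unfold N. apply Rmult_le_pos; [apply Rlt_le, Rdiv_lt_0_compat; lra|apply Rabs_pos]. }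
assert (hcN : c / 2 * N = Rabs (s * x - g 0)) by (unfold N; field; lra).
destruct (lip_ivt g (- N) N (K + c) (s * x)) as (th & h1 & h2); try lra.
- intros a b ha hb. destruct (Rle_or_lt a b) as [q|q].
  + rewrite Rabs_minus_sym, (Rabs_minus_sym a). assert (w := hg a b q).
    assert (0 <= c / 2 * (b - a)) by (apply Rmult_le_pos; lra). rewrite !Rabs_pos_eq; lra.
  + assert (w := hg b a ltac:(lra)).
    assert (0 <= c / 2 * (a - b)) by (apply Rmult_le_pos; lra). rewrite !Rabs_pos_eq; lra.
- assert (w1 := hg (- N) 0 ltac:(lra)). assert (w2 := hg 0 N ltac:(lra)).
  pose proof (Rle_abs (s * x - g 0)). pose proof (Rle_abs (- (s * x - g 0))). rewrite Rabs_Ropp in H0. lra.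
- destruct (hrr th) as (p1 & p2). exists th, (rr th). split; [|split; auto].
  + split; [|lra]. destruct p1 as [[p|p] _]; auto. exfalso. rewrite <- p, hY0 in p2. lra.
  + unfold g in h2. destruct hs as [-> | ->]; lra.
Qed.

(** * The curve in envelope coordinates *)

(** Convergence at a point [u] strictly between [|h|] and [d] puts [|h|] strictly inside the disk of
    convergence, as termwise differentiation requires. *)
Lemma analytic_radius a t f d : 0 < d -> (forall h, Rabs h < d -> is_pseries a h (f (t + h))) ->
  forall h, Rabs h < d -> Rbar_lt (Rabs h) (CV_radius a).
Proof.
intros hd hf h hh. apply Rbar_not_le_lt. intro hle.
set (u := (Rabs h + d) / 2). assert (hu : Rabs h < u < d) by (unfold u; lra).
assert (hau : Rabs u = u) by (apply Rabs_pos_eq; pose proof (Rabs_pos h); lra).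
apply (CV_disk_outside a u).
- rewrite hau. eapply Rbar_le_lt_trans; [exact hle|]. simpl. lra.
- assert (hs := hf u ltac:(lra)). apply is_pseries_R in hs.
  apply ex_series_lim_0. eexists; exact hs.
Qed.

Lemma analytic_is_derive f t : analytic_at f t -> is_derive f t (Derive f t) /\ analytic_at (Derive f) t.
Proof.
intros (a & d & hd & hf).
assert (hr := analytic_radius a t f d hd hf).
assert (hder : forall h, Rabs h < d -> is_derive f (t + h) (PSeries (PS_derive a) h)).
{ intros h hh. apply (is_derive_ext_loc (fun u => PSeries a (u - t))).
  - assert (hp : 0 < d - Rabs h) by lra. exists (mkposreal _ hp). intros u hu.
    change (Rabs (u - (t + h)) < d - Rabs h) in hu.
    assert (hut : Rabs (u - t) < d).
    { replace (u - t) with ((u - (t + h)) + h) by ring. eapply Rle_lt_trans; [apply Rabs_triang|]. lra. }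
    rewrite (is_pseries_unique _ _ _ (hf (u - t) hut)). f_equal. ring.
  - replace (PSeries (PS_derive a) h) with (scal 1 (PSeries (PS_derive a) h)) by (unfold scal; simpl; unfold mult; simpl; ring).
    apply (is_derive_comp (PSeries a) (fun u => u - t)).
    + replace (t + h - t) with h by ring. apply is_derive_PSeries. auto.
    + auto_derive; auto. }
split.
- apply Derive_correct. eexists. rewrite <- (Rplus_0_r t). apply hder. rewrite Rabs_R0. auto.
- exists (PS_derive a), d. split; auto. intros h hh.
  rewrite (is_derive_unique _ _ _ (hder h hh)). apply PSeries_correct, CV_radius_inside.
  rewrite CV_radius_derive. auto.
Qed.

Lemma is_derive_cont (f : R -> R) (x l : R) : is_derive f x l -> continuous f x.
Proof. intro h. apply (ex_derive_continuous f). eexists; exact h. Qed.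

Lemma continuous_eps_inv (g : R -> R) t : continuous g t ->
  forall e, 0 < e -> exists d, 0 < d /\ forall s, Rabs (s - t) < d -> Rabs (g s - g t) < e.
Proof.
intros h e he. destruct (proj1 (filterlim_locally _ _) h (mkposreal e he)) as ((d & hd) & hh).
exists d; split; [exact hd|]. intros s hs. apply (hh s hs).
Qed.

Lemma is_derive_eps (f : R -> R) (x l : R) : is_derive f x l -> forall e, 0 < e ->
  exists d, 0 < d /\ forall y, Rabs (y - x) < d -> Rabs (f y - f x - l * (y - x)) <= e * Rabs (y - x).
Proof.
intros h e he. apply is_derive_Reals in h. destruct (derivable_pt_lim_eps _ _ _ h e he) as (d & hd & hh).
exists d; split; auto. intros y hy. specialize (hh (y - x) hy). replace (x + (y - x)) with y in hh by ring. auto.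
Qed.

Lemma Derive_periodic f p : (forall t, f (t + p) = f t) -> forall t, Derive f (t + p) = Derive f t.
Proof.
intros h t. unfold Derive. f_equal. apply Lim_ext. intro y. replace (t + p + y) with ((t + y) + p) by ring. rewrite !h. reflexivity.
Qed.

Lemma period_one_Z (f : R -> R) : (forall t, f (t + 1) = f t) -> forall (n : Z) t, f (t + IZR n) = f t.
Proof.
intros h n t.
assert (hn : forall (m : nat) t, f (t + INR m) = f t).
{ induction m; intro u; [simpl; f_equal; ring|]. rewrite S_INR, <- Rplus_assoc, h. auto. }
destruct (Z_le_gt_dec 0 n) as [h0|h0].
- rewrite <- (Z2Nat.id n h0), <- INR_IZR_INZ. auto.
- rewrite <- (hn (Z.to_nat (- n)) (t + IZR n)). f_equal. rewrite INR_IZR_INZ, Z2Nat.id, opp_IZR by lia. ring.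
Qed.

Lemma positive_periodic_bounds (f : R -> R) : (forall t, f (t + 1) = f t) -> (forall t, 0 < f t) ->
  (forall t, continuous f t) -> exists m M, 0 < m /\ forall t, m <= f t <= M.
Proof.
intros hp hpos hc.
assert (h01 : exists m M, 0 < m /\ forall t, 0 <= t <= 1 -> m <= f t <= M).
{ apply (interval_induction (fun u v => exists m M, 0 < m /\ forall t, u <= t <= v -> m <= f t <= M) 0 1); [lra| |].
  - intros u v w _ _ _ _ (m1 & M1 & h1 & q1) (m2 & M2 & h2 & q2). exists (Rmin m1 m2), (Rmax M1 M2).
    split; [apply Rmin_pos; auto|]. pose proof (Rmin_l m1 m2). pose proof (Rmin_r m1 m2). pose proof (Rmax_l M1 M2). pose proof (Rmax_r M1 M2).
    intros t ht. destruct (Rle_or_lt t v); [specialize (q1 t ltac:(lra))|specialize (q2 t ltac:(lra))]; lra.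
  - intros x _. pose proof (hpos x). destruct (continuous_eps_inv f x (hc x) (f x / 2) ltac:(lra)) as (d & hd & h).
    exists d; split; auto. intros u v _ q1 q2 q3 q4 _. exists (f x / 2), (2 * f x). split; [lra|].
    intros t ht. specialize (h t ltac:(apply Rabs_def1; lra)). apply Rabs_def2 in h. lra. }
destruct h01 as (m & M & hm & h). exists m, M. split; auto. intro t.
destruct (exists_frac t) as (n & hn). rewrite <- (period_one_Z f hp n t). auto.
Qed.

Lemma vlen_pos u : u <> (0, 0) -> 0 < vlen u.
Proof.
intro h. unfold vlen. apply sqrt_lt_R0. destruct u as (a, b); simpl.
destruct (Req_dec a 0) as [->|ha].
- destruct (Req_dec b 0) as [->|hb]; [exfalso; auto|]. assert (0 < b * b) by (apply Rsqr_pos_lt; auto). nra.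
- assert (0 < a * a) by (apply Rsqr_pos_lt; auto). nra.
Qed.

Lemma vlen_sq u : vlen u ^ 2 = fst u ^ 2 + snd u ^ 2.
Proof.
unfold vlen. rewrite <- Rsqr_pow2, Rsqr_sqrt; auto.
pose proof (pow2_ge_0 (fst u)). pose proof (pow2_ge_0 (snd u)). lra.
Qed.

(** Two distinct points with the same unit tangent would each lie strictly to the left of the
    tangent line at the other, but these lines are parallel with the same orientation. *)
Lemma gauss_injective c s t (e : vec) : strictly_convex_curve c ->
  (fst (velocity c s) / vlen (velocity c s), snd (velocity c s) / vlen (velocity c s)) = e ->
  (fst (velocity c t) / vlen (velocity c t), snd (velocity c t) / vlen (velocity c t)) = e ->
  c s = c t.
Proof.
intros hc hs ht. apply NNPP; intro hne.
assert (h1 := scc_left hc (s := s) (t := t) hne).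
assert (h2 := scc_left hc (s := t) (t := s) ltac:(auto)).
pose proof (vlen_pos _ (scc_regular hc (t := s))) as ps. pose proof (vlen_pos _ (scc_regular hc (t := t))) as pt.
rewrite <- ht in hs. assert (q1 := f_equal fst hs). assert (q2 := f_equal snd hs).
unfold det, vsub in *; cbn [fst snd] in *.
set (vs := velocity c s) in *. set (vt := velocity c t) in *.
assert (e1 : fst vs = vlen vs / vlen vt * fst vt) by (transitivity (vlen vs * (fst vs / vlen vs)); [field; lra|rewrite q1; field; lra]).
assert (e2 : snd vs = vlen vs / vlen vt * snd vt) by (transitivity (vlen vs * (snd vs / vlen vs)); [field; lra|rewrite q2; field; lra]).
rewrite e1, e2 in h2. assert (0 < vlen vs / vlen vt) by (apply Rdiv_lt_0_compat; auto).
set (m := vlen vs / vlen vt) in *.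
assert (h3 : m * fst vt * (snd (c t) - snd (c s)) - m * snd vt * (fst (c t) - fst (c s)) =
  - (m * (fst vt * (snd (c s) - snd (c t)) - snd vt * (fst (c s) - fst (c t))))) by ring.
nra.
Qed.

(** No regularity of [gamma] is given, only its tangent direction. For a nearby angle the
    intermediate value theorem produces a parameter with that direction, [gauss_injective]
    identifies its point with the value of [gamma], and the parameter is expanded to first order in
    the angle. *)
Lemma gamma_derive c gamma : strictly_convex_curve c -> tangent_angle_param c gamma -> forall th, exists t, gamma th = c t /\
  is_derive (fun s => fst (gamma s)) th (/ curvature c t * cos th) /\
  is_derive (fun s => snd (gamma s)) th (/ curvature c t * sin th).
Proof.
intros hc hg th. destruct (hg th) as (t0 & hgt & hdir). exists t0. split; auto.
set (x := fun s => fst (c s)). set (y := fun s => snd (c s)).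
assert (ax : forall t, analytic_at x t) by (intro; apply (scc_analytic hc)).
assert (ay : forall t, analytic_at y t) by (intro; apply (scc_analytic hc)).
assert (dx := fun t => analytic_is_derive x t (ax t)). assert (dy := fun t => analytic_is_derive y t (ay t)).
set (x' := Derive x) in *. set (y' := Derive y) in *.
assert (dx' := fun t => analytic_is_derive x' t (proj2 (dx t))). assert (dy' := fun t => analytic_is_derive y' t (proj2 (dy t))).
set (x'' := Derive x') in *. set (y'' := Derive y') in *.
assert (hv : forall t, velocity c t = (x' t, y' t)) by reflexivity.
assert (hcu : curvature c t0 = (x' t0 * y'' t0 - y' t0 * x'' t0) / vlen (x' t0, y' t0) ^ 3) by reflexivity.
pose proof (vlen_pos _ (scc_regular hc (t := t0))) as hl. rewrite hv in hl.
pose proof (scc_curvature hc t0) as hk.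
set (k := curvature c t0) in *. set (l := vlen (x' t0, y' t0)) in *.
assert (hl2 : l ^ 2 = x' t0 ^ 2 + y' t0 ^ 2) by apply vlen_sq.
rewrite hv in hdir. fold l in hdir. unfold dir in hdir.
assert (hcos := f_equal fst hdir). assert (hsin := f_equal snd hdir). cbn [fst snd] in hcos, hsin.
assert (ex0 : x' t0 = l * cos th) by (rewrite <- hcos; field; lra).
assert (ey0 : y' t0 = l * sin th) by (rewrite <- hsin; field; lra).
assert (hkl : x' t0 * y'' t0 - y' t0 * x'' t0 = k * l ^ 3) by (rewrite hcu; field; lra).
(* Components of the velocity along [dir th] and along its left normal. *)
set (P := fun t => cos th * x' t + sin th * y' t). set (Q := fun t => cos th * y' t - sin th * x' t).
pose proof (sin2_cos2 th) as hsc. unfold Rsqr in hsc.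
assert (hP0 : P t0 = l). { unfold P. rewrite ex0, ey0. nra. }
assert (hQ0 : Q t0 = 0). { unfold Q. rewrite ex0, ey0. ring. }
set (Lam := k * l ^ 2). assert (hLam : 0 < Lam) by (unfold Lam; apply Rmult_lt_0_compat; [auto|apply pow_lt; auto]).
assert (hQd : is_derive Q t0 Lam).
{ replace Lam with (cos th * y'' t0 - sin th * x'' t0).
  - apply @is_derive_minus; apply is_derive_scal; [apply dy'|apply dx'].
  - unfold Lam. rewrite ex0, ey0 in hkl. apply Rmult_eq_reg_l with l; [|lra].
    transitivity (l * cos th * y'' t0 - l * sin th * x'' t0); [ring|]. rewrite hkl. ring. }
assert (hPc : continuous P t0).
{ apply (is_derive_cont P t0 (cos th * x'' t0 + sin th * y'' t0)).
  apply @is_derive_plus; apply is_derive_scal; [apply dx'|apply dy']. }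
(* For [phi] small, the point of tangent angle [th + phi] has parameter [t0 + tau] with [tau ~ l phi / Lam]. *)
assert (main : forall e, 0 < e -> exists d, 0 < d /\ forall ph, Rabs ph < d -> exists t,
   gamma (th + ph) = c t /\ Rabs (t - t0 - l / Lam * ph) <= e * Rabs ph /\ Rabs (t - t0) < e).
(* [B] will bound [|t - t0| / |ph|], and [Kc] is the constant of the final error estimate; neither
   depends on [e]. *)
{ set (B := 2 * (2 * l + 2) / Lam). assert (hB : 0 < B) by (apply Rdiv_lt_0_compat; lra).
  set (Kc := ((Lam + 2) * B + (l + 2)) / Lam). assert (hKc : 0 < Kc).
  { apply Rdiv_lt_0_compat; auto. assert (0 < (Lam + 2) * B) by (apply Rmult_lt_0_compat; lra). lra. }
  intros e he.
  set (e1 := Rmin (Rmin 1 (l / 4)) (Rmin (Lam / (2 * (Lam + 2))) (e / Kc))).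
  assert (he1 : 0 < e1). { repeat apply Rmin_pos; try lra; apply Rdiv_lt_0_compat; lra. }
  assert (f1 : e1 <= 1) by (eapply Rle_trans; [apply Rmin_l|apply Rmin_l]).
  assert (f2 : e1 <= l / 4) by (eapply Rle_trans; [apply Rmin_l|apply Rmin_r]).
  assert (f3 : e1 <= Lam / (2 * (Lam + 2))) by (eapply Rle_trans; [apply Rmin_r|apply Rmin_l]).
  assert (f4 : e1 <= e / Kc) by (eapply Rle_trans; [apply Rmin_r|apply Rmin_r]).
  clearbody e1.
  assert (f3' : e1 * (Lam + 2) <= Lam / 2).
  { apply Rmult_le_compat_r with (r := Lam + 2) in f3; [|lra]. replace (Lam / (2 * (Lam + 2)) * (Lam + 2)) with (Lam / 2) in f3 by (field; lra). auto. }
  assert (f4' : e1 * Kc <= e).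
  { apply Rmult_le_compat_r with (r := Kc) in f4; [|lra]. replace (e / Kc * Kc) with e in f4 by (field; lra). auto. }
  destruct (is_derive_eps Q t0 Lam hQd e1 he1) as (d1 & hd1 & q1).
  destruct (continuous_eps_inv P t0 hPc e1 he1) as (d2 & hd2 & q2).
  set (eta := Rmin (Rmin d1 d2) (Rmin (Rmin e 1) (l / 4 / Lam)) / 2).
  assert (het0 : 0 < Rmin (Rmin d1 d2) (Rmin (Rmin e 1) (l / 4 / Lam))).
  { repeat apply Rmin_pos; auto; [lra|]. apply Rdiv_lt_0_compat; lra. }
  assert (het : 0 < eta) by (unfold eta; lra).
  assert (et : eta < Rmin (Rmin d1 d2) (Rmin (Rmin e 1) (l / 4 / Lam))) by (unfold eta; lra).
  assert (et1 := Rlt_le_trans _ _ _ et (Rmin_l _ _)). assert (et2 := Rlt_le_trans _ _ _ et (Rmin_r _ _)).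
  assert (et3 := Rlt_le_trans _ _ _ et1 (Rmin_l _ _)). assert (et4 := Rlt_le_trans _ _ _ et1 (Rmin_r _ _)).
  assert (et50 := Rlt_le_trans _ _ _ et2 (Rmin_l _ _)). assert (et5 := Rlt_le_trans _ _ _ et50 (Rmin_l _ _)). assert (et51 := Rlt_le_trans _ _ _ et50 (Rmin_r _ _)). assert (et6 := Rlt_le_trans _ _ _ et2 (Rmin_r _ _)).
  assert (et7 : Lam * eta < l / 4).
  { apply Rmult_lt_compat_l with (r := Lam) in et6; auto. replace (Lam * (l / 4 / Lam)) with (l / 4) in et6 by (field; lra). auto. }
  clearbody eta. clear et et1 et2 et50 et6 het0.
  destruct (derivable_pt_lim_eps _ _ _ (derivable_pt_lim_sin 0) e1 he1) as (d3 & hd3 & q3).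
  destruct (derivable_pt_lim_eps _ _ _ (derivable_pt_lim_cos 0) e1 he1) as (d4 & hd4 & q4).
  rewrite cos_0, sin_0 in *.
  set (d5 := Lam * eta / (8 * (l + 1))). assert (hd5 : 0 < d5) by (apply Rdiv_lt_0_compat; [apply Rmult_lt_0_compat; auto|lra]).
  exists (Rmin (Rmin d3 d4) (Rmin d5 (/ 2))). split; [repeat apply Rmin_pos; auto; lra|].
  intros ph hph.
  assert (p1 := Rlt_le_trans _ _ _ hph (Rmin_l _ _)). assert (p2 := Rlt_le_trans _ _ _ hph (Rmin_r _ _)).
  assert (p3 := Rlt_le_trans _ _ _ p1 (Rmin_l _ _)). assert (p4 := Rlt_le_trans _ _ _ p1 (Rmin_r _ _)).
  assert (p5 := Rlt_le_trans _ _ _ p2 (Rmin_l _ _)). assert (p6 := Rlt_le_trans _ _ _ p2 (Rmin_r _ _)).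
  clear hph p1 p2. specialize (q3 ph p3). specialize (q4 ph p4). rewrite Rplus_0_l in q3, q4.
  replace (sin ph - 0 - 1 * ph) with (sin ph - ph) in q3 by ring. replace (cos ph - 1 - - 0 * ph) with (cos ph - 1) in q4 by ring.
  assert (p5' : 8 * (l + 1) * Rabs ph < Lam * eta).
  { apply Rmult_lt_compat_l with (r := 8 * (l + 1)) in p5; [|lra].
    replace (8 * (l + 1) * d5) with (Lam * eta) in p5 by (unfold d5; field; lra). auto. }
  set (a := Rabs ph) in *. assert (ha : 0 <= a) by apply Rabs_pos.
  assert (hcp : Rabs (cos ph - 1) <= / 2) by nra. apply Rabs_le_between in hcp.
  assert (hsp : Rabs (sin ph) <= 2 * a).
  { replace (sin ph) with ((sin ph - ph) + ph) by ring. eapply Rle_trans; [apply Rabs_triang|]. fold a. nra. }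
  assert (hPt : forall t, Rabs (t - t0) <= eta -> Rabs (P t - l) <= e1).
  { intros t ht. rewrite <- hP0. apply Rlt_le, q2. lra. }
  assert (hQt : forall t, Rabs (t - t0) <= eta -> Rabs (Q t - Lam * (t - t0)) <= e1 * Rabs (t - t0)).
  { intros t ht. specialize (q1 t ltac:(lra)). rewrite hQ0, Rminus_0_r in q1. auto. }
  (* The component of the velocity along the left normal of [dir (th + ph)]; the parameter sought is
     a zero of it. *)
  set (Phi := fun t => cos ph * Q t - sin ph * P t).
  assert (hPhi : Phi (t0 - eta) <= 0 /\ 0 <= Phi (t0 + eta)).
  { assert (hb : forall t, Rabs (t - t0) = eta -> Rabs (sin ph * P t) <= Lam * eta / 4 * (l + 1) / (l + 1) /\ Rabs (Q t - Lam * (t - t0)) <= Lam / 2 * eta).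
    { intros t ht. specialize (hPt t ltac:(lra)). specialize (hQt t ltac:(lra)). rewrite ht in hQt. split.
      - replace (Lam * eta / 4 * (l + 1) / (l + 1)) with (Lam * eta / 4) by (field; lra).
        rewrite Rabs_mult. assert (Rabs (P t) <= l + 1). { apply Rabs_le_between in hPt. apply Rabs_le. lra. }
        apply Rle_trans with (2 * a * (l + 1)); [apply Rmult_le_compat; auto using Rabs_pos|]. lra.
      - assert (e1 <= Lam / 2) by nra. nra. }
    destruct (hb (t0 - eta)) as (b1 & b2). { replace (t0 - eta - t0) with (- eta) by ring. rewrite Rabs_Ropp, Rabs_pos_eq; lra. }
    destruct (hb (t0 + eta)) as (b3 & b4). { replace (t0 + eta - t0) with eta by ring. rewrite Rabs_pos_eq; lra. }
    replace (Lam * eta / 4 * (l + 1) / (l + 1)) with (Lam * eta / 4) in * by (field; lra).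
    replace (t0 - eta - t0) with (- eta) in b2 by ring. replace (t0 + eta - t0) with eta in b4 by ring.
    apply Rabs_le_between in b1. apply Rabs_le_between in b2. apply Rabs_le_between in b3. apply Rabs_le_between in b4.
    assert (0 < Lam * eta) by (apply Rmult_lt_0_compat; auto). unfold Phi. set (W := Lam * eta) in *.
    assert (cos ph * Q (t0 - eta) <= - (W / 4)) by (assert (Q (t0 - eta) <= - (W / 2)) by (unfold W; lra); clearbody W; nra).
    assert (W / 4 <= cos ph * Q (t0 + eta)) by (assert (W / 2 <= Q (t0 + eta)) by (unfold W in b4 |- *; lra); clearbody W; nra). split; lra. }
  destruct (IVT_gen Phi (t0 - eta) (t0 + eta) 0) as (t & ht & hPhi0).
  { intro u. apply continuity_pt_filterlim.
    apply (is_derive_cont Phi u (cos ph * (cos th * y'' u - sin th * x'' u) - sin ph * (cos th * x'' u + sin th * y'' u))).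
    apply @is_derive_minus; apply is_derive_scal.
    - apply @is_derive_minus; apply is_derive_scal; [apply dy'|apply dx'].
    - apply @is_derive_plus; apply is_derive_scal; [apply dx'|apply dy']. }
  { rewrite Rmin_left, Rmax_right; lra. }
  rewrite Rmin_left, Rmax_right in ht by lra.
  assert (htau : Rabs (t - t0) <= eta) by (apply Rabs_le; lra).
  specialize (hPt t htau). specialize (hQt t htau).
  set (tau := t - t0) in *. set (b := Rabs tau) in *. assert (hb : 0 <= b) by apply Rabs_pos.
  assert (hPabs : Rabs (P t) <= l + 1) by (apply Rabs_le_between in hPt; apply Rabs_le; lra).
  assert (hQabs : Rabs (Q t) <= (Lam + 1) * b).
  { replace (Q t) with ((Q t - Lam * tau) + Lam * tau) by ring. eapply Rle_trans; [apply Rabs_triang|].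
    rewrite Rabs_mult, (Rabs_pos_eq Lam) by lra. fold b. nra. }
  assert (hid : Lam * tau - l * ph = - (Q t - Lam * tau) - (cos ph - 1) * Q t + ((sin ph - ph) * P t + ph * (P t - l))).
  { unfold Phi in hPhi0. transitivity (Lam * tau - l * ph + (sin ph * P t - cos ph * Q t)); [lra|ring]. }
  assert (hest : Rabs (Lam * tau - l * ph) <= e1 * ((Lam + 2) * b + (l + 2) * a)).
  { rewrite hid. eapply Rle_trans; [apply Rabs_triang|].
    assert (w1 : Rabs (- (Q t - Lam * tau) - (cos ph - 1) * Q t) <= e1 * b + e1 * ((Lam + 1) * b)).
    { eapply Rle_trans; [apply Rabs_triang|]. rewrite !Rabs_Ropp, Rabs_mult. apply Rplus_le_compat; auto.
      apply Rmult_le_compat; auto using Rabs_pos. nra. }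
    assert (w2 : Rabs ((sin ph - ph) * P t + ph * (P t - l)) <= e1 * a * (l + 1) + a * e1).
    { eapply Rle_trans; [apply Rabs_triang|]. rewrite !Rabs_mult. apply Rplus_le_compat; apply Rmult_le_compat; auto using Rabs_pos; try lra; apply Rle_refl. }
    nra. }
  assert (hbB : b <= B * a).
  { assert (Lam * b <= l * a + e1 * ((Lam + 2) * b + (l + 2) * a)).
    { replace (Lam * b) with (Rabs (Lam * tau)) by (rewrite Rabs_mult, Rabs_pos_eq by lra; reflexivity).
      replace (Lam * tau) with ((Lam * tau - l * ph) + l * ph) by ring. eapply Rle_trans; [apply Rabs_triang|].
      rewrite (Rabs_mult l), (Rabs_pos_eq l) by lra. fold a. lra. }
    assert (e1 * ((Lam + 2) * b) <= Lam / 2 * b) by nra. assert (e1 * ((l + 2) * a) <= (l + 2) * a) by nra.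
    apply Rmult_le_reg_l with (Lam / 2); [lra|].
    replace (Lam / 2 * (B * a)) with ((2 * l + 2) * a) by (unfold B; field; lra). lra. }
  exists t. split; [|split].
  - destruct (hg (th + ph)) as (t' & hgt' & hdir').
    rewrite hgt'. apply (gauss_injective c t' t (dir (th + ph)) hc hdir').
    rewrite hv. simpl fst. simpl snd.
    (* The component of the velocity along [dir (th + ph)]; its positivity excludes the opposite
       direction. *)
    set (m := cos ph * P t + sin ph * Q t).
    pose proof (sin2_cos2 ph) as hsc2. unfold Rsqr in hsc2. unfold Phi in hPhi0.
    assert (hxx : x' t = m * cos (th + ph)).
    { rewrite cos_plus. unfold m.
      replace ((cos ph * P t + sin ph * Q t) * (cos th * cos ph - sin th * sin ph)) with
        (cos th * ((sin ph * sin ph + cos ph * cos ph) * P t + sin ph * (cos ph * Q t - sin ph * P t)) -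
         sin th * ((sin ph * sin ph + cos ph * cos ph) * Q t - cos ph * (cos ph * Q t - sin ph * P t))) by ring.
      rewrite hPhi0, hsc2. unfold P, Q.
      transitivity ((sin th * sin th + cos th * cos th) * x' t); [rewrite hsc; ring|ring]. }
    assert (hyy : y' t = m * sin (th + ph)).
    { rewrite sin_plus. unfold m.
      replace ((cos ph * P t + sin ph * Q t) * (sin th * cos ph + cos th * sin ph)) with
        (sin th * ((sin ph * sin ph + cos ph * cos ph) * P t + sin ph * (cos ph * Q t - sin ph * P t)) +
         cos th * ((sin ph * sin ph + cos ph * cos ph) * Q t - cos ph * (cos ph * Q t - sin ph * P t))) by ring.
      rewrite hPhi0, hsc2. unfold P, Q.
      transitivity ((sin th * sin th + cos th * cos th) * y' t); [rewrite hsc; ring|ring]. }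
    assert (hm : 0 < m).
    { unfold m. apply Rabs_le_between in hPt.
      assert (Rabs (sin ph * Q t) <= 2 * a * ((Lam + 1) * b)) by (rewrite Rabs_mult; apply Rmult_le_compat; auto using Rabs_pos).
      assert (b <= eta) by exact htau.
      assert (hq : 2 * a * ((Lam + 1) * b) <= l / 4).
      { assert (a <= / 32) by nra. assert (a <= l / 32) by nra.
        assert (Lam * b <= Lam * eta) by (apply Rmult_le_compat_l; lra).
        assert (0 <= Lam * b) by (apply Rmult_le_pos; lra).
        assert (a * (Lam * b) <= / 32 * (l / 4)) by (apply Rmult_le_compat; lra).
        assert (a * b <= l / 32 * 1) by (apply Rmult_le_compat; lra). lra. }
      apply Rabs_le_between in H. assert (he5 : l * 3 / 4 <= P t) by lra. assert (l * 3 / 8 <= cos ph * P t) by nra. lra. }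
    assert (hvl : vlen (x' t, y' t) = m).
    { unfold vlen. simpl fst; simpl snd. rewrite hxx, hyy.
      pose proof (sin2_cos2 (th + ph)) as hsc3. unfold Rsqr in hsc3.
      replace ((m * cos (th + ph)) ^ 2 + (m * sin (th + ph)) ^ 2) with (m ^ 2 * (sin (th + ph) * sin (th + ph) + cos (th + ph) * cos (th + ph))) by ring.
      rewrite hsc3, Rmult_1_r. apply sqrt_pow2. lra. }
    rewrite hvl, hxx, hyy. unfold dir. f_equal; field; lra.
  - fold tau. replace (tau - l / Lam * ph) with ((Lam * tau - l * ph) / Lam) by (field; lra).
    unfold Rdiv. rewrite Rabs_mult, (Rabs_pos_eq (/ Lam)) by (left; apply Rinv_0_lt_compat; auto).
    apply Rmult_le_reg_r with Lam; auto. rewrite Rmult_assoc, Rinv_l, Rmult_1_r by lra.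
    assert (hKL : Kc * Lam = (Lam + 2) * B + (l + 2)) by (unfold Kc; field; lra).
    apply Rle_trans with (e1 * (Kc * Lam) * a).
    + rewrite hKL. eapply Rle_trans; [exact hest|]. rewrite Rmult_assoc. apply Rmult_le_compat_l; [lra|].
      assert ((Lam + 2) * b <= (Lam + 2) * (B * a)) by (apply Rmult_le_compat_l; lra). lra.
    + replace (e1 * (Kc * Lam) * a) with ((e1 * Kc) * (Lam * a)) by ring. replace (e * a * Lam) with (e * (Lam * a)) by ring.
      apply Rmult_le_compat_r; auto. apply Rmult_le_pos; lra.
  - fold tau. fold b. unfold b in *. lra. }
(* The speed times the derivative of the parameter in the angle is the radius of curvature. *)
assert (hrate : l * (l / Lam) = / k) by (unfold Lam; field; lra).
assert (fin : forall (pr : vec -> R) (f : R -> R) co, (forall t, pr (c t) = f t) -> Rabs co <= 1 -> is_derive f t0 (l * co) ->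
  is_derive (fun s => pr (gamma s)) th (/ k * co)).
{ intros pr f co hpr hco hf. apply is_derive_Reals. intros e he.
  set (C := 2 * (l / Lam + 1) + l + 1). assert (hlL : 0 < l / Lam) by (apply Rdiv_lt_0_compat; auto).
  assert (hC : 0 < C) by (unfold C; lra).
  set (e' := e / 2 / C). assert (he' : 0 < e') by (apply Rdiv_lt_0_compat; lra).
  destruct (is_derive_eps f t0 (l * co) hf e' he') as (d1 & hd1 & w1).
  set (e2 := Rmin (Rmin e' 1) d1). assert (he2 : 0 < e2) by (repeat apply Rmin_pos; auto; lra).
  assert (i1 : e2 <= e') by (eapply Rle_trans; [apply Rmin_l|apply Rmin_l]).
  assert (i2 : e2 <= 1) by (eapply Rle_trans; [apply Rmin_l|apply Rmin_r]).
  assert (i3 : e2 <= d1) by apply Rmin_r. clearbody e2.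
  destruct (main e2 he2) as (d & hd & w). exists (mkposreal d hd). intros ph hph0 hph. simpl in hph.
  destruct (w ph hph) as (t & g1 & g2 & g3).
  rewrite g1, hgt, !hpr. specialize (w1 t ltac:(lra)).
  assert (hpa : 0 < Rabs ph) by (apply Rabs_pos_lt; auto).
  replace ((f t - f t0) / ph - / k * co) with ((f t - f t0 - / k * co * ph) / ph) by (field; split; lra).
  unfold Rdiv. rewrite Rabs_mult, Rabs_inv. apply Rmult_lt_reg_r with (Rabs ph); auto.
  rewrite Rmult_assoc, Rinv_l, Rmult_1_r by lra.
  replace (f t - f t0 - / k * co * ph) with ((f t - f t0 - l * co * (t - t0)) + l * co * (t - t0 - l / Lam * ph)) by (rewrite <- hrate; ring).
  set (b := Rabs (t - t0)) in *. set (a := Rabs ph) in *.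
  assert (hb : b <= (l / Lam + 1) * a).
  { unfold b. replace (t - t0) with ((t - t0 - l / Lam * ph) + l / Lam * ph) by ring.
    eapply Rle_trans; [apply Rabs_triang|]. rewrite Rabs_mult, (Rabs_pos_eq (l / Lam)) by lra. fold a.
    assert (e2 * a <= 1 * a) by (apply Rmult_le_compat_r; lra). lra. }
  eapply Rle_lt_trans; [apply Rabs_triang|].
  assert (j1 : e' * b <= e' * ((l / Lam + 1) * a)) by (apply Rmult_le_compat_l; lra).
  assert (j2 : Rabs (l * co * (t - t0 - l / Lam * ph)) <= l * (e' * a)).
  { rewrite !Rabs_mult, (Rabs_pos_eq l) by lra. rewrite Rmult_assoc. apply Rmult_le_compat_l; [lra|].
    rewrite <- (Rmult_1_l (e' * a)). apply Rmult_le_compat; auto using Rabs_pos.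
    eapply Rle_trans; [exact g2|]. apply Rmult_le_compat_r; lra. }
  assert (j3 : e' * C = e / 2) by (unfold e'; field; lra).
  assert (j4 : e' * (C * a) = e / 2 * a) by (rewrite <- Rmult_assoc, j3; ring).
  assert (0 < e' * a) by (apply Rmult_lt_0_compat; auto). assert (0 < e * a) by (apply Rmult_lt_0_compat; auto).
  assert (j5 : e' * (C * a) = 2 * (e' * ((l / Lam + 1) * a)) + l * (e' * a) + e' * a) by (unfold C; ring).
  assert (0 < e' * ((l / Lam + 1) * a)) by (apply Rmult_lt_0_compat; [auto|apply Rmult_lt_0_compat; lra]).
  lra. }
split.
- apply (fin fst x (cos th)); [reflexivity|apply Rabs_le; apply COS_bound|]. rewrite <- ex0. apply dx.
- apply (fin snd y (sin th)); [reflexivity|apply Rabs_le; apply SIN_bound|]. rewrite <- ey0. apply dy.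
Qed.

(** The curve seen from its tangent angle: [rh] is the radius of curvature, bounded above and below
    by compactness. *)
Record envelope (gamma : R -> vec) (k1 k2 : R) : Prop := {
  ev_pos : 0 < k1;
  ev_der : forall th, exists rh, k1 <= rh <= k2 /\
    is_derive (fun s => fst (gamma s)) th (rh * cos th) /\ is_derive (fun s => snd (gamma s)) th (rh * sin th);
  ev_per : forall th, gamma (th + 2 * PI) = gamma th
}.

Lemma curvature_continuous c t : strictly_convex_curve c -> continuous (curvature c) t.
Proof.
intro hc.
set (x := fun s => fst (c s)). set (y := fun s => snd (c s)).
assert (dx := fun t => analytic_is_derive x t (proj1 (scc_analytic hc t))). assert (dy := fun t => analytic_is_derive y t (proj2 (scc_analytic hc t))).
assert (dx' := fun t => analytic_is_derive (Derive x) t (proj2 (dx t))). assert (dy' := fun t => analytic_is_derive (Derive y) t (proj2 (dy t))).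
assert (dx'' := fun t => analytic_is_derive (Derive (Derive x)) t (proj2 (dx' t))). assert (dy'' := fun t => analytic_is_derive (Derive (Derive y)) t (proj2 (dy' t))).
pose proof (vlen_pos _ (scc_regular hc (t := t))) as hl. unfold vlen in hl.
change (fst (velocity c t)) with (Derive x t) in hl. change (snd (velocity c t)) with (Derive y t) in hl.
assert (hr : 0 < Derive x t ^ 2 + Derive y t ^ 2).
{ destruct (Rle_or_lt (Derive x t ^ 2 + Derive y t ^ 2) 0); [|auto]. rewrite sqrt_neg_0 in hl; auto; lra. }
assert (cx' := is_derive_cont _ _ _ (proj1 (dx' t))). assert (cy' := is_derive_cont _ _ _ (proj1 (dy' t))).
assert (cx'' := is_derive_cont _ _ _ (proj1 (dx'' t))). assert (cy'' := is_derive_cont _ _ _ (proj1 (dy'' t))).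
apply (continuous_ext (fun t => (Derive x t * Derive (Derive y) t - Derive y t * Derive (Derive x) t) * / (sqrt (Derive x t * Derive x t + Derive y t * Derive y t) * (sqrt (Derive x t * Derive x t + Derive y t * Derive y t) * sqrt (Derive x t * Derive x t + Derive y t * Derive y t))))).
{ intro u. unfold curvature, det, vlen, Rdiv.
  change (fst (velocity c u)) with (Derive x u). change (snd (velocity c u)) with (Derive y u).
  change (fst (velocity (velocity c) u)) with (Derive (Derive x) u). change (snd (velocity (velocity c) u)) with (Derive (Derive y) u).
  replace (Derive x u ^ 2 + Derive y u ^ 2) with (Derive x u * Derive x u + Derive y u * Derive y u) by ring.
  simpl. rewrite Rmult_1_r. reflexivity. }
assert (cs : continuous (fun t => sqrt (Derive x t * Derive x t + Derive y t * Derive y t)) t).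
{ apply (continuous_comp (fun t => Derive x t * Derive x t + Derive y t * Derive y t) sqrt).
  - apply (continuous_plus (fun t => Derive x t * Derive x t)); apply @continuous_mult; auto.
  - apply continuous_sqrt. }
apply (continuous_mult (fun t => Derive x t * Derive (Derive y) t - Derive y t * Derive (Derive x) t)).
- apply (continuous_minus (fun t => Derive x t * Derive (Derive y) t)); apply @continuous_mult; auto.
- apply continuous_Rinv_comp.
  + apply (continuous_mult (fun t => sqrt (Derive x t * Derive x t + Derive y t * Derive y t))); auto.
    apply @continuous_mult; auto.
  + replace (Derive x t * Derive x t + Derive y t * Derive y t) with (Derive x t ^ 2 + Derive y t ^ 2) by ring.
    assert (0 < sqrt (Derive x t ^ 2 + Derive y t ^ 2)) by auto. apply Rgt_not_eq. repeat apply Rmult_lt_0_compat; auto.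
Qed.

Lemma convex_envelope c gamma : strictly_convex_curve c -> tangent_angle_param c gamma -> exists k1 k2, envelope gamma k1 k2.
Proof.
intros hc hg.
assert (hvp : forall t, velocity c (t + 1) = velocity c t).
{ intro t. unfold velocity. f_equal; apply (Derive_periodic (fun s => _ (c s)) 1); intro u; rewrite (scc_closed hc); auto. }
destruct (positive_periodic_bounds (curvature c)) as (m & M & hm & hb).
- intro t. unfold curvature. rewrite !hvp.
  assert (e : velocity (velocity c) (t + 1) = velocity (velocity c) t).
  { unfold velocity at 1 3. f_equal; apply (Derive_periodic (fun s => _ (velocity c s)) 1); intro u; rewrite hvp; auto. }
  rewrite e. auto.
- apply scc_curvature; auto.
- intro t. apply curvature_continuous; auto.
- assert (hM : 0 < M) by (specialize (hb 0); lra).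
  exists (/ M), (/ m). split.
  + apply Rinv_0_lt_compat; auto.
  + intro th. destruct (gamma_derive c gamma hc hg th) as (t & _ & h1 & h2). exists (/ curvature c t). split; auto.
    specialize (hb t). split; apply Rinv_le_contravar; lra.
  + intro th. destruct (hg th) as (t & h1 & h2). destruct (hg (th + 2 * PI)) as (t' & h1' & h2').
    rewrite h1, h1'. apply (gauss_injective c t' t (dir th) hc); auto. rewrite h2'. unfold dir. rewrite cos_2PI_plus || rewrite (Rplus_comm th); f_equal; [|].
    * replace (2 * PI + th) with (th + 2 * PI) by ring. rewrite cos_plus, cos_2PI, sin_2PI. ring.
    * replace (2 * PI + th) with (th + 2 * PI) by ring. rewrite sin_plus, cos_2PI, sin_2PI. ring.
Qed.

(** * Support function and lengths of tangent segments *)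

(** The support function for the outer normal [(sin th, - cos th)]. Its derivative is [tang], and
    the derivative of [tang] is [rh - supp]. *)
Definition supp (gamma : R -> vec) (th : R) : R := det (gamma th) (dir th).
Definition tang (gamma : R -> vec) (th : R) : R := fst (gamma th) * cos th + snd (gamma th) * sin th.

Lemma gamma_supp_tang gamma th :
  fst (gamma th) = supp gamma th * sin th + tang gamma th * cos th /\
  snd (gamma th) = tang gamma th * sin th - supp gamma th * cos th.
Proof.
unfold supp, tang, det, dir; cbn [fst snd]. pose proof (sin2_cos2 th) as h. unfold Rsqr in h.
split; [transitivity (fst (gamma th) * (sin th * sin th + cos th * cos th))|transitivity (snd (gamma th) * (sin th * sin th + cos th * cos th))]; try (rewrite h; ring); ring.
Qed.

(** [lead] is the distance from [gamma th] to the tangent line of angle [th1], and [trail] the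
    distance from [gamma th1] to that of angle [th]. Divided by the sine of the angle between the
    lines, they give the two tangent lengths. *)
Definition lead (gamma : R -> vec) (th th1 : R) : R :=
  supp gamma th1 - supp gamma th * cos (th1 - th) - tang gamma th * sin (th1 - th).
Definition trail (gamma : R -> vec) (th th1 : R) : R :=
  supp gamma th - supp gamma th1 * cos (th1 - th) + tang gamma th1 * sin (th1 - th).

(** The vector equation is projected on the normals of the two tangent lines; these are transverse,
    so the two projections are equivalent to it. *)
Lemma dual_billiard_lengths gamma th r th1 r1 :
  dual_billiard gamma th r th1 r1 <-> 0 < r /\ 0 < r1 /\ 0 < th1 - th < PI /\
    r * sin (th1 - th) = lead gamma th th1 /\ r1 * sin (th1 - th) = trail gamma th th1.
Proof.
unfold dual_billiard, lead, trail, along, dir. cbn [fst snd].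
destruct (gamma_supp_tang gamma th) as (a1 & a2). destruct (gamma_supp_tang gamma th1) as (b1 & b2).
set (h := supp gamma th) in *. set (h1 := supp gamma th1) in *. set (g := tang gamma th) in *. set (g1 := tang gamma th1) in *.
rewrite a1, a2, b1, b2. rewrite sin_minus, cos_minus.
pose proof (sin2_cos2 th) as hs. pose proof (sin2_cos2 th1) as hs1. unfold Rsqr in hs, hs1.
split.
- intros (p1 & p2 & p3 & p4). split; auto. split; auto. split; auto.
  assert (e1 := f_equal fst p4). assert (e2 := f_equal snd p4). cbn [fst snd] in e1, e2.
  set (s := sin th) in *. set (co := cos th) in *. set (s1 := sin th1) in *. set (c1 := cos th1) in *.
  split.
  + transitivity ((h * s + g * co + r * co) * s1 - (g * s - h * co + r * s) * c1 - (h * (co * c1 + s * s1) + g * (s1 * co - c1 * s))); [ring|].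
    replace (h * s + g * co + r * co) with (h1 * s1 + g1 * c1 + - r1 * c1) by lra.
    replace (g * s - h * co + r * s) with (g1 * s1 - h1 * c1 + - r1 * s1) by lra.
    transitivity (h1 * (s1 * s1 + c1 * c1) - (h * (co * c1 + s * s1) + g * (s1 * co - c1 * s))); [ring|]. rewrite hs1. replace (c1 * co + s1 * s) with (co * c1 + s * s1) by ring. ring.
  + transitivity (- ((g1 * s1 - h1 * c1 + - r1 * s1) * co - (h1 * s1 + g1 * c1 + - r1 * c1) * s) + (g1 * (s1 * co - c1 * s) - h1 * (co * c1 + s * s1))); [ring|].
    replace (h1 * s1 + g1 * c1 + - r1 * c1) with (h * s + g * co + r * co) by lra.
    replace (g1 * s1 - h1 * c1 + - r1 * s1) with (g * s - h * co + r * s) by lra.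
    transitivity (h * (s * s + co * co) + (g1 * (s1 * co - c1 * s) - h1 * (co * c1 + s * s1))); [ring|]. rewrite hs. ring.
- intros (p1 & p2 & p3 & e1 & e2). split; auto. split; auto. split; auto.
  assert (hsd : sin th1 * cos th - cos th1 * sin th <> 0).
  { rewrite <- sin_minus. apply Rgt_not_eq, sin_gt_0; lra. }
  set (s := sin th) in *. set (co := cos th) in *. set (s1 := sin th1) in *. set (c1 := cos th1) in *.
  set (u := h * s + g * co + r * co - (h1 * s1 + g1 * c1 + - r1 * c1)).
  set (v := g * s - h * co + r * s - (g1 * s1 - h1 * c1 + - r1 * s1)).
  assert (w1 : u * s1 - v * c1 = 0).
  { transitivity (r * (s1 * co - c1 * s) - (h1 * (s1 * s1 + c1 * c1) - h * (c1 * co + s1 * s) - g * (s1 * co - c1 * s))); [unfold u, v; ring|]. rewrite hs1, e1. ring. }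
  assert (w2 : co * v - s * u = 0).
  { transitivity (r1 * (s1 * co - c1 * s) - (h * (s * s + co * co) - h1 * (c1 * co + s1 * s) + g1 * (s1 * co - c1 * s))); [unfold u, v; ring|]. rewrite hs, e2. ring. }
  assert (u = 0). { apply Rmult_eq_reg_r with (s1 * co - c1 * s); auto. transitivity (co * (u * s1 - v * c1) + c1 * (co * v - s * u)); [ring|]. rewrite w1, w2. ring. }
  assert (v = 0). { apply Rmult_eq_reg_r with (s1 * co - c1 * s); auto. transitivity (s * (u * s1 - v * c1) + s1 * (co * v - s * u)); [ring|]. rewrite w1, w2. ring. }
  unfold u, v in *. f_equal; lra.
Qed.

Lemma supp_derive gamma k1 k2 : envelope gamma k1 k2 -> forall th, is_derive (supp gamma) th (tang gamma th) /\
  exists rh, k1 <= rh <= k2 /\ is_derive (tang gamma) th (rh - supp gamma th).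
Proof.
intros hev th. destruct (ev_der _ _ _ hev th) as (rh & hr & hx & hy). split; [|exists rh; split; auto].
- unfold supp, tang, det, dir; cbn [fst snd].
  evar_last.
  + apply (is_derive_minus (fun th => fst (gamma th) * sin th) (fun th => snd (gamma th) * cos th)).
    * apply (is_derive_mult (fun th => fst (gamma th)) sin); [exact hx|apply is_derive_Reals, derivable_pt_lim_sin|]. intros; apply Rmult_comm.
    * apply (is_derive_mult (fun th => snd (gamma th)) cos); [exact hy|apply is_derive_Reals, derivable_pt_lim_cos|]. intros; apply Rmult_comm.
  + unfold minus, plus, opp, mult; simpl. unfold mult; simpl. ring.
- unfold tang.
  evar_last.
  + apply (is_derive_plus (fun th => fst (gamma th) * cos th) (fun th => snd (gamma th) * sin th)).
    * apply (is_derive_mult (fun th => fst (gamma th)) cos); [exact hx|apply is_derive_Reals, derivable_pt_lim_cos|]. intros; apply Rmult_comm.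
    * apply (is_derive_mult (fun th => snd (gamma th)) sin); [exact hy|apply is_derive_Reals, derivable_pt_lim_sin|]. intros; apply Rmult_comm.
  + unfold minus, plus, opp, mult; simpl. unfold mult; simpl. pose proof (sin2_cos2 th) as h. unfold Rsqr in h.
    unfold supp, det, dir; cbn [fst snd].
    transitivity (rh * (sin th * sin th + cos th * cos th) - (fst (gamma th) * sin th - snd (gamma th) * cos th)); [ring|rewrite h; ring].
Qed.

Lemma decreasing_of_derive (f f' : R -> R) a b : a <= b -> (forall t, a <= t <= b -> is_derive f t (f' t)) ->
  (forall t, a <= t <= b -> f' t <= 0) -> f b <= f a.
Proof.
intros hab hd hs. destruct (MVT_gen f a b f') as (t & ht & he).
- intros t ht. apply hd. rewrite Rmin_left, Rmax_right in ht; lra.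
- intros t ht. apply continuity_pt_filterlim. eapply is_derive_cont. apply hd. rewrite Rmin_left, Rmax_right in ht; lra.
- rewrite Rmin_left, Rmax_right in ht by lra. specialize (hs t ht). nra.
Qed.

Lemma increasing_of_derive (f f' : R -> R) a b : a <= b -> (forall t, a <= t <= b -> is_derive f t (f' t)) ->
  (forall t, a <= t <= b -> 0 <= f' t) -> f a <= f b.
Proof.
intros hab hd hs. apply Ropp_le_cancel. apply (decreasing_of_derive (fun t => - f t) (fun t => - f' t) a b hab).
- intros t ht. apply (is_derive_opp f). auto.
- intros t ht. specialize (hs t ht). lra.
Qed.

Lemma is_derive_cos_minus_l a t : is_derive (fun t => cos (a - t)) t (sin (a - t)).
Proof. unfold Rminus. auto_derive; auto. ring. Qed.
Lemma is_derive_sin_minus_l a t : is_derive (fun t => sin (a - t)) t (- cos (a - t)).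
Proof. unfold Rminus. auto_derive; auto. ring. Qed.
Lemma is_derive_cos_minus_r a t : is_derive (fun t => cos (t - a)) t (- sin (t - a)).
Proof. unfold Rminus. auto_derive; auto. ring. Qed.
Lemma is_derive_sin_minus_r a t : is_derive (fun t => sin (t - a)) t (cos (t - a)).
Proof. unfold Rminus. auto_derive; auto. ring. Qed.

Lemma lead_derive gamma k1 k2 th th1 : envelope gamma k1 k2 -> exists rh, k1 <= rh <= k2 /\
  is_derive (fun t => lead gamma t th1) th (- (rh * sin (th1 - th))).
Proof.
intro hev. destruct (supp_derive gamma k1 k2 hev th) as (h1 & rh & hr & h2). exists rh; split; auto.
unfold lead. evar_last.
- apply (is_derive_minus (fun t => supp gamma th1 - supp gamma t * cos (th1 - t)) (fun t => tang gamma t * sin (th1 - t))).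
  + apply (is_derive_minus (fun t => supp gamma th1) (fun t => supp gamma t * cos (th1 - t))); [apply @is_derive_const|].
    apply (is_derive_mult (supp gamma) (fun t => cos (th1 - t))); [exact h1|apply is_derive_cos_minus_l|]. intros; apply Rmult_comm.
  + apply (is_derive_mult (tang gamma) (fun t => sin (th1 - t))); [exact h2|apply is_derive_sin_minus_l|]. intros; apply Rmult_comm.
- unfold minus, plus, opp, mult, zero; simpl. unfold mult; simpl. ring.
Qed.

Lemma trail_derive gamma k1 k2 th th1 : envelope gamma k1 k2 -> exists rh, k1 <= rh <= k2 /\
  is_derive (fun t => trail gamma th t) th1 (rh * sin (th1 - th)).
Proof.
intro hev. destruct (supp_derive gamma k1 k2 hev th1) as (h1 & rh & hr & h2). exists rh; split; auto.
unfold trail. evar_last.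
- apply (is_derive_plus (fun t => supp gamma th - supp gamma t * cos (t - th)) (fun t => tang gamma t * sin (t - th))).
  + apply (is_derive_minus (fun t => supp gamma th) (fun t => supp gamma t * cos (t - th))); [apply @is_derive_const|].
    apply (is_derive_mult (supp gamma) (fun t => cos (t - th))); [exact h1|apply is_derive_cos_minus_r|]. intros; apply Rmult_comm.
  + apply (is_derive_mult (tang gamma) (fun t => sin (t - th))); [exact h2|apply is_derive_sin_minus_r|]. intros; apply Rmult_comm.
- unfold minus, plus, opp, mult, zero; simpl. unfold mult; simpl. ring.
Qed.

(** The derivative of [lead] in [th] is [- rh sin (th1 - th)]. For a circle of radius [k] the same
    quantity is [k (1 - cos (th1 - th))]; both vanish at [th = th1], and their derivatives
    compare. *)
Lemma lead_bounds gamma k1 k2 th th1 : envelope gamma k1 k2 -> 0 <= th1 - th <= PI ->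
  k1 * (1 - cos (th1 - th)) <= lead gamma th th1 <= k2 * (1 - cos (th1 - th)).
Proof.
intros hev hd.
assert (l0 : lead gamma th1 th1 = 0) by (unfold lead; rewrite Rminus_diag, cos_0, sin_0; ring).
assert (hD : forall k, exists f', forall t, is_derive (fun t => lead gamma t th1 - k * (1 - cos (th1 - t))) t (f' t) /\
   (th <= t <= th1 -> (k = k1 -> f' t <= 0) /\ (k = k2 -> 0 <= f' t))).
{ intro k. assert (hc : forall t, exists v, is_derive (fun t => lead gamma t th1 - k * (1 - cos (th1 - t))) t v /\
   (th <= t <= th1 -> (k = k1 -> v <= 0) /\ (k = k2 -> 0 <= v))).
  { intro t. destruct (lead_derive gamma k1 k2 t th1 hev) as (rh & hr & hl). exists (- (rh * sin (th1 - t)) - k * (- sin (th1 - t))). split.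
    - apply (is_derive_minus (fun t => lead gamma t th1) (fun t => k * (1 - cos (th1 - t)))); [exact hl|].
      apply (is_derive_scal (fun t => 1 - cos (th1 - t))). unfold Rminus. auto_derive; auto. ring.
    - intro ht. assert (0 <= sin (th1 - t)) by (apply sin_ge_0; lra). split; intros ->; nra. }
  exists (fun t => proj1_sig (constructive_indefinite_description _ (hc t))). intro t. destruct constructive_indefinite_description; auto. }
split.
- destruct (hD k1) as (f' & h). assert (q := decreasing_of_derive (fun t => lead gamma t th1 - k1 * (1 - cos (th1 - t))) f' th th1 ltac:(lra) (fun t _ => proj1 (h t)) (fun t ht => proj1 (proj2 (h t) ht) eq_refl)).
  cbv beta in q. rewrite l0, Rminus_diag, cos_0 in q. lra.
- destruct (hD k2) as (f' & h). assert (q := increasing_of_derive (fun t => lead gamma t th1 - k2 * (1 - cos (th1 - t))) f' th th1 ltac:(lra) (fun t _ => proj1 (h t)) (fun t ht => proj2 (proj2 (h t) ht) eq_refl)).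
  cbv beta in q. rewrite l0, Rminus_diag, cos_0 in q. lra.
Qed.

Lemma trail_bounds gamma k1 k2 th th1 : envelope gamma k1 k2 -> 0 <= th1 - th <= PI ->
  k1 * (1 - cos (th1 - th)) <= trail gamma th th1 <= k2 * (1 - cos (th1 - th)).
Proof.
intros hev hd.
assert (l0 : trail gamma th th = 0) by (unfold trail; rewrite Rminus_diag, cos_0, sin_0; ring).
assert (hD : forall k, exists f', forall t, is_derive (fun t => trail gamma th t - k * (1 - cos (t - th))) t (f' t) /\
   (th <= t <= th1 -> (k = k1 -> 0 <= f' t) /\ (k = k2 -> f' t <= 0))).
{ intro k. assert (hc : forall t, exists v, is_derive (fun t => trail gamma th t - k * (1 - cos (t - th))) t v /\
   (th <= t <= th1 -> (k = k1 -> 0 <= v) /\ (k = k2 -> v <= 0))).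
  { intro t. destruct (trail_derive gamma k1 k2 th t hev) as (rh & hr & hl). exists (rh * sin (t - th) - k * sin (t - th)). split.
    - apply (is_derive_minus (fun t => trail gamma th t) (fun t => k * (1 - cos (t - th)))); [exact hl|].
      apply (is_derive_scal (fun t => 1 - cos (t - th))). unfold Rminus. auto_derive; auto. ring.
    - intro ht. assert (0 <= sin (t - th)) by (apply sin_ge_0; lra). split; intros ->; nra. }
  exists (fun t => proj1_sig (constructive_indefinite_description _ (hc t))). intro t. destruct constructive_indefinite_description; auto. }
split.
- destruct (hD k1) as (f' & h). assert (q := increasing_of_derive (fun t => trail gamma th t - k1 * (1 - cos (t - th))) f' th th1 ltac:(lra) (fun t _ => proj1 (h t)) (fun t ht => proj1 (proj2 (h t) ht) eq_refl)).
  cbv beta in q. rewrite l0, Rminus_diag, cos_0 in q. lra.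
- destruct (hD k2) as (f' & h). assert (q := decreasing_of_derive (fun t => trail gamma th t - k2 * (1 - cos (t - th))) f' th th1 ltac:(lra) (fun t _ => proj1 (h t)) (fun t ht => proj2 (proj2 (h t) ht) eq_refl)).
  cbv beta in q. rewrite l0, Rminus_diag, cos_0 in q. lra.
Qed.

Lemma x_cos_le_sin x : 0 <= x <= PI / 2 -> x * cos x <= sin x.
Proof.
intro hx. assert (q := increasing_of_derive (fun t => sin t - t * cos t) (fun t => t * sin t) 0 x ltac:(lra)).
cbv beta in q. rewrite sin_0, Rmult_0_l in q.
assert (0 - 0 <= sin x - x * cos x); [|lra]. apply q.
- intros t _. auto_derive; auto. ring.
- intros t ht. apply Rmult_le_pos; [lra|]. apply sin_ge_0; lra.
Qed.

Lemma half_angle x : sin x = 2 * sin (x / 2) * cos (x / 2) /\ 1 - cos x = 2 * sin (x / 2) * sin (x / 2).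
Proof.
split.
- rewrite <- sin_2a. f_equal. lra.
- replace x with (2 * (x / 2)) at 1 by lra. rewrite cos_2a_sin. ring.
Qed.

Lemma cos_half_ge x : 0 <= x <= 2 -> / 2 <= cos (x / 2).
Proof.
intro hx. rewrite <- cos_PI3 || replace (/ 2) with (1 / 2) by lra. try rewrite <- cos_PI3.
pose proof PI_RGT_0. pose proof PI_4. assert (3 <= PI) by (pose proof PI2_3_2; lra).
apply cos_decr_1; lra.
Qed.

(** By half angles, [r] lies between [k1] and [k2] times the tangent of [(th1 - th) / 2], and [r1]
    below [k2] times it, as for tangents to circles. *)
Lemma dual_billiard_step gamma k1 k2 th r th1 r1 : envelope gamma k1 k2 -> dual_billiard gamma th r th1 r1 ->
  k1 * (th1 - th) <= 2 * r /\ (th1 - th <= 2 -> r <= k2 * (th1 - th)) /\ k1 * r1 <= k2 * r.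
Proof.
intros hev hd. apply dual_billiard_lengths in hd. destruct hd as (h1 & h2 & h3 & h4 & h5).
assert (hl := lead_bounds _ _ _ th th1 hev ltac:(lra)). assert (ht := trail_bounds _ _ _ th th1 hev ltac:(lra)).
rewrite <- h4 in hl. rewrite <- h5 in ht.
destruct (half_angle (th1 - th)) as (e1 & e2). rewrite e1, e2 in *. clear e1 e2 h4 h5.
set (x := th1 - th) in *.
assert (hs : 0 < sin (x / 2)) by (apply sin_gt_0; lra). assert (hc : 0 < cos (x / 2)) by (apply cos_gt_0; lra).
pose proof (ev_pos _ _ _ hev) as hk1.
assert (a1 : k1 * sin (x / 2) <= r * cos (x / 2)).
{ apply Rmult_le_reg_l with (2 * sin (x / 2)); [lra|]. lra. }
assert (a2 : r * cos (x / 2) <= k2 * sin (x / 2)).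
{ apply Rmult_le_reg_l with (2 * sin (x / 2)); [lra|]. lra. }
assert (a3 : r1 * cos (x / 2) <= k2 * sin (x / 2)).
{ apply Rmult_le_reg_l with (2 * sin (x / 2)); [lra|]. lra. }
assert (hk2 : 0 < k2). { destruct (ev_der _ _ _ hev 0) as (rh & q & _). lra. }
pose proof (x_cos_le_sin (x / 2) ltac:(lra)) as a4.
split; [|split].
- apply Rmult_le_reg_r with (cos (x / 2)); auto.
  assert (k1 * (x / 2 * cos (x / 2)) <= k1 * sin (x / 2)) by (apply Rmult_le_compat_l; lra). lra.
- intro hx. pose proof (cos_half_ge x ltac:(lra)). assert (sin (x / 2) <= x / 2) by (left; apply sin_lt_x; lra).
  assert (k2 * sin (x / 2) <= k2 * (x / 2)) by (apply Rmult_le_compat_l; lra).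
  assert (r * / 2 <= r * cos (x / 2)) by (apply Rmult_le_compat_l; lra). lra.
- apply Rmult_le_reg_r with (cos (x / 2)); auto.
  assert (k1 * (r1 * cos (x / 2)) <= k1 * (k2 * sin (x / 2))) by (apply Rmult_le_compat_l; lra).
  assert (k2 * (k1 * sin (x / 2)) <= k2 * (r * cos (x / 2))) by (apply Rmult_le_compat_l; lra). lra.
Qed.

(** Intermediate value theorem for [lead - r sin]: it is at most 0 at the small angle [d0], where
    [k2 d0 <= r], and at least 0 at a right angle, where [lead >= k1 > r]. *)
Lemma dual_billiard_exists gamma k1 k2 th r : envelope gamma k1 k2 -> 0 < r < k1 ->
  exists th1 r1, dual_billiard gamma th r th1 r1.
Proof.
intros hev hr. assert (hk2 : k1 <= k2). { destruct (ev_der _ _ _ hev 0) as (rh & q & _). lra. }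
set (d0 := Rmin 1 (r / k2)). assert (hd0 : 0 < d0) by (apply Rmin_pos; [lra|apply Rdiv_lt_0_compat; lra]).
assert (hd1 : d0 <= 1) by apply Rmin_l. assert (hd2 : d0 * k2 <= r).
{ assert (q : d0 <= r / k2) by apply Rmin_r. apply Rmult_le_compat_r with (r := k2) in q; [|lra]. replace (r / k2 * k2) with r in q by (field; lra). auto. }
clearbody d0. assert (hpi : 3 <= PI) by (pose proof PI2_3_2; lra).
set (f := fun t => lead gamma th t - r * sin (t - th)).
assert (hf : forall t, continuous f t).
{ intro t. destruct (supp_derive _ _ _ hev t) as (h1 & _).
  apply (continuous_minus (fun t => lead gamma th t) (fun t => r * sin (t - th))).
  - apply (continuous_minus (fun t => supp gamma t - supp gamma th * cos (t - th)) (fun t => tang gamma th * sin (t - th))).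
    + apply (continuous_minus (supp gamma) (fun t => supp gamma th * cos (t - th))).
      * eapply is_derive_cont; exact h1.
      * eapply is_derive_cont. apply is_derive_scal. apply is_derive_cos_minus_r.
    + eapply is_derive_cont. apply is_derive_scal. apply is_derive_sin_minus_r.
  - eapply is_derive_cont. apply is_derive_scal. apply is_derive_sin_minus_r. }
assert (f0 : f (th + d0) <= 0).
{ unfold f. pose proof (lead_bounds _ _ _ th (th + d0) hev ltac:(lra)) as q.
  replace (th + d0 - th) with d0 in * by ring. destruct (half_angle d0) as (e1 & e2). rewrite e1. rewrite e2 in q.
  pose proof (cos_half_ge d0 ltac:(lra)). assert (sin (d0 / 2) <= d0 / 2) by (left; apply sin_lt_x; lra).
  assert (hs : 0 < sin (d0 / 2)) by (apply sin_gt_0; lra).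
  assert (k2 * sin (d0 / 2) <= k2 * (d0 / 2)) by (apply Rmult_le_compat_l; lra).
  assert (r * / 2 <= r * cos (d0 / 2)) by (apply Rmult_le_compat_l; lra).
  assert (2 * sin (d0 / 2) * (k2 * sin (d0 / 2)) <= 2 * sin (d0 / 2) * (r * cos (d0 / 2))) by (apply Rmult_le_compat_l; lra). lra. }
assert (f1 : 0 <= f (th + PI / 2)).
{ unfold f. pose proof (lead_bounds _ _ _ th (th + PI / 2) hev ltac:(lra)) as q.
  replace (th + PI / 2 - th) with (PI / 2) in * by ring. rewrite cos_PI2 in q. rewrite sin_PI2. lra. }
destruct (IVT_gen f (th + d0) (th + PI / 2) 0) as (t & ht & hft).
{ intro t. apply continuity_pt_filterlim. apply hf. }
{ rewrite Rmin_left, Rmax_right; lra. }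
rewrite Rmin_left, Rmax_right in ht by lra.
assert (hs : 0 < sin (t - th)) by (apply sin_gt_0; lra).
exists t, (trail gamma th t / sin (t - th)). apply dual_billiard_lengths.
pose proof (trail_bounds _ _ _ th t hev ltac:(lra)) as q.
destruct (half_angle (t - th)) as (_ & e2). rewrite e2 in q.
assert (hs2 : 0 < sin ((t - th) / 2)) by (apply sin_gt_0; lra).
assert (0 < k1 * (2 * sin ((t - th) / 2) * sin ((t - th) / 2))) by (repeat apply Rmult_lt_0_compat; lra).
split; [lra|]. split; [apply Rdiv_lt_0_compat; lra|]. split; [lra|]. split; [unfold f in hft; lra|]. field. lra.
Qed.

Lemma continuous_periodic_bounded (f : R -> R) : (forall t, continuous f t) -> (forall t, f (t + 2 * PI) = f t) ->
  exists B, 0 < B /\ forall t, Rabs (f t) <= B.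
Proof.
intros hc hp. pose proof PI_RGT_0 as hpi.
destruct (positive_periodic_bounds (fun t => 1 + Rabs (f (2 * PI * t)))) as (m & M & hm & h).
- intro t. rewrite <- (hp (2 * PI * t)). do 3 f_equal. ring.
- intro t. pose proof (Rabs_pos (f (2 * PI * t))). lra.
- intro t. apply (continuous_plus (fun _ => 1)); [apply continuous_const|].
  apply (continuous_comp (fun t => f (2 * PI * t)) Rabs); [|apply continuous_Rabs].
  apply (continuous_comp (fun t => 2 * PI * t) f); [|apply hc].
  apply (is_derive_cont (fun t => 2 * PI * t) t (2 * PI)). auto_derive; auto. ring.
- exists M. split.
  + specialize (h 0). lra.
  + intro t. specialize (h (t / (2 * PI))). replace (2 * PI * (t / (2 * PI))) with t in h by (field; lra). pose proof (Rabs_pos (f t)). lra.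
Qed.

Lemma supp_periodic gamma k1 k2 : envelope gamma k1 k2 -> forall th, supp gamma (th + 2 * PI) = supp gamma th /\ tang gamma (th + 2 * PI) = tang gamma th.
Proof.
intros hev th. unfold supp, tang, det, dir; cbn [fst snd]. rewrite (ev_per _ _ _ hev).
rewrite cos_plus, sin_plus, cos_2PI, sin_2PI. split; ring.
Qed.

Lemma supp_bounded gamma k1 k2 : envelope gamma k1 k2 -> exists B, 0 < B /\ forall th, Rabs (supp gamma th) <= B /\ Rabs (tang gamma th) <= B.
Proof.
intro hev.
destruct (continuous_periodic_bounded (supp gamma)) as (B1 & p1 & q1).
{ intro t. destruct (supp_derive _ _ _ hev t) as (h1 & _). eapply is_derive_cont; exact h1. }
{ intro t. apply (supp_periodic _ _ _ hev). }
destruct (continuous_periodic_bounded (tang gamma)) as (B2 & p2 & q2).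
{ intro t. destruct (supp_derive _ _ _ hev t) as (_ & rh & _ & h1). eapply is_derive_cont; exact h1. }
{ intro t. apply (supp_periodic _ _ _ hev). }
exists (B1 + B2). split; [lra|]. intro t. specialize (q1 t). specialize (q2 t). lra.
Qed.

Lemma lipschitz_of_derive (f : R -> R) C : (forall t, exists l, is_derive f t l /\ Rabs l <= C) -> forall a b, Rabs (f b - f a) <= C * Rabs (b - a).
Proof.
intros h a b.
set (f' := fun t => proj1_sig (constructive_indefinite_description _ (h t))).
assert (hf : forall t, is_derive f t (f' t) /\ Rabs (f' t) <= C) by (intro t; unfold f'; destruct constructive_indefinite_description; auto).
destruct (MVT_gen f a b f') as (t & _ & he).
- intros t _. apply hf.
- intros t _. apply continuity_pt_filterlim. eapply is_derive_cont. apply hf.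
- rewrite he, Rabs_mult. apply Rmult_le_compat_r; [apply Rabs_pos|apply hf].
Qed.

Lemma lead_trail_lipschitz gamma k1 k2 : envelope gamma k1 k2 -> exists C, 0 < C /\ forall th t t',
  Rabs (lead gamma th t' - lead gamma th t) <= C * Rabs (t' - t) /\ Rabs (trail gamma th t' - trail gamma th t) <= C * Rabs (t' - t).
Proof.
intro hev. destruct (supp_bounded _ _ _ hev) as (B & hB & hb).
assert (hk2 : 0 < k1 <= k2). { split; [apply (ev_pos _ _ _ hev)|]. destruct (ev_der _ _ _ hev 0) as (rh & q & _). lra. }
exists (3 * B + k2). split; [lra|]. intros th t t'. split.
- apply (lipschitz_of_derive (fun t => lead gamma th t)). intro u.
  exists (tang gamma u + supp gamma th * sin (u - th) - tang gamma th * cos (u - th)). split.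
  + unfold lead. destruct (supp_derive _ _ _ hev u) as (h1 & _).
    apply (is_derive_minus (fun u => supp gamma u - supp gamma th * cos (u - th)) (fun u => tang gamma th * sin (u - th))).
    * evar_last; [apply (is_derive_minus (supp gamma) (fun u => supp gamma th * cos (u - th))); [exact h1|apply is_derive_scal, is_derive_cos_minus_r]|].
      unfold minus, plus, opp; simpl. ring.
    * apply is_derive_scal, is_derive_sin_minus_r.
  + pose proof (proj1 (hb th)). pose proof (proj2 (hb th)). pose proof (proj2 (hb u)).
    assert (Rabs (supp gamma th * sin (u - th)) <= B * 1) by (rewrite Rabs_mult; apply Rmult_le_compat; auto using Rabs_pos; apply Rabs_le; apply SIN_bound).
    assert (Rabs (tang gamma th * cos (u - th)) <= B * 1) by (rewrite Rabs_mult; apply Rmult_le_compat; auto using Rabs_pos; apply Rabs_le; apply COS_bound).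
    apply Rabs_le_between in H1, H2, H3. apply Rabs_le. lra.
- apply (lipschitz_of_derive (fun t => trail gamma th t)). intro u.
  destruct (trail_derive _ _ _ th u hev) as (rh & hr & h1). exists (rh * sin (u - th)). split; auto.
  rewrite Rabs_mult, (Rabs_pos_eq rh) by lra. assert (Rabs (sin (u - th)) <= 1) by (apply Rabs_le; apply SIN_bound).
  pose proof (Rabs_pos (sin (u - th))). nra.
Qed.

(** * A generating function *)

(** Up to the coboundary of [defect], [gen] is the area swept by a side of the
    polygon; [gen_fst] and [gen_snd] are its partial derivatives. *)
Definition gen (gamma : R -> vec) (th th1 : R) : R :=
  (2 * supp gamma th * supp gamma th1 - (supp gamma th ^ 2 + supp gamma th1 ^ 2) * cos (th1 - th)) / (2 * sin (th1 - th)).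
Definition gen_fst (gamma : R -> vec) (th th1 : R) : R :=
  / 2 * (tang gamma th ^ 2 - supp gamma th ^ 2 - (lead gamma th th1 / sin (th1 - th)) ^ 2).
Definition gen_snd (gamma : R -> vec) (th th1 : R) : R :=
  / 2 * ((trail gamma th th1 / sin (th1 - th)) ^ 2 - tang gamma th1 ^ 2 + supp gamma th1 ^ 2).

Lemma gen_derive_fst gamma k1 k2 th th1 : envelope gamma k1 k2 -> sin (th1 - th) <> 0 ->
  is_derive (fun t => gen gamma t th1) th (gen_fst gamma th th1).
Proof.
intros hev hs. destruct (supp_derive _ _ _ hev th) as (h1 & _).
unfold gen. evar_last.
- apply (is_derive_div (fun t => 2 * supp gamma t * supp gamma th1 - (supp gamma t ^ 2 + supp gamma th1 ^ 2) * cos (th1 - t)) (fun t => 2 * sin (th1 - t)) th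
   (2 * tang gamma th * supp gamma th1 - (2 * tang gamma th * supp gamma th * cos (th1 - th) + (supp gamma th ^ 2 + supp gamma th1 ^ 2) * sin (th1 - th)))
   (2 * - cos (th1 - th))).
  + apply (is_derive_minus (fun t => 2 * supp gamma t * supp gamma th1) (fun t => (supp gamma t ^ 2 + supp gamma th1 ^ 2) * cos (th1 - t))).
    * apply (is_derive_ext (fun t => (2 * supp gamma th1) * supp gamma t)); [intro; match goal with |- @eq _ ?a ?b => change (@eq R a b) end; ring|].
      evar_last; [apply is_derive_scal; exact h1|]. match goal with |- @eq _ ?a ?b => change (@eq R a b) end. ring.
    * evar_last; [apply (is_derive_mult (fun t => supp gamma t ^ 2 + supp gamma th1 ^ 2) (fun t => cos (th1 - t)) th (2 * tang gamma th * supp gamma th) (sin (th1 - th)))|].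
      { evar_last; [apply (is_derive_plus (fun t => supp gamma t ^ 2) (fun _ => supp gamma th1 ^ 2)); [apply (is_derive_pow (supp gamma) 2); exact h1|apply @is_derive_const]|].
        unfold plus, zero; simpl. ring. }
      { apply is_derive_cos_minus_l. }
      { intros; apply Rmult_comm. }
      unfold plus, mult; simpl. unfold mult; simpl. ring.
  + apply is_derive_scal, is_derive_sin_minus_l.
  + lra.
- unfold gen_fst, lead. pose proof (sin2_cos2 (th1 - th)) as hsc. unfold Rsqr in hsc.
  set (s := sin (th1 - th)) in *. set (c := cos (th1 - th)) in *.
  set (h := supp gamma th) in *. set (h' := supp gamma th1) in *. set (g := tang gamma th) in *.
  apply Rmult_eq_reg_r with (2 * s * s); [|repeat apply Rmult_integral_contrapositive_currified; auto].
  transitivity ((2 * g * h' - (2 * g * h * c + (h ^ 2 + h' ^ 2) * s)) * s + (2 * h * h' - (h ^ 2 + h' ^ 2) * c) * c); [field; auto|].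
  transitivity ((g ^ 2 - h ^ 2) * s ^ 2 - (h' - h * c - g * s) ^ 2); [|field; auto].
  transitivity ((g ^ 2 - h ^ 2) * s ^ 2 - (h' - h * c - g * s) ^ 2 + h' ^ 2 * (1 - (s * s + c * c))); [ring|]. rewrite hsc. ring.
Qed.

Lemma gen_derive_snd gamma k1 k2 th th1 : envelope gamma k1 k2 -> sin (th1 - th) <> 0 ->
  is_derive (fun t => gen gamma th t) th1 (gen_snd gamma th th1).
Proof.
intros hev hs. destruct (supp_derive _ _ _ hev th1) as (h1 & _).
unfold gen. evar_last.
- apply (is_derive_div (fun t => 2 * supp gamma th * supp gamma t - (supp gamma th ^ 2 + supp gamma t ^ 2) * cos (t - th)) (fun t => 2 * sin (t - th)) th1
   (2 * supp gamma th * tang gamma th1 - (2 * tang gamma th1 * supp gamma th1 * cos (th1 - th) - (supp gamma th ^ 2 + supp gamma th1 ^ 2) * sin (th1 - th)))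
   (2 * cos (th1 - th))).
  + apply (is_derive_minus (fun t => 2 * supp gamma th * supp gamma t) (fun t => (supp gamma th ^ 2 + supp gamma t ^ 2) * cos (t - th))).
    * apply is_derive_scal; exact h1.
    * evar_last; [apply (is_derive_mult (fun t => supp gamma th ^ 2 + supp gamma t ^ 2) (fun t => cos (t - th)) th1 (2 * tang gamma th1 * supp gamma th1) (- sin (th1 - th)))|].
      { evar_last; [apply (is_derive_plus (fun _ => supp gamma th ^ 2) (fun t => supp gamma t ^ 2)); [apply @is_derive_const|apply (is_derive_pow (supp gamma) 2); exact h1]|].
        unfold plus, zero; simpl. ring. }
      { apply is_derive_cos_minus_r. }
      { intros; apply Rmult_comm. }
      unfold plus, mult; simpl. unfold mult; simpl. ring.
  + apply is_derive_scal, is_derive_sin_minus_r.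
  + lra.
- unfold gen_snd, trail. pose proof (sin2_cos2 (th1 - th)) as hsc. unfold Rsqr in hsc.
  set (s := sin (th1 - th)) in *. set (c := cos (th1 - th)) in *.
  set (h := supp gamma th) in *. set (h' := supp gamma th1) in *. set (g := tang gamma th1) in *.
  apply Rmult_eq_reg_r with (2 * s * s); [|repeat apply Rmult_integral_contrapositive_currified; auto].
  transitivity ((2 * h * g - (2 * g * h' * c - (h ^ 2 + h' ^ 2) * s)) * s - (2 * h * h' - (h ^ 2 + h' ^ 2) * c) * c); [field; auto|].
  transitivity ((h' ^ 2 - g ^ 2) * s ^ 2 + (h - h' * c + g * s) ^ 2); [|field; auto].
  transitivity ((h' ^ 2 - g ^ 2) * s ^ 2 + (h - h' * c + g * s) ^ 2 - h ^ 2 * (1 - (s * s + c * c))); [ring|]. rewrite hsc. ring.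
Qed.

Lemma continuity_2d_pt_minus_comp (f : R -> R) x y : continuity_pt f (y - x) -> continuity_2d_pt (fun u v => f (v - u)) x y.
Proof.
intro h. apply (continuity_1d_2d_pt_comp f (fun u v => v - u)); auto.
apply (continuity_2d_pt_minus (fun u v => v) (fun u v => u)); [apply continuity_2d_pt_id2|apply continuity_2d_pt_id1].
Qed.

(** All vertices of a polygon move at once, so joint differentiability is needed; it follows from
    the continuity of the first partial derivative and the existence of the second. *)
Lemma gen_differentiable gamma k1 k2 th th1 : envelope gamma k1 k2 -> sin (th1 - th) <> 0 -> forall e, 0 < e ->
  exists d, 0 < d /\ forall u v, Rabs (u - th) < d -> Rabs (v - th1) < d ->
  Rabs (gen gamma u v - gen gamma th th1 - (gen_fst gamma th th1 * (u - th) + gen_snd gamma th th1 * (v - th1))) <= e * (Rabs (u - th) + Rabs (v - th1)).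
Proof.
intros hev hs e he.
assert (ch : forall t, continuity_pt (supp gamma) t). { intro t. apply continuity_pt_filterlim. eapply is_derive_cont. apply (supp_derive _ _ _ hev). }
assert (cg : forall t, continuity_pt (tang gamma) t). { intro t. apply continuity_pt_filterlim. destruct (supp_derive _ _ _ hev t) as (_ & rh & _ & h1). eapply is_derive_cont. exact h1. }
assert (cs : continuity_2d_pt (fun u v => sin (v - u)) th th1) by (apply continuity_2d_pt_minus_comp, continuity_sin).
assert (cc : continuity_2d_pt (fun u v => cos (v - u)) th th1) by (apply continuity_2d_pt_minus_comp, continuity_cos).
assert (c1 : forall f : R -> R, (forall t, continuity_pt f t) -> continuity_2d_pt (fun u v => f u) th th1).
{ intros f hf. apply (continuity_1d_2d_pt_comp f (fun u v => u)); auto. apply continuity_2d_pt_id1. }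
assert (c2 : forall f : R -> R, (forall t, continuity_pt f t) -> continuity_2d_pt (fun u v => f v) th th1).
{ intros f hf. apply (continuity_1d_2d_pt_comp f (fun u v => v)); auto. apply continuity_2d_pt_id2. }
assert (hloc := continuity_2d_pt_neq_0 _ _ _ cs hs).
assert (hdiff : differentiable_pt_lim (gen gamma) th th1 (gen_fst gamma th th1) (gen_snd gamma th th1)).
{ apply filterdiff_differentiable_pt_lim.
  apply (is_derive_filterdiff (gen gamma) th th1 (gen_fst gamma) (gen_snd gamma th th1)).
  - apply (proj1 (locally_2d_locally (fun u v => is_derive (fun z => gen gamma z v) u (gen_fst gamma u v)) th th1)). destruct hloc as (d & hd). exists d. intros u v hu hv. apply (gen_derive_fst _ _ _ _ _ hev). auto.
  - apply (gen_derive_snd _ _ _ _ _ hev). auto.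
  - apply continuity_2d_pt_filterlim.
    apply continuity_2d_pt_ext with (fun u v => / 2 * (tang gamma u * tang gamma u - supp gamma u * supp gamma u - ((supp gamma v - supp gamma u * cos (v - u) - tang gamma u * sin (v - u)) * / sin (v - u)) * ((supp gamma v - supp gamma u * cos (v - u) - tang gamma u * sin (v - u)) * / sin (v - u)))).
    + intros u v. unfold gen_fst, lead, Rdiv. ring.
    + assert (cr : continuity_2d_pt (fun u v => (supp gamma v - supp gamma u * cos (v - u) - tang gamma u * sin (v - u)) * / sin (v - u)) th th1).
        { apply (continuity_2d_pt_mult (fun u v => supp gamma v - supp gamma u * cos (v - u) - tang gamma u * sin (v - u))); [|apply continuity_2d_pt_inv; auto].
          apply (continuity_2d_pt_minus (fun u v => supp gamma v - supp gamma u * cos (v - u))).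
          - apply (continuity_2d_pt_minus (fun u v => supp gamma v)); auto. apply (continuity_2d_pt_mult (fun u v => supp gamma u)); auto.
          - apply (continuity_2d_pt_mult (fun u v => tang gamma u)); auto. }
        apply (continuity_2d_pt_mult (fun u v => / 2)); [apply continuity_2d_pt_const|].
        apply (continuity_2d_pt_minus (fun u v => tang gamma u * tang gamma u - supp gamma u * supp gamma u)).
        { apply (continuity_2d_pt_minus (fun u v => tang gamma u * tang gamma u)); [apply (continuity_2d_pt_mult (fun u v => tang gamma u)); auto|apply (continuity_2d_pt_mult (fun u v => supp gamma u)); auto]. }
        apply continuity_2d_pt_mult; exact cr. }
destruct (hdiff (mkposreal e he)) as ((d & hd) & h). exists d. split; auto.
intros u v hu hv. eapply Rle_trans; [apply (h u v hu hv)|]. simpl. apply Rmult_le_compat_l; [lra|].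
pose proof (Rabs_pos (u - th)). pose proof (Rabs_pos (v - th1)). apply Rmax_lub; lra.
Qed.

Lemma segment_area_det u v : segment_area u v = / 2 * det u v.
Proof.
unfold segment_area. f_equal. rewrite (RInt_ext _ (fun _ => det u v)).
- rewrite RInt_const. unfold scal; simpl. unfold mult; simpl. ring.
- intros t _. unfold along, vsub, det; simpl. ring.
Qed.

Definition defect (gamma : R -> vec) (th r : R) : R := / 2 * (r * supp gamma th + supp gamma th * tang gamma th).

(** The side on the tangent line at [gamma th1] is centred at [gamma th1] with half length [r1], so
    it contributes [r1 * supp gamma th1]; the rest is algebra with [lead] and [trail]. *)
Lemma segment_area_gen gamma th r th1 r1 : dual_billiard gamma th r th1 r1 ->
  segment_area (along (gamma th) r (dir th)) (along (gamma th1) r1 (dir th1)) =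
  gen gamma th th1 + (defect gamma th1 r1 - defect gamma th r).
Proof.
intro hd. assert (hd' := proj1 (dual_billiard_lengths _ _ _ _ _) hd).
destruct hd as (_ & _ & _ & ->). destruct hd' as (h1 & h2 & h3 & h4 & h5).
assert (hs : sin (th1 - th) <> 0) by (apply Rgt_not_eq, sin_gt_0; lra).
rewrite segment_area_det.
replace (det (along (gamma th1) (- r1) (dir th1)) (along (gamma th1) r1 (dir th1))) with (2 * r1 * supp gamma th1) by (unfold det, along, supp, det; simpl; ring).
unfold gen, defect. unfold lead in h4. unfold trail in h5.
set (s := sin (th1 - th)) in *. set (c := cos (th1 - th)) in *.
set (h := supp gamma th) in *. set (h' := supp gamma th1) in *. set (g := tang gamma th) in *. set (g' := tang gamma th1) in *.
apply Rmult_eq_reg_r with (2 * s); [|apply Rmult_integral_contrapositive_currified; auto].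
transitivity (h' * (2 * (r1 * s))); [field|].
transitivity (2 * h * h' - (h ^ 2 + h' ^ 2) * c + (h' * (r1 * s) + h' * g' * s - (h * (r * s) + h * g * s))); [|field; auto].
rewrite h4, h5. ring.
Qed.

Lemma sum_n_telescope (w : nat -> R) n : sum_n (fun k => w (S k) - w k) n = w (S n) - w 0%nat.
Proof. induction n; [rewrite sum_O; auto|]. rewrite sum_Sn, IHn. unfold plus; simpl. ring. Qed.

Lemma trajectory_area_gen gamma k1 k2 p q th r : envelope gamma k1 k2 -> (1 <= q)%nat -> periodic_trajectory gamma p q th r ->
  trajectory_area gamma q th r = sum_n (fun k => gen gamma (th (Z.of_nat k)) (th (Z.of_nat k + 1)%Z)) (q - 1).
Proof.
intros hev hq (h1 & h2). unfold trajectory_area.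
rewrite (sum_n_ext _ (fun k => gen gamma (th (Z.of_nat k)) (th (Z.of_nat k + 1)%Z) + (defect gamma (th (Z.of_nat (S k))) (r (Z.of_nat (S k))) - defect gamma (th (Z.of_nat k)) (r (Z.of_nat k))))).
2:{ intro k. rewrite Nat2Z.inj_succ, <- Z.add_1_r. apply segment_area_gen. auto. }
rewrite (sum_n_plus (fun k => gen gamma (th (Z.of_nat k)) (th (Z.of_nat k + 1)%Z))).
rewrite (sum_n_telescope (fun k => defect gamma (th (Z.of_nat k)) (r (Z.of_nat k)))).
replace (S (q - 1)) with q by lia.
destruct (h2 0%Z) as (e1 & e2). rewrite Z.add_0_l in e1, e2. rewrite e1, e2.
assert (hp : forall (n : nat) t, supp gamma (t + 2 * PI * INR n) = supp gamma t /\ tang gamma (t + 2 * PI * INR n) = tang gamma t).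
{ induction n; intro t; [simpl; rewrite Rmult_0_r, Rplus_0_r; auto|].
  rewrite S_INR. replace (t + 2 * PI * (INR n + 1)) with ((t + 2 * PI) + 2 * PI * INR n) by ring.
  destruct (IHn (t + 2 * PI)) as (-> & ->). apply (supp_periodic _ _ _ hev). }
unfold defect. simpl (Z.of_nat 0). destruct (hp p (th 0%Z)) as (-> & ->). unfold plus; simpl. ring.
Qed.

(** * The dual billiard map near the boundary *)

Lemma chart_Y_bounds X Y s c K d th r : good_chart X Y s c K d -> 0 <= r <= d -> c * r <= Y th r <= K * r.
Proof.
intros hg hr. destruct (gc_est _ _ _ _ _ _ hg th th) as (e & _ & _ & h).
destruct (h th th 0 r) as (_ & _ & h3 & _); try lra.
- rewrite Rabs_R0. lra.
- rewrite Rabs_pos_eq; lra.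
- specialize (h3 ltac:(lra)). rewrite (gc_Y0 _ _ _ _ _ _ hg) in h3. lra.
Qed.

Lemma diff2_sign (g : C * C -> C) (t : R) (p : C * C) : t = 1 \/ t = -1 ->
  diff2 g ((RtoC t * fst p)%C, (RtoC t * snd p)%C) -> diff2 (fun p => (RtoC t * g ((RtoC t * fst p)%C, (RtoC t * snd p)%C))%C) p.
Proof.
intros ht (l & m & h). exists l, m. intros e he. destruct (h e he) as (d & hd & q). exists d; split; auto.
assert (hc : Cmod (RtoC t) = 1). { rewrite Cmod_R. destruct ht; subst t; [apply Rabs_R1|]. rewrite Rabs_left; lra. }
assert (htt : (RtoC t * RtoC t)%C = RtoC 1). { rewrite <- RtoC_mult. f_equal. destruct ht; subst t; ring. }
intros p' h1 h2. cbn [fst snd] in q.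
specialize (q ((RtoC t * fst p')%C, (RtoC t * snd p')%C)). cbn [fst snd] in q.
assert (e1 : forall x y : C, (RtoC t * x - RtoC t * y)%C = (RtoC t * (x - y))%C) by (intros; ring).
rewrite !e1, !Cmod_mult, !hc, !Rmult_1_l in q. specialize (q h1 h2).
set (g1 := g ((RtoC t * fst p')%C, (RtoC t * snd p')%C)) in *. set (g0 := g ((RtoC t * fst p)%C, (RtoC t * snd p)%C)) in *.
replace (RtoC t * g1 - RtoC t * g0 - l * (fst p' - fst p) - m * (snd p' - snd p))%C with (RtoC t * (g1 - g0 - l * (RtoC t * (fst p' - fst p)) - m * (RtoC t * (snd p' - snd p))))%C.
- rewrite Cmod_mult, hc, Rmult_1_l. exact q.
- transitivity (RtoC t * g1 - RtoC t * g0 - (RtoC t * RtoC t) * (l * (fst p' - fst p)) - (RtoC t * RtoC t) * (m * (snd p' - snd p)))%C; [ring|]. rewrite htt. ring.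
Qed.

(** The sign [t] is the one put into the coordinates by [boundary_good_chart]; conjugating the map
    by this symmetry preserves the conditions of the normal form. *)
Lemma normal_form_normal_map F a b t : 0 < a -> 0 < b -> t = 1 \/ t = -1 -> resonant_normal_form F a b ->
  exists G, normal_map G a b /\ forall x y, Rabs y < b -> G (RtoC (t * x), RtoC (t * y)) = (RtoC (t * fst (F (x, y))), RtoC (t * snd (F (x, y)))).
Proof.
intros ha hb ht hF. destruct (rnf_extension hF) as (G0 & h1 & h2 & h3). destruct (rnf_form hF) as (M & dl & hdl & h4).
set (sg := fun p : C * C => ((RtoC t * fst p)%C, (RtoC t * snd p)%C)).
set (G := fun p : C * C => ((RtoC t * fst (G0 (sg p)))%C, (RtoC t * snd (G0 (sg p)))%C)).
assert (htt : t * t = 1) by (destruct ht; subst t; ring).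
assert (hcm : Cmod (RtoC t) = 1). { rewrite Cmod_R. destruct ht; subst t; [apply Rabs_R1|]. rewrite Rabs_left; lra. }
assert (hat : forall z, Rabs (t * z) = Rabs z). { intro z. rewrite Rabs_mult, <- Cmod_R, hcm. ring. }
assert (hdom : forall p : C * C, Rabs (snd (fst p)) < a -> Cmod (snd p) < b -> in_polystrip a b (sg p)).
{ intros p q1 q2. split; unfold sg; cbn [fst snd].
  - replace (snd (RtoC t * fst p)%C) with (t * snd (fst p)) by (simpl; ring). rewrite hat. auto.
  - rewrite Cmod_mult, hcm, Rmult_1_l. auto. }
assert (hreal : forall x y, Rabs y < b -> G (RtoC (t * x), RtoC (t * y)) = (RtoC (t * fst (F (x, y))), RtoC (t * snd (F (x, y))))).
{ intros x y hy. unfold G, sg. cbn [fst snd]. rewrite <- !RtoC_mult, <- !Rmult_assoc, !htt, !Rmult_1_l, h3 by auto. cbn [fst snd]. rewrite !RtoC_mult. reflexivity. }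
assert (hreal' : forall x y, Rabs y < b -> G (RtoC x, RtoC y) = (RtoC (t * fst (F (t * x, t * y))), RtoC (t * snd (F (t * x, t * y))))).
{ intros x y hy. rewrite <- hreal by (rewrite hat; auto). rewrite <- !Rmult_assoc, !htt, !Rmult_1_l. reflexivity. }
exists G. split; [|exact hreal]. split; auto.
- intros p q1 q2. destruct (holomorphic_at_diff2 _ _ (h1 _ (hdom p q1 q2))) as (d1 & d2).
  split; [apply (diff2_sign (fun x => fst (G0 x)))|apply (diff2_sign (fun x => snd (G0 x)))]; auto.
- intros x y q1 q2. unfold G, sg; cbn [fst snd]. destruct ht; subst t.
  + assert (e : (1 * (x + 1))%C = (1 * x + 1)%C) by ring. rewrite e.
    assert (e' := h2 ((1 * x)%C, (1 * y)%C) (hdom (x, y) q1 q2)). cbn [fst snd] in e'. rewrite e'. cbn [fst snd]. f_equal. ring.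
  (* For [t = -1] the translation by 1 becomes a translation by [-1], so periodicity is applied at
     the shifted point. *)
  + assert (em : RtoC (-1) = Copp (RtoC 1)) by (rewrite <- RtoC_opp; f_equal; lra).
    assert (hp : in_polystrip a b ((RtoC (-1) * (x + 1))%C, (RtoC (-1) * y)%C)).
    { apply (hdom ((x + 1)%C, y)); auto. cbn [fst snd]. replace (snd (x + 1)%C) with (snd x) by (simpl; ring). auto. }
    assert (e := h2 _ hp). cbn [fst snd] in e.
    replace (Cplus (RtoC (-1) * (x + 1))%C (RtoC 1)) with (RtoC (-1) * x)%C in e by (rewrite em; ring).
    rewrite e. cbn [fst snd]. f_equal. rewrite em. ring.
- intros x y hy. rewrite hreal' by auto. split; reflexivity.
- exists M, (Rmin dl b). split; [apply Rmin_pos; auto|]. intros x y hy.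
  assert (q1 := Rlt_le_trans _ _ _ hy (Rmin_l _ _)). assert (q2 := Rlt_le_trans _ _ _ hy (Rmin_r _ _)).
  rewrite hreal' by auto. cbn [fst snd]. rewrite <- !RtoC_minus, !Cmod_R.
  destruct (h4 (t * x) (t * y)) as (w1 & w2); try (rewrite hat; auto). rewrite hat in w1, w2.
  split.
  + rewrite <- hat. replace (t * (t * fst (F (t * x, t * y)) - x - y)) with (fst (F (t * x, t * y)) - (t * x + t * y)); auto.
    transitivity (t * t * fst (F (t * x, t * y)) - (t * x + t * y)); [rewrite htt; ring|ring].
  + rewrite <- hat. replace (t * (t * snd (F (t * x, t * y)) - y)) with (snd (F (t * x, t * y)) - t * y); auto.
    transitivity (t * t * snd (F (t * x, t * y)) - t * y); [rewrite htt; ring|ring].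
Qed.

(** Near the boundary [G] is the dual billiard map on lifts, without an integer ambiguity in the
    abscissa. *)
Record conjugated (gamma : R -> vec) (G : C * C -> C * C) (X Y : R -> R -> R) (d r0 : R) : Prop := {
  cj_pos : 0 < r0;
  cj_le : r0 <= d;
  cj_step : forall th r th1 r1, r <= r0 -> dual_billiard gamma th r th1 r1 ->
    r1 <= d /\ G (RtoC (X th r), RtoC (Y th r)) = (RtoC (X th1 r1), RtoC (Y th1 r1))
}.

(** Along a billiard step the displacements of [G] and of the chart are both [O(r)], so the integer
    by which the two lifts could differ is at most [Q r < 1] in absolute value, hence 0. *)
Lemma real_model gamma k1 k2 a b : envelope gamma k1 k2 -> analytic_resonant_boundary gamma a b ->
  exists G X Y s c K d r0, normal_map G a b /\ good_chart X Y s c K d /\ conjugated gamma G X Y d r0.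
Proof.
intros hev (ha & hb & X & Y & rho & F & hbc & hF & hconj).
destruct (boundary_good_chart X Y rho hbc) as (t & s & c & K & d & ht & hd & hg).
destruct (normal_form_normal_map F a b t ha hb ht hF) as (G & hG & hGF).
exists G, (fun th r => t * X th r), (fun th r => t * Y th r), s, c, K, d.
destruct (chart_bilip _ _ _ _ _ _ hg) as (Lam & hLam & hlip).
destruct (nm_form _ _ _ hG) as (M & dl & hdl & hform).
pose proof (gc_d _ _ _ _ _ _ hg) as hd0. pose proof (gc_K _ _ _ _ _ _ hg) as hK. pose proof (gc_c _ _ _ _ _ _ hg) as hc.
pose proof (ev_pos _ _ _ hev) as hk1. assert (hk2 : k1 <= k2). { destruct (ev_der _ _ _ hev 0) as (rh & q & _). lra. }
(* [kk] bounds [r1 / r]. The three terms of [Q] come from [y], from the remainder of the normal form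
   and from the displacement of the chart. *)
set (kk := k2 / k1). assert (hkk : 1 <= kk). { unfold kk. apply Rmult_le_reg_r with k1; auto. replace (k2 / k1 * k1) with k2 by (field; lra). lra. }
set (Q := K + Rabs M * K ^ 2 + Lam * (2 / k1 + 1 + kk)).
assert (hik : 0 < 2 / k1) by (apply Rdiv_lt_0_compat; lra).
assert (hQ : 0 < Q).
{ unfold Q. pose proof (Rabs_pos M). assert (0 <= Rabs M * K ^ 2) by (apply Rmult_le_pos; [auto|apply pow_le; lra]).
  assert (0 < Lam * (2 / k1 + 1 + kk)) by (apply Rmult_lt_0_compat; lra). lra. }
set (r0 := Rmin (Rmin (d / kk) 1) (Rmin (/ (2 * Q)) (Rmin dl b / (2 * K)))).
assert (hr0 : 0 < r0). { repeat apply Rmin_pos; try lra; try apply Rdiv_lt_0_compat; try apply Rinv_0_lt_compat; try lra. apply Rmin_pos; auto. }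
assert (i1 : r0 <= d / kk) by (eapply Rle_trans; [apply Rmin_l|apply Rmin_l]).
assert (i2 : r0 <= 1) by (eapply Rle_trans; [apply Rmin_l|apply Rmin_r]).
assert (i3 : r0 <= / (2 * Q)) by (eapply Rle_trans; [apply Rmin_r|apply Rmin_l]).
assert (i4 : r0 <= Rmin dl b / (2 * K)) by (eapply Rle_trans; [apply Rmin_r|apply Rmin_r]).
clearbody r0.
apply Rmult_le_compat_r with (r := kk) in i1; [|lra]. replace (d / kk * kk) with d in i1 by (field; lra).
apply Rmult_le_compat_r with (r := 2 * Q) in i3; [|lra]. rewrite Rinv_l in i3 by lra.
apply Rmult_le_compat_r with (r := 2 * K) in i4; [|lra]. replace (Rmin dl b / (2 * K) * (2 * K)) with (Rmin dl b) in i4 by (field; lra).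
pose proof (Rmin_l dl b) as j1. pose proof (Rmin_r dl b) as j2. assert (j3 : 0 < r0 * (2 * K)) by (apply Rmult_lt_0_compat; lra).
exists r0. split; auto. split; auto. split; auto; [nra|].
intros th r th1 r1 hr hdb. destruct (dual_billiard_step _ _ _ _ _ _ _ hev hdb) as (b1 & _ & b2).
assert (hrp : 0 < r) by apply hdb. assert (hrp1 : 0 < r1) by apply hdb. assert (hdp : 0 < th1 - th < PI) by apply hdb.
assert (b2' : r1 <= kk * r). { apply Rmult_le_reg_l with k1; auto. replace (k1 * (kk * r)) with (k2 * r) by (unfold kk; field; lra). auto. }
assert (b1' : th1 - th <= 2 / k1 * r). { apply Rmult_le_reg_l with k1; auto. replace (k1 * (2 / k1 * r)) with (2 * r) by (field; lra). auto. }
assert (hr1d : r1 <= d) by nra. assert (hrd : r <= d) by nra. split; auto.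
assert (hY := chart_Y_bounds _ _ _ _ _ _ th r hg ltac:(lra)). cbv beta in hY.
assert (hKr : K * r < Rmin dl b) by nra.
assert (hcr : 0 < c * r) by (apply Rmult_lt_0_compat; auto).
assert (hat : forall z, Rabs (t * z) = Rabs z). { intro z. rewrite Rabs_mult. destruct ht; subst t; [rewrite Rabs_R1; ring|]. rewrite (Rabs_left (-1)); lra. }
assert (hYa : Rabs (t * Y th r) = t * Y th r) by (apply Rabs_pos_eq; lra).
assert (hYb : Rabs (Y th r) < b) by (rewrite <- hat, hYa; lra).
destruct (hconj th r th1 r1 ltac:(lra) ltac:(lra) hYb hdb) as (k & hk).
assert (hgx := hGF (X th r) (Y th r) hYb). rewrite hk in hgx. cbn [fst snd] in hgx.
destruct (hform (t * X th r) (t * Y th r)) as (w1 & _). { rewrite hYa. lra. }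
rewrite hgx in w1. cbn [fst snd] in w1. rewrite <- !RtoC_minus, Cmod_R in w1. rewrite hYa in w1.
destruct (hlip th th1 r r1) as (_ & w2); [rewrite Rabs_pos_eq; lra|rewrite Rabs_pos_eq; lra|].
rewrite (Rabs_pos_eq (th1 - th)) in w2 by lra.
assert (w3 : Rabs (r1 - r) <= (kk + 1) * r) by (apply Rabs_le; split; nra).
assert (w4 : Rabs (t * X th1 r1 - t * X th r) <= Lam * (2 / k1 + 1 + kk) * r).
{ pose proof (Rabs_pos (t * Y th1 r1 - t * Y th r)).
  assert (Lam * (th1 - th + Rabs (r1 - r)) <= Lam * ((2 / k1 + 1 + kk) * r)) by (apply Rmult_le_compat_l; lra). lra. }
assert (w5 : M * (t * Y th r) ^ 2 <= Rabs M * K ^ 2 * r).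
{ pose proof (Rle_abs M). pose proof (Rabs_pos M).
  assert ((t * Y th r) ^ 2 <= (K * r) ^ 2) by (apply pow_incr; lra). assert (0 <= (t * Y th r) ^ 2) by (apply pow2_ge_0).
  assert ((K * r) ^ 2 <= K ^ 2 * r). { replace ((K * r) ^ 2) with (K ^ 2 * r * r) by ring. assert (0 <= K ^ 2 * r) by (apply Rmult_le_pos; [apply pow2_ge_0|lra]). nra. }
  apply Rle_trans with (Rabs M * (t * Y th r) ^ 2); [apply Rmult_le_compat_r; auto|]. rewrite Rmult_assoc. apply Rmult_le_compat_l; lra. }
assert (hkz : Rabs (t * IZR k) <= Q * r).
{ replace (t * IZR k) with ((t * (X th1 r1 + IZR k) - t * X th r - t * Y th r) + (t * Y th r - (t * X th1 r1 - t * X th r))) by ring.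
  eapply Rle_trans; [apply Rabs_triang|]. apply Rabs_le_between in w4.
  assert (Rabs (t * Y th r - (t * X th1 r1 - t * X th r)) <= K * r + Lam * (2 / k1 + 1 + kk) * r) by (apply Rabs_le; lra).
  unfold Q. lra. }
rewrite hat in hkz. assert (hk1z : Rabs (IZR k) < 1) by nra.
rewrite <- abs_IZR in hk1z. apply lt_IZR in hk1z. assert (hk0 : k = 0%Z) by lia. subst k.
rewrite hgx. rewrite Rplus_0_r. reflexivity.
Qed.

(** With [q = 1] it also serves for functions of a number of turns. *)
Lemma quasi_periodic_Z (f : Z -> R) (q : Z) (w : R) : (forall k, f (k + q)%Z = f k + w) -> forall n k, f (k + q * n)%Z = f k + w * IZR n.
Proof.
intros h.
assert (hn : forall (m : nat) k, f (k + q * Z.of_nat m)%Z = f k + w * INR m).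
{ induction m; intro k; [simpl; rewrite Z.mul_0_r, Z.add_0_r; ring|].
  rewrite Nat2Z.inj_succ, S_INR. replace (k + q * Z.succ (Z.of_nat m))%Z with ((k + q * Z.of_nat m) + q)%Z by ring. rewrite h, IHm. ring. }
intros n k. destruct (Z_le_gt_dec 0 n).
- rewrite <- (Z2Nat.id n l), <- INR_IZR_INZ. auto.
- assert (e := hn (Z.to_nat (- n)) (k + q * n)%Z). rewrite INR_IZR_INZ, Z2Nat.id, opp_IZR in e by lia.
  replace (k + q * n + q * - n)%Z with k in e by ring. lra.
Qed.

Lemma chart_period X Y s c K d : good_chart X Y s c K d -> forall (n : Z) th r, Rabs r <= d ->
  X (th + 2 * PI * IZR n) r = X th r + s * IZR n /\ Y (th + 2 * PI * IZR n) r = Y th r.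
Proof.
intros hg n th r hr.
assert (hx := quasi_periodic_Z (fun k => X (th + 2 * PI * IZR k) r) 1 s). assert (hy := quasi_periodic_Z (fun k => Y (th + 2 * PI * IZR k) r) 1 0).
cbv beta in hx, hy.
assert (e : forall k, th + 2 * PI * IZR (k + 1) = (th + 2 * PI * IZR k) + 2 * PI) by (intro k; rewrite plus_IZR; ring).
specialize (hx ltac:(intro k; rewrite e; apply (gc_per _ _ _ _ _ _ hg); auto) n 0%Z).
specialize (hy ltac:(intro k; rewrite e, Rplus_0_r; apply (gc_per _ _ _ _ _ _ hg); auto) n 0%Z).
replace (0 + 1 * n)%Z with n in hx, hy by ring. rewrite Rmult_0_r, Rplus_0_r in hx, hy. split; [exact hx|]. lra.
Qed.

Lemma some_small_step (a : nat -> R) (D : R) n : (1 <= n)%nat -> a n - a 0%nat <= INR n * D -> exists j, (j < n)%nat /\ a (S j) - a j <= D.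
Proof.
intros hn h. apply NNPP; intro hne.
assert (hall : forall k, (k <= n)%nat -> (1 <= k)%nat -> INR k * D < a k - a 0%nat).
{ induction k; intros hk h1; [lia|].
  assert (hs : D < a (S k) - a k). { apply Rnot_le_lt; intro. apply hne. exists k; split; [lia|auto]. }
  rewrite S_INR. destruct k; [simpl; lra|]. specialize (IHk ltac:(lia) ltac:(lia)). lra. }
specialize (hall n (le_n _) hn). lra.
Qed.

(** The mean step of the angle is [2 PI mu], so some step is at most that and some [r j] is [O(mu)].
    The other radii are not known to be small beforehand: the normal form propagates the bound over
    one period, and then [orbit_near_curve] applies. *)
Lemma trajectory_on_curve gamma k1 k2 G a b X Y s c K d r0 kp L :
  envelope gamma k1 k2 -> normal_map G a b -> good_chart X Y s c K d -> conjugated gamma G X Y d r0 -> 0 < kp -> 1 <= L ->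
  exists m, 0 < m /\ forall p q : nat, (1 <= p)%nat -> (1 <= q)%nat -> INR p <= L -> INR p / INR q <= m ->
  forall th r, periodic_trajectory gamma p q th r ->
  s = 1 /\ forall k : Z, 0 < r k <= r0 /\
    Cmod (RtoC (Y (th k) (r k)) - RtoC (INR p / INR q))%C <= kp * (INR p / INR q).
Proof.
intros hev hG hg hcj hkp hL.
pose proof (gc_d _ _ _ _ _ _ hg) as hd0. pose proof (gc_K _ _ _ _ _ _ hg) as hK. pose proof (gc_c _ _ _ _ _ _ hg) as hc.
destruct hcj as [hr0 hr0d hstep]. pose proof PI_RGT_0 as hpi.
pose proof (ev_pos _ _ _ hev) as hk1. assert (hk2 : k1 <= k2). { destruct (ev_der _ _ _ hev 0) as (rh & w & _). lra. }
destruct (nm_form _ _ _ hG) as (M & dl & hdl & hform).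
set (C0 := K * (k2 * (2 * PI))). assert (hC0 : 0 < C0) by (unfold C0; apply Rmult_lt_0_compat; [lra|apply Rmult_lt_0_compat; lra]).
assert (hC0e : C0 = K * (k2 * (2 * PI))) by reflexivity. clearbody C0.
destruct (orbit_near_curve G a b kp C0 L hG hkp (Rlt_le _ _ hC0) hL) as (m0 & hm0 & hnear).
set (M1 := Rabs M + 1). assert (hM1 : 0 < M1) by (unfold M1; pose proof (Rabs_pos M); lra). assert (hMM : M <= M1) by (unfold M1; pose proof (Rle_abs M); lra). clearbody M1.
set (mm := Rmin (Rmin m0 (/ PI)) (Rmin (Rmin (c * r0 / (2 * C0)) (r0 / (k2 * (2 * PI)))) (Rmin (dl / (4 * C0)) (/ (8 * M1 * C0 * C0 * L + 4 * C0 * M1))))).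
assert (hB : 0 < 8 * M1 * C0 * C0 * L + 4 * C0 * M1).
{ assert (0 < 8 * M1 * C0 * C0 * L) by (repeat apply Rmult_lt_0_compat; lra). assert (0 < 4 * C0 * M1) by (repeat apply Rmult_lt_0_compat; lra). lra. }
exists mm. split.
{ assert (z1 : 0 < / PI) by (apply Rinv_0_lt_compat; auto).
  assert (z2 : 0 < c * r0 / (2 * C0)) by (apply Rdiv_lt_0_compat; [apply Rmult_lt_0_compat; auto|lra]).
  assert (z3 : 0 < r0 / (k2 * (2 * PI))) by (apply Rdiv_lt_0_compat; [auto|apply Rmult_lt_0_compat; lra]).
  assert (z4 : 0 < dl / (4 * C0)) by (apply Rdiv_lt_0_compat; lra).
  assert (z5 := Rinv_0_lt_compat _ hB). unfold mm. repeat apply Rmin_pos; assumption. }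
intros p q hp hq hpL hmu th r (htr & hper).
set (mu := INR p / INR q) in *.
assert (hqR : 1 <= INR q) by (apply (le_INR 1); auto). assert (hpR : 1 <= INR p) by (apply (le_INR 1); auto).
assert (hmu0 : 0 < mu) by (unfold mu; apply Rdiv_lt_0_compat; lra).
assert (hmq : mu * INR q = INR p) by (unfold mu; field; lra).
assert (q1 := Rle_trans _ _ _ hmu (Rmin_l _ _)). assert (q2 := Rle_trans _ _ _ hmu (Rmin_r _ _)).
assert (q3 := Rle_trans _ _ _ q1 (Rmin_l _ _)). assert (q4 := Rle_trans _ _ _ q1 (Rmin_r _ _)).
assert (q5 := Rle_trans _ _ _ q2 (Rmin_l _ _)). assert (q6 := Rle_trans _ _ _ q2 (Rmin_r _ _)).
assert (q7 := Rle_trans _ _ _ q5 (Rmin_l _ _)). assert (q8 := Rle_trans _ _ _ q5 (Rmin_r _ _)).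
assert (q9 := Rle_trans _ _ _ q6 (Rmin_l _ _)). assert (q10 := Rle_trans _ _ _ q6 (Rmin_r _ _)).
clear q1 q2 q5 q6 hmu. clearbody mm.
assert (hmue : mu = INR p / INR q) by reflexivity. clearbody mu.
apply Rmult_le_compat_r with (r := PI) in q4; [|lra]. rewrite Rinv_l in q4 by lra.
apply Rmult_le_compat_r with (r := 2 * C0) in q7; [|lra]. replace (c * r0 / (2 * C0) * (2 * C0)) with (c * r0) in q7 by (field; lra).
assert (hk2pi : 0 < k2 * (2 * PI)) by (apply Rmult_lt_0_compat; lra).
apply Rmult_le_compat_r with (r := k2 * (2 * PI)) in q8; [|lra]. replace (r0 / (k2 * (2 * PI)) * (k2 * (2 * PI))) with r0 in q8 by (field; lra).
apply Rmult_le_compat_r with (r := 4 * C0) in q9; [|lra]. replace (dl / (4 * C0) * (4 * C0)) with dl in q9 by (field; lra).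
apply Rmult_le_compat_r with (r := 8 * M1 * C0 * C0 * L + 4 * C0 * M1) in q10; [|lra]. rewrite Rinv_l in q10 by lra.
assert (hCmu : 0 < C0 * mu) by (apply Rmult_lt_0_compat; auto).
assert (hM2 : M1 * (2 * C0 * mu) <= / 2).
{ assert (0 <= mu * (8 * M1 * C0 * C0 * L)) by (apply Rmult_le_pos; [lra|repeat apply Rmult_le_pos; lra]). lra. }
assert (hM3 : 8 * M1 * C0 * C0 * L * mu <= 1).
{ assert (0 <= mu * (4 * C0 * M1)) by (apply Rmult_le_pos; [lra|repeat apply Rmult_le_pos; lra]). lra. }
assert (hrp : forall k, 0 < r k) by (intro k; apply (htr k)).
set (x := fun k => X (th k) (r k)). set (y := fun k => Y (th k) (r k)).
(* Some step of the trajectory is at most the average one. *)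
assert (hj : exists j : Z, r j <= k2 * (2 * PI * mu)).
{ destruct (some_small_step (fun k => th (Z.of_nat k)) (2 * PI * mu) q hq) as (j & _ & hj).
  - destruct (hper 0%Z) as (e & _). rewrite Z.add_0_l in e. simpl (Z.of_nat 0). rewrite e. rewrite <- hmq. lra.
  - exists (Z.of_nat j). rewrite Nat2Z.inj_succ, <- Z.add_1_r in hj.
    destruct (dual_billiard_step _ _ _ _ _ _ _ hev (htr (Z.of_nat j))) as (_ & w & _).
    eapply Rle_trans; [apply w; lra|]. apply Rmult_le_compat_l; lra. }
destruct hj as (j & hj).
(* As long as [y <= 2 C0 mu], a step adds at most [8 M1 C0^3 mu^3] to [y], and [q] steps at most
   [C0 mu]. The bound on [y] in turn gives [r <= r0], which [hstep] requires. *)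
assert (hsmall : forall i : nat, (i <= q)%nat -> r (j + Z.of_nat i)%Z <= r0 /\ y (j + Z.of_nat i)%Z <= C0 * mu + INR i * (8 * M1 * C0 ^ 3 * mu ^ 3)).
{ induction i; intro hi.
  - simpl. rewrite Z.add_0_r. assert (hjr : r j <= r0) by lra. split; auto.
    pose proof (chart_Y_bounds _ _ _ _ _ _ (th j) (r j) hg ltac:(specialize (hrp j); lra)) as w. fold (y j) in w.
    assert (K * r j <= K * (k2 * (2 * PI * mu))) by (apply Rmult_le_compat_l; lra). assert (C0 * mu = K * (k2 * (2 * PI * mu))) by (rewrite hC0e; ring). simpl (INR 0). lra.
  - destruct (IHi ltac:(lia)) as (w1 & w2).
    rewrite Nat2Z.inj_succ, <- Z.add_1_r, Z.add_assoc. set (k := (j + Z.of_nat i)%Z) in *.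
    destruct (hstep _ _ _ _ w1 (htr k)) as (w3 & w4). fold (x k) (y k) (x (k + 1)%Z) (y (k + 1)%Z) in w4.
    assert (hiR : INR i + 1 <= INR q) by (rewrite <- S_INR; apply le_INR; auto).
    assert (hgrow : (INR i + 1) * (8 * M1 * C0 ^ 3 * mu ^ 3) <= C0 * mu).
    { apply Rle_trans with (INR q * (8 * M1 * C0 ^ 3 * mu ^ 3)).
      - apply Rmult_le_compat_r; auto. repeat apply Rmult_le_pos; try lra; apply pow_le; lra.
      - replace (INR q * (8 * M1 * C0 ^ 3 * mu ^ 3)) with ((mu * INR q) * (8 * M1 * C0 * C0 * mu) * (C0 * mu)) by ring. rewrite hmq.
        rewrite <- (Rmult_1_l (C0 * mu)) at 2. apply Rmult_le_compat_r; [lra|].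
        assert (INR p * (8 * M1 * C0 * C0 * mu) <= L * (8 * M1 * C0 * C0 * mu)) by (apply Rmult_le_compat_r; auto; repeat apply Rmult_le_pos; lra). lra. }
    assert (hstepg : 0 <= 8 * M1 * C0 ^ 3 * mu ^ 3) by (repeat apply Rmult_le_pos; try lra; apply pow_le; lra).
    assert (hyk := chart_Y_bounds _ _ _ _ _ _ (th k) (r k) hg ltac:(specialize (hrp k); lra)). fold (y k) in hyk.
    assert (hyp : 0 < y k) by (specialize (hrp k); nra).
    assert (hy2 : y k <= 2 * C0 * mu) by lra.
    destruct (hform (x k) (y k)) as (_ & w5). { rewrite Rabs_pos_eq; lra. }
    rewrite w4 in w5. cbn [fst snd] in w5. rewrite <- RtoC_minus, Cmod_R, (Rabs_pos_eq (y k)) in w5 by lra. apply Rabs_le_between in w5.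
    assert (hy3 : y k ^ 3 <= (2 * C0 * mu) ^ 3) by (apply pow_incr; lra). assert (0 <= y k ^ 3) by (apply pow_le; lra).
    assert (hM8 : M * y k ^ 3 <= 8 * M1 * C0 ^ 3 * mu ^ 3).
    { apply Rle_trans with (M1 * y k ^ 3); [apply Rmult_le_compat_r; auto|]. replace (8 * M1 * C0 ^ 3 * mu ^ 3) with (M1 * (2 * C0 * mu) ^ 3) by ring. apply Rmult_le_compat_l; lra. }
    rewrite S_INR. assert (hy' : y (k + 1)%Z <= C0 * mu + (INR i + 1) * (8 * M1 * C0 ^ 3 * mu ^ 3)) by lra. split; auto.
    assert (hyk' := chart_Y_bounds _ _ _ _ _ _ (th (k + 1)%Z) (r (k + 1)%Z) hg ltac:(specialize (hrp (k + 1)%Z); lra)). fold (y (k + 1)%Z) in hyk'.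
    apply Rmult_le_reg_l with c; auto. lra. }
assert (hallr : forall k, r k <= r0 /\ y k <= 2 * (C0 * mu)).
{ intro k. set (i := Z.to_nat ((k - j) mod Z.of_nat q)).
  assert (hmod := Z.mod_pos_bound (k - j) (Z.of_nat q) ltac:(lia)).
  assert (hk : k = (j + Z.of_nat i + Z.of_nat q * ((k - j) / Z.of_nat q))%Z).
  { unfold i. rewrite Z2Nat.id by lia. pose proof (Z.div_mod (k - j) (Z.of_nat q) ltac:(lia)). lia. }
  assert (er := quasi_periodic_Z r (Z.of_nat q) 0 ltac:(intro k'; rewrite Rplus_0_r; apply hper) ((k - j) / Z.of_nat q)%Z (j + Z.of_nat i)%Z).
  assert (et := quasi_periodic_Z th (Z.of_nat q) (2 * PI * INR p) ltac:(intro k'; apply hper) ((k - j) / Z.of_nat q)%Z (j + Z.of_nat i)%Z).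
  rewrite <- hk in er, et. rewrite Rmult_0_l, Rplus_0_r in er.
  destruct (hsmall i ltac:(unfold i; lia)) as (w1 & w2).
  rewrite er. split; auto. unfold y. rewrite er, et.
  replace (th (j + Z.of_nat i)%Z + 2 * PI * INR p * IZR ((k - j) / Z.of_nat q)) with (th (j + Z.of_nat i)%Z + 2 * PI * IZR (Z.of_nat p * ((k - j) / Z.of_nat q))) by (rewrite mult_IZR, <- INR_IZR_INZ; ring).
  rewrite (proj2 (chart_period _ _ _ _ _ _ hg (Z.of_nat p * ((k - j) / Z.of_nat q)) (th (j + Z.of_nat i)%Z) (r (j + Z.of_nat i)%Z) ltac:(specialize (hrp (j + Z.of_nat i)%Z); rewrite Rabs_pos_eq; lra))).
  fold (y (j + Z.of_nat i)%Z). assert (INR i <= INR q) by (apply le_INR; unfold i; lia).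
  assert (INR i * (8 * M1 * C0 ^ 3 * mu ^ 3) <= C0 * mu); [|lra].
  apply Rle_trans with (INR q * (8 * M1 * C0 ^ 3 * mu ^ 3)).
  - apply Rmult_le_compat_r; auto. repeat apply Rmult_le_pos; try lra; apply pow_le; lra.
  - replace (INR q * (8 * M1 * C0 ^ 3 * mu ^ 3)) with ((mu * INR q) * (8 * M1 * C0 * C0 * mu) * (C0 * mu)) by ring. rewrite hmq.
    rewrite <- (Rmult_1_l (C0 * mu)) at 2. apply Rmult_le_compat_r; [lra|].
    assert (INR p * (8 * M1 * C0 * C0 * mu) <= L * (8 * M1 * C0 * C0 * mu)) by (apply Rmult_le_compat_r; auto; repeat apply Rmult_le_pos; lra). lra. }
assert (hG1 : forall k, G (RtoC (x k), RtoC (y k)) = (RtoC (x (k + 1)%Z), RtoC (y (k + 1)%Z))).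
{ intro k. apply (hstep _ _ _ _ (proj1 (hallr k)) (htr k)). }
assert (hyp : forall k, 0 < y k). { intro k. assert (w := chart_Y_bounds _ _ _ _ _ _ (th k) (r k) hg ltac:(specialize (hrp k); destruct (hallr k); lra)). fold (y k) in w. specialize (hrp k). nra. }
assert (hinc : forall k, 0 < x (k + 1)%Z - x k).
{ intro k. specialize (hyp k). destruct (hallr k) as (_ & w). destruct (hform (x k) (y k)) as (w5 & _). { rewrite Rabs_pos_eq; lra. }
  rewrite hG1 in w5. cbn [fst snd] in w5. rewrite <- !RtoC_minus, Cmod_R, (Rabs_pos_eq (y k)) in w5 by lra. apply Rabs_le_between in w5.
  assert (M * y k ^ 2 <= / 2 * y k).
  { replace (M * y k ^ 2) with (M * y k * y k) by ring. apply Rmult_le_compat_r; [lra|]. assert (M * y k <= M1 * y k) by (apply Rmult_le_compat_r; lra).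
    assert (M1 * y k <= M1 * (2 * C0 * mu)) by (apply Rmult_le_compat_l; lra). lra. }
  lra. }
assert (hxq : forall k, x (k + Z.of_nat q)%Z = x k + s * INR p /\ y (k + Z.of_nat q)%Z = y k).
{ intro k. unfold x, y. destruct (hper k) as (-> & ->). rewrite INR_IZR_INZ.
  apply (chart_period _ _ _ _ _ _ hg). rewrite Rabs_pos_eq; [destruct (hallr k); lra|left; apply hrp]. }
(* The abscissa increases at each step, whereas with [s = -1] it would decrease by [p] over a
   period. *)
assert (hs : s = 1).
{ destruct (gc_s _ _ _ _ _ _ hg) as [hs|hs]; auto. exfalso.
  assert (hall : forall n : nat, x 0%Z <= x (Z.of_nat n)).
  { induction n; [simpl; lra|]. rewrite Nat2Z.inj_succ, <- Z.add_1_r. specialize (hinc (Z.of_nat n)). lra. }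
  specialize (hall q). destruct (hxq 0%Z) as (e & _). rewrite Z.add_0_l in e. rewrite e, hs in hall. lra. }
split; auto. intro k. split; [split; [apply hrp|apply hallr]|].
rewrite hmue in q3 |- *. apply (hnear p q hp hq hpL q3 x y hG1).
- intro i. rewrite (proj1 (hxq i)), hs. ring.
- intro i. apply hxq.
- exists j. rewrite <- hmue. rewrite Rabs_pos_eq by (left; apply hyp). destruct (hsmall 0%nat ltac:(lia)) as (_ & w). simpl (Z.of_nat 0) in w. rewrite Z.add_0_r in w. simpl in w. lra.
Qed.

(** * Areas of closed polygons *)

Fixpoint psum (F : nat -> R) (n : nat) : R := match n with O => 0 | S n => psum F n + F n end.

Lemma psum_sum_n F n : psum F (S n) = sum_n F n.
Proof. induction n; [rewrite sum_O; simpl; ring|]. rewrite sum_Sn, <- IHn. reflexivity. Qed.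

Lemma psum_ext F F' n : (forall k, (k < n)%nat -> F k = F' k) -> psum F n = psum F' n.
Proof. induction n; intro h; simpl; auto. rewrite IHn, h; auto. Qed.

Definition polygon_gen (gamma : R -> vec) (t : nat -> R) (n : nat) : R := psum (fun k => gen gamma (t k) (t (S k))) n.

(** At an inner vertex the derivative of one side is [- al k] and that of the next is [al k], each
    up to [V]: they cancel and only the two end terms remain. [e] accounts for the remainders of
    differentiability. *)
Lemma gen_sum_variation gamma k1 k2 (t al : nat -> R) V e n : envelope gamma k1 k2 -> 0 < e -> 0 <= V ->
  (forall k, (k < n)%nat -> sin (t (S k) - t k) <> 0 /\ Rabs (gen_fst gamma (t k) (t (S k)) - al k) <= V /\
     Rabs (gen_snd gamma (t k) (t (S k)) + al (S k)) <= V) ->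
  exists d, 0 < d /\ forall t' D, D < d -> (forall k, (k <= n)%nat -> Rabs (t' k - t k) <= D) ->
    Rabs (polygon_gen gamma t' n - polygon_gen gamma t n - (al 0%nat * (t' 0%nat - t 0%nat) - al n * (t' n - t n))) <= INR n * (2 * V + 2 * e) * D.
Proof.
intros hev he hV. unfold polygon_gen. induction n; intro h.
- exists 1. split; [lra|]. intros t' D _ _. simpl. rewrite !Rminus_diag, Rabs_R0. lra.
- destruct (IHn ltac:(intros; apply h; lia)) as (d1 & hd1 & w1).
  destruct (h n (le_n _)) as (b1 & b2 & b3).
  destruct (gen_differentiable _ _ _ _ _ hev b1 e he) as (d2 & hd2 & w2).
  exists (Rmin d1 d2). split; [apply Rmin_pos; auto|]. intros t' D hD ht.
  assert (q1 := Rlt_le_trans _ _ _ hD (Rmin_l _ _)). assert (q2 := Rlt_le_trans _ _ _ hD (Rmin_r _ _)).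
  specialize (w1 t' D q1 ltac:(intros; apply ht; lia)).
  pose proof (ht n ltac:(lia)) as u1. pose proof (ht (S n) (le_n _)) as u2.
  specialize (w2 (t' n) (t' (S n)) ltac:(lra) ltac:(lra)).
  set (g1 := gen gamma (t' n) (t' (S n))) in *. set (g0 := gen gamma (t n) (t (S n))) in *.
  set (P := gen_fst gamma (t n) (t (S n))) in *. set (Q := gen_snd gamma (t n) (t (S n))) in *.
  cbn [psum]. fold g1. fold g0. rewrite S_INR.
  set (s1 := psum _ n) in *. set (s0 := psum _ n) in *.
  set (x := t' n - t n) in *. set (y := t' (S n) - t (S n)) in *.
  assert (v1 : Rabs ((P - al n) * x) <= V * D) by (rewrite Rabs_mult; apply Rmult_le_compat; auto using Rabs_pos).
  assert (v2 : Rabs ((Q + al (S n)) * y) <= V * D) by (rewrite Rabs_mult; apply Rmult_le_compat; auto using Rabs_pos).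
  assert (v3 : e * (Rabs x + Rabs y) <= e * (2 * D)) by (apply Rmult_le_compat_l; lra).
  apply Rabs_le_between in w1. apply Rabs_le_between in w2. apply Rabs_le_between in v1. apply Rabs_le_between in v2.
  apply Rabs_le. split; nra.
Qed.

Lemma quarter_le_sin x : 0 <= x <= 2 -> x / 4 <= sin x.
Proof.
intro hx. destruct (half_angle x) as (-> & _). pose proof (cos_half_ge x hx) as h.
assert (hpi : 3 <= PI) by (pose proof PI2_3_2; lra). pose proof (x_cos_le_sin (x / 2) ltac:(lra)) as h1.
assert (h2 : x / 2 * / 2 <= x / 2 * cos (x / 2)) by (apply Rmult_le_compat_l; lra).
assert (x / 4 * / 2 <= sin (x / 2) * cos (x / 2)) by (apply Rmult_le_compat; lra). lra.
Qed.

(** [lead] and [trail] are Lipschitz in the second angle, and the division by the sine costs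
    [1 / rho]: the gap [t - th] is at least [rho / (2 k2)], hence its sine at least
    [rho / (8 k2)]. *)
Lemma perturbed_lengths gamma k1 k2 : envelope gamma k1 k2 -> exists C, 0 < C /\ forall th r th1 r1 t rho W,
  dual_billiard gamma th r th1 r1 -> 0 < rho -> rho <= r <= Rmin 1 (k1 / 2) -> r1 <= 1 -> Rabs (t - th1) <= W -> W <= rho / (2 * k2) -> W <= 1 ->
  0 < sin (t - th) /\ Rabs (lead gamma th t / sin (t - th) - r) <= C * W / rho /\ Rabs (trail gamma th t / sin (t - th) - r1) <= C * W / rho.
Proof.
intro hev. destruct (lead_trail_lipschitz _ _ _ hev) as (C & hC & hl).
pose proof (ev_pos _ _ _ hev) as hk1. assert (hk2 : k1 <= k2). { destruct (ev_der _ _ _ hev 0) as (rh & w & _). lra. }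
exists ((C + 1) * (8 * k2)). split; [apply Rmult_lt_0_compat; lra|].
intros th r th1 r1 t rho W hdb hrho hr hr1 ht hW hW1.
destruct (dual_billiard_step _ _ _ _ _ _ _ hev hdb) as (b1 & b2 & _).
assert (hdb' := proj1 (dual_billiard_lengths _ _ _ _ _) hdb). destruct hdb' as (c1 & c2 & c3 & c4 & c5).
pose proof (Rmin_l 1 (k1 / 2)). pose proof (Rmin_r 1 (k1 / 2)).
assert (hd1 : th1 - th <= 1) by (apply Rmult_le_reg_l with k1; auto; lra).
specialize (b2 ltac:(lra)).
assert (hW' : W * (2 * k2) <= rho). { apply Rmult_le_compat_r with (r := 2 * k2) in hW; [|lra]. replace (rho / (2 * k2) * (2 * k2)) with rho in hW by (field; lra). auto. }
apply Rabs_le_between in ht.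
assert (hgap : rho <= 2 * k2 * (t - th)).
{ replace (2 * k2 * (t - th)) with (2 * (k2 * (th1 - th)) + 2 * k2 * (t - th1)) by ring. assert (2 * k2 * - W <= 2 * k2 * (t - th1)) by (apply Rmult_le_compat_l; lra). lra. }
assert (hx0 : 0 < t - th) by nra.
assert (hs := quarter_le_sin (t - th) ltac:(lra)).
set (s := sin (t - th)) in *. assert (hs0 : 0 < s) by lra.
assert (hs8 : rho <= 8 * k2 * s) by nra.
assert (key : forall l l0 r0, 0 < r0 <= 1 -> r0 * sin (th1 - th) = l0 -> Rabs (l - l0) <= C * Rabs (t - th1) -> Rabs (l / s - r0) <= (C + 1) * (8 * k2) * W / rho).
{ intros l l0 r0 h1 h2 h3.
  replace (l / s - r0) with ((l - l0 - r0 * (s - sin (th1 - th))) / s) by (rewrite <- h2; field; lra).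
  assert (hsl : Rabs (s - sin (th1 - th)) <= Rabs (t - th1)).
  { unfold s. eapply Rle_trans; [apply sin_lip|]. right. f_equal. ring. }
  assert (htW : Rabs (t - th1) <= W) by (apply Rabs_le; lra).
  assert (hnum : Rabs (l - l0 - r0 * (s - sin (th1 - th))) <= (C + 1) * W).
  { eapply Rle_trans; [apply Rabs_triang|]. rewrite Rabs_Ropp, Rabs_mult, (Rabs_pos_eq r0) by lra.
    assert (C * Rabs (t - th1) <= C * W) by (apply Rmult_le_compat_l; lra).
    assert (r0 * Rabs (s - sin (th1 - th)) <= 1 * W) by (apply Rmult_le_compat; try lra; apply Rabs_pos). lra. }
  unfold Rdiv. rewrite Rabs_mult, (Rabs_pos_eq (/ s)) by (left; apply Rinv_0_lt_compat; auto).
  replace ((C + 1) * (8 * k2) * W * / rho) with (((C + 1) * W) * (8 * k2 * / rho)) by ring.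
  apply Rmult_le_compat; auto using Rabs_pos; [left; apply Rinv_0_lt_compat; auto|].
  apply Rmult_le_reg_r with (s * rho); [apply Rmult_lt_0_compat; auto|].
  replace (/ s * (s * rho)) with rho by (field; lra). replace (8 * k2 * / rho * (s * rho)) with (8 * k2 * s) by (field; lra). auto. }
split; auto. destruct (hl th th1 t) as (l1 & l2).
split; [apply (key _ (lead gamma th th1))|apply (key _ (trail gamma th th1))]; auto; lra.
Qed.

(** The last angle is replaced by the first one plus [p] turns: the polygon closes exactly, and only
    its last side leaves the orbit. *)
Definition close_polygon (th : nat -> R) (p q k : nat) : R := if Nat.ltb k q then th k else th 0%nat + 2 * PI * INR p.

Lemma supp_periodic_nat gamma k1 k2 : envelope gamma k1 k2 -> forall (n : nat) t,
  supp gamma (t + 2 * PI * INR n) = supp gamma t /\ tang gamma (t + 2 * PI * INR n) = tang gamma t.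
Proof.
intros hev. induction n; intro t; [simpl; rewrite Rmult_0_r, Rplus_0_r; auto|].
rewrite S_INR. replace (t + 2 * PI * (INR n + 1)) with ((t + 2 * PI) + 2 * PI * INR n) by ring.
destruct (IHn (t + 2 * PI)) as (-> & ->). apply (supp_periodic _ _ _ hev).
Qed.

Lemma square_diff_le u v U : 0 <= v <= 1 -> Rabs (u - v) <= U -> U <= 1 -> Rabs (/ 2 * (u ^ 2 - v ^ 2)) <= 2 * U.
Proof.
intros hv hu hU. replace (/ 2 * (u ^ 2 - v ^ 2)) with ((u - v) * (/ 2 * (u + v))) by field.
rewrite Rabs_mult, (Rmult_comm 2). apply Rmult_le_compat; auto using Rabs_pos. apply Rabs_le_between in hu. apply Rabs_le. lra.
Qed.

(* For an orbit segment that closes up to [W], the gradient of the closed polygon's area telescopes up to [O(W / rho)]. *)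
Lemma closed_polygon_gradient gamma k1 k2 : envelope gamma k1 k2 -> exists C, 0 < C /\ forall (p q : nat) (th r : nat -> R) rho W,
  (1 <= q)%nat -> (forall k, (k < q)%nat -> dual_billiard gamma (th k) (r k) (th (S k)) (r (S k))) ->
  0 < rho -> (forall k, (k <= q)%nat -> rho <= r k <= Rmin 1 (k1 / 2)) ->
  Rabs (th q - (th 0%nat + 2 * PI * INR p)) <= W -> Rabs (r q - r 0%nat) <= W -> W <= rho / (2 * k2) -> C * W / rho <= 1 ->
  exists al : nat -> R, al q = al 0%nat /\ forall k, (k < q)%nat ->
    sin (close_polygon th p q (S k) - close_polygon th p q k) <> 0 /\
    Rabs (gen_fst gamma (close_polygon th p q k) (close_polygon th p q (S k)) - al k) <= 2 * (C * W / rho) /\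
    Rabs (gen_snd gamma (close_polygon th p q k) (close_polygon th p q (S k)) + al (S k)) <= 2 * (C * W / rho).
Proof.
intro hev. destruct (perturbed_lengths _ _ _ hev) as (C & hC & hpl). exists (C + 1). split; [lra|].
intros p q th r rho W hq hdb hrho hr hth hrq hW hU.
assert (hr1 : forall k, (k <= q)%nat -> r k <= 1). { intros k hk. pose proof (hr k hk). pose proof (Rmin_l 1 (k1 / 2)). lra. }
assert (hrho1 : rho <= 1) by (pose proof (hr 0%nat ltac:(lia)); specialize (hr1 0%nat ltac:(lia)); lra).
assert (hW0 : 0 <= W) by (pose proof (Rabs_pos (r q - r 0%nat)); lra).
assert (hWr : W <= W / rho). { apply Rmult_le_reg_r with rho; auto. replace (W / rho * rho) with W by (field; lra). nra. }
assert (hCW : 0 <= C * W / rho). { apply Rmult_le_pos; [apply Rmult_le_pos; lra|left; apply Rinv_0_lt_compat; auto]. }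
assert (hUe : (C + 1) * W / rho = C * W / rho + W / rho) by (field; lra).
set (U := (C + 1) * W / rho) in *. assert (hU0 : 0 <= U) by lra.
(* Along an orbit, [gen_fst] of the side that starts at [k] and minus [gen_snd] of the side that
   ends at [k] are both equal to [beta k]. *)
set (beta := fun k => / 2 * (tang gamma (th k) ^ 2 - supp gamma (th k) ^ 2 - r k ^ 2)).
exists (fun k => if Nat.ltb k q then beta k else beta 0%nat). rewrite Nat.ltb_irrefl.
split. { destruct (Nat.ltb_spec 0 q); [auto|lia]. }
intros k hk. unfold close_polygon. destruct (Nat.ltb_spec k q); [|lia].
destruct (Nat.ltb_spec (S k) q) as [hk1|hk1].
- specialize (hdb k hk). destruct (proj1 (dual_billiard_lengths _ _ _ _ _) hdb) as (c1 & c2 & c3 & c4 & c5).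
  assert (hs : 0 < sin (th (S k) - th k)) by (apply sin_gt_0; lra).
  split; [lra|].
  assert (e1 : lead gamma (th k) (th (S k)) / sin (th (S k) - th k) = r k) by (rewrite <- c4; field; lra).
  assert (e2 : trail gamma (th k) (th (S k)) / sin (th (S k) - th k) = r (S k)) by (rewrite <- c5; field; lra).
  unfold gen_fst, gen_snd, beta. rewrite e1, e2.
  split; match goal with |- Rabs ?z <= _ => replace z with 0 by ring end; rewrite Rabs_R0; lra.
- assert (hqk : q = S k) by lia. specialize (hdb k hk). rewrite <- hqk in hdb.
  destruct (hpl (th k) (r k) (th q) (r q) (th 0%nat + 2 * PI * INR p) rho W hdb hrho (hr k ltac:(lia)) (hr1 q (le_n _))) as (s1 & s2 & s3); auto.
  { rewrite Rabs_minus_sym. auto. }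
  { lra. }
  split; [lra|]. unfold gen_fst, gen_snd, beta.
  destruct (supp_periodic_nat _ _ _ hev p (th 0%nat)) as (-> & ->).
  set (R0 := lead _ _ _ / _) in *. set (R1 := trail _ _ _ / _) in *.
  split.
  + replace (/ 2 * (tang gamma (th k) ^ 2 - supp gamma (th k) ^ 2 - R0 ^ 2) - / 2 * (tang gamma (th k) ^ 2 - supp gamma (th k) ^ 2 - r k ^ 2)) with (- (/ 2 * (R0 ^ 2 - r k ^ 2))) by ring.
    rewrite Rabs_Ropp. apply square_diff_le; auto; [|lra]. specialize (hr1 k ltac:(lia)). specialize (hr k ltac:(lia)). lra.
  + replace (/ 2 * (R1 ^ 2 - tang gamma (th 0%nat) ^ 2 + supp gamma (th 0%nat) ^ 2) + / 2 * (tang gamma (th 0%nat) ^ 2 - supp gamma (th 0%nat) ^ 2 - r 0%nat ^ 2)) with (/ 2 * (R1 ^ 2 - r 0%nat ^ 2)) by ring.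
    apply square_diff_le; auto.
    * specialize (hr1 0%nat ltac:(lia)). specialize (hr 0%nat ltac:(lia)). lra.
    * replace (R1 - r 0%nat) with ((R1 - r q) + (r q - r 0%nat)) by ring. eapply Rle_trans; [apply Rabs_triang|]. lra.
Qed.

Lemma RtoC_fst (z : C) : snd z = 0 -> RtoC (fst z) = z.
Proof. destruct z as (u, v). simpl. intros ->. reflexivity. Qed.

Lemma iterates_real G a b n (x y : R) : normal_map G a b -> (forall k, (k < n)%nat -> Cmod (snd (it G k (RtoC x, RtoC y))) < b) ->
  snd (fst (it G n (RtoC x, RtoC y))) = 0 /\ snd (snd (it G n (RtoC x, RtoC y))) = 0.
Proof.
intros hG h. induction n; [split; reflexivity|].
destruct (IHn ltac:(intros; apply h; lia)) as (h1 & h2). specialize (h n (le_n _)).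
change (it G (S n) (RtoC x, RtoC y)) with (G (it G n (RtoC x, RtoC y))).
destruct (it G n (RtoC x, RtoC y)) as (u, v). cbn [fst snd] in *.
rewrite <- (RtoC_fst u h1), <- (RtoC_fst v h2) in *. apply (nm_real _ _ _ hG). rewrite <- Cmod_R. auto.
Qed.

(** The iterates of the real points of the curve in envelope coordinates: orbit segments of the dual
    billiard, which need not close up. *)
Record curve_orbit (gamma : R -> vec) (G : C * C -> C * C) (X Y : R -> R -> R) (Yc : C -> C) (rho r1 : R) (q : nat) (th r : nat -> R -> R) : Prop := {
  co_x : forall k x, (k <= q)%nat -> RtoC (X (th k x) (r k x)) = fst (it G k (RtoC x, Yc (RtoC x)));
  co_y : forall k x, (k <= q)%nat -> RtoC (Y (th k x) (r k x)) = snd (it G k (RtoC x, Yc (RtoC x)));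
  co_r : forall k x, (k <= q)%nat -> rho <= r k x <= r1;
  co_step : forall k x, (k < q)%nat -> dual_billiard gamma (th k x) (r k x) (th (S k) x) (r (S k) x)
}.

Lemma chart_injective X Y s c K d th r th' r' : good_chart X Y s c K d -> Rabs r <= d -> Rabs r' <= d ->
  X th r = X th' r' -> Y th r = Y th' r' -> th = th' /\ r = r'.
Proof.
intros hg h1 h2 e1 e2. destruct (chart_bilip _ _ _ _ _ _ hg) as (Lam & hL & h). destruct (h th th' r r' h1 h2) as (q & _).
rewrite e1, e2, !Rminus_diag, Rabs_R0, Rplus_0_r, Rmult_0_r in q.
pose proof (Rabs_pos (th' - th)). pose proof (Rabs_pos (r' - r)).
assert (z1 : Rabs (th' - th) = 0) by lra. assert (z2 : Rabs (r' - r) = 0) by lra.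
destruct (Req_dec (th' - th) 0) as [w1|w1]; [|apply Rabs_no_R0 in w1; lra]. destruct (Req_dec (r' - r) 0) as [w2|w2]; [|apply Rabs_no_R0 in w2; lra]. lra.
Qed.

(** The ordinates stay between [mu / 2] and [3 mu / 2], so each iterate has a preimage under the
    chart. The dual billiard image of a preimage exists and has the coordinates given by [G]; by
    injectivity of the chart it is the next preimage. *)
Lemma exists_curve_orbit gamma k1 k2 G a b X Y s c K d r0 a2 kp Kc p q Yc : envelope gamma k1 k2 -> normal_map G a b ->
  good_chart X Y s c K d -> conjugated gamma G X Y d r0 -> 0 < a2 -> kp <= / 4 -> periodic_curve G a2 b kp Kc p q Yc ->
  forall mu, mu = INR p / INR q -> 0 < mu -> 0 <= Kc -> Kc * mu <= / 4 -> 2 * mu <= c * Rmin r0 (k1 / 2) ->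
  exists th r, curve_orbit gamma G X Y Yc (mu / (2 * K)) (2 * mu / c) q th r.
Proof.
intros hev hG hg hcj ha2 hkp hpc mu hmu hmu0 hKc hKm hsm.
pose proof (gc_d _ _ _ _ _ _ hg) as hd0. pose proof (gc_K _ _ _ _ _ _ hg) as hK. pose proof (gc_c _ _ _ _ _ _ hg) as hc.
pose proof (ev_pos _ _ _ hev) as hk1. destruct hcj as [hr0 hr0d hstep].
pose proof (Rmin_l r0 (k1 / 2)) as m1. pose proof (Rmin_r r0 (k1 / 2)) as m2.
assert (h2m : 0 < 2 * mu / c) by (apply Rdiv_lt_0_compat; lra).
assert (hR1 : 2 * mu / c <= Rmin r0 (k1 / 2)). { apply Rmult_le_reg_r with c; auto. replace (2 * mu / c * c) with (2 * mu) by (field; lra). lra. }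
assert (hcd : 2 * mu <= c * d). { apply Rle_trans with (1 := hsm). apply Rmult_le_compat_l; lra. }
assert (hx0 : forall x : R, Rabs (snd (RtoC x)) < a2) by (intro x; simpl; rewrite Rabs_R0; auto).
assert (hYr : forall x : R, Yc (RtoC x) = RtoC (fst (Yc (RtoC x)))) by (intro x; symmetry; apply RtoC_fst, (pc_real _ _ _ _ _ _ _ _ hpc)).
assert (hreal : forall k x, (k <= q)%nat -> snd (fst (it G k (RtoC x, Yc (RtoC x)))) = 0 /\ snd (snd (it G k (RtoC x, Yc (RtoC x)))) = 0).
{ intros k x hk. rewrite hYr. apply (iterates_real G a b); auto. intros i hi. rewrite <- hYr. apply (pc_dom _ _ _ _ _ _ _ _ hpc); auto. lia. }
assert (hyb : forall k x, (k <= q)%nat -> mu / 2 <= fst (snd (it G k (RtoC x, Yc (RtoC x)))) <= 3 / 2 * mu).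
{ intros k x hk. pose proof (pc_disk _ _ _ _ _ _ _ _ hpc _ (hx0 x)) as w1. pose proof (pc_y _ _ _ _ _ _ _ _ hpc k _ hk (hx0 x)) as w2.
  rewrite <- hmu in w1, w2.
  pose proof (Rle_trans _ _ _ (fst_le_Cmod _) w1) as w3. pose proof (Rle_trans _ _ _ (fst_le_Cmod _) w2) as w4. rewrite fst_minus in w3, w4. change (fst (RtoC mu)) with mu in w3.
  assert (kp * mu <= / 4 * mu) by (apply Rmult_le_compat_r; lra). assert (Kc * mu ^ 2 <= / 4 * mu) by (replace (Kc * mu ^ 2) with (Kc * mu * mu) by ring; apply Rmult_le_compat_r; lra).
  apply Rabs_le_between in w3. apply Rabs_le_between in w4. lra. }
assert (hex : forall kx : nat * R, exists tr : R * R, (fst kx <= q)%nat -> 0 < snd tr <= d /\ X (fst tr) (snd tr) = fst (fst (it G (fst kx) (RtoC (snd kx), Yc (RtoC (snd kx))))) /\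
   Y (fst tr) (snd tr) = fst (snd (it G (fst kx) (RtoC (snd kx), Yc (RtoC (snd kx)))))).
{ intros (k, x). cbn [fst snd]. destruct (le_dec k q) as [hk|hk]; [|exists (0, 0); intro; contradiction].
  destruct (chart_surj _ _ _ _ _ _ hg (fst (fst (it G k (RtoC x, Yc (RtoC x))))) (fst (snd (it G k (RtoC x, Yc (RtoC x)))))) as (t & r & h1 & h2 & h3).
  { specialize (hyb k x hk). lra. }
  exists (t, r). intros _. auto. }
destruct (choice _ hex) as (tr & htr).
set (th := fun k x => fst (tr (k, x))). set (r := fun k x => snd (tr (k, x))). exists th, r.
assert (hall : forall k x, (k <= q)%nat -> 0 < r k x <= d /\ X (th k x) (r k x) = fst (fst (it G k (RtoC x, Yc (RtoC x)))) /\
   Y (th k x) (r k x) = fst (snd (it G k (RtoC x, Yc (RtoC x))))) by (intros k x hk; apply (htr (k, x)); auto).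
assert (hX : forall k x, (k <= q)%nat -> RtoC (X (th k x) (r k x)) = fst (it G k (RtoC x, Yc (RtoC x)))).
{ intros k x hk. destruct (hall k x hk) as (_ & -> & _). apply RtoC_fst, hreal; auto. }
assert (hY : forall k x, (k <= q)%nat -> RtoC (Y (th k x) (r k x)) = snd (it G k (RtoC x, Yc (RtoC x)))).
{ intros k x hk. destruct (hall k x hk) as (_ & _ & ->). apply RtoC_fst, hreal; auto. }
assert (hR : forall k x, (k <= q)%nat -> mu / (2 * K) <= r k x <= 2 * mu / c).
{ intros k x hk. destruct (hall k x hk) as (h1 & _ & h3). pose proof (chart_Y_bounds _ _ _ _ _ _ (th k x) (r k x) hg ltac:(lra)) as w. rewrite h3 in w. specialize (hyb k x hk).
  split.
  - apply Rmult_le_reg_l with K; auto. replace (K * (mu / (2 * K))) with (mu / 2) by (field; lra). lra.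
  - apply Rmult_le_reg_l with c; auto. replace (c * (2 * mu / c)) with (2 * mu) by (field; lra). lra. }
split; auto.
intros k x hk. destruct (hall k x ltac:(lia)) as (h1 & _). pose proof (hR k x ltac:(lia)) as h2.
destruct (dual_billiard_exists _ _ _ (th k x) (r k x) hev ltac:(lra)) as (t & r' & hdb).
destruct (hstep (th k x) (r k x) t r' ltac:(lra) hdb) as (h3 & h4).
rewrite hX, hY in h4 by lia. rewrite <- surjective_pairing in h4.
change (G (it G k (RtoC x, Yc (RtoC x)))) with (it G (S k) (RtoC x, Yc (RtoC x))) in h4.
assert (hrp : 0 < r') by apply hdb.
destruct (hall (S k) x hk) as (h5 & h6 & h7).
destruct (chart_injective X Y s c K d (th (S k) x) (r (S k) x) t r' hg) as (e1 & e2).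
- rewrite Rabs_pos_eq; lra.
- rewrite Rabs_pos_eq; lra.
- rewrite h6, h4. reflexivity.
- rewrite h7, h4. reflexivity.
- rewrite e1, e2. exact hdb.
Qed.

Definition curve_area (gamma : R -> vec) (th : nat -> R -> R) (p q : nat) (x : R) : R := polygon_gen gamma (close_polygon (fun k => th k x) p q) q.

(** The end terms of [gen_sum_variation] cancel, because [al q = al 0] and both ends of the closed
    polygon move by the same amount. There remains a local Lipschitz bound, proportional to the
    closing error [C W / rho] and to the Lipschitz constant [B] of the angles; [path_lipschitz]
    makes it global. *)
Lemma curve_area_variation gamma k1 k2 X Y c K d Lam : envelope gamma k1 k2 -> good_chart X Y 1 c K d -> 0 < Lam ->
  (forall th th' r r', Rabs r <= d -> Rabs r' <= d -> Rabs (th' - th) + Rabs (r' - r) <= Lam * (Rabs (X th' r' - X th r) + Rabs (Y th' r' - Y th r))) ->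
  exists C, 0 < C /\ forall G b a2 kp Kc p q Yc L rho r1 th r W B,
  0 < a2 -> 0 <= Kc -> 0 <= b -> (1 <= p)%nat -> (1 <= q)%nat -> INR p <= L -> periodic_curve G a2 b kp Kc p q Yc ->
  curve_orbit gamma G X Y Yc rho r1 q th r -> 0 < rho -> r1 <= Rmin d (Rmin 1 (k1 / 2)) ->
  (forall x : R, Cmod (snd (it G q (RtoC x, Yc (RtoC x))) - Yc (RtoC x))%C <= W) -> Lam * W <= rho / (2 * k2) -> C * W / rho <= 1 ->
  B = Lam * (1 + 4 * ((Kc + 1) * L) / a2 + 4 * b / a2) ->
  forall x x', Rabs (curve_area gamma th p q x' - curve_area gamma th p q x) <= INR q * (4 * (C * W / rho)) * B * Rabs (x' - x).
Proof.
intros hev hg hLam hlip. destruct (closed_polygon_gradient _ _ _ hev) as (C & hC & hgrad).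
exists (C * Lam). split; [apply Rmult_lt_0_compat; auto|].
intros G b a2 kp Kc p q Yc L rho r1 th r W B ha2 hKc hb hp hq hpL hpc [hX hY hR hdb] hrho hr1 hw hW1 hW2 hB.
pose proof (gc_d _ _ _ _ _ _ hg) as hd0.
assert (hqR : 1 <= INR q) by (apply (le_INR 1); auto). assert (hpR : 1 <= INR p) by (apply (le_INR 1); auto).
pose proof (Rmin_l d (Rmin 1 (k1 / 2))) as m1. pose proof (Rmin_r d (Rmin 1 (k1 / 2))) as m2.
assert (hrd : forall k x, (k <= q)%nat -> Rabs (r k x) <= d). { intros k x hk. specialize (hR k x hk). rewrite Rabs_pos_eq; lra. }
assert (hB0 : 0 < B).
{ rewrite hB. apply Rmult_lt_0_compat; auto. assert (0 <= 4 * ((Kc + 1) * L) / a2) by (apply Rmult_le_pos; [apply Rmult_le_pos; [lra|apply Rmult_le_pos; lra]|left; apply Rinv_0_lt_compat; auto]).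
  assert (0 <= 4 * b / a2) by (apply Rmult_le_pos; [lra|left; apply Rinv_0_lt_compat; auto]). lra. }
assert (hthl : forall k x x', (k <= q)%nat -> Rabs (th k x' - th k x) <= B * Rabs (x' - x)).
{ intros k x x' hk. destruct (curve_lipschitz G a2 b kp Kc p q L Yc ha2 hKc hb hp hq hpL hpc k x' x hk) as (w1 & w2).
  rewrite <- !hX, <- RtoC_minus, Cmod_R in w1 by auto. rewrite <- !hY, <- RtoC_minus, Cmod_R in w2 by auto.
  specialize (hlip (th k x) (th k x') (r k x) (r k x') (hrd k x hk) (hrd k x' hk)). pose proof (Rabs_pos (r k x' - r k x)).
  apply Rle_trans with (Lam * (Rabs (X (th k x') (r k x') - X (th k x) (r k x)) + Rabs (Y (th k x') (r k x') - Y (th k x) (r k x)))); [lra|].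
  rewrite hB, Rmult_assoc. apply Rmult_le_compat_l; lra. }
assert (hW0 : 0 <= W) by (specialize (hw 0); pose proof (Cmod_ge_0 (snd (it G q (RtoC 0, Yc (RtoC 0))) - Yc (RtoC 0))%C); lra).
assert (hCWe : C * Lam * W / rho = C * (Lam * W) / rho) by (unfold Rdiv; ring). rewrite hCWe in *.
assert (hCW0 : 0 <= C * (Lam * W) / rho). { apply Rmult_le_pos; [repeat apply Rmult_le_pos; lra|left; apply Rinv_0_lt_compat; auto]. }
set (U := C * (Lam * W) / rho) in *.
assert (hclose : forall x, Rabs (th q x - (th 0%nat x + 2 * PI * INR p)) <= Lam * W /\ Rabs (r q x - r 0%nat x) <= Lam * W).
{ intro x. assert (hx0 : Rabs (snd (RtoC x)) < a2) by (simpl; rewrite Rabs_R0; auto).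
  assert (e1 : X (th q x) (r q x) = X (th 0%nat x) (r 0%nat x) + INR p).
  { apply RtoC_inj. rewrite RtoC_plus, !hX by lia. apply (pc_eq _ _ _ _ _ _ _ _ hpc); auto. }
  assert (e2 : Rabs (Y (th q x) (r q x) - Y (th 0%nat x) (r 0%nat x)) <= W).
  { rewrite <- Cmod_R, RtoC_minus, !hY by lia. apply hw. }
  destruct (chart_period _ _ _ _ _ _ hg (Z.of_nat p) (th 0%nat x) (r 0%nat x) (hrd 0%nat x ltac:(lia))) as (f1 & f2).
  rewrite <- INR_IZR_INZ, Rmult_1_l in f1. rewrite <- INR_IZR_INZ in f2.
  specialize (hlip (th 0%nat x + 2 * PI * INR p) (th q x) (r 0%nat x) (r q x) (hrd 0%nat x ltac:(lia)) (hrd q x (le_n _))).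
  rewrite f1, f2, e1, Rminus_diag, Rabs_R0, Rplus_0_l in hlip.
  assert (Lam * Rabs (Y (th q x) (r q x) - Y (th 0%nat x) (r 0%nat x)) <= Lam * W) by (apply Rmult_le_compat_l; lra).
  pose proof (Rabs_pos (th q x - (th 0%nat x + 2 * PI * INR p))). pose proof (Rabs_pos (r q x - r 0%nat x)). lra. }
assert (key : forall x x', x <= x' -> Rabs (curve_area gamma th p q x' - curve_area gamma th p q x) <= INR q * (4 * U) * B * (x' - x)).
{ intros xa xb hab.
  assert (q1 := path_lipschitz (fun x => RtoC (curve_area gamma th p q x)) xa xb (INR q * (4 * U) * B) hab). cbv beta in q1.
  rewrite <- RtoC_minus, Cmod_R in q1. apply q1. clear q1.
  intros x _ e he.
  destruct (hgrad p q (fun k => th k x) (fun k => r k x) rho (Lam * W) hq) as (al & hal & hk); auto.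
  { intros k hk. specialize (hR k x hk). lra. }
  { apply hclose. }
  { apply hclose. }
  (* Summed over the [q] sides, this error adds exactly [e] to the Lipschitz constant. *)
  set (e' := e / (2 * INR q * B)). assert (hqB : 0 < 2 * INR q * B) by (repeat apply Rmult_lt_0_compat; lra). assert (he' : 0 < e') by (apply Rdiv_lt_0_compat; auto).
  destruct (gen_sum_variation gamma k1 k2 (close_polygon (fun k => th k x) p q) al (2 * U) e' q hev he' ltac:(lra) hk) as (dd & hdd & hv).
  exists (dd / B). split; [apply Rdiv_lt_0_compat; auto|]. intros s _ hs.
  rewrite <- RtoC_minus, Cmod_R.
  specialize (hv (close_polygon (fun k => th k s) p q) (B * Rabs (s - x))).
  assert (hz0 : close_polygon (fun k => th k s) p q 0 - close_polygon (fun k => th k x) p q 0 = th 0%nat s - th 0%nat x).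
  { unfold close_polygon. destruct (Nat.ltb_spec 0 q); [auto|lia]. }
  assert (hzq : close_polygon (fun k => th k s) p q q - close_polygon (fun k => th k x) p q q = th 0%nat s - th 0%nat x).
  { unfold close_polygon. rewrite Nat.ltb_irrefl. ring. }
  rewrite hz0, hzq, hal, Rminus_diag, Rminus_0_r in hv.
  eapply Rle_trans; [apply hv|].
  - apply Rmult_lt_compat_l with (r := B) in hs; auto. replace (B * (dd / B)) with dd in hs by (field; lra). auto.
  - intros k hkq. unfold close_polygon. destruct (Nat.ltb_spec k q).
    + apply hthl; lia.
    + replace (th 0%nat s + 2 * PI * INR p - (th 0%nat x + 2 * PI * INR p)) with (th 0%nat s - th 0%nat x) by ring. apply hthl; lia.
  - right. unfold e'. field. lra. }
intros x x'. destruct (Rle_or_lt x x') as [h|h].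
- rewrite (Rabs_pos_eq (x' - x)) by lra. auto.
- rewrite Rabs_minus_sym, (Rabs_minus_sym x'), (Rabs_pos_eq (x - x')) by lra. apply key. lra.
Qed.

(** * Periodic trajectories as orbits of points of the curve *)

Section Trajectory.
Context gamma k1 k2 G a b X Y c K d r0 a2 kp Kc p q Yc (hev : envelope gamma k1 k2) (hG : normal_map G a b)
  (hg : good_chart X Y 1 c K d) (hcj : conjugated gamma G X Y d r0) (ha2 : 0 < a2) (hpc : periodic_curve G a2 b kp Kc p q Yc)
  (hq : (1 <= q)%nat) (theta r : Z -> R) (htr : periodic_trajectory gamma p q theta r)
  (hr : forall k, 0 < r k <= r0) (hdisk : forall k, Cmod (RtoC (Y (theta k) (r k)) - RtoC (INR p / INR q))%C <= kp * (INR p / INR q)).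

Lemma trajectory_iterates k n : it G n (RtoC (X (theta k) (r k)), RtoC (Y (theta k) (r k))) =
  (RtoC (X (theta (k + Z.of_nat n)%Z) (r (k + Z.of_nat n)%Z)), RtoC (Y (theta (k + Z.of_nat n)%Z) (r (k + Z.of_nat n)%Z))).
Proof.
induction n; [simpl; rewrite Z.add_0_r; reflexivity|].
change (it G (S n) ?z) with (G (it G n z)). rewrite IHn.
rewrite Nat2Z.inj_succ, <- Z.add_1_r, Z.add_assoc. apply (cj_step _ _ _ _ _ _ hcj).
- apply hr.
- apply htr.
Qed.

Lemma trajectory_radius k : Rabs (r k) <= d.
Proof. pose proof (cj_le _ _ _ _ _ _ hcj). specialize (hr k). rewrite Rabs_pos_eq; lra. Qed.

Lemma trajectory_return k : X (theta (k + Z.of_nat q)%Z) (r (k + Z.of_nat q)%Z) = X (theta k) (r k) + INR p /\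
  Y (theta (k + Z.of_nat q)%Z) (r (k + Z.of_nat q)%Z) = Y (theta k) (r k).
Proof.
destruct (proj2 htr k) as (-> & ->). rewrite INR_IZR_INZ.
destruct (chart_period _ _ _ _ _ _ hg (Z.of_nat p) (theta k) (r k) (trajectory_radius k)) as (-> & ->). split; ring.
Qed.

Lemma trajectory_curve k : Yc (RtoC (X (theta k) (r k))) = RtoC (Y (theta k) (r k)).
Proof.
symmetry. apply (pc_unique _ _ _ _ _ _ _ _ hpc); auto.
- simpl. rewrite Rabs_R0. auto.
- rewrite trajectory_iterates. cbn [fst]. rewrite (proj1 (trajectory_return k)). apply RtoC_plus.
Qed.

Lemma trajectory_zero k : snd (it G q (RtoC (X (theta k) (r k)), Yc (RtoC (X (theta k) (r k))))) = Yc (RtoC (X (theta k) (r k))).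
Proof. rewrite trajectory_curve, trajectory_iterates. cbn [snd]. rewrite (proj2 (trajectory_return k)). reflexivity. Qed.

(** Over the abscissa of a point of the trajectory, the orbit segment of the curve is the trajectory
    itself by injectivity of the chart, and closing it changes nothing. *)
Lemma trajectory_area_curve rho r1 th rr : curve_orbit gamma G X Y Yc rho r1 q th rr -> 0 < rho -> r1 <= d ->
  trajectory_area gamma q theta r = curve_area gamma th p q (X (theta 0%Z) (r 0%Z)).
Proof.
intros [hX hY hR hdb] hrho hr1. rewrite (trajectory_area_gen gamma k1 k2 p q theta r hev hq htr).
rewrite <- psum_sum_n. replace (S (q - 1)) with q by lia. unfold curve_area, polygon_gen.
set (x0 := X (theta 0%Z) (r 0%Z)).
assert (ht : forall k, (k <= q)%nat -> th k x0 = theta (Z.of_nat k)).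
{ intros k hk. destruct (chart_injective X Y 1 c K d (th k x0) (rr k x0) (theta (Z.of_nat k)) (r (Z.of_nat k)) hg) as (e & _); auto.
  - specialize (hR k x0 hk). rewrite Rabs_pos_eq; lra.
  - apply trajectory_radius.
  - apply RtoC_inj. rewrite hX by auto. unfold x0. rewrite trajectory_curve, trajectory_iterates. reflexivity.
  - apply RtoC_inj. rewrite hY by auto. unfold x0. rewrite trajectory_curve, trajectory_iterates. reflexivity. }
apply psum_ext. intros k hk. unfold close_polygon. destruct (Nat.ltb_spec k q); [|lia].
rewrite ht by lia. f_equal. destruct (Nat.ltb_spec (S k) q).
- rewrite ht by lia. f_equal. lia.
- rewrite ht by lia. simpl (Z.of_nat 0). rewrite <- (proj1 (proj2 htr 0%Z)). f_equal. lia.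
Qed.

End Trajectory.

(** * Comparison of two trajectories *)

(** It absorbs a factor [q^2]: one [q] comes from the number of sides, the other from
    [1 / rho = O(q)]. *)
Lemma sqr_exp_bound x : 0 < x -> x ^ 2 * exp (- x) <= 4.
Proof.
intro hx. pose proof (exp_ineq1 (x / 2) ltac:(lra)) as h. pose proof (exp_pos (x / 2)).
assert (e : exp x = exp (x / 2) * exp (x / 2)) by (rewrite <- exp_plus; f_equal; lra).
rewrite exp_Ropp. apply Rmult_le_reg_r with (exp x); [apply exp_pos|].
rewrite Rmult_assoc, Rinv_l by (apply Rgt_not_eq, exp_pos). rewrite e. nra.
Qed.

Lemma rotate_2PI_Z (n : Z) th : cos (th + 2 * PI * IZR n) = cos th /\ sin (th + 2 * PI * IZR n) = sin th.
Proof.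
assert (hx := quasi_periodic_Z (fun k => cos (th + 2 * PI * IZR k)) 1 0). assert (hy := quasi_periodic_Z (fun k => sin (th + 2 * PI * IZR k)) 1 0).
cbv beta in hx, hy.
assert (e : forall k, th + 2 * PI * IZR (k + 1) = (th + 2 * PI * IZR k) + 2 * PI) by (intro k; rewrite plus_IZR; ring).
specialize (hx ltac:(intro k; rewrite e, Rplus_0_r, cos_plus, cos_2PI, sin_2PI; ring) n 0%Z).
specialize (hy ltac:(intro k; rewrite e, Rplus_0_r, sin_plus, cos_2PI, sin_2PI; ring) n 0%Z).
replace (0 + 1 * n)%Z with n in hx, hy by ring. rewrite Rmult_0_l, !Rplus_0_r, Rmult_0_r, Rplus_0_r in hx, hy. auto.
Qed.

Lemma along_2PI_Z gamma k1 k2 (n : Z) th r : envelope gamma k1 k2 ->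
  along (gamma (th + 2 * PI * IZR n)) r (dir (th + 2 * PI * IZR n)) = along (gamma th) r (dir th).
Proof.
intro hev.
assert (hgx := quasi_periodic_Z (fun k => fst (gamma (th + 2 * PI * IZR k))) 1 0). assert (hgy := quasi_periodic_Z (fun k => snd (gamma (th + 2 * PI * IZR k))) 1 0).
cbv beta in hgx, hgy.
assert (e : forall k, th + 2 * PI * IZR (k + 1) = (th + 2 * PI * IZR k) + 2 * PI) by (intro k; rewrite plus_IZR; ring).
specialize (hgx ltac:(intro k; rewrite e, (ev_per _ _ _ hev); ring) n 0%Z). specialize (hgy ltac:(intro k; rewrite e, (ev_per _ _ _ hev); ring) n 0%Z).
replace (0 + 1 * n)%Z with n in hgx, hgy by ring. rewrite Rmult_0_l, Rmult_0_r, !Rplus_0_r in hgx, hgy.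
destruct (rotate_2PI_Z n th) as (e1 & e2). unfold along, dir. cbn [fst snd]. rewrite hgx, hgy, e1, e2. reflexivity.
Qed.

Lemma shifted_trajectory gamma k1 k2 p q (n : Z) th r : envelope gamma k1 k2 -> periodic_trajectory gamma p q th r ->
  periodic_trajectory gamma p q (fun k => th k + 2 * PI * IZR n) r /\
  trajectory_area gamma q (fun k => th k + 2 * PI * IZR n) r = trajectory_area gamma q th r.
Proof.
intros hev (h1 & h2). split; [split|].
- intro k. destruct (h1 k) as (w1 & w2 & w3 & w4). split; auto. split; auto. split; [lra|]. rewrite !(along_2PI_Z gamma k1 k2); auto.
- intro k. destruct (h2 k) as (w1 & w2). split; auto. lra.
- unfold trajectory_area. apply sum_n_ext. intro k. unfold vertex. rewrite !(along_2PI_Z gamma k1 k2); auto.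
Qed.

Lemma shifted_birkhoff p q (n : Z) th : birkhoff p q th -> birkhoff p q (fun k => th k + 2 * PI * IZR n).
Proof. intros h k k' j. rewrite <- (h k k' j). split; lra. Qed.

Lemma psum_rotate (F : Z -> R) (q : nat) : (forall k, F (k + Z.of_nat q)%Z = F k) -> forall k : nat, psum (fun i => F (Z.of_nat k + Z.of_nat i)%Z) q = psum (fun i => F (Z.of_nat i)) q.
Proof.
intros hF. induction k; [apply psum_ext; auto|]. rewrite <- IHk.
assert (h : forall n, psum (fun i => F (Z.of_nat (S k) + Z.of_nat i)%Z) n + F (Z.of_nat k) = psum (fun i => F (Z.of_nat k + Z.of_nat i)%Z) n + F (Z.of_nat k + Z.of_nat n)%Z).
{ induction n; [simpl psum; rewrite Z.add_0_r; ring|]. cbn [psum].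
  replace (Z.of_nat k + Z.of_nat (S n))%Z with (Z.of_nat (S k) + Z.of_nat n)%Z by lia. lra. }
specialize (h q). rewrite hF in h. lra.
Qed.

(** It allows two trajectories to be compared starting from a shared point. *)
Lemma trajectory_area_rotate gamma k1 k2 p q th r (k : nat) : envelope gamma k1 k2 -> (1 <= q)%nat -> periodic_trajectory gamma p q th r ->
  trajectory_area gamma q th r = psum (fun i => segment_area (vertex gamma th r (Z.of_nat k + Z.of_nat i)) (vertex gamma th r (Z.of_nat k + Z.of_nat i + 1))) q.
Proof.
intros hev hq (h1 & h2). unfold trajectory_area. rewrite <- psum_sum_n. replace (S (q - 1)) with q by lia.
symmetry. apply (psum_rotate (fun k => segment_area (vertex gamma th r k) (vertex gamma th r (k + 1)))).
assert (hv : forall j, vertex gamma th r (j + Z.of_nat q) = vertex gamma th r j).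
{ intro j. unfold vertex. destruct (h2 j) as (-> & ->). rewrite INR_IZR_INZ. apply (along_2PI_Z gamma k1 k2); auto. }
intro j. rewrite hv. f_equal. replace (j + Z.of_nat q + 1)%Z with ((j + 1) + Z.of_nat q)%Z by ring. apply hv.
Qed.

(** Equal angles modulo a turn exclude both strict inequalities, so the Birkhoff order makes the two
    fractions equal modulo 1, and coprimality concludes. *)
Lemma birkhoff_distinct p q th k l (n : Z) : birkhoff p q th -> Nat.gcd p q = 1%nat -> (k < q)%nat -> (l < q)%nat ->
  th (Z.of_nat k) = th (Z.of_nat l) + 2 * PI * IZR n -> k = l.
Proof.
intros hb hgcd hk hl h. apply (coprime_fraction p q k l n hgcd hk hl).
assert (h1 := hb (Z.of_nat k) (Z.of_nat l) n). assert (h2 := hb (Z.of_nat l) (Z.of_nat k) (- n)%Z).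
rewrite opp_IZR in h2. rewrite <- !INR_IZR_INZ in h1, h2.
destruct (Rtotal_order (INR k * INR p / INR q) (INR l * INR p / INR q + IZR n)) as [w|[w|w]]; auto.
- apply h1 in w. lra.
- assert (w' : INR l * INR p / INR q < INR k * INR p / INR q + - IZR n) by lra. apply h2 in w'. lra.
Qed.

Lemma curve_period_Z G a b kp Kc p q Yc : periodic_curve G a b kp Kc p q Yc -> 0 < a -> forall (n : Z) (x : R), Yc (RtoC (x + IZR n)) = Yc (RtoC x).
Proof.
intros hpc ha n x.
assert (hstep : forall x : R, Yc (RtoC (x + 1)) = Yc (RtoC x)).
{ intro u. assert (w := pc_per _ _ _ _ _ _ _ _ hpc 0%nat (RtoC u) ltac:(lia) ltac:(simpl; rewrite Rabs_R0; auto)).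
  apply (f_equal snd) in w. rewrite RtoC_plus. exact w. }
assert (h := quasi_periodic_Z (fun k => fst (Yc (RtoC (x + IZR k)))) 1 0). cbv beta in h.
specialize (h ltac:(intro k; rewrite plus_IZR, <- Rplus_assoc, hstep; ring) n 0%Z).
replace (0 + 1 * n)%Z with n in h by ring. rewrite Rmult_0_l, !Rplus_0_r in h.
rewrite <- (RtoC_fst (Yc (RtoC (x + IZR n)))), <- (RtoC_fst (Yc (RtoC x))) by apply (pc_real _ _ _ _ _ _ _ _ hpc). f_equal. exact h.
Qed.

(** Both points lie on the curve, which is a 1-periodic graph: equal abscissas modulo 1 give equal
    ordinates, and the chart is injective on the cylinder. *)
Lemma trajectory_coincidence G a b X Y c K d a2 kp Kc p q Yc u r u' r' (n : Z) :
  normal_map G a b -> good_chart X Y 1 c K d -> 0 < a2 -> periodic_curve G a2 b kp Kc p q Yc ->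
  Rabs r <= d -> Rabs r' <= d ->
  Yc (RtoC (X u r)) = RtoC (Y u r) -> Yc (RtoC (X u' r')) = RtoC (Y u' r') ->
  X u r = X u' r' + IZR n -> (exists k : Z, u = u' + 2 * PI * IZR k) /\ r = r'.
Proof.
intros hG hg ha2 hpc hr hr' h1 h2 hX. apply (gc_inj _ _ _ _ _ _ hg u' r' u r n hr' hr hX).
apply RtoC_inj. rewrite <- h1, <- h2, hX. apply (curve_period_Z _ _ _ _ _ _ _ _ hpc ha2).
Qed.

Lemma trajectory_area_unique gamma k1 k2 G a b X Y c K d r0 a2 kp Kc p q Yc theta r theta' r' (k l : nat) :
  envelope gamma k1 k2 -> normal_map G a b -> good_chart X Y 1 c K d -> conjugated gamma G X Y d r0 -> 0 < a2 ->
  periodic_curve G a2 b kp Kc p q Yc -> (1 <= q)%nat ->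
  periodic_trajectory gamma p q theta r -> periodic_trajectory gamma p q theta' r' ->
  (forall k, 0 < r k <= r0) -> (forall k, 0 < r' k <= r0) ->
  theta (Z.of_nat k) = theta' (Z.of_nat l) -> r (Z.of_nat k) = r' (Z.of_nat l) ->
  trajectory_area gamma q theta r = trajectory_area gamma q theta' r'.
Proof.
intros hev hG hg hcj ha2 hpc hq htr htr' hr hr' e1 e2.
rewrite (trajectory_area_rotate gamma k1 k2 p q theta r k), (trajectory_area_rotate gamma k1 k2 p q theta' r' l); auto.
assert (h : forall i : nat, theta (Z.of_nat k + Z.of_nat i)%Z = theta' (Z.of_nat l + Z.of_nat i)%Z /\ r (Z.of_nat k + Z.of_nat i)%Z = r' (Z.of_nat l + Z.of_nat i)%Z).
{ intro i.
  assert (w := trajectory_iterates gamma G X Y d r0 p q hcj theta r htr hr (Z.of_nat k) i).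
  assert (w' := trajectory_iterates gamma G X Y d r0 p q hcj theta' r' htr' hr' (Z.of_nat l) i).
  rewrite <- e1, <- e2, w in w'.
  apply (chart_injective X Y 1 c K d _ _ _ _ hg).
  - apply (trajectory_radius gamma G X Y d r0 hcj r hr).
  - apply (trajectory_radius gamma G X Y d r0 hcj r' hr').
  - apply RtoC_inj. apply (f_equal fst) in w'. exact w'.
  - apply RtoC_inj. apply (f_equal snd) in w'. exact w'. }
apply psum_ext. intros i _. unfold vertex. destruct (h i) as (-> & ->).
destruct (h (S i)) as (h1 & h2). rewrite !Nat2Z.inj_succ, <- !Z.add_1_r, !Z.add_assoc in h1, h2. rewrite h1, h2. reflexivity.
Qed.

Lemma exp_le x y : x <= y -> exp x <= exp y.
Proof. intros [h| ->]; [left; apply exp_increasing; auto|apply Rle_refl]. Qed.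

Lemma exists_INR_ge x : exists n : nat, x <= INR n.
Proof. destruct (INR_unbounded x) as (n & h). exists n. lra. Qed.

(** The gap between [alpha] and [a] is cut into eight parts [eta]. The curve is defined for
    [|Im x| < alpha + 4 eta], and its zeros are used between the heights [alpha + 3 eta] and [eta].
    Of the resulting rate [alpha + 2 eta], the part [al = alpha + eta] is kept, and its excess over
    [alpha] absorbs the powers of [q]. *)
Lemma birkhoff_area_bound c gamma a b alpha L : strictly_convex_curve c -> tangent_angle_param c gamma ->
  analytic_resonant_boundary gamma a b -> 0 < alpha < a -> 1 <= L ->
  exists (K : R) (N : nat), 0 < K /\ (1 <= N)%nat /\ forall p q : nat, Nat.gcd p q = 1%nat -> (N <= q)%nat -> (0 < p)%nat -> INR p <= L ->
  forall theta r theta' r', periodic_trajectory gamma p q theta r -> birkhoff p q theta ->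
    periodic_trajectory gamma p q theta' r' -> birkhoff p q theta' ->
    Rabs (trajectory_area gamma q theta r - trajectory_area gamma q theta' r') <= K * exp (- (2 * PI * alpha * INR q)).
Proof.
intros hc hgam hab halpha hL. pose proof PI_RGT_0 as hpi.
destruct (convex_envelope c gamma hc hgam) as (k1 & k2 & hev).
destruct (real_model gamma k1 k2 a b hev hab) as (G & X & Y & s & cc & K & d & r0 & hG & hg & hcj).
set (eta := (a - alpha) / 8). assert (heta : 0 < eta) by (unfold eta; lra).
assert (ha : a = alpha + 8 * eta) by (unfold eta; field). clearbody eta.
set (a2 := alpha + 4 * eta).
destruct (exists_periodic_curve G a b a2 L hG ltac:(unfold a2; lra) hL) as (kp & Kc & m1 & hkp & hKc & hm1 & hcurve).
destruct (trajectory_on_curve gamma k1 k2 G a b X Y s cc K d r0 kp L hev hG hg hcj ltac:(lra) hL) as (m2 & hm2 & htraj).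
destruct (gc_s _ _ _ _ _ _ hg) as [hs|hs].
(* With the opposite orientation there is no periodic trajectory for large [q], and any constant
   will do. *)
2:{ destruct (exists_INR_ge (L / m2)) as (N & hN). exists 1, (S N). split; [lra|]. split; [lia|].
  intros p q hgcd hq hp hpL theta r theta' r' htr _ _ _. exfalso.
  assert (hqN : INR N + 1 <= INR q) by (rewrite <- S_INR; apply le_INR; auto). pose proof (pos_INR N).
  destruct (htraj p q ltac:(lia) ltac:(lia) hpL) with (th := theta) (r := r) as (w & _); auto; [|lra].
  apply Rmult_le_reg_r with (INR q); [lra|]. replace (INR p / INR q * INR q) with (INR p) by (field; lra).
  apply Rmult_le_compat_r with (r := m2) in hN; [|lra]. replace (L / m2 * m2) with L in hN by (field; lra). nra. }
subst s.
destruct (chart_bilip _ _ _ _ _ _ hg) as (Lam & hLam & hlip).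
destruct (curve_area_variation gamma k1 k2 X Y cc K d Lam hev hg hLam ltac:(intros; apply hlip; auto)) as (C & hC & hvar).
pose proof (gc_d _ _ _ _ _ _ hg) as hd0. pose proof (gc_K _ _ _ _ _ _ hg) as hK. pose proof (gc_c _ _ _ _ _ _ hg) as hcc.
pose proof (ev_pos _ _ _ hev) as hk1. assert (hk2 : k1 <= k2). { destruct (ev_der _ _ _ hev 0) as (rh & w & _). lra. }
pose proof (nm_b _ _ _ hG) as hb. pose proof (cj_pos _ _ _ _ _ _ hcj) as hr0. pose proof (cj_le _ _ _ _ _ _ hcj) as hr0d.
set (t := alpha + 3 * eta). set (al := alpha + eta).
set (S0 := 2 * b * (4 * exp (2 * ((kap eta + kap t) * (Kc * L))) / (1 - exp (- (2 * PI * t))) ^ 2)).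
set (S1 := Rabs S0 + 1). assert (hS1 : 0 < S1) by (unfold S1; pose proof (Rabs_pos S0); lra). assert (hS01 : S0 <= S1) by (unfold S1; pose proof (Rle_abs S0); lra). clearbody S1.
set (B := Lam * (1 + 4 * ((Kc + 1) * L) / a2 + 4 * b / a2)).
assert (ha2 : 0 < a2) by (unfold a2; lra).
assert (hB : 0 < B).
{ unfold B. apply Rmult_lt_0_compat; auto. assert (0 <= 4 * ((Kc + 1) * L) / a2) by (apply Rmult_le_pos; [apply Rmult_le_pos; [lra|apply Rmult_le_pos; lra]|left; apply Rinv_0_lt_compat; auto]).
  assert (0 <= 4 * b / a2) by (apply Rmult_le_pos; [lra|left; apply Rinv_0_lt_compat; auto]). lra. }
assert (hBe : B = Lam * (1 + 4 * ((Kc + 1) * L) / a2 + 4 * b / a2)) by reflexivity. clearbody B.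
set (be := 2 * PI * eta). assert (hbe : 0 < be) by (unfold be; apply Rmult_lt_0_compat; lra).
assert (hbee : be = 2 * PI * eta) by reflexivity. clearbody be.
set (rr := Rmin r0 (Rmin 1 (k1 / 2))). assert (hrr : 0 < rr) by (repeat apply Rmin_pos; lra).
assert (hrr1 : rr <= r0) by apply Rmin_l. assert (hrr2 : rr <= 1) by (eapply Rle_trans; [apply Rmin_r|apply Rmin_l]). assert (hrr3 : rr <= k1 / 2) by (eapply Rle_trans; [apply Rmin_r|apply Rmin_r]).
clearbody rr.
(* [N1] and [N2] make [mu] small enough for the curve and for the trajectories, [N3] and [N4] for
   the orbit segments; [N5] and [N6] make the closing error small compared with [rho]. *)
destruct (exists_INR_ge (L / m1)) as (N1 & hN1). destruct (exists_INR_ge (L / m2)) as (N2 & hN2).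
destruct (exists_INR_ge (4 * Kc * L)) as (N3 & hN3). destruct (exists_INR_ge (2 * L / (cc * rr))) as (N4 & hN4).
destruct (exists_INR_ge (4 * S1 / be ^ 2 * (4 * K * k2 * Lam))) as (N5 & hN5). destruct (exists_INR_ge (4 * S1 / be ^ 2 * (2 * K * C))) as (N6 & hN6).
exists (8 * C * K * B * (S1 * (4 / be ^ 2))), (1 + N1 + N2 + N3 + N4 + N5 + N6)%nat.
assert (hbe2 : 0 < be ^ 2) by (apply pow_lt; auto). assert (h4b : 0 < 4 / be ^ 2) by (apply Rdiv_lt_0_compat; lra).
split; [repeat apply Rmult_lt_0_compat; lra|]. split; [lia|].
intros p q hgcd hq hp hpL theta r theta1 r1 htr hbk htr1 hbk1.
assert (hqR : 1 <= INR q) by (apply (le_INR 1); lia). assert (hpR : 1 <= INR p) by (apply (le_INR 1); lia).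
assert (hNq : forall n, (n <= q)%nat -> INR n <= INR q) by (intros; apply le_INR; auto).
set (mu := INR p / INR q). assert (hmu0 : 0 < mu) by (apply Rdiv_lt_0_compat; lra). assert (hmq : mu * INR q = INR p) by (unfold mu; field; lra).
assert (hmu1 : 1 <= mu * INR q) by lra.
assert (hle : forall z, L <= z * INR q -> mu <= z). { intros z hz. apply Rmult_le_reg_r with (INR q); lra. }
assert (hdiv : forall z n, 0 < z -> (n <= q)%nat -> L / z <= INR n -> mu <= z).
{ intros z n hz hn h. apply hle. specialize (hNq n hn). assert (h' : L / z <= INR q) by lra. apply Rmult_le_compat_r with (r := z) in h'; [|lra]. replace (L / z * z) with L in h' by (field; lra). lra. }
assert (hmm1 : mu <= m1) by (apply (hdiv m1 N1); auto; lia). assert (hmm2 : mu <= m2) by (apply (hdiv m2 N2); auto; lia).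
assert (hmm3 : Kc * mu <= / 4).
{ assert (INR N3 <= INR q) by (apply hNq; lia). apply Rmult_le_reg_r with (INR q); [lra|]. rewrite Rmult_assoc, hmq.
  assert (Kc * INR p <= Kc * L) by (apply Rmult_le_compat_l; lra). lra. }
assert (hmm4 : 2 * mu <= cc * rr).
{ assert (0 < cc * rr) by (apply Rmult_lt_0_compat; auto). assert (mu <= cc * rr / 2); [|lra]. apply (hdiv _ N4); [lra|lia|].
  replace (L / (cc * rr / 2)) with (2 * L / (cc * rr)) by (field; split; lra). auto. }
destruct (hcurve p q ltac:(lia) ltac:(lia) hpL hmm1) as (Yc & hpc).
destruct (exists_curve_orbit gamma k1 k2 G a b X Y 1 cc K d r0 a2 kp Kc p q Yc hev hG hg hcj ha2 ltac:(lra) hpc mu eq_refl hmu0 hKc hmm3) as (th & rad & hco).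
{ apply Rle_trans with (1 := hmm4). apply Rmult_le_compat_l; [lra|]. apply Rmin_glb; lra. }
set (rho := mu / (2 * K)) in *. assert (hrho : 0 < rho) by (apply Rdiv_lt_0_compat; lra).
assert (hR1 : 2 * mu / cc <= rr). { apply Rmult_le_reg_r with cc; auto. replace (2 * mu / cc * cc) with (2 * mu) by (field; lra). lra. }
(* The area bound is proportional to the distance of the starting points: translate by a period to make it at most 1. *)
destruct (exists_frac (X (theta 0%Z) (r 0%Z) - X (theta1 0%Z) (r1 0%Z))) as (n & hn).
destruct (shifted_trajectory gamma k1 k2 p q (- n) theta1 r1 hev htr1) as (htr' & harea).
assert (hbk' := shifted_birkhoff p q (- n) theta1 hbk1). rewrite <- harea. clear harea.
destruct (htraj p q ltac:(lia) ltac:(lia) hpL hmm2 theta r htr) as (_ & hon).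
destruct (htraj p q ltac:(lia) ltac:(lia) hpL hmm2 theta1 r1 htr1) as (_ & hon1).
assert (hrad : forall k, Rabs (r k) <= d) by (intro k; apply (trajectory_radius gamma G X Y d r0 hcj); apply hon).
assert (hrad' : forall k, Rabs (r1 k) <= d) by (intro k; apply (trajectory_radius gamma G X Y d r0 hcj); apply hon1).
set (theta' := fun k => theta1 k + 2 * PI * IZR (- n)) in *.
destruct (htraj p q ltac:(lia) ltac:(lia) hpL hmm2 theta' r1 htr') as (_ & hon').
assert (hstart : Rabs (X (theta' 0%Z) (r1 0%Z) - X (theta 0%Z) (r 0%Z)) <= 1).
{ unfold theta'. rewrite (proj1 (chart_period _ _ _ _ _ _ hg (- n) (theta1 0%Z) (r1 0%Z) (hrad' 0%Z))), opp_IZR. apply Rabs_le. lra. }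
clearbody theta'.
assert (hbound0 : 0 <= 8 * C * K * B * (S1 * (4 / be ^ 2)) * exp (- (2 * PI * alpha * INR q))).
{ left. apply Rmult_lt_0_compat; [|apply exp_pos]. repeat apply Rmult_lt_0_compat; lra. }
set (f := fun k : nat => X (theta (Z.of_nat k)) (r (Z.of_nat k))). set (g := fun k : nat => X (theta' (Z.of_nat k)) (r1 (Z.of_nat k))).
assert (hc1 := trajectory_curve gamma G b X Y cc K d r0 a2 kp Kc p q Yc hg hcj ha2 hpc theta r htr ltac:(intro; apply hon) ltac:(intro; apply hon)).
assert (hc2 := trajectory_curve gamma G b X Y cc K d r0 a2 kp Kc p q Yc hg hcj ha2 hpc theta' r1 htr' ltac:(intro; apply hon') ltac:(intro; apply hon')).
(* If the orbits share a point modulo 1 their areas are equal; otherwise they provide [2 q] distinct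
   zeros modulo 1. *)
destruct (classic (exists k l n, (k < q)%nat /\ (l < q)%nat /\ f k = g l + IZR n)) as [(k & l & j & hk & hl & hkl)|hne].
- destruct (trajectory_coincidence G a b X Y cc K d a2 kp Kc p q Yc _ _ _ _ j hG hg ha2 hpc (hrad _) (hrad' _) (hc1 _) (hc2 _) hkl) as ((i & hi) & er).
  destruct (shifted_trajectory gamma k1 k2 p q i theta' r1 hev htr') as (htr'' & harea). rewrite <- harea.
  rewrite (trajectory_area_unique gamma k1 k2 G a b X Y cc K d r0 a2 kp Kc p q Yc theta r (fun k => theta' k + 2 * PI * IZR i) r1 k l); auto.
  + rewrite Rminus_diag, Rabs_R0. auto.
  + lia.
  + intro; apply hon.
  + intro; apply hon1.
- set (W := S1 * exp (- (2 * PI * al * INR q))).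
  assert (hw : forall x : R, Cmod (snd (it G q (RtoC x, Yc (RtoC x))) - Yc (RtoC x))%C <= W).
  { intro x. eapply Rle_trans; [apply (curve_displacement_small G b a2 kp Kc p q L al eta t Yc f g)|]; auto; try lia; try lra.
    - unfold t; lra.
    - unfold t, a2; lra.
    - unfold al, t; lra.
    - intros k hk. unfold f. split; [|apply (trajectory_zero gamma G b X Y cc K d r0 a2 kp Kc p q Yc hg hcj ha2 hpc theta r htr); intro; apply hon].
      rewrite hc1, (trajectory_iterates gamma G X Y d r0 p q hcj theta r htr); [reflexivity|intro; apply hon].
    - intros k hk. unfold g. split; [|apply (trajectory_zero gamma G b X Y cc K d r0 a2 kp Kc p q Yc hg hcj ha2 hpc theta' r1 htr'); intro; apply hon'].
      rewrite hc2, (trajectory_iterates gamma G X Y d r0 p q hcj theta' r1 htr'); [reflexivity|intro; apply hon'].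
    - intros k l j hk hl hkl. destruct (trajectory_coincidence G a b X Y cc K d a2 kp Kc p q Yc _ _ _ _ j hG hg ha2 hpc (hrad _) (hrad _) (hc1 _) (hc1 _) hkl) as ((i & hi) & _).
      apply (birkhoff_distinct p q theta k l i); auto.
    - intros k l j hk hl hkl. destruct (trajectory_coincidence G a b X Y cc K d a2 kp Kc p q Yc _ _ _ _ j hG hg ha2 hpc (hrad' _) (hrad' _) (hc2 _) (hc2 _) hkl) as ((i & hi) & _).
      apply (birkhoff_distinct p q theta' k l i); auto.
    - intros k l j hk hl hkl. apply hne. exists k, l, j. auto.
    - fold S0. unfold W. apply Rmult_le_compat_r; [left; apply exp_pos|auto]. }
  assert (hexp : INR q ^ 2 * W <= S1 * (4 / be ^ 2) * exp (- (2 * PI * alpha * INR q))).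
  { unfold W. replace (- (2 * PI * al * INR q)) with (- (be * INR q) + - (2 * PI * alpha * INR q)) by (unfold al; rewrite hbee; ring).
    rewrite exp_plus. pose proof (sqr_exp_bound (be * INR q) ltac:(apply Rmult_lt_0_compat; lra)) as h.
    replace (INR q ^ 2 * (S1 * (exp (- (be * INR q)) * exp (- (2 * PI * alpha * INR q))))) with (S1 * ((INR q ^ 2 * exp (- (be * INR q))) * exp (- (2 * PI * alpha * INR q)))) by ring.
    rewrite (Rmult_assoc S1 (4 / be ^ 2)). apply Rmult_le_compat_l; [lra|]. apply Rmult_le_compat_r; [left; apply exp_pos|].
    apply Rmult_le_reg_l with (be ^ 2); auto. replace (be ^ 2 * (4 / be ^ 2)) with 4 by (field; lra).
    replace (be ^ 2 * (INR q ^ 2 * exp (- (be * INR q)))) with ((be * INR q) ^ 2 * exp (- (be * INR q))) by ring. auto. }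
  assert (hq2 : INR q ^ 2 * W <= 4 * S1 / be ^ 2).
  { eapply Rle_trans; [exact hexp|]. replace (4 * S1 / be ^ 2) with (S1 * (4 / be ^ 2) * 1) by (field; lra).
    apply Rmult_le_compat_l; [repeat apply Rmult_le_pos; lra|]. rewrite <- exp_0. apply exp_le. assert (0 <= 2 * PI * alpha * INR q) by (apply Rmult_le_pos; [apply Rmult_le_pos; lra|lra]). lra. }
  assert (hW0 : 0 < W) by (unfold W; apply Rmult_lt_0_compat; [auto|apply exp_pos]).
  assert (hsmall : forall z N, 0 < z -> (N <= q)%nat -> 4 * S1 / be ^ 2 * z <= INR N -> INR q * W * z <= 1).
  { intros z N hz hN h. specialize (hNq N hN). apply Rmult_le_reg_l with (INR q); [lra|].
    replace (INR q * (INR q * W * z)) with (INR q ^ 2 * W * z) by ring. apply Rmult_le_compat_r with (r := z) in hq2; lra. }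
  assert (hirho : 1 <= 2 * K * (INR q * rho)). { unfold rho. replace (2 * K * (INR q * (mu / (2 * K)))) with (mu * INR q) by (field; lra). lra. }
  assert (hirho' : / rho <= 2 * K * INR q). { apply Rmult_le_reg_r with rho; auto. rewrite Rinv_l by lra. lra. }
  assert (hkl : 0 < K * k2 * Lam) by (repeat apply Rmult_lt_0_compat; lra). assert (hkc : 0 < K * C) by (repeat apply Rmult_lt_0_compat; lra).
  assert (hs5 := hsmall (4 * K * k2 * Lam) N5 ltac:(lra) ltac:(lia) hN5). assert (hs6 := hsmall (2 * K * C) N6 ltac:(lra) ltac:(lia) hN6).
  assert (hCW : C * W / rho <= 2 * K * C * (INR q * W)).
  { unfold Rdiv. replace (2 * K * C * (INR q * W)) with (C * W * (2 * K * INR q)) by ring. apply Rmult_le_compat_l; auto. left. apply Rmult_lt_0_compat; auto. }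
  rewrite (trajectory_area_curve gamma k1 k2 G b X Y cc K d r0 a2 kp Kc p q Yc hev hg hcj ha2 hpc ltac:(lia) theta r htr ltac:(intro; apply hon) ltac:(intro; apply hon) rho (2 * mu / cc) th rad hco hrho ltac:(lra)).
  rewrite (trajectory_area_curve gamma k1 k2 G b X Y cc K d r0 a2 kp Kc p q Yc hev hg hcj ha2 hpc ltac:(lia) theta' r1 htr' ltac:(intro; apply hon') ltac:(intro; apply hon') rho (2 * mu / cc) th rad hco hrho ltac:(lra)).
  rewrite Rabs_minus_sym.
  eapply Rle_trans; [apply (hvar G b a2 kp Kc p q Yc L rho (2 * mu / cc) th rad W B); auto; try lia; try lra|].
  + repeat apply Rmin_glb; lra.
  + apply Rmult_le_reg_r with (2 * k2 * (2 * K * INR q)); [repeat apply Rmult_lt_0_compat; lra|].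
    replace (rho / (2 * k2) * (2 * k2 * (2 * K * INR q))) with (2 * K * (INR q * rho)) by (field; lra).
    replace (Lam * W * (2 * k2 * (2 * K * INR q))) with (INR q * W * (4 * K * k2 * Lam)) by ring. lra.
  + apply Rle_trans with (INR q * (4 * (2 * K * C * (INR q * W))) * B * 1).
    * apply Rmult_le_compat; auto using Rabs_pos.
      -- apply Rmult_le_pos; [|lra]. apply Rmult_le_pos; [lra|]. apply Rmult_le_pos; [lra|].
         apply Rmult_le_pos; [left; apply Rmult_lt_0_compat; auto|left; apply Rinv_0_lt_compat; auto].
      -- apply Rmult_le_compat_r; [lra|]. apply Rmult_le_compat_l; lra.
    * replace (INR q * (4 * (2 * K * C * (INR q * W))) * B * 1) with (8 * C * K * B * (INR q ^ 2 * W)) by ring.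
      rewrite (Rmult_assoc (8 * C * K * B) (S1 * (4 / be ^ 2))). apply Rmult_le_compat_l; [|exact hexp]. repeat apply Rmult_le_pos; lra.
Qed.

Theorem theorem9 (c gamma : R -> vec) (a_star : R)
  (hGamma : strictly_convex_curve c)
  (hgamma : tangent_angle_param c gamma)
  (ha : exists b_star : R, analytic_resonant_boundary gamma a_star b_star)
  (alpha L : R) (halpha : 0 < alpha < a_star) (hL : 1 <= L) :
  exists (K : R) (q_star : nat), 0 < K /\ (1 <= q_star)%nat /\
    forall p q : nat,
      Nat.gcd p q = 1%nat -> (q_star <= q)%nat -> (0 < p)%nat -> INR p <= L ->
      Rbar_le (area_spread gamma p q)
        (Finite (K * exp (- (2 * PI * alpha * INR q / INR p)))).
Proof.
destruct ha as (b & hb).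
destruct (birkhoff_area_bound c gamma a_star b alpha L hGamma hgamma hb halpha hL) as (K & N & hK & hN & h).
exists K, N. split; auto. split; auto. intros p q hgcd hq hp hpL.
unfold area_spread. apply (proj2 (Lub_Rbar_correct _)). intros x [->|(theta & r & theta' & r' & h1 & h2 & h3 & h4 & ->)].
- simpl. left. apply Rmult_lt_0_compat; [auto|apply exp_pos].
- simpl. eapply Rle_trans; [apply (h p q hgcd hq hp hpL theta r theta' r' h1 h2 h3 h4)|].
  (* The exponent obtained carries no division by [p], and [p >= 1]. *)
  apply Rmult_le_compat_l; [lra|]. apply exp_le. apply Ropp_le_contravar.
  assert (hpR : 1 <= INR p) by (apply (le_INR 1); lia). pose proof PI_RGT_0.
  assert (0 <= 2 * PI * alpha * INR q) by (apply Rmult_le_pos; [apply Rmult_le_pos; lra|apply pos_INR]).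
  apply Rmult_le_reg_r with (INR p); [lra|]. unfold Rdiv. rewrite Rmult_assoc, Rinv_l by lra. nra.
Qed.
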